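(* Let $(L\rightrightarrows L_M;G\rightrightarrows M)$ be a line bundle groupoid, $A$ the Lie algebroid of $G$, $\theta\in\Omega^1(G,L)$ a multiplicative $1$-form, and $\nabla$ a connection on $L_M$. Let $\eta_\nabla=s^*\nabla-t^*\nabla\in\Omega^1(G)$. Then the vector bundle morphism $$\mathsf MR_\theta\colon\mathsf MK_\theta=TG\oplus L\to\mathsf MK_\theta^\dagger=T^\dagger G\oplus\mathbb R_G,\qquad(v,\lambda)\mapsto\big(\iota_vd^{t^*\nabla}\theta+\lambda\otimes\eta_\nabla,\ -\eta_\nabla(v)\big)$$ is a VB groupoid morphism (called the Morita curvature of $\theta$), which acts on units as $$TM\oplus L_M\to A^\dagger=\operatorname{Hom}(A,L_M),\qquad(v,\lambda)\mapsto\big(\iota_vd^{t^*\nabla}\theta\big)|_A+\lambda\otimes\eta_\nabla|_A .$$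
   Context: A VB groupoid (VBG) $(V\rightrightarrows V_M;G\rightrightarrows M)$ consists of Lie groupoids $V\rightrightarrows V_M$, $G\rightrightarrows M$ and vector bundles $V\to G$, $V_M\to M$ such that all structure maps $s,t,m,i,u$ of $V$ are vector bundle (VB) morphisms covering those of $G$. Products $gg'$ are defined when $s(g)=t(g')$; units are regarded as submanifolds. The core is $C=\ker(s\colon V\to V_M)|_M$. A VBG morphism is a VB morphism that is also a Lie groupoid morphism, covering a Lie groupoid morphism. A line bundle groupoid is a VBG $(L\rightrightarrows L_M;G\rightrightarrows M)$ with $L\to G$, $L_M\to M$ line bundles; its structure maps are isomorphisms on fibers, so sections, line bundle valued forms, and connections can be pulled back along them; $s_g:=s|_{L_g}$, and $G$ acts on $L_M$ by $g.v=t(s_g^{-1}(v))$. $\theta\in\Omega^1(G,L)$ is multiplicative if $\partial\theta=\mathrm{pr}_2^*\theta-m^*\theta+\mathrm{pr}_1^*\theta=0$ (pull-backs of line bundle valued forms along the maps $L^{(2)}\to L$). $A=\ker(ds)|_M$. Morita kernel: $\mathsf MK_\theta$ is the VBG $TG\oplus L\rightrightarrows TM\oplus L_M$ over $G$ with $s(v,\lambda)=(ds(v),s(\lambda))$, $t(v,\lambda)=(dt(v),t(\lambda+\theta(v)))$, $u(v,\lambda)=(du(v),u(\lambda))$, $(v,\lambda)(v',\lambda')=(vv',s_{gg'}^{-1}(s(\lambda')))$ for composable elements over $g,g'$; its core is $A$. Twisted dual: if $V\rightrightarrows V_M$ is a VBG over $G$ with core $C$, its $L$-twisted dual is the VBG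 $V^\dagger=\operatorname{Hom}(V,L)\rightrightarrows C^\dagger=\operatorname{Hom}(C,L_M)$ over $G$ with, for $\psi\in V^\dagger_g$, $\langle s(\psi),c\rangle=-s\langle\psi,0_g\cdot c^{-1}\rangle$, $\langle t(\psi),c'\rangle=t\langle\psi,c'\cdot0_g\rangle$ ($c\in C_{s(g)}$, $c'\in C_{t(g)}$), multiplication $\langle\psi\psi',vv'\rangle=s_{gg'}^{-1}(g'^{-1}.s\langle\psi,v\rangle+s\langle\psi',v'\rangle)$, and unit $\psi\mapsto\psi\circ\mathrm{pr}_C$ for $\psi\in C^\dagger_x$, where $\mathrm{pr}_C\colon V|_M\to C$ is the projection with kernel $V_M$. In particular $\mathsf MK_\theta^\dagger=T^\dagger G\oplus\mathbb R_G\rightrightarrows A^\dagger$ with $T^\dagger G=\operatorname{Hom}(TG,L)$, $\mathbb R_G=G\times\mathbb R=\operatorname{Hom}(L,L)$. $s^*\nabla,t^*\nabla$ are the pull-back connections on $L\to G$ along $s,t\colon L\to L_M$; $d^{t^*\nabla}$ is the connection differential on $\Omega^\bullet(G,L)$. *)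

(* Defs.v *)
(* Smooth manifolds, vector bundles and Lie groupoids are first introduced as
   bare data ([mfd], [vb], [gpd], [vbg]: sets, atlases and structure maps); the
   axioms are the predicates [is_manifold], [is_vb], [is_lie], [is_vbg].  Thus
   TG, direct sums, Hom bundles, cores, Morita kernels and twisted duals are
   given by explicit formulas.  The underlying set of a manifold or of the
   total space of a bundle is a subset ([pts], [vin]) of a carrier type; values
   of maps outside of these subsets are irrelevant. *)
From HB Require Import structures.
From mathcomp Require Import all_boot all_order all_algebra.
From mathcomp Require Import all_classical all_reals all_analysis.
Import numFieldNormedType.Exports.
Import Order.TTheory GRing.Theory Num.Theory.
Local Open Scope classical_set_scope.
Local Open Scope ring_scope.

(* An element of [P], and [x0] if there is none.  It is used where [P] determines
   its element (for [pull_conn]: its values on local sections), so that the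
   choice is irrelevant. *)
Definition the {T : Type} (x0 : T) (P : set T) : T :=
  match pselect (exists x, P x) with
  | left h => sval (cid h)
  | right _ => x0
  end.

Fixpoint Ck {R : realType} {m n : nat} (k : nat) (O : set 'rV[R]_m)
    (F : 'rV[R]_m -> 'rV[R]_n) : Prop :=
  match k with
  | 0 => forall p, O p -> {for p, continuous F}
  | k'.+1 => (forall p, O p -> differentiable F p) /\
             forall v, Ck k' O (fun p => 'd F p v)
  end.

Definition Cinfty {R : realType} {m n : nat} (O : set 'rV[R]_m)
    (F : 'rV[R]_m -> 'rV[R]_n) : Prop := forall k, Ck k O F.

Record mfd (R : realType) := Mfd {
  pt :> Type;
  pts : set pt;
  dim : nat;
  cidx : Type;
  cdom : cidx -> set pt;
  cmap : cidx -> pt -> 'rV[R]_dim }.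
Arguments pts {R} M _ : rename.
Arguments dim {R} M : rename.
Arguments cidx {R} M : rename.
Arguments cdom {R M} i _ : rename.
Arguments cmap {R M} i _ : rename.

(* [F] is a smooth local extension, near [cmap i x], of the expression of
   [f : S -> N] in the charts [i] (around [x]) and [j].  For [S] open it is the
   germ of the coordinate expression of [f] itself. *)
Definition is_rep {R : realType} {M N : mfd R} (S : set M) (f : M -> N)
    (i : cidx M) (j : cidx N) (x : M) (F : 'rV[R]_(dim M) -> 'rV[R]_(dim N)) :
    Prop :=
  cdom i x /\
  exists O : set 'rV[R]_(dim M),
    [/\ open O, O (cmap i x), Cinfty O F &
        forall y, S y -> cdom i y -> O (cmap i y) ->
          cdom j (f y) /\ cmap j (f y) = F (cmap i y)].

(* Smoothness on [S], which is either open or an embedded submanifold. *)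
Definition smooth_on {R : realType} {M N : mfd R} (S : set M) (f : M -> N) :
    Prop :=
  forall x, S x -> exists i j F, is_rep S f i j x F.

Definition smooth {R : realType} {M N : mfd R} (f : M -> N) : Prop :=
  smooth_on (pts M) f.

Definition mopen {R : realType} {M : mfd R} (W : set M) : Prop :=
  W `<=` pts M /\ forall i, open (cmap i @` (W `&` cdom i)).

Record is_manifold {R : realType} (M : mfd R) : Prop := {
  mfd_cover : forall x, pts M x <-> exists i : cidx M, cdom i x;
  mfd_inj : forall (i : cidx M) x y,
    cdom i x -> cdom i y -> cmap i x = cmap i y -> x = y;
  mfd_open : forall i : cidx M, open (cmap i @` cdom i);
  mfd_compat : forall (i j : cidx M) x, cdom i x -> cdom j x ->
    exists F, is_rep (pts M) id i j x F;
  mfd_hausdorff : forall x y : M, pts M x -> pts M y -> x <> y ->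
    exists U V : set M,
      [/\ mopen U, mopen V, U x, V y & U `&` V = set0];
  mfd_countable : exists I : set (cidx M),
    countable I /\ forall x, pts M x -> exists2 i, I i & cdom i x }.

Definition euc {R : realType} (n : nat) : mfd R :=
  {| pt := 'rV[R]_n; pts := setT; dim := n; cidx := unit;
     cdom := fun _ => setT; cmap := fun _ p => p |}.

Definition mprod {R : realType} (M N : mfd R) : mfd R :=
  {| pt := (M * N)%type;
     pts := [set p | pts M p.1 /\ pts N p.2];
     dim := (dim M + dim N)%N;
     cidx := (cidx M * cidx N)%type;
     cdom := fun ij => [set p | cdom ij.1 p.1 /\ cdom ij.2 p.2];
     cmap := fun ij p => row_mx (cmap ij.1 p.1) (cmap ij.2 p.2) |}.

(* A vector bundle over [M], given by an atlas of local trivializations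
   [tmap a] over the subsets [tdom a] of [M]. *)
Record vb {R : realType} (M : mfd R) := Vb {
  vtot :> Type;
  vin : set vtot;
  vrk : nat;
  vproj : vtot -> M;
  vzero : M -> vtot;
  vadd : vtot -> vtot -> vtot;
  vscal : R -> vtot -> vtot;
  tidx : Type;
  tdom : tidx -> set M;
  tmap : tidx -> vtot -> 'rV[R]_vrk }.
Arguments Vb {R M}.
Arguments vtot {R M} E : rename.
Arguments vin {R M E} _ : rename.
Arguments vrk {R M} E : rename.
Arguments vproj {R M E} _ : rename.
Arguments vzero {R M} E x : rename.
Arguments vadd {R M E} _ _ : rename.
Arguments vscal {R M E} r _ : rename.
Arguments tidx {R M} E : rename.
Arguments tdom {R M E} a _ : rename.
Arguments tmap {R M E} a _ : rename.

Definition vopp {R : realType} {M : mfd R} {E : vb M} (e : E) : E :=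
  vscal (-1) e.

Definition fib {R : realType} {M : mfd R} (E : vb M) (x : M) : set E :=
  [set e | vin e /\ vproj e = x].

Definition total {R : realType} {M : mfd R} (E : vb M) : mfd R :=
  {| pt := vtot E;
     pts := @vin R M E;
     dim := (dim M + vrk E)%N;
     cidx := (cidx M * tidx E)%type;
     cdom := fun ia =>
       [set e : E | [/\ vin e, cdom ia.1 (vproj e) & tdom ia.2 (vproj e)]];
     cmap := fun ia (e : E) => row_mx (cmap ia.1 (vproj e)) (tmap ia.2 e) |}.

(* Smooth compatibility of the trivializations is part of the requirement that
   the total space is a manifold. *)
Record is_vb {R : realType} {M : mfd R} (E : vb M) : Prop := {
  vb_base : is_manifold M;
  vb_total : is_manifold (total E);
  vb_proj : forall e : E, vin e -> pts M (vproj e);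
  vb_zero : forall x, pts M x -> fib E x (vzero E x);
  vb_add : forall x (e e' : E), fib E x e -> fib E x e' -> fib E x (vadd e e');
  vb_scal : forall x (r : R) (e : E), fib E x e -> fib E x (vscal r e);
  vb_tdom : forall a : tidx E, mopen (tdom a);
  vb_cover : forall x, pts M x -> exists a : tidx E, tdom a x;
  vb_tmap0 : forall (a : tidx E) x, tdom a x -> tmap a (vzero E x) = 0;
  vb_tmapD : forall (a : tidx E) x (e e' : E),
    tdom a x -> fib E x e -> fib E x e' ->
    tmap a (vadd e e') = tmap a e + tmap a e';
  vb_tmapZ : forall (a : tidx E) x r (e : E),
    tdom a x -> fib E x e -> tmap a (vscal r e) = r *: tmap a e;
  vb_bij : forall (a : tidx E) x p, tdom a x ->
    exists! e : E, fib E x e /\ tmap a e = p }.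

Record is_vbmor {R : realType} {M N : mfd R} {E : vb M} {E' : vb N}
    (F : E -> E') (f : M -> N) : Prop := {
  vbmor_smooth : smooth (F : total E -> total E');
  vbmor_smooth_base : smooth f;
  vbmor_fib : forall x e, pts M x -> fib E x e -> fib E' (f x) (F e);
  vbmor_add : forall x e e', pts M x -> fib E x e -> fib E x e' ->
    F (vadd e e') = vadd (F e) (F e');
  vbmor_scal : forall x r e, pts M x -> fib E x e ->
    F (vscal r e) = vscal r (F e) }.

Definition section_on {R : realType} {M : mfd R} {E : vb M} (W : set M)
    (s : M -> E) : Prop :=
  (forall x, W x -> fib E x (s x)) /\ smooth_on W (s : M -> total E).

(* The preimage of [mu] under the restriction of [F] to the fibre over [x]. *)
Definition fibinv {R : realType} {M N : mfd R} {E : vb M} {E' : vb N}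
    (F : E -> E') (x : M) (mu : E') : E :=
  the (vzero E x) [set e | fib E x e /\ F e = mu].

Definition dsum {R : realType} {M : mfd R} (E F : vb M) : vb M :=
  {| vtot := (E * F)%type;
     vin := [set p : E * F | [/\ vin p.1, vin p.2 & vproj p.1 = vproj p.2]];
     vrk := (vrk E + vrk F)%N;
     vproj := fun p => vproj p.1;
     vzero := fun x => (vzero E x, vzero F x);
     vadd := fun p q => (vadd p.1 q.1, vadd p.2 q.2);
     vscal := fun r p => (vscal r p.1, vscal r p.2);
     tidx := (tidx E * tidx F)%type;
     tdom := fun ab => tdom ab.1 `&` tdom ab.2;
     tmap := fun ab p => row_mx (tmap ab.1 p.1) (tmap ab.2 p.2) |}.

(* An element of Hom(E, F) over [hbase] is a map on the whole carrier of [E],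
   equal to zero away from the fibre over [hbase]. *)
Record hom {R : realType} {M : mfd R} (E F : vb M) := Hom {
  hbase : M;
  happ :> E -> F }.
Arguments Hom {R M E F}.
Arguments hbase {R M E F}.
Arguments happ {R M E F}.

Definition is_hom {R : realType} {M : mfd R} {E F : vb M} (psi : hom E F) :
    Prop :=
  let x := hbase psi in
  [/\ pts M x,
      forall e, fib E x e -> fib F x (psi e),
      forall e e', fib E x e -> fib E x e' ->
        psi (vadd e e') = vadd (psi e) (psi e'),
      forall r e, fib E x e -> psi (vscal r e) = vscal r (psi e) &
      forall e, ~ fib E x e -> psi e = vzero F x].

Definition mkhom {R : realType} {M : mfd R} {E F : vb M} (x : M)
    (f : E -> F) : hom E F :=
  {| hbase := x;
     happ := fun e => if pselect (fib E x e) then f e else vzero F x |}.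

Definition frame {R : realType} {M : mfd R} {E : vb M} (a : tidx E) (x : M)
    (k : 'I_(vrk E)) : E :=
  the (vzero E x) [set e | fib E x e /\ tmap a e = delta_mx 0 k].

Definition homb {R : realType} {M : mfd R} (E F : vb M) : vb M :=
  {| vtot := hom E F;
     vin := @is_hom R M E F;
     vrk := (vrk E * vrk F)%N;
     vproj := @hbase R M E F;
     vzero := fun x => {| hbase := x; happ := fun _ => vzero F x |};
     vadd := fun psi psi' =>
       {| hbase := hbase psi; happ := fun e => vadd (psi e) (psi' e) |};
     vscal := fun r psi =>
       {| hbase := hbase psi; happ := fun e => vscal r (psi e) |};
     tidx := (tidx E * tidx F)%type;
     tdom := fun ab => tdom ab.1 `&` tdom ab.2;
     tmap := fun ab psi =>
       mxvec (\matrix_(k < vrk E, l < vrk F)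
                tmap ab.2 (psi (frame ab.1 (hbase psi) k)) 0 l) |}.

(* A tangent vector at [tbase] is the family of its components in all charts
   around [tbase], transforming by the differentials of the chart changes
   (and 0 for the other charts). *)
Record tvec {R : realType} (M : mfd R) := TVec {
  tbase : M;
  tcoef : cidx M -> 'rV[R]_(dim M) }.
Arguments TVec {R M}.
Arguments tbase {R M}.
Arguments tcoef {R M}.

Definition is_tvec {R : realType} {M : mfd R} (v : tvec M) : Prop :=
  [/\ pts M (tbase v),
      forall i, ~ cdom i (tbase v) -> tcoef v i = 0 &
      forall i j F, is_rep (pts M) id i j (tbase v) F ->
        tcoef v j = 'd F (cmap i (tbase v)) (tcoef v i)].

Definition tangent {R : realType} (M : mfd R) : vb M :=
  {| vtot := tvec M;
     vin := @is_tvec R M;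
     vrk := dim M;
     vproj := @tbase R M;
     vzero := fun x => TVec x (fun _ => 0);
     vadd := fun v w => TVec (tbase v) (fun i => tcoef v i + tcoef w i);
     vscal := fun r v => TVec (tbase v) (fun i => r *: tcoef v i);
     tidx := cidx M;
     tdom := @cdom R M;
     tmap := fun i v => tcoef v i |}.

(* The differential of [f : S -> N] at a vector [v] tangent to [S]. *)
Definition dmap_on {R : realType} {M N : mfd R} (S : set M) (f : M -> N)
    (v : tangent M) : tangent N :=
  the (vzero (tangent N) (f (tbase v)))
    [set w | fib (tangent N) (f (tbase v)) w /\
       forall i j F, is_rep S f i j (tbase v) F ->
         tcoef w j = 'd F (cmap i (tbase v)) (tcoef v i)].

Definition dmap {R : realType} {M N : mfd R} (f : M -> N) :
    tangent M -> tangent N := dmap_on (pts M) f.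

Definition to_euc {R : realType} {M : mfd R} (h : M -> R) : M -> euc 1 :=
  fun x => (h x)%:M.

(* The derivative v(h) of a function smooth near the base point of [v]. *)
Definition deriv {R : realType} {M : mfd R} (v : tangent M) (h : M -> R) : R :=
  tcoef (dmap (to_euc h) v) tt 0 0.

Definition bracket {R : realType} {M : mfd R} (X Y : M -> tangent M) (x : M) :
    tangent M :=
  the (vzero (tangent M) x)
    [set u | fib (tangent M) x u /\
       forall (W : set M) h, mopen W -> W x -> smooth_on W (to_euc h) ->
         deriv u h = deriv (X x) (fun y => deriv (Y y) h)
                   - deriv (Y x) (fun y => deriv (X y) h)].

(* The vector (v, w) in T(M x N) = TM x TN. *)
Definition tpair {R : realType} {M N : mfd R} (v : tangent M) (w : tangent N) :
    tangent (mprod M N) :=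
  the (vzero (tangent (mprod M N)) (tbase v, tbase w))
    [set u | [/\ vin u, dmap (fst : mprod M N -> M) u = v
                      & dmap (snd : mprod M N -> N) u = w]].

(* Connections act on local sections. *)
Definition conn {R : realType} {M : mfd R} (E : vb M) :=
  tangent M -> (M -> E) -> E.

Record is_conn {R : realType} {M : mfd R} {E : vb M} (D : conn E) : Prop := {
  conn_fib : forall (W : set M) (v : tangent M) (s : M -> E), mopen W -> W (tbase v) -> vin v ->
    section_on W s -> fib E (tbase v) (D v s);
  conn_local : forall (W : set M) (v : tangent M) (s s' : M -> E), mopen W -> W (tbase v) -> vin v ->
    section_on W s -> section_on W s' -> (forall x, W x -> s x = s' x) ->
    D v s = D v s';
  conn_addv : forall (W : set M) (v w : tangent M) (s : M -> E), mopen W -> W (tbase v) -> vin v -> vin w ->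
    tbase v = tbase w -> section_on W s ->
    D (vadd v w) s = vadd (D v s) (D w s);
  conn_scalv : forall (W : set M) r (v : tangent M) (s : M -> E), mopen W -> W (tbase v) -> vin v ->
    section_on W s -> D (vscal r v) s = vscal r (D v s);
  conn_adds : forall (W : set M) (v : tangent M) (s s' : M -> E), mopen W -> W (tbase v) -> vin v ->
    section_on W s -> section_on W s' ->
    D v (fun x => vadd (s x) (s' x)) = vadd (D v s) (D v s');
  conn_leibniz : forall (W : set M) (v : tangent M) (h : M -> R) (s : M -> E), mopen W -> W (tbase v) -> vin v ->
    smooth_on W (to_euc h) -> section_on W s ->
    D v (fun x => vscal (h x) (s x)) =
      vadd (vscal (deriv v h) (s (tbase v))) (vscal (h (tbase v)) (D v s));
  conn_smooth : forall (W : set M) (X : M -> tangent M) (s : M -> E), mopen W -> section_on W X -> section_on W s ->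
    section_on W (fun x => D (X x) s) }.

(* The pull-back of the connection [nab] along a vector bundle morphism [F],
   covering [f], which is an isomorphism on fibres: the connection on [E]
   compatible with pull-backs of sections. *)
Definition pull_conn {R : realType} {M N : mfd R} {E : vb M} {E' : vb N}
    (F : E -> E') (f : M -> N) (nab : conn E') : conn E :=
  the ((fun v _ => vzero E (tbase v)) : conn E)
    [set D : conn E | is_conn D /\
       forall (W : set N) (s : N -> E') (v : tangent M), mopen W -> section_on W s -> vin v ->
         W (f (tbase v)) ->
         D v (fun x => fibinv F x (s (f x))) =
           fibinv F (tbase v) (nab (dmap f v) s)].

(* (d^D theta)(X, Y) = D_X (theta Y) - D_Y (theta X) - theta [X, Y], evaluated
   on the values v, w of X, Y at a point. *)
Definition conn_diff {R : realType} {M : mfd R} {E : vb M} (D : conn E)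
    (theta : tangent M -> E) (v w : tangent M) : E :=
  the (vzero E (tbase v))
    [set l | forall (W : set M) (X Y : M -> tangent M),
       mopen W -> W (tbase v) -> section_on W X -> section_on W Y ->
       X (tbase v) = v -> Y (tbase v) = w ->
       l = vadd (vadd (D v (theta \o Y)) (vopp (D w (theta \o X))))
                (vopp (theta (bracket X Y (tbase v))))].

(* The real valued 1-form D - D', for connections D, D' on a line bundle. *)
Definition conn_minus {R : realType} {M : mfd R} {E : vb M} (D D' : conn E)
    (v : tangent M) : R :=
  the 0 [set r | forall (W : set M) s, mopen W -> W (tbase v) ->
           section_on W s ->
           D v s = vadd (D' v s) (vscal r (s (tbase v)))].

Record gpd (R : realType) := Gpd {
  arr : mfd R;
  obj : mfd R;
  src : arr -> obj;
  tgt : arr -> obj;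
  mul : arr -> arr -> arr;
  unt : obj -> arr }.
Arguments arr {R} G : rename.
Arguments obj {R} G : rename.
Arguments src {R G} _ : rename.
Arguments tgt {R G} _ : rename.
Arguments mul {R G} _ _ : rename.
Arguments unt {R G} _ : rename.

Definition composable {R : realType} (G : gpd R) :
    set (mprod (arr G) (arr G)) :=
  [set p | [/\ pts (arr G) p.1, pts (arr G) p.2 & src p.1 = tgt p.2]].

Definition is_inverse {R : realType} {G : gpd R} (g h : arr G) : Prop :=
  [/\ pts (arr G) h, src h = tgt g, tgt h = src g,
      mul g h = unt (tgt g) & mul h g = unt (src g)].

Definition ginv {R : realType} {G : gpd R} (g : arr G) : arr G :=
  the g [set h | is_inverse g h].

Record is_lie {R : realType} (G : gpd R) : Prop := {
  lie_arr : is_manifold (arr G);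
  lie_obj : is_manifold (obj G);
  lie_src : smooth (@src R G);
  lie_tgt : smooth (@tgt R G);
  lie_unt : smooth (@unt R G);
  lie_mul : smooth_on (composable G)
              (fun p : mprod (arr G) (arr G) => mul p.1 p.2);
  lie_inv : smooth (@ginv R G);
  lie_src_subm : forall (g : arr G) w, pts (arr G) g ->
    fib (tangent (obj G)) (src g) w ->
    exists2 v, fib (tangent (arr G)) g v & dmap (@src R G) v = w;
  lie_tgt_subm : forall (g : arr G) w, pts (arr G) g ->
    fib (tangent (obj G)) (tgt g) w ->
    exists2 v, fib (tangent (arr G)) g v & dmap (@tgt R G) v = w;
  lie_src_unt : forall x : obj G, pts (obj G) x -> src (unt x) = x;
  lie_tgt_unt : forall x : obj G, pts (obj G) x -> tgt (unt x) = x;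
  lie_src_mul : forall g h : arr G, composable G (g, h) ->
    src (mul g h) = src h;
  lie_tgt_mul : forall g h : arr G, composable G (g, h) ->
    tgt (mul g h) = tgt g;
  lie_assoc : forall g h k : arr G,
    composable G (g, h) -> composable G (h, k) ->
    mul g (mul h k) = mul (mul g h) k;
  lie_mul_unt : forall g : arr G, pts (arr G) g -> mul g (unt (src g)) = g;
  lie_unt_mul : forall g : arr G, pts (arr G) g -> mul (unt (tgt g)) g = g;
  lie_inverse : forall g : arr G, pts (arr G) g -> is_inverse g (ginv g) }.

Record is_liemor {R : realType} {G H : gpd R} (f : arr G -> arr H)
    (f0 : obj G -> obj H) : Prop := {
  liemor_smooth : smooth f;
  liemor_smooth_obj : smooth f0;
  liemor_src : forall g, pts (arr G) g -> src (f g) = f0 (src g);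
  liemor_tgt : forall g, pts (arr G) g -> tgt (f g) = f0 (tgt g);
  liemor_unt : forall x, pts (obj G) x -> f (unt x) = unt (f0 x);
  liemor_mul : forall g h, composable G (g, h) ->
    f (mul g h) = mul (f g) (f h) }.

Record vbg {R : realType} (G : gpd R) := Vbg {
  vtop : vb (arr G);
  vbot : vb (obj G);
  vsrc : vtop -> vbot;
  vtgt : vtop -> vbot;
  vmul : vtop -> vtop -> vtop;
  vunt : vbot -> vtop }.
Arguments vtop {R G} V : rename.
Arguments vbot {R G} V : rename.
Arguments vsrc {R G V} _ : rename.
Arguments vtgt {R G V} _ : rename.
Arguments vmul {R G V} _ _ : rename.
Arguments vunt {R G V} _ : rename.

Definition vgpd {R : realType} {G : gpd R} (V : vbg G) : gpd R :=
  {| arr := total (vtop V); obj := total (vbot V);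
     src := @vsrc R G V; tgt := @vtgt R G V;
     mul := @vmul R G V; unt := @vunt R G V |}.

Definition vcomposable {R : realType} {G : gpd R} {V : vbg G} (g h : arr G)
    (v w : vtop V) : Prop :=
  [/\ fib (vtop V) g v, fib (vtop V) h w & vsrc v = vtgt w].

Definition vinv {R : realType} {G : gpd R} {V : vbg G} (v : vtop V) : vtop V :=
  @ginv R (vgpd V) v.

(* The last three fields say that multiplication is a vector bundle morphism
   on the fibre product V^(2) -> G^(2). *)
Record is_vbg {R : realType} {G : gpd R} (V : vbg G) : Prop := {
  vbg_base : is_lie G;
  vbg_top : is_vb (vtop V);
  vbg_bot : is_vb (vbot V);
  vbg_total : is_lie (vgpd V);
  vbg_src : is_vbmor (@vsrc R G V) (@src R G);
  vbg_tgt : is_vbmor (@vtgt R G V) (@tgt R G);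
  vbg_unt : is_vbmor (@vunt R G V) (@unt R G);
  vbg_inv : is_vbmor (@vinv R G V) (@ginv R G);
  vbg_mul : forall g h (v w : vtop V), composable G (g, h) -> vcomposable g h v w ->
    fib (vtop V) (mul g h) (vmul v w);
  vbg_mul_add : forall g h (v w v' w' : vtop V), composable G (g, h) ->
    vcomposable g h v w -> vcomposable g h v' w' ->
    vmul (vadd v v') (vadd w w') = vadd (vmul v w) (vmul v' w');
  vbg_mul_scal : forall g h r (v w : vtop V), composable G (g, h) ->
    vcomposable g h v w ->
    vmul (vscal r v) (vscal r w) = vscal r (vmul v w) }.

Record is_vbgmor {R : realType} {G H : gpd R} {V : vbg G} {W : vbg H}
    (F : vtop V -> vtop W) (F0 : vbot V -> vbot W)
    (f : arr G -> arr H) (f0 : obj G -> obj H) : Prop := {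
  vbgmor_top : is_vbmor F f;
  vbgmor_bot : is_vbmor F0 f0;
  vbgmor_total : @is_liemor R (vgpd V) (vgpd W) F F0;
  vbgmor_base : is_liemor f f0 }.

(* The core ker(s)|_M, with projection to the base M.  Its trivializations are
   all fibrewise linear isomorphisms [p.2] over open subsets [p.1] for which
   the corresponding local sections [sg ^~ q] are smooth in V. *)
Definition is_core {R : realType} {G : gpd R} {V : vbg G} (c : vtop V) : Prop :=
  exists x, [/\ pts (obj G) x, fib (vtop V) (unt x) c & vsrc c = vzero (vbot V) x].

Definition core_fib {R : realType} {G : gpd R} (V : vbg G) (x : obj G) :
    set (vtop V) :=
  [set c | is_core c /\ src (vproj c) = x].

Definition core_rk {R : realType} {G : gpd R} (V : vbg G) : nat :=
  (vrk (vtop V) - vrk (vbot V))%N.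

Definition is_core_triv {R : realType} {G : gpd R} {V : vbg G}
    (W : set (obj G)) (tau : vtop V -> 'rV[R]_(core_rk V)) : Prop :=
  mopen W /\
  exists sg : obj G -> 'rV[R]_(core_rk V) -> vtop V,
    [/\ forall x q, W x -> core_fib V x (sg x q) /\ tau (sg x q) = q,
        forall x c, W x -> core_fib V x c -> sg x (tau c) = c,
        forall x c c', W x -> core_fib V x c -> core_fib V x c' ->
          tau (vadd c c') = tau c + tau c',
        forall x r c, W x -> core_fib V x c -> tau (vscal r c) = r *: tau c &
        forall q, smooth_on W ((fun x => sg x q) : obj G -> total (vtop V))].

Definition core {R : realType} {G : gpd R} (V : vbg G) : vb (obj G) :=
  {| vtot := vtop V;
     vin := @is_core R G V;
     vrk := core_rk V;
     vproj := fun c => src (vproj c);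
     vzero := fun x => vzero (vtop V) (unt x);
     vadd := @vadd R (arr G) (vtop V);
     vscal := @vscal R (arr G) (vtop V);
     tidx := {p : set (obj G) * (vtop V -> 'rV[R]_(core_rk V)) |
              is_core_triv p.1 p.2};
     tdom := fun p => (sval p).1;
     tmap := fun p => (sval p).2 |}.

(* The tangent map of the multiplication, on T(G^(2)) = TG x_TM TG. *)
Definition tmul {R : realType} {G : gpd R} (v w : tangent (arr G)) :
    tangent (arr G) :=
  dmap_on (composable G) (fun p : mprod (arr G) (arr G) => mul p.1 p.2)
    (tpair v w).

Definition tangent_gpd {R : realType} (G : gpd R) : vbg G :=
  {| vtop := tangent (arr G); vbot := tangent (obj G);
     vsrc := dmap (@src R G); vtgt := dmap (@tgt R G);
     vmul := tmul; vunt := dmap (@unt R G) |}.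

Definition algebroid {R : realType} (G : gpd R) : vb (obj G) :=
  core (tangent_gpd G).

Definition is_lbg {R : realType} {G : gpd R} (L : vbg G) : Prop :=
  [/\ is_vbg L, vrk (vtop L) = 1%N & vrk (vbot L) = 1%N].

(* s_g^{-1} *)
Definition lsinv {R : realType} {G : gpd R} {L : vbg G} (g : arr G)
    (l : vbot L) : vtop L := fibinv (@vsrc R G L) g l.

Definition lact {R : realType} {G : gpd R} {L : vbg G} (g : arr G)
    (l : vbot L) : vbot L := vtgt (lsinv g l).

(* The inverse of [F : L^(2) -> L] restricted to the fibre over (g, h). *)
Definition lift2 {R : realType} {G : gpd R} {L : vbg G}
    (F : vtop L * vtop L -> vtop L) (g h : arr G) (l : vtop L) :
    vtop L * vtop L :=
  the (vzero (vtop L) g, vzero (vtop L) h)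
    [set p | vcomposable g h p.1 p.2 /\ F p = l].

(* pr_2^* theta - m^* theta + pr_1^* theta = 0, as an L^(2)-valued 1-form on
   G^(2). *)
Definition multiplicative {R : realType} {G : gpd R} {L : vbg G}
    (theta : tangent (arr G) -> vtop L) : Prop :=
  forall (g h : arr G) (v w : tangent (arr G)),
    composable G (g, h) -> @vcomposable R G (tangent_gpd G) g h v w ->
    let p2 := lift2 snd g h (theta w) in
    let pm := lift2 (fun p => vmul p.1 p.2) g h (theta (tmul v w)) in
    let p1 := lift2 fst g h (theta v) in
    vadd (vadd p2.1 (vopp pm.1)) p1.1 = vzero (vtop L) g /\
    vadd (vadd p2.2 (vopp pm.2)) p1.2 = vzero (vtop L) h.

Definition is_form1 {R : realType} {M : mfd R} {E : vb M}
    (theta : tangent M -> E) : Prop := is_vbmor theta id.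

Definition morita_kernel {R : realType} {G : gpd R} {L : vbg G}
    (theta : tangent (arr G) -> vtop L) : vbg G :=
  {| vtop := dsum (tangent (arr G)) (vtop L);
     vbot := dsum (tangent (obj G)) (vbot L);
     vsrc := fun p => (dmap (@src R G) p.1, vsrc p.2);
     vtgt := fun p => (dmap (@tgt R G) p.1, vtgt (vadd p.2 (theta p.1)));
     vmul := fun p q =>
       (tmul p.1 q.1, lsinv (mul (tbase p.1) (tbase q.1)) (vsrc q.2));
     vunt := fun p => (dmap (@unt R G) p.1, vunt p.2) |}.

(* pr_C, for v over a unit. *)
Definition core_pr {R : realType} {G : gpd R} {V : vbg G} (v : vtop V) :
    vtop V := vadd v (vopp (vunt (vsrc v))).

Definition twisted_dual {R : realType} {G : gpd R} (V L : vbg G) : vbg G :=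
  {| vtop := homb (vtop V) (vtop L);
     vbot := homb (core V) (vbot L);
     vsrc := fun psi : hom (vtop V) (vtop L) =>
       mkhom (E := core V) (src (hbase psi)) (fun c : vtop V =>
         vopp (vsrc (psi (vmul (vzero (vtop V) (hbase psi)) (vinv c)))));
     vtgt := fun psi : hom (vtop V) (vtop L) =>
       mkhom (E := core V) (tgt (hbase psi)) (fun c : vtop V =>
         vtgt (psi (vmul c (vzero (vtop V) (hbase psi)))));
     vmul := fun psi psi' : hom (vtop V) (vtop L) =>
       let g := hbase psi in
       let g' := hbase psi' in
       mkhom (mul g g') (fun w => the (vzero (vtop L) (mul g g'))
         [set l | forall v v', vcomposable g g' v v' -> vmul v v' = w ->
            l = lsinv (mul g g')
                  (vadd (lact (ginv g') (vsrc (psi v))) (vsrc (psi' v')))]);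
     vunt := fun phi : hom (core V) (vbot L) =>
       mkhom (unt (hbase phi)) (fun v => vunt (phi (core_pr v))) |}.

Section MoritaCurvature.
Context {R : realType} {G : gpd R} {L : vbg G}
  (theta : tangent (arr G) -> vtop L) (nab : conn (vbot L)).

Definition s_pull : conn (vtop L) := pull_conn (@vsrc R G L) (@src R G) nab.
Definition t_pull : conn (vtop L) := pull_conn (@vtgt R G L) (@tgt R G) nab.

Definition eta : tangent (arr G) -> R := conn_minus s_pull t_pull.

Let MK := morita_kernel theta.
Let MKd := twisted_dual MK L.

(* The identification of Hom(TG, L) + R_G = Hom(TG, L) + Hom(L, L) with
   Hom(TG + L, L). *)
Definition dual_pair (alpha : hom (tangent (arr G)) (vtop L)) (r : R) :
    vtop MKd :=
  mkhom (hbase alpha)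
    (fun q : vtop MK => vadd (alpha q.1) (vscal r q.2)).

(* The identification of Hom(A, L_M) with Hom(C, L_M), where the core C of MK
   consists of the (a, 0) with a in A. *)
Definition dual_core (phi : hom (algebroid G) (vbot L)) : vbot MKd :=
  mkhom (E := core MK) (hbase phi) (fun c : vtop MK => phi c.1).

Definition morita_curv (p : vtop MK) : vtop MKd :=
  dual_pair
    (mkhom (tbase p.1) (fun w : tangent (arr G) =>
       vadd (conn_diff t_pull theta p.1 w) (vscal (eta w) p.2)))
    (- eta p.1).

(* [v] in TM and values in L restricted to M are identified with their images
   under the unit maps TM -> TG and L_M -> L; the inverse of the latter is the
   source map. *)
Definition morita_curv_units (p : vbot MK) : vbot MKd :=
  dual_core
    (mkhom (E := algebroid G) (tbase p.1) (fun a : tangent (arr G) =>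
       vadd (vsrc (conn_diff t_pull theta (dmap (@unt R G) p.1) a))
            (vscal (eta a) p.2))).

End MoritaCurvature.

(* Main.v *)
(* Tangent vectors are velocities of curves, so identities between differentials of the structure
   maps reduce to identities between points; composable pairs of tangent vectors are velocities of
   composable curves because s is a submersion.

   In a line bundle groupoid s and t are injective on the fibres of L, so G acts on L_M.  Let
   K = d^{t^*nabla} theta.  Comparing the connections through the action shows that eta is
   multiplicative, and the exterior derivative of the multiplicativity equation of theta gives, for
   composable pairs (v, w) and (v', w') over (g, h),
     t K(vw, v'w') = t K(v, v') + g.(t K(w, w')) - eta(v) g.(t theta(w')) + eta(v') g.(t theta(w)).
   Hence theta, eta and K vanish on units, and all the groupoid identities for
   <(v, l), (w, m)> = K(v, w) + eta(w) l - eta(v) m follow by writing v = v.1_{ds v} = 1_{dt v}.v and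
   inverting core elements. *)
From HB Require Import structures.
From mathcomp Require Import all_boot all_order all_algebra.
From mathcomp Require Import all_classical all_reals all_analysis.
From mathcomp Require Import ring lra.
Import numFieldNormedType.Exports.
Import Order.TTheory GRing.Theory Num.Theory.
Require Import Defs.
Local Open Scope classical_set_scope.
Local Open Scope ring_scope.
Set Implicit Arguments.
Unset Strict Implicit.
Unset Printing Implicit Defensive.
Arguments mfd_cover {R M}.
Arguments mfd_inj {R M} _ [i x y].
Arguments mfd_open {R M}.
Arguments vb_base {R M E}.
Arguments vb_total {R M E}.
Arguments vb_proj {R M E} _ [e].
Arguments vb_zero {R M E} _ [x].
Arguments vb_add {R M E} _ [x e e'].
Arguments vb_scal {R M E} _ [x] r [e].
Arguments vb_tdom {R M E}.
Arguments vb_cover {R M E} _ [x].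
Arguments vb_tmap0 {R M E} _ [a x].
Arguments vb_tmapD {R M E} _ [a x e e'].
Arguments vb_tmapZ {R M E} _ [a x] r [e].
Arguments vb_bij {R M E} _ [a x] p.
Arguments vbmor_smooth {R M N E E' F f}.
Arguments vbmor_smooth_base {R M N E E' F f}.
Arguments vbmor_fib {R M N E E' F f} _ [x e].
Arguments vbmor_add {R M N E E' F f} _ [x e e'].
Arguments vbmor_scal {R M N E E' F f} _ [x] r [e].
Arguments conn_fib {R M E D} _ [W v s].
Arguments conn_local {R M E D} _ [W v s s'].
Arguments conn_addv {R M E D} _ [W v w s].
Arguments conn_scalv {R M E D} _ [W] r [v s].
Arguments conn_leibniz {R M E D} _ [W v h s].
Arguments conn_smooth {R M E D} _ [W X s].
Arguments lie_arr {R G}.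
Arguments lie_obj {R G}.
Arguments lie_src {R G}.
Arguments lie_tgt {R G}.
Arguments lie_unt {R G}.
Arguments lie_mul {R G}.
Arguments lie_inv {R G}.
Arguments lie_src_subm {R G} _ [g w].
Arguments lie_src_unt {R G} _ [x].
Arguments lie_tgt_unt {R G} _ [x].
Arguments lie_src_mul {R G} _ [g h].
Arguments lie_tgt_mul {R G} _ [g h].
Arguments lie_assoc {R G} _ [g h k].
Arguments lie_mul_unt {R G} _ [g].
Arguments lie_unt_mul {R G} _ [g].
Arguments lie_inverse {R G} _ [g].
Arguments vbg_mul {R G V} _ [g h v w].
Arguments vbg_mul_scal {R G V} _ [g h] r [v w].

(** * Calculus in coordinates *)

(** Why the pairing is multiplicative: the two terms with [theta] in the formula for K are an error
    caused by differentiating the action of g on L_M, and that derivative is [eta] up to connection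
    forms. The target map of the Morita kernel carries the same [theta]: if (v, l) and (w, m) are
    composable, then t l = g.(t m + t theta(w)). In eta(v') l this yields the extra term eta(v')
    g.(t theta(w)), so the error is absorbed; likewise with the roles of the two pairs exchanged.

    Two obstacles shape the calculus. G^(2) is not given as a manifold, so its tangent vectors are
    kernel vectors of a submersion in charts, and a form on it has to be differentiated as a form
    along a level set. Curves are differentiable at 0 only, so that a contraction argument suffices
    to lift them through a submersion.

    Elements of L over g are compared through their targets, in a frame of L_M at t(g); each
    identity in L becomes one between real numbers. Objects given by a choice (differentials,
    brackets, pulled back connections, products in the twisted dual) each require existence and
    uniqueness before they can be computed. *)

Section EpsDiff.
Context {R : realType} {V W : normedModType R}.
Implicit Types f g : V -> W.

Lemma is_diff_eps f x (df : {linear V -> W}) : continuous df ->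
  (forall e, 0 < e -> \forall h \near (0 : V),
    `|f (h + x) - f x - df h| <= e * `|h|) ->
  is_diff x f df.
Proof.
move=> cdf fdf.
have E : f \o shift x = cst (f x) + df +o_ (0 : V) id.
  apply/eqaddoP => e e0; have := fdf e e0; apply: filterS => h /=.
  by rewrite !fctE /= opprD addrA.
have D := diff_unique cdf E; apply: DiffDef => //.
by apply/diff_locallyP; rewrite D.
Qed.

Lemma diff_eps f x : differentiable f x -> forall e, 0 < e ->
  \forall h \near (0 : V), `|f (h + x) - f x - 'd f x h| <= e * `|h|.
Proof.
move=> /diff_locallyP[_ /eqaddoP E] e e0; have := E e e0; apply: filterS => h /=.
by rewrite !fctE /= opprD addrA.
Qed.

Lemma near_is_diff f g x : (\forall y \near x, f y = g y) ->
  differentiable f x -> is_diff x g ('d f x).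
Proof.
move=> fg df; apply: is_diff_eps; first exact: diff_continuous.
move=> e e0; have gx : f x = g x by exact: nbhs_singleton fg.
have fg' : \forall h \near (0 : V), f (h + x) = g (h + x).
  have := fg; rewrite (near_shift 0 x) //= => H.
  by apply: filterS H => h; rewrite /= subr0.
by have := diff_eps df e0; apply: filterS2 fg' => h -> ; rewrite gx.
Qed.

Lemma near_diff f g x : (\forall y \near x, f y = g y) ->
  differentiable f x -> 'd g x = 'd f x :> (V -> W).
Proof. by move=> fg df; have D := near_is_diff fg df; exact: diff_val. Qed.

Lemma near_differentiable f g x : (\forall y \near x, f y = g y) ->
  differentiable f x -> differentiable g x.
Proof. by move=> fg df; have D := near_is_diff fg df; exact: ex_diff. Qed.

End EpsDiff.

(* ['d f p v] and [differentiable f p] for real valued [f], locked to keep unification from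
   unfolding the differential. *)
HB.lock Definition dd {R : realType} {V : normedModType R} (f : V -> R) (p v : V) : R :=
  'd f p v.
HB.lock Definition dfb {R : realType} {V : normedModType R} (f : V -> R) (p : V) : Prop :=
  differentiable f p.

(** * Differentials of real valued and row valued functions *)

Section LockedDiff.
Context {R : realType}.

Lemma ddE {V : normedModType R} (f : V -> R) p v : dd f p v = 'd f p v.
Proof. by rewrite dd.unlock. Qed.

Lemma dfbE {V : normedModType R} (f : V -> R) p : dfb f p <-> differentiable f p.
Proof. by rewrite dfb.unlock. Qed.

Section Generic.
Context {V : normedModType R}.
Implicit Types (f g : V -> R) (p v w : V).

Lemma ddDr f p v w : dd f p (v + w) = dd f p v + dd f p w.
Proof. by rewrite !ddE linearD. Qed.

Lemma ddZr f p c v : dd f p (c *: v) = c * dd f p v.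
Proof. by rewrite !ddE linearZ. Qed.

Lemma dd0r f p : dd f p 0 = 0.
Proof. by rewrite -(scale0r 0) ddZr mul0r. Qed.

Lemma ddBr f p v w : dd f p (v - w) = dd f p v - dd f p w.
Proof. by rewrite ddDr -scaleN1r ddZr mulN1r. Qed.

Lemma dd_sumr f p (I : Type) (r : seq I) (P : pred I) (v : I -> V) :
  dd f p (\sum_(i <- r | P i) v i) = \sum_(i <- r | P i) dd f p (v i).
Proof. by rewrite (big_morph (dd f p) (ddDr f p) (dd0r f p)). Qed.

Lemma near_dfb f g p : (\forall y \near p, f y = g y) -> dfb f p -> dfb g p.
Proof. by move=> fg /dfbE df; apply/dfbE; exact: near_differentiable fg df. Qed.

Lemma near_dd f g p v : (\forall y \near p, f y = g y) -> dfb f p -> dd g p v = dd f p v.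
Proof. by move=> fg /dfbE df; rewrite !ddE (near_diff fg df). Qed.

Lemma dfb_continuous f p : dfb f p -> {for p, continuous f}.
Proof. by move=> /dfbE; exact: differentiable_continuous. Qed.

Lemma dfb_cst (c : R) p : dfb (fun _ : V => c) p.
Proof. by apply/dfbE; exact: differentiable_cst. Qed.

Lemma dd_cst (c : R) p v : dd (fun _ : V => c) p v = 0.
Proof. by rewrite ddE diff_cst. Qed.

Lemma dfbD f g p : dfb f p -> dfb g p -> dfb (fun x => f x + g x) p.
Proof. by move=> /dfbE df /dfbE dg; apply/dfbE; exact: differentiableD. Qed.

Lemma ddD f g p v : dfb f p -> dfb g p -> dd (fun x => f x + g x) p v = dd f p v + dd g p v.
Proof.
move=> /dfbE df /dfbE dg; rewrite !ddE.
by have -> : 'd (fun x => f x + g x) p = 'd f p \+ 'd g p :> (V -> R) by exact: diffD.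
Qed.

Lemma dfbN f p : dfb f p -> dfb (fun x => - f x) p.
Proof. by move=> /dfbE df; apply/dfbE; exact: differentiableN. Qed.

Lemma ddN f p v : dfb f p -> dd (fun x => - f x) p v = - dd f p v.
Proof.
move=> /dfbE df; rewrite !ddE.
by have -> : 'd (fun x => - f x) p = - ('d f p : V -> R) :> (V -> R) by exact: diffN.
Qed.

Lemma dfbB f g p : dfb f p -> dfb g p -> dfb (fun x => f x - g x) p.
Proof. by move=> df dg; apply: dfbD => //; exact: dfbN. Qed.

Lemma ddB f g p v : dfb f p -> dfb g p -> dd (fun x => f x - g x) p v = dd f p v - dd g p v.
Proof. by move=> df dg; rewrite (ddD v df (dfbN dg)) ddN. Qed.

Lemma dfbM f g p : dfb f p -> dfb g p -> dfb (fun x => f x * g x) p.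
Proof. by move=> /dfbE df /dfbE dg; apply/dfbE; exact: differentiableM. Qed.

Lemma ddM f g p v : dfb f p -> dfb g p ->
  dd (fun x => f x * g x) p v = f p * dd g p v + g p * dd f p v.
Proof.
move=> /dfbE df /dfbE dg; rewrite !ddE.
have -> : 'd (fun x => f x * g x) p = f p \*: 'd g p + g p \*: 'd f p :> (V -> R) by exact: diffM.
by [].
Qed.

Lemma dfbV f p : f p != 0 -> dfb f p -> dfb (fun x => (f x)^-1) p.
Proof. by move=> f0 /dfbE df; apply/dfbE; exact: differentiableV. Qed.

Lemma ddV f p v : f p != 0 -> dfb f p ->
  dd (fun x => (f x)^-1) p v = - ((f p)^-1 * (f p)^-1 * dd f p v).
Proof.
move=> f0 /dfbE df; rewrite !ddE diffV //=.
by rewrite -[LHS]/(- (f p) ^- 2 * 'd f p v) -exprVn expr2 mulNr.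
Qed.

Lemma dfb_sum_dd n (f : 'I_n -> V -> R) p v : (forall i, dfb (f i) p) ->
  dfb (fun x => \sum_i f i x) p /\ dd (fun x => \sum_i f i x) p v = \sum_i dd (f i) p v.
Proof.
move=> df; elim: n f df => [|n IH] f df.
  rewrite big_ord0 (_ : (fun x => _) = fun=> 0); last by apply/funext => x; rewrite big_ord0.
  by split; [exact: dfb_cst|exact: dd_cst].
have [D E] := IH (fun i => f (lift ord0 i)) (fun i => df _).
rewrite big_ord_recl -E (_ : (fun x => _) = fun x => f ord0 x + \sum_(i < n) f (lift ord0 i) x);
  last by apply/funext => x; rewrite big_ord_recl.
by split; [exact: dfbD|exact: ddD].
Qed.

Lemma dfb_sum n (f : 'I_n -> V -> R) p : (forall i, dfb (f i) p) ->
  dfb (fun x => \sum_i f i x) p.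
Proof. by move=> df; have [] := dfb_sum_dd p df. Qed.

Lemma dd_sum n (f : 'I_n -> V -> R) p v : (forall i, dfb (f i) p) ->
  dd (fun x => \sum_i f i x) p v = \sum_i dd (f i) p v.
Proof. by move=> df; have [] := dfb_sum_dd v df. Qed.

Lemma dfb_eps f p : dfb f p -> forall e, 0 < e ->
  \forall h \near (0 : V), `|f (h + p) - f p - dd f p h| <= e * `|h|.
Proof.
move=> /dfbE df e e0; have := diff_eps df e0.
by apply: filterS => h; rewrite ddE.
Qed.

End Generic.

Lemma row_sumE {n} (v : 'rV[R]_n) : v = \sum_j v 0 j *: delta_mx 0 j.
Proof. exact: row_sum_delta. Qed.

Lemma diff_coordE {m} (p v : 'rV[R]_m) i : 'd (fun x : 'rV[R]_m => x 0 i) p v = v 0 i.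
Proof.
have @f' : {linear 'rV[R]_m -> R}.
  by exists (fun N : 'rV[R]_m => N 0 i); do 2![eexists]; do ?[constructor];
     rewrite ?mxE// => ? *; rewrite ?mxE//; move=> ?; rewrite !mxE.
by rewrite (_ : (fun _ => _) = f') // diff_lin //; exact: coord_continuous.
Qed.

Lemma dfb_coord {m} (p : 'rV[R]_m) i : dfb (fun x : 'rV[R]_m => x 0 i) p.
Proof. by apply/dfbE; exact: differentiable_coord. Qed.

Lemma dd_coord {m} (p v : 'rV[R]_m) i : dd (fun x : 'rV[R]_m => x 0 i) p v = v 0 i.
Proof. by rewrite ddE diff_coordE. Qed.

Lemma dd_rowE {n} (f : 'rV[R]_n -> R) p v :
  dd f p v = \sum_j v 0 j * dd f p (delta_mx 0 j).
Proof. by rewrite {1}(row_sumE v) dd_sumr; apply: eq_bigr => j _; rewrite ddZr. Qed.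

Lemma near_forall_ord {V : normedModType R} {n} (p : V) (P : 'I_n -> V -> Prop) :
  (forall j, \forall x \near p, P j x) -> \forall x \near p, forall j, P j x.
Proof. exact: filter_forall. Qed.

Section RowValued.
Context {V : normedModType R} {n : nat}.
Implicit Types (F : V -> 'rV[R]_n) (p v : V).

(** Componentwise versions of [differentiable] and ['d]. By [dfvE] and [dv_diff] they agree with the
    originals, so the work can be done with real valued functions. *)
Definition dfv F p := forall j, dfb (fun x => F x 0 j) p.
Definition dv F p v : 'rV[R]_n := \row_j dd (fun x => F x 0 j) p v.

Lemma dvE F p v j : dv F p v 0 j = dd (fun x => F x 0 j) p v.
Proof. by rewrite mxE. Qed.

Lemma dfvE F p : dfv F p <-> differentiable F p.
Proof.
split=> [dF|dF j]; last first.
  apply/dfbE; exact: (differentiable_comp dF (differentiable_coord (F p) 0 j)).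
rewrite (_ : F = \sum_j (fun x => F x 0 j *: delta_mx 0 j)); last first.
  by apply/funext => x; rewrite fct_sumE -row_sumE.
by apply: differentiable_sum => j; apply: differentiableZl; apply/dfbE.
Qed.

Lemma dv_diff F p v : differentiable F p -> dv F p v = 'd F p v.
Proof.
move=> dF; apply/rowP => j; rewrite dvE ddE.
have dc := differentiable_coord (F p) 0 j.
have E : 'd ((fun x : 'rV[R]_n => x 0 j) \o F) p = 'd (fun x : 'rV[R]_n => x 0 j) (F p) \o 'd F p :> (V -> R).
  exact: diff_comp.
by rewrite -[LHS]/('d ((fun x : 'rV[R]_n => x 0 j) \o F) p v) E /= diff_coordE.
Qed.

Lemma continuous_rV F p :
  (forall j, {for p, continuous (fun x => F x 0 j)}) -> {for p, continuous F}.
Proof.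
move=> cF; suff : F x @[x --> p] --> F p by [].
apply/cvgrPdist_le => /= e e0; near=> x.
rewrite /Num.Def.normr/= mx_normrE (bigmax_le _ (ltW e0))//= => -[i j] _.
rewrite !mxE /= ord1; move: j; near: x; apply: filter_forall => j.
by have /cvgrPdist_le := cF j; exact.
Unshelve. all: by end_near. Qed.

Lemma dfv_continuous F p : dfv F p -> {for p, continuous F}.
Proof. by move=> dF; apply: continuous_rV => j; exact: dfb_continuous. Qed.

Lemma dfb_dd_comp (f : 'rV[R]_n -> R) F p v : dfv F p -> dfb f (F p) ->
  dfb (fun x => f (F x)) p /\ dd (fun x => f (F x)) p v = dd f (F p) (dv F p v).
Proof.
move=> /dfvE dF /dfbE df; rewrite dfbE !ddE dv_diff //.
split; first exact: (differentiable_comp dF df).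
have E : 'd (f \o F) p = 'd f (F p) \o 'd F p :> (V -> R) by exact: diff_comp.
by rewrite -[LHS]/('d (f \o F) p v) E.
Qed.

Lemma dfb_comp (f : 'rV[R]_n -> R) F p : dfv F p -> dfb f (F p) -> dfb (fun x => f (F x)) p.
Proof. by move=> dF df; have [] := dfb_dd_comp p dF df. Qed.

Lemma dd_comp (f : 'rV[R]_n -> R) F p v : dfv F p -> dfb f (F p) ->
  dd (fun x => f (F x)) p v = dd f (F p) (dv F p v).
Proof. by move=> dF df; have [] := dfb_dd_comp v dF df. Qed.

Lemma dvDr F p v w : dv F p (v + w) = dv F p v + dv F p w.
Proof. by apply/rowP => j; rewrite !mxE ddDr. Qed.

Lemma dvZr F p c v : dv F p (c *: v) = c *: dv F p v.
Proof. by apply/rowP => j; rewrite !mxE ddZr. Qed.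

Lemma near_dfv F G p : (\forall y \near p, F y = G y) -> dfv F p -> dfv G p.
Proof. by move=> FG dF j; apply: near_dfb (dF j); apply: filterS FG => y ->. Qed.

Lemma near_dv F G p v : (\forall y \near p, F y = G y) -> dfv F p -> dv G p v = dv F p v.
Proof.
move=> FG dF; apply/rowP => j; rewrite !dvE.
by apply: near_dd (dF j); apply: filterS FG => y ->.
Qed.

End RowValued.

Lemma dfv_comp {V : normedModType R} {m n} (G : 'rV[R]_m -> 'rV[R]_n) (F : V -> 'rV[R]_m) p :
  dfv F p -> dfv G (F p) -> dfv (fun x => G (F x)) p.
Proof. by move=> dF dG j; apply: (@dfb_comp _ _ (fun y => G y 0 j)). Qed.

Lemma dv_comp {V : normedModType R} {m n} (G : 'rV[R]_m -> 'rV[R]_n) (F : V -> 'rV[R]_m) p v :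
  dfv F p -> dfv G (F p) -> dv (fun x => G (F x)) p v = dv G (F p) (dv F p v).
Proof.
move=> dF dG; apply/rowP => j; rewrite !dvE.
by rewrite (@dd_comp _ _ (fun y => G y 0 j)).
Qed.

End LockedDiff.

(** * Smooth functions on open sets of coordinate space *)

Section SmoothCalculus.
Context {R : realType}.
Implicit Types m n : nat.

(** The scalar counterpart of [Ck]. By [CinftyP] a map is smooth on an open set if and only if its
    components are, so products, inverses and determinants are treated for real valued functions. *)
Fixpoint smk {m} (k : nat) (O : set 'rV[R]_m) (f : 'rV[R]_m -> R) : Prop :=
  match k with
  | 0 => forall p, O p -> {for p, continuous f}
  | k'.+1 => (forall p, O p -> dfb f p) /\
             forall v, smk k' O (fun p => dd f p v)
  end.

Lemma smk0 {m} (O : set 'rV[R]_m) f :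
  smk 0 O f = (forall p, O p -> {for p, continuous f}).
Proof. by []. Qed.

Lemma smkS {m} k (O : set 'rV[R]_m) f :
  smk k.+1 O f = ((forall p, O p -> dfb f p) /\
    (forall v, smk k O (fun p => dd f p v))).
Proof. by []. Qed.

Definition sm {m} (O : set 'rV[R]_m) (f : 'rV[R]_m -> R) := forall k, smk k O f.

Lemma smkW {m} k (O : set 'rV[R]_m) f : smk k.+1 O f -> smk k O f.
Proof.
elim: k f => [|k IH] f [df sf].
  by move=> p Op; apply: dfb_continuous; exact: df.
by split=> // v; exact: IH.
Qed.

Lemma smk_diff {m} k (O : set 'rV[R]_m) f p : smk k.+1 O f -> O p -> dfb f p.
Proof. by move=> [+ _]; apply. Qed.

Lemma sm_diff {m} (O : set 'rV[R]_m) f p : sm O f -> O p -> dfb f p.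
Proof. by move=> /(_ 1%N) [+ _]; apply. Qed.

Lemma sm_d {m} (O : set 'rV[R]_m) f v : sm O f -> sm O (fun p => dd f p v).
Proof. by move=> sf k; have := sf k.+1; rewrite smkS => -[_]; exact. Qed.

Lemma smk_sub {m} k (O O' : set 'rV[R]_m) f : O' `<=` O -> smk k O f -> smk k O' f.
Proof.
move=> OO; elim: k f => [|k IH] f; first by move=> H p /OO; exact: H.
by rewrite !smkS => -[df sf]; split=> [p Op|v]; [exact/df/OO|exact: IH].
Qed.

(** Openness of [O] turns equality on [O] into equality of germs; then the derivatives agree on [O]
    too and the induction proceeds. *)
Lemma smk_ext {m} k (O : set 'rV[R]_m) f g : open O ->
  (forall p, O p -> f p = g p) -> smk k O f -> smk k O g.
Proof.
move=> oO; elim: k f g => [|k IH] f g fg.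
all: have nfg p : O p -> \forall y \near p, f y = g y.
all: try by move=> Op; apply: filterS (open_nbhs_nbhs (conj oO Op)) => y; exact: fg.
  move=> cf p Op; have E : {near p, f =1 g} := nfg p Op.
  have H : f x @[x --> p] --> g p by rewrite -(fg p Op); exact: cf.
  by have : g x @[x --> p] --> g p by apply: cvg_trans H; exact: near_eq_cvg E.
rewrite !smkS => -[df sf]; split=> [p Op|v].
  by apply: near_dfb (nfg p Op) _; exact: df.
by apply: IH (sf v) => p Op; rewrite (near_dd v (nfg p Op)) //; exact: df.
Qed.

Lemma sm_sub {m} (O O' : set 'rV[R]_m) f : O' `<=` O -> sm O f -> sm O' f.
Proof. by move=> OO sf k; exact: smk_sub (sf k). Qed.

Lemma sm_ext {m} (O : set 'rV[R]_m) f g : open O ->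
  (forall p, O p -> f p = g p) -> sm O f -> sm O g.
Proof. by move=> oO fg sf k; exact: smk_ext (sf k). Qed.

Lemma smk_cst {m} k (O : set 'rV[R]_m) (c : R) : smk k O (fun _ => c).
Proof.
elim: k c => [|k IH] c; first by move=> p _; exact: cst_continuous.
rewrite smkS; split=> [p _|v]; first exact: dfb_cst.
have -> : (fun p : 'rV[R]_m => dd (fun _ : 'rV[R]_m => c) p v) = fun=> 0.
  by apply/funext => p; rewrite dd_cst.
exact: IH.
Qed.

Lemma sm_coord {m} (O : set 'rV[R]_m) i : sm O (fun p => p 0 i).
Proof.
case=> [|k]; first by move=> p _; exact: coord_continuous.
rewrite smkS; split=> [p _|v]; first exact: dfb_coord.
rewrite (_ : (fun p => _) = fun=> v 0 i); first exact: smk_cst.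
by apply/funext => p; rewrite dd_coord.
Qed.

Lemma sm_cst {m} (O : set 'rV[R]_m) (c : R) : sm O (fun _ => c).
Proof. by move=> k; exact: smk_cst. Qed.

Lemma smkD {m} k (O : set 'rV[R]_m) f g : open O -> smk k O f -> smk k O g ->
  smk k O (fun x => f x + g x).
Proof.
move=> oO; elim: k f g => [|k IH] f g.
  rewrite !smk0 => cf cg p Op.
  exact: (@continuousD _ _ _ f g p (cf p Op) (cg p Op)).
rewrite !smkS => -[df sf] [dg sg]; split=> [p Op|v]; first by apply: dfbD; auto.
apply: (smk_ext oO _ (IH _ _ (sf v) (sg v))) => p Op.
by rewrite ddD; auto.
Qed.

Lemma smkM {m} k (O : set 'rV[R]_m) f g : open O -> smk k O f -> smk k O g ->
  smk k O (fun x => f x * g x).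
Proof.
move=> oO; elim: k f g => [|k IH] f g.
  rewrite !smk0 => cf cg p Op.
  exact: (@continuousM _ _ f g p (cf p Op) (cg p Op)).
move=> sf sg; move: (sf) (sg); rewrite !smkS => -[df sdf] [dg sdg].
split=> [p Op|v]; first by apply: dfbM; auto.
apply: (@smk_ext _ _ _ (fun p => f p * dd g p v + g p * dd f p v) _ oO).
  by move=> p Op; rewrite ddM; auto.
by apply: smkD => //; apply: IH => //; exact: smkW.
Qed.

Lemma smk_sum {m n} k (O : set 'rV[R]_m) (f : 'I_n -> 'rV[R]_m -> R) : open O ->
  (forall i, smk k O (f i)) -> smk k O (fun x => \sum_i f i x).
Proof.
move=> oO; elim: n f => [|n IH] f sf.
  apply: (@smk_ext _ _ _ (fun=> 0) _ oO); last exact: smk_cst.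
  by move=> p _; rewrite big_ord0.
apply: (@smk_ext _ _ _ (fun x => f ord0 x + \sum_(i < n) f (lift ord0 i) x) _ oO).
  by move=> p _; rewrite big_ord_recl.
by apply: smkD => //; apply: IH.
Qed.

(** The derivative of [f^-1] is [- f^-1 * f^-1 * df], in which [f^-1] occurs one order lower, where
    the induction hypothesis covers it. *)
Lemma smk_inv {m} k (O : set 'rV[R]_m) f : open O -> (forall p, O p -> f p != 0) ->
  smk k O f -> smk k O (fun x => (f x)^-1).
Proof.
move=> oO f0; elim: k => [|k IH].
  rewrite !smk0 => cf p Op; have cfp : f x @[x --> p] --> f p := cf p Op.
  exact: cvgV (f0 p Op) cfp.
move=> sf; move: (sf); rewrite !smkS => -[df sdf].
split=> [p Op|v]; first by apply: dfbV; auto.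
apply: (@smk_ext _ _ _ (fun p => (- 1 * ((f p)^-1 * (f p)^-1)) * dd f p v) _ oO).
  by move=> p Op; rewrite ddV; auto; rewrite mulN1r mulNr.
have := IH (smkW sf) => sV.
by apply: smkM => //; apply: smkM => //; [exact: smk_cst|exact: smkM].
Qed.

Lemma smD {m} (O : set 'rV[R]_m) f g : open O -> sm O f -> sm O g ->
  sm O (fun x => f x + g x).
Proof. by move=> oO sf sg k; exact: smkD. Qed.

Lemma smM {m} (O : set 'rV[R]_m) f g : open O -> sm O f -> sm O g ->
  sm O (fun x => f x * g x).
Proof. by move=> oO sf sg k; exact: smkM. Qed.

Lemma smN {m} (O : set 'rV[R]_m) f : open O -> sm O f -> sm O (fun x => - f x).
Proof.
move=> oO sf; apply: (@sm_ext _ _ (fun x => -1 * f x)) => //.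
  by move=> p _; rewrite mulN1r.
by apply: smM => //; exact: sm_cst.
Qed.

Lemma sm_sum {m n} (O : set 'rV[R]_m) (f : 'I_n -> 'rV[R]_m -> R) : open O ->
  (forall i, sm O (f i)) -> sm O (fun x => \sum_i f i x).
Proof. by move=> oO sf k; apply: smk_sum => // i; exact: sf. Qed.

Lemma sm_inv {m} (O : set 'rV[R]_m) f : open O -> (forall p, O p -> f p != 0) ->
  sm O f -> sm O (fun x => (f x)^-1).
Proof. by move=> oO f0 sf k; exact: smk_inv. Qed.

(** The induction is over all [f], because the chain rule brings in the partial derivatives of [f]
    composed with [F], to which the hypothesis of order [k] is applied. *)
Lemma smk_comp {m n} k (O : set 'rV[R]_m) (O' : set 'rV[R]_n)
    (F : 'rV[R]_m -> 'rV[R]_n) f : open O ->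
  (forall p, O p -> O' (F p)) -> (forall j, smk k O (fun p => F p 0 j)) ->
  smk k O' f -> smk k O (fun p => f (F p)).
Proof.
move=> oO FO; elim: k f => [|k IH] f sF sf.
  move: sF sf => /= sF sf p Op; apply: (@continuous_comp _ _ _ F f); last exact: sf (FO _ Op).
  by apply: continuous_rV => j; exact: sF.
have dF p : O p -> dfv F p by move=> Op j; apply: smk_diff (sF j) Op.
move: (sf); rewrite !smkS => -[df sdf].
split=> [p Op|v]; first by apply: dfb_comp; [exact: dF|exact/df/FO].
apply: (@smk_ext _ _ _ (fun p => \sum_j dd (fun x => F x 0 j) p v * dd f (F p) (delta_mx 0 j)) _ oO).
  move=> p Op; rewrite dd_comp; [|exact: dF|exact/df/FO].
  by rewrite [RHS]dd_rowE; apply: eq_bigr => j _; rewrite dvE.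
apply: smk_sum => // j; apply: smkM => //; first by have := sF j; rewrite smkS => -[].
apply: (IH (fun q => dd f q (delta_mx 0 j))) => // i; exact: smkW.
Qed.

Lemma sm_comp {m n} (O : set 'rV[R]_m) (O' : set 'rV[R]_n)
    (F : 'rV[R]_m -> 'rV[R]_n) f : open O ->
  (forall p, O p -> O' (F p)) -> (forall j, sm O (fun p => F p 0 j)) ->
  sm O' f -> sm O (fun p => f (F p)).
Proof. by move=> oO FO sF sf k; apply: smk_comp (sf k) => // j; exact: sF. Qed.

Definition smv {m n} (O : set 'rV[R]_m) (F : 'rV[R]_m -> 'rV[R]_n) :=
  forall j, sm O (fun p => F p 0 j).

Lemma smv_dfv {m n} (O : set 'rV[R]_m) (F : 'rV[R]_m -> 'rV[R]_n) p : smv O F -> O p -> dfv F p.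
Proof. by move=> sF Op j; exact: sm_diff (sF j) Op. Qed.

Lemma CinftyP {m n} (O : set 'rV[R]_m) (F : 'rV[R]_m -> 'rV[R]_n) : open O ->
  Cinfty O F <-> smv O F.
Proof.
move=> oO; suff H k (G : 'rV[R]_m -> 'rV[R]_n) :
    Ck k O G <-> forall j, smk k O (fun p => G p 0 j).
  split=> [CF j k|sF k]; first by have /H := CF k; apply.
  by apply/H => j; exact: sF.
elim: k G => [|k IH] G.
  split=> [/= cG j p Op|cG p Op].
    by apply: (@continuous_comp _ _ _ G (fun q : 'rV[R]_n => q 0 j));
      [exact: cG|exact: coord_continuous].
  by apply: continuous_rV => j; exact: cG.
split=> [[dG sG] j|sG].
  rewrite smkS; split=> [p Op|v]; first by have /dfvE/(_ j) := dG p Op.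
  have /IH/(_ j) := sG v; apply: smk_ext => // p Op.
  by rewrite -dv_diff ?dvE //; exact: dG.
have dG p : O p -> differentiable G p.
  by move=> Op; apply/dfvE => j; apply: smk_diff (sG j) Op.
split=> // v; apply/IH => j; have [_ /(_ v)] := sG j; apply: smk_ext => // p Op.
by rewrite -dv_diff ?dvE //; exact: dG.
Qed.

End SmoothCalculus.

(** * Symmetry of second derivatives *)

Section Schwarz.
Context {R : realType}.

Lemma nbhs_norm_shift {V : normedModType R} (p : V) (P : set V) : nbhs p P ->
  exists2 d : R, 0 < d & forall h, `|h| < d -> P (h + p).
Proof.
move=> /nbhs_normP[d /= d0 H]; exists d => // h hd; apply: H.
by rewrite /= opprD addrCA subrr addr0 normrN.
Qed.

Lemma dd_line {V : normedModType R} (f : V -> R) (v c : V) (s : R) : dfb f (s *: v + c) ->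
  is_derive s 1 (fun t : R => f (t *: v + c)) (dd f (s *: v + c) v).
Proof.
move=> /dfbE df.
have D1 : is_diff s (fun t : R => t *: v + c) (fun t : R => t *: v).
  have D := is_diffD (is_diff_scalel s v) (is_diff_cst c s).
  by rewrite addr0 in D.
have dl : differentiable (fun t : R => t *: v + c) s by exact: ex_diff.
have dfl : differentiable (f \o (fun t : R => t *: v + c)) s.
  exact: differentiable_comp.
have Hd : derivable (f \o (fun t : R => t *: v + c)) s 1 by exact: diff_derivable.
have H := derivableP Hd.
have E : 'D_1 (f \o (fun t : R => t *: v + c)) s = dd f (s *: v + c) v.
  rewrite deriveE // diff_comp //= ddE.
  by have -> : 'd (fun t : R => t *: v + c) s 1 = v by rewrite diff_val scale1r.
by rewrite E in H.
Qed.

Lemma line_MVT {V : normedModType R} (f : V -> R) (v c : V) (h : R) : 0 < h ->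
  (forall s, 0 <= s <= h -> dfb f (s *: v + c)) ->
  exists2 s, 0 <= s <= h & f (h *: v + c) - f c = dd f (s *: v + c) v * h.
Proof.
move=> h0 df; pose g (t : R) := f (t *: v + c).
have [s sI E] : exists2 s, s \in `]0, h[ & g h - g 0 = dd f (s *: v + c) v * (h - 0).
  apply: (@MVT _ g (fun s => dd f (s *: v + c) v)) => //.
    by move=> s; rewrite in_itv /= => /andP[s0 sh]; apply/dd_line/df; rewrite !ltW.
  apply: derivable_within_continuous => s; rewrite in_itv /= => sI.
  by have [] := dd_line (df s sI).
exists s; first by move: sI; rewrite in_itv /= => /andP[? ?]; rewrite !ltW.
by move: E; rewrite /g scale0r add0r subr0.
Qed.

Lemma dd_shift {V : normedModType R} (f : V -> R) (x c : V) : dfb f (x + c) ->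
  dfb (fun y => f (y + c)) x /\
  forall v, dd (fun y => f (y + c)) x v = dd f (x + c) v.
Proof.
move=> /dfbE df.
have D : is_diff x (fun y : V => y + c) id.
  have D := is_diffD (is_diff_id x) (is_diff_cst c x).
  by rewrite addr0 in D.
have dt : differentiable (fun y : V => y + c) x by exact: ex_diff.
split; first by apply/dfbE; exact: (differentiable_comp dt df).
move=> v; rewrite !ddE.
have E : 'd (f \o (fun y : V => y + c)) x = 'd f (x + c) \o 'd (fun y : V => y + c) x :> (V -> R).
  exact: diff_comp.
by rewrite -[LHS]/('d (f \o (fun y : V => y + c)) x v) E /= diff_val.
Qed.

Lemma shift_difference {V : normedModType R} (f : V -> R) (x c v : V) :
  dfb f (x + c) -> dfb f x ->
  dfb (fun y => f (y + c) - f y) x /\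
  dd (fun y => f (y + c) - f y) x v = dd f (x + c) v - dd f x v.
Proof.
move=> d1 d2; have [d3 E] := dd_shift d1.
by split; [exact: dfbB|rewrite ddB // E].
Qed.

(** The mean value theorem along [v], applied to [y |-> f (y + h w) - f y], leaves the increment of
    the derivative [phi] between [s v + p] and [s v + p + h w]. Both values of [phi] are then
    expanded to first order at [p]. *)
Lemma second_difference {m} (O : set 'rV[R]_m) f p v w : open O -> sm O f -> O p ->
  forall e, 0 < e -> exists2 h0 : R, 0 < h0 & forall h, 0 < h < h0 ->
  `|f (h *: v + p + h *: w) - f (h *: v + p) - (f (p + h *: w) - f p)
     - dd (fun x => dd f x v) p w * (h * h)| <= e * (h * h).
Proof.
move=> oO sf Op e e0; pose phi x := dd f x v.
have dphi : dfb phi p by apply: sm_diff Op; exact: sm_d.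
(* The two arguments [s v + h w] and [s v] of the expansion have total norm at most
   [h (|v| + |v| + |w|)], so precision [e / N] suffices; the summand 1 makes [N] positive. *)
pose N := `|v| + `|v| + `|w| + 1.
have N0 : 0 < N by rewrite /N ltr_wpDl // !addr_ge0.
have [d1 d10 H1] := nbhs_norm_shift (dfb_eps dphi (divr_gt0 e0 N0)).
have [d2 d20 H2] := nbhs_norm_shift (open_nbhs_nbhs (conj oO Op)).
pose d := Num.min d1 d2; have d0 : 0 < d by rewrite /d lt_min d10.
have dd1 : d <= d1 by rewrite /d ge_min lexx.
have dd2 : d <= d2 by rewrite /d ge_min lexx orbT.
exists (d / N); first exact: divr_gt0.
move=> h /andP[h0 hd]; rewrite ltr_pdivlMr // in hd.
have nw : `|h *: w| = h * `|w| by rewrite normrZ gtr0_norm.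
have nv s : 0 <= s <= h -> `|s *: v| <= h * `|v|.
  by move=> /andP[s0 sh]; rewrite normrZ ger0_norm // ler_wpM2r.
have v0 : 0 <= h * `|v| by rewrite mulr_ge0 // ltW.
have w0 : 0 <= h * `|w| by rewrite mulr_ge0 // ltW.
have hd' : h * `|v| + h * `|v| + h * `|w| + h < d by rewrite -!mulrDr -[X in _ + X]mulr1 -mulrDr.
have small s : 0 <= s <= h -> `|s *: v + h *: w| < d /\ `|s *: v| < d.
  move=> /nv A; have B := ler_normD (s *: v) (h *: w); rewrite nw in B.
  by split; lra.
have OO s : 0 <= s <= h -> O (s *: v + p + h *: w) /\ O (s *: v + p).
  move=> /small[A B]; split; last exact/H2/(lt_le_trans B).
  by rewrite addrAC; apply/H2/(lt_le_trans A).
have [|s sI ->] := @line_MVT _ (fun y => f (y + h *: w) - f y) v p h h0.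
  move=> s /OO[A B].
  by have [] := shift_difference v (sm_diff sf A) (sm_diff sf B).
have [A B] := OO s sI.
have [_ ->] := shift_difference v (sm_diff sf A) (sm_diff sf B).
have [sA sB] := small s sI.
have := H1 _ (lt_le_trans sA dd1); have := H1 _ (lt_le_trans sB dd1).
rewrite !addr0 [s *: v + h *: w + p]addrAC [dd phi p (_ + _)]ddDr [dd phi p (h *: w)]ddZr /phi.
have n1 := nv s sI; have n2 := ler_normD (s *: v) (h *: w); rewrite nw in n2.
move: (dd f (s *: v + p + h *: w) v) (dd f (s *: v + p) v) (dd f p v).
move: (dd (fun x => dd f x v) p w) => Y a b c.
move: (dd (fun x => dd f x v) p (s *: v)) => X Hb Ha.
have -> : (a - b) * h - Y * (h * h) = h * ((a - c - (X + h * Y)) - (b - c - X)) by ring.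
rewrite normrM gtr0_norm // mulrCA ler_pM2l //.
apply: (le_trans (ler_normB _ _)); apply: (le_trans (lerD Ha Hb)).
rewrite -mulrDr -mulrA ler_wpM2l //; first exact: ltW.
rewrite mulrC ler_pdivrMr // /N !mulrDr mulr1; lra.
Qed.

(** Exchanging [v] and [w] does not change the second difference, as it is the same combination of
    four values of [f]; divided by [h * h] it is close to either mixed derivative. *)
Lemma schwarz {m} (O : set 'rV[R]_m) f p v w : open O -> sm O f -> O p ->
  dd (fun x => dd f x v) p w = dd (fun x => dd f x w) p v.
Proof.
move=> oO sf Op; apply/eqP; rewrite -subr_eq0 -normr_le0; apply/ler_addgt0Pl => e e0.
rewrite addr0; have e2 : 0 < e / 2 by rewrite divr_gt0.
have [h1 h10 H1] := second_difference v w oO sf Op e2.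
have [h2 h20 H2] := second_difference w v oO sf Op e2.
pose h := Num.min h1 h2 / 2.
have h0 : 0 < Num.min h1 h2 by rewrite lt_min h10.
have hh : 0 < h by rewrite /h divr_gt0.
have hl : h < Num.min h1 h2 by rewrite /h ltr_pdivrMr // ltr_pMr // ltr1n.
have := H1 h; rewrite hh (lt_le_trans hl) ?ge_min ?lexx // => /(_ isT).
have := H2 h; rewrite hh (lt_le_trans hl) ?ge_min ?lexx ?orbT // => /(_ isT).
rewrite [h *: w + p + h *: v]addrAC [p + h *: v]addrC [p + h *: w]addrC.
rewrite [h *: v + p + h *: w]addrAC [h *: w + h *: v]addrC.
move: (f _) (f (h *: w + p)) (f (h *: v + p)) (f p) => a b c g.
move: (dd _ p v) (dd _ p w) => X Y A B.
have hh2 : 0 < h * h by exact: mulr_gt0.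
rewrite -(ler_pM2r hh2) -{1}(gtr0_norm hh2) -normrM.
have -> : (Y - X) * (h * h) = (a - b - (c - g) - X * (h * h)) - (a - c - (b - g) - Y * (h * h)) by ring.
apply: (le_trans (ler_normB _ _)); apply: (le_trans (lerD A B)).
by rewrite -mulrDl -splitr.
Qed.

End Schwarz.

(** * Smoothness of determinants and adjugates *)

Section SmoothDet.
Context {R : realType} {N : nat}.
Variable O : set 'rV[R]_N.
Hypothesis oO : open O.

Lemma sm_prod n (f : 'I_n -> 'rV[R]_N -> R) :
  (forall i, sm O (f i)) -> sm O (fun x => \prod_i f i x).
Proof.
elim: n f => [|n IH] f sf.
  by apply: (@sm_ext _ _ _ (fun=> 1)) (sm_cst _ _) => // p _; rewrite big_ord0.
apply: (@sm_ext _ _ _ (fun x => f ord0 x * \prod_(i < n) f (lift ord0 i) x)) => //.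
  by move=> p _; rewrite big_ord_recl.
by apply: smM => //; exact: IH.
Qed.

Lemma sm_bigsum (I : Type) (r : seq I) (P : pred I) (f : I -> 'rV[R]_N -> R) :
  (forall i, sm O (f i)) -> sm O (fun x => \sum_(i <- r | P i) f i x).
Proof.
move=> sf; elim: r => [|i r IH].
  by apply: (@sm_ext _ _ _ (fun=> 0)) (sm_cst _ _) => // p _; rewrite big_nil.
case Pi: (P i); last first.
  by apply: (sm_ext oO _ IH) => p _; rewrite big_cons Pi.
by apply: (sm_ext oO _ (smD oO (sf i) IH)) => p _; rewrite big_cons Pi.
Qed.

Lemma sm_det n (M : 'rV[R]_N -> 'M[R]_n) :
  (forall i j, sm O (fun z => M z i j)) -> sm O (fun z => \det (M z)).
Proof.
move=> sM; apply: sm_bigsum => s; apply: smM => //; first exact: sm_cst.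
by apply: sm_prod => i.
Qed.

Lemma sm_adj n (M : 'rV[R]_N -> 'M[R]_n) i j :
  (forall i j, sm O (fun z => M z i j)) -> sm O (fun z => (\adj (M z)) i j).
Proof.
move=> sM; apply: (@sm_ext _ _ _ (fun z => (-1) ^+ (j + i) * \det (row' j (col' i (M z))))) => //.
  by move=> p _; rewrite mxE.
apply: smM => //; first exact: sm_cst.
apply: sm_det => k l; apply: (sm_ext oO _ (sM (lift j k) (lift i l))) => p _.
by rewrite !mxE.
Qed.

End SmoothDet.

(** * Lifting curves through a submersion *)

Section CurveLifting.
Context {R : realType}.

Lemma rV_norm_le {m} (v : 'rV[R]_m) e : 0 <= e -> (forall j, `|v 0 j| <= e) -> `|v| <= e.
Proof.
move=> e0 H; rewrite [leLHS]/Num.Def.normr/= mx_normrE; apply: bigmax_le => // -[i j] _ /=.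
by rewrite ord1.
Qed.

Lemma rV_norm_ge {m} (v : 'rV[R]_m) j : `|v 0 j| <= `|v|.
Proof.
rewrite [leRHS]/Num.Def.normr/= mx_normrE.
exact: (le_bigmax _ (fun ij => `|v ij.1 ij.2|) (0, j)).
Qed.

Lemma mulmx_bound {m n} (B : 'M[R]_(m, n)) :
  exists2 K, 0 < K & forall u : 'rV[R]_m, `|u *m B| <= K * `|u|.
Proof.
exists (\sum_i `|row i B| + 1); first by rewrite ltr_wpDl // sumr_ge0.
move=> u; rewrite mulmx_sum_row; apply: (le_trans (ler_norm_sum _ _ _)).
rewrite mulrDl mul1r mulr_suml; apply: ler_wpDr => //.
apply: ler_sum => i _; rewrite normrZ mulrC ler_wpM2l //; exact: rV_norm_ge.
Qed.

(** Strict differentiability: two moving points are compared through the differential at the fixed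
    point [p], which is what a contraction estimate needs. It follows from the mean value theorem on
    the segment from [y] to [x] and the continuity of the partial derivatives at [p]. *)
Lemma strict_diff_coord {m} (O : set 'rV[R]_m) g p : open O -> sm O g -> O p ->
  forall e, 0 < e -> exists2 d : R, 0 < d & forall x y, `|x - p| < d -> `|y - p| < d ->
    `|g x - g y - dd g p (x - y)| <= e * `|x - y|.
Proof.
move=> oO sg Op e e0; have m0 : 0 < m%:R + 1 :> R by rewrite ltr_wpDl.
(* Each of the [m] partial derivatives may vary by [e']; the summand 1 keeps the denominator
   positive when [m = 0]. *)
pose e' := e / (m%:R + 1); have e'0 : 0 < e' by rewrite divr_gt0.
have [d1 d10 H1] : exists2 d : R, 0 < d & forall h, `|h| < d ->
    forall j : 'I_m, `|dd g (h + p) (delta_mx 0 j) - dd g p (delta_mx 0 j)| <= e'.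
  have N : \forall x \near p, forall j : 'I_m, `|dd g x (delta_mx 0 j) - dd g p (delta_mx 0 j)| <= e'.
    apply: (@near_forall_ord R 'rV[R]_m) => j.
    have /dfb_continuous : dfb (fun x => dd g x (delta_mx 0 j)) p.
      by apply: sm_diff Op; exact: sm_d.
    by move=> /cvgrPdist_le/(_ _ e'0); apply: filterS => y; rewrite distrC.
  by have [d d0 H] := nbhs_norm_shift N; exists d.
have [d2 d20 H2] := nbhs_norm_shift (open_nbhs_nbhs (conj oO Op)).
pose d := Num.min d1 d2; have d0 : 0 < d by rewrite /d lt_min d10.
exists d => // x y xd yd.
have sd s : 0 <= s <= 1 -> `|s *: (x - y) + y - p| < d.
  move=> /andP[s0 s1]; have -> : s *: (x - y) + y - p = s *: (x - p) + (1 - s) *: (y - p).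
    by apply/rowP => j; rewrite !mxE; ring.
  apply: (le_lt_trans (ler_normD _ _)); rewrite !normrZ !ger0_norm ?subr_ge0 //.
  move: xd yd; move: `|x - p| `|y - p| => a b ad bd.
  have [->|sn] := eqVneq s 1; first by lra.
  have : s * a <= s * d by rewrite ler_wpM2l // ltW.
  have : (1 - s) * b < (1 - s) * d by rewrite ltr_pM2l // subr_gt0 lt_neqAle sn.
  lra.
have dd1 : d <= d1 by rewrite /d ge_min lexx.
have dd2 : d <= d2 by rewrite /d ge_min lexx orbT.
have Os s : 0 <= s <= 1 -> O (s *: (x - y) + y).
  by move=> /sd H; have := H2 _ (lt_le_trans H dd2); rewrite subrK.
have [|s sI] := @line_MVT _ _ g (x - y) y 1 ltr01; first by move=> s /Os; exact: sm_diff.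
rewrite scale1r subrK mulr1 => ->.
have B j := H1 _ (lt_le_trans (sd s sI) dd1) j.
have K : `|dd g (s *: (x - y) + y) (x - y) - dd g p (x - y)| <= (m%:R * e') * `|x - y|.
  rewrite (dd_rowE g (s *: (x - y) + y)) (dd_rowE g p) -sumrB.
  apply: (le_trans (ler_norm_sum _ _ _)).
  have -> : m%:R * e' * `|x - y| = \sum_(j < m) (e' * `|x - y|).
    by rewrite sumr_const card_ord -mulrA mulr_natl.
  apply: ler_sum => j _; rewrite -mulrBr normrM mulrC; apply: ler_pM => //.
    by have := B j; rewrite subrK.
  exact: rV_norm_ge.
apply: (le_trans K); rewrite ler_wpM2r // /e' mulrCA ler_piMr ?ltW //.
by rewrite ltr_pdivrMr // mul1r ltrDl.
Qed.

Lemma strict_diff {m n} (O : set 'rV[R]_m) (F : 'rV[R]_m -> 'rV[R]_n) p :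
  open O -> smv O F -> O p ->
  forall e, 0 < e -> exists2 d : R, 0 < d & forall x y, `|x - p| < d -> `|y - p| < d ->
    `|F x - F y - dv F p (x - y)| <= e * `|x - y|.
Proof.
move=> oO sF Op e e0.
have /choice[d Hd] : forall j : 'I_n, exists d : R, 0 < d /\
    forall x y, `|x - p| < d -> `|y - p| < d ->
    `|F x 0 j - F y 0 j - dd (fun x => F x 0 j) p (x - y)| <= e * `|x - y|.
  by move=> j; have [d d0 H] := strict_diff_coord oO (sF j) Op e0; exists d.
exists (\big[Num.min/1]_j d j).
  by elim/big_ind: _ => // [x y x0 y0|j _]; [rewrite lt_min x0|have [] := Hd j].
move=> x y xd yd; apply: rV_norm_le; first by rewrite mulr_ge0 // ltW.
move=> j; rewrite !mxE; have [_ H] := Hd j; apply: H.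
  by apply: (lt_le_trans xd); exact: bigmin_le.
by apply: (lt_le_trans yd); exact: bigmin_le.
Qed.

(** The fixed point theorem below is applied to row vectors and asks for their completeness. *)
HB.instance Definition _ n := Uniform_isComplete.Build 'rV[R]_n cauchy_cvg.

Lemma contraction_rV {n} (T : 'rV[R]_n -> 'rV[R]_n) (r : R) : 0 <= r ->
  (forall x, `|x| <= r -> `|T x| <= r) ->
  (forall x y, `|x| <= r -> `|y| <= r -> `|T x - T y| <= 2^-1 * `|x - y|) ->
  exists2 x, `|x| <= r & T x = x.
Proof.
move=> r0 Tr Tc; pose U := [set x : 'rV[R]_n | `|x| <= r].
have TU : {homo T : x / U x >-> U x} by exact: Tr.
pose f : {fun U >-> U} := HB.pack T (isFun.Build _ _ U U T TU).
have cf : is_contraction f.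
  have q0 : (0 <= 2^-1 :> R) by rewrite invr_ge0.
  exists (NngNum q0); split; first by rewrite /= invf_lt1 // ltr1n.
  by move=> [x y] [/= Ux Uy]; exact: Tc.
have clU : closed U.
  apply: (@closed_comp _ _ (fun x : 'rV[R]_n => `|x|) [set y | y <= r]).
    by move=> x _; exact: norm_continuous.
  exact: closed_le.
have U0 : U 0 by rewrite /U /= normr0.
by have [x Ux xE] := banach_fixed_point cf clU (ex_intro _ 0 U0); exists x.
Qed.

Lemma dvBr {V : normedModType R} {n} (F : V -> 'rV[R]_n) p v w :
  dv F p (v - w) = dv F p v - dv F p w.
Proof. by rewrite dvDr -scaleN1r dvZr scaleN1r. Qed.

Lemma dv_eps {V : normedModType R} {n} (F : V -> 'rV[R]_n) p : dfv F p ->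
  forall e, 0 < e ->
  exists2 d : R, 0 < d & forall h, `|h| < d -> `|F (h + p) - F p - dv F p h| <= e * `|h|.
Proof.
move=> dF e e0.
have N : nbhs (0 : V) [set h | forall j, `|F (h + p) 0 j - F p 0 j - dd (fun x => F x 0 j) p h| <= e * `|h|].
  by apply: filter_forall => j; exact: dfb_eps.
have [d d0 H] := nbhs_norm_shift N; exists d => // h /H /= {}H.
apply: rV_norm_le; first by rewrite mulr_ge0 // ltW.
by move=> j; have := H j; rewrite !mxE !addr0.
Qed.

Lemma dfb_dd_eps {V : normedModType R} (f : V -> R) p (df : {linear V -> R}) : continuous df ->
  (forall e, 0 < e -> exists2 d : R, 0 < d & forall h, `|h| < d ->
    `|f (h + p) - f p - df h| <= e * `|h|) ->
  dfb f p /\ forall v, dd f p v = df v.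
Proof.
move=> cdf H; have D : is_diff p f df.
  apply: is_diff_eps => // e e0; have [d d0 {}H] := H e e0.
  by apply/nbhs_normP; exists d => // h /=; rewrite sub0r normrN; exact: H.
by split=> [|v]; [apply/dfbE; exact: ex_diff|rewrite ddE diff_val].
Qed.

Lemma dfv_dv_curve {n} (c : R -> 'rV[R]_n) (v : 'rV[R]_n) :
  (forall e, 0 < e -> exists2 d : R, 0 < d & forall h, `|h| < d ->
    `|c h - c 0 - h *: v| <= e * `|h|) ->
  dfv c 0 /\ dv c 0 1 = v.
Proof.
move=> H; suff S j : dfb (fun t => c t 0 j) 0 /\ dd (fun t => c t 0 j) 0 1 = v 0 j.
  by split=> [j|]; [have [] := S j|apply/rowP => j; rewrite mxE; have [] := S j].
have V : 'd (fun t : R => t *: (v 0 j : R^o)) (0 : R) = (fun t : R => t *: (v 0 j : R^o)) :> (R -> R^o).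
  exact: diff_val.
have [||D E] := @dfb_dd_eps R (fun t => c t 0 j) 0 ('d (fun t : R => t *: (v 0 j : R^o)) (0 : R)).
- by rewrite V; exact: scalel_continuous.
- rewrite V => e e0; have [d d0 {}H] := H e e0; exists d => // h /H {}H.
  apply: le_trans H; rewrite addr0.
  by have := rV_norm_ge (c h - c 0 - h *: v) j; rewrite !mxE.
by split=> //; rewrite E V scale1r.
Qed.

(** The line [p + t v] is corrected by a vector [x B] in the image of the right inverse [B] of the
    differential. The correction solves a fixed point equation, and its size is at most twice the
    defect [r t]. The defect is [o(t)], because [g] and [F (p + t v)] have the same value and
    velocity at 0, so the velocity of the corrected curve is still [v]. Regularity of the solution
    away from [t = 0] is neither claimed nor required by the notion of curve used later. *)
Lemma curve_lift {m n} (O : set 'rV[R]_n) (F : 'rV[R]_n -> 'rV[R]_m) (B : 'M[R]_(m, n))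
    p v (g : R -> 'rV[R]_m) :
  open O -> smv O F -> O p -> (forall u, dv F p (u *m B) = u) ->
  dfv g 0 -> g 0 = F p -> dv g 0 1 = dv F p v ->
  exists c : R -> 'rV[R]_n,
    [/\ c 0 = p, dfv c 0, dv c 0 1 = v & \forall t \near 0, F (c t) = g t].
Proof.
move=> oO sF Op FB dg g0 gv.
have [K K0 HK] := mulmx_bound B.
(* Since [x B] has norm at most [K |x|], precision [e] in the strict differentiability of [F] makes
   the map [T] below contract by the factor 1/2. *)
pose e := (2 * K)^-1; have e0 : 0 < e by rewrite invr_gt0 mulr_gt0.
have [d d0 Hd] := strict_diff oO sF Op e0.
pose r t := `|g t - F (p + t *: v)|.
have r0 t : 0 <= r t by exact: normr_ge0.
have key t : `|t| * `|v| + K * (2 * r t) < d ->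
    exists2 x : 'rV[R]_m, `|x| <= 2 * r t & F (p + t *: v + x *m B) = g t.
  move=> small; have nr : 0 <= 2 * r t by rewrite mulr_ge0.
  have near x : `|x| <= 2 * r t -> `|p + t *: v + x *m B - p| < d.
    move=> xr; have -> : p + t *: v + x *m B - p = t *: v + x *m B.
      by apply/rowP => j; rewrite !mxE; ring.
    apply: le_lt_trans small.
    apply: (le_trans (ler_normD _ _)); rewrite normrZ lerD2l.
    by apply: (le_trans (HK x)); rewrite ler_wpM2l // ltW.
  (* A simplified Newton step: [dv F p (x *m B) = x], so the linear part of
     [x |-> F (p + t v + x B)] at [p] is the identity. *)
  pose T x := x - (F (p + t *: v + x *m B) - g t).
  have Tc x y : `|x| <= 2 * r t -> `|y| <= 2 * r t -> `|T x - T y| <= 2^-1 * `|x - y|.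
    move=> xr yr; have := Hd _ _ (near x xr) (near y yr).
    rewrite opprD addrACA subrr add0r -mulmxBl FB => H.
    have -> : T x - T y = - (F (p + t *: v + x *m B) - F (p + t *: v + y *m B) - (x - y)).
      by apply/rowP => j; rewrite !mxE; ring.
    rewrite normrN; apply: (le_trans H).
    have := HK (x - y); rewrite -(ler_pM2l e0) => /le_trans; apply.
    rewrite mulrA ler_wpM2r // /e invfM -mulrA mulVf ?mulr1 //; exact: lt0r_neq0.
  have T0 : `|T 0| = r t by rewrite /T mul0mx addr0 sub0r normrN distrC.
  have [x xr Tx] : exists2 x, `|x| <= 2 * r t & T x = x.
    apply: contraction_rV => // x xr.
    have := Tc x 0 xr; rewrite normr0 subr0 => /(_ nr) H.
    have -> : T x = T x - T 0 + T 0 by rewrite subrK.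
    apply: (le_trans (ler_normD _ _)); rewrite T0.
    have : 2^-1 * `|x| <= r t by rewrite ler_pdivrMl // mulrC.
    by move: H; move: (r t) (`|T x - T 0|) (2^-1 * `|x|) => a b c; lra.
  exists x => //; move: Tx; rewrite /T => /eqP; rewrite -subr_eq0 addrAC subrr add0r.
  by rewrite oppr_eq0 subr_eq0 => /eqP.
(* At times that are not small the correction is 0; the equation is only wanted near [t = 0]. *)
have /choice[xi Hxi] : forall t, exists x : 'rV[R]_m, `|x| <= 2 * r t /\
    (`|t| * `|v| + K * (2 * r t) < d -> F (p + t *: v + x *m B) = g t).
  move=> t; case: (pselect (`|t| * `|v| + K * (2 * r t) < d)) => [/key[x]|H].
    by exists x.
  by exists 0; rewrite normr0 mulr_ge0.
have rz : r 0 = 0 by rewrite /r scale0r addr0 g0 subrr normr0.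
have xi0 : xi 0 = 0.
  by apply/eqP; rewrite -normr_le0; have [] := Hxi 0; rewrite rz mulr0.
exists (fun t => p + t *: v + xi t *m B).
have c0 : p + 0 *: v + xi 0 *m B = p by rewrite xi0 scale0r mul0mx !addr0.
have rsmall e' : 0 < e' -> exists2 d : R, 0 < d & forall h, `|h| < d -> r h <= e' * `|h|.
  move=> e'0; have e1 : 0 < e' / 2 by rewrite divr_gt0.
  have V1 : 0 < `|v| + 1 by rewrite ltr_wpDl.
  have e2 : 0 < e' / 2 / (`|v| + 1) by rewrite divr_gt0.
  have [a a0 Ha] := dv_eps dg e1; have [b b0 Hb] := dv_eps (smv_dfv sF Op) e2.
  exists (Num.min a (b / (`|v| + 1))); first by rewrite lt_min a0 divr_gt0.
  move=> h; rewrite lt_min => /andP[/Ha h1]; rewrite ltr_pdivlMr // => hb.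
  have hv : `|h *: v| <= `|h| * (`|v| + 1) by rewrite normrZ ler_wpM2l // lerDl.
  have h2 := Hb _ (le_lt_trans hv hb).
  have -> : r h = `|(g (h + 0) - g 0 - dv g 0 h) - (F (h *: v + p) - F p - dv F p (h *: v))|.
    have gh : dv g 0 h = dv F p (h *: v) by rewrite dvZr -gv -dvZr; congr (dv g 0 _); rewrite -[LHS]mulr1.
    by rewrite /r gh g0 addr0 [p + _]addrC; congr (`| _ |); apply/rowP => j; rewrite !mxE; ring.
  apply: (le_trans (ler_normB _ _)); apply: (le_trans (lerD h1 h2)).
  rewrite [leRHS](_ : _ = e' / 2 * `|h| + e' / 2 * `|h|); last by rewrite -mulrDl -splitr.
  rewrite lerD2l -mulrA ler_wpM2l //; first exact: ltW.
  by rewrite mulrC ler_pdivrMr.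
have [|D E] := @dfv_dv_curve _ (fun t => p + t *: v + xi t *m B) v.
  move=> e' e'0; have [|d2 d20 H2] := rsmall (e' / (K * 2)).
    by rewrite divr_gt0 // mulr_gt0.
  exists d2 => // h /H2 rh; rewrite c0.
  have -> : p + h *: v + xi h *m B - p - h *: v = xi h *m B.
    by apply/rowP => j; rewrite !mxE; ring.
  apply: (le_trans (HK _)); have [xr _] := Hxi h.
  have : K * `|xi h| <= K * (2 * r h) by rewrite ler_wpM2l // ltW.
  move=> /le_trans; apply; rewrite mulrA mulrC -ler_pdivlMr ?mulr_gt0 //.
  by rewrite mulrAC.
split=> //.
(* Once [r t <= |t|], the smallness condition of [key] is implied by [|t| * (M + 1) < d]. *)
pose M := `|v| + K * 2; have M0 : 0 < M + 1 by rewrite ltr_wpDl // addr_ge0 // mulr_ge0 // ltW.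
have [d3 d30 H3] := rsmall 1 ltr01.
apply/nbhs_normP; exists (Num.min d3 (d / (M + 1))); first by rewrite /= lt_min d30 divr_gt0.
move=> t /=; rewrite sub0r normrN lt_min => /andP[/H3 rt td].
have [_ ->] := Hxi t => //.
rewrite ltr_pdivlMr // in td; apply: le_lt_trans td.
have : K * (2 * r t) <= K * (2 * `|t|) by rewrite mul1r in rt; rewrite ler_pM2l // ler_pM2l.
rewrite /M; have := normr_ge0 t; move: (`|v|) (`|t|) (r t) => a b c b0 h.
apply: (le_trans (lerD (lexx _) h)); lra.
Qed.

End CurveLifting.

Lemma near_all {R : realType} {V : normedModType R} (p : V) (P : V -> Prop) :
  (forall x, P x) -> \forall x \near p, P x.
Proof. exact: nearW. Qed.

(** * Exterior derivative of a 1-form along a level set *)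

Section ConstrainedForm.
Context {R : realType} {N m : nat}.
Variables (O : set 'rV[R]_N) (Phi : 'rV[R]_N -> 'rV[R]_m) (p : 'rV[R]_N).
Hypothesis oO : open O.
Hypothesis sPhi : smv O Phi.
Hypothesis Op : O p.

Lemma surj_right_inverse (F : 'rV[R]_N -> 'rV[R]_m) q : (forall u, exists v, dv F q v = u) ->
  exists B : 'M[R]_(m, N), forall u, dv F q (u *m B) = u.
Proof.
move=> sF; have /choice[b Hb] : forall i : 'I_m, exists v, dv F q v = delta_mx 0 i by move=> i; exact: sF.
exists (\matrix_i b i) => u; rewrite mulmx_sum_row.
apply/rowP => j; rewrite dvE dd_sumr {2}(row_sumE u) summxE; apply: eq_bigr => i _.
by rewrite ddZr rowK -dvE Hb [RHS]mxE.
Qed.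

Variable B : 'M[R]_(m, N).
Hypothesis PhiB : forall u, dv Phi p (u *m B) = u.

(** [D z] is the differential of [Phi] at [z] composed with [B], equal to the identity at [p]. The
    field [V w] is the projection of [w] to the kernel of that differential along [B], multiplied by
    [\det (D z)]: with the adjugate instead of the inverse it is smooth and tangent to the level
    sets on all of [O], also where [D z] is singular. *)
Let D z : 'M[R]_m := \matrix_(i, j) dd (fun x => Phi x 0 j) z (row i B).
Let V w z : 'rV[R]_N := \det (D z) *: w - dv Phi z w *m \adj (D z) *m B.

Local Lemma DE z u : dv Phi z (u *m B) = u *m D z.
Proof.
apply/rowP => j; rewrite dvE mulmx_sum_row dd_sumr mxE; apply: eq_bigr => i _.
by rewrite ddZr [D z i j]mxE.
Qed.

Local Lemma smD_entry i j : sm O (fun z => D z i j).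
Proof.
by apply: (@sm_ext _ _ _ (fun z => dd (fun x => Phi x 0 j) z (row i B))) => //;
  [move=> q _; rewrite mxE|exact: sm_d].
Qed.

Local Lemma smV w : smv O (V w).
Proof.
move=> k; apply: (@sm_ext _ _ _ (fun z => \det (D z) * w 0 k +
    - \sum_i (\sum_j dd (fun x => Phi x 0 j) z w * (\adj (D z)) j i) * B i k)) => //.
  move=> z _; rewrite !mxE; congr (_ - _); apply: eq_bigr => i _; rewrite [in RHS]mxE.
  by congr (_ * _); apply: eq_bigr => j _; rewrite dvE.
apply: smD => //; first by apply: smM => //; [exact: sm_det smD_entry|exact: sm_cst].
apply: smN => //; apply: sm_sum => // i; apply: smM => //; last exact: sm_cst.
apply: sm_sum => // j; apply: smM => //; first exact: sm_d.
exact: sm_adj smD_entry.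
Qed.

Local Lemma dvV w z : dv Phi z (V w z) = 0.
Proof.
by rewrite /V dvBr dvZr DE -mulmxA mul_adj_mx mul_mx_scalar subrr.
Qed.

Local Lemma Vp w : dv Phi p w = 0 -> V w p = w.
Proof.
move=> w0; rewrite /V w0 !mul0mx subr0; have -> : D p = 1%:M.
  by apply/row_matrixP => i; rewrite rowE -DE PhiB row1.
by rewrite det1 scale1r.
Qed.

Hypothesis Phip : Phi p = 0.
Variable a : 'I_N -> 'rV[R]_N -> R.
Hypothesis sa : forall k, sm O (a k).
Hypothesis a0 : forall z, O z -> Phi z = 0 ->
  forall v, dv Phi z v = 0 -> \sum_k a k z * v 0 k = 0.

(** The function [a (V w)] vanishes on the zero set of [Phi], so its derivative along a tangent [v]
    vanishes. The curve in the zero set that realizes [v] is a lift of the constant curve 0 by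
    [curve_lift]. *)
Local Lemma tangential_derivative v w : dv Phi p v = 0 -> dv Phi p w = 0 ->
  \sum_k a k p * dv (V w) p v 0 k + \sum_k w 0 k * dd (a k) p v = 0.
Proof.
move=> v0 w0; pose E z := \sum_k a k z * V w z 0 k.
have da k : dfb (a k) p by exact: sm_diff (sa k) Op.
have dV k : dfb (fun z => V w z 0 k) p by exact: sm_diff (smV w k) Op.
have dE : dfb E p by apply: dfb_sum => k; exact: dfbM.
suff : dd E p v = 0.
  rewrite dd_sum => [|k]; last exact: dfbM.
  move=> H; rewrite -[RHS]H -big_split; apply: eq_bigr => k _ /=.
  by rewrite ddM // Vp // dvE.
have [c [c0 dc cv cz]] : exists c : R -> 'rV[R]_N,
    [/\ c 0 = p, dfv c 0, dv c 0 1 = v & \forall t \near 0, Phi (c t) = 0].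
  apply: (curve_lift (g := fun=> 0) oO sPhi Op PhiB) => //.
  - by move=> j; exact: dfb_cst.
  - rewrite v0; apply/rowP => j; rewrite dvE mxE.
    by rewrite dd_cst.
have Oc : \forall t \near 0, O (c t).
  have cc := dfv_continuous dc; apply: cc; rewrite c0; exact: open_nbhs_nbhs.
have -> : dd E p v = dd (fun t => E (c t)) 0 1 by rewrite dd_comp ?c0 ?cv.
rewrite (@near_dd _ _ (fun=> 0)) ?dd_cst //; last exact: dfb_cst.
by apply: filterS2 Oc cz => t Ot zt; rewrite /E a0 //; exact: dvV.
Qed.

(** The identity [dvV] holds at every point, not only on the zero set, so it can be differentiated
    directly. *)
Local Lemma dPhi_V v w (l : 'I_m) : dv Phi p v = 0 -> dv Phi p w = 0 ->
  \sum_k w 0 k * dd (fun z => dd (fun x => Phi x 0 l) z (delta_mx 0 k)) p v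
    + dd (fun x => Phi x 0 l) p (dv (V w) p v) = 0.
Proof.
move=> v0 w0; pose E z := \sum_k V w z 0 k * dd (fun x => Phi x 0 l) z (delta_mx 0 k).
have dV k : dfb (fun z => V w z 0 k) p by exact: sm_diff (smV w k) Op.
have dP k : dfb (fun z => dd (fun x => Phi x 0 l) z (delta_mx 0 k)) p.
  exact: sm_diff (sm_d _ (sPhi l)) Op.
have : dd E p v = 0.
  rewrite (@near_dd _ _ (fun=> 0)) ?dd_cst //; last exact: dfb_cst.
  apply: (@near_all R 'rV[R]_N) => z; have /rowP/(_ l) := dvV w z.
  by rewrite dvE mxE dd_rowE.
rewrite dd_sum => [|k]; last exact: dfbM.
move=> H; rewrite -[RHS]H (dd_rowE _ p (dv _ _ _)) -big_split; apply: eq_bigr => k _ /=.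
by rewrite ddM // Vp // dvE [_ * dd (fun z => V w z 0 k) p v]mulrC.
Qed.

(* Both directions are extended to the fields [V v], [V w] of kernels of [d Phi],
   along which [a] vanishes on the zero set of [Phi]; this replaces a
   parametrization of that zero set. *)
Lemma constrained_form_closed v w : dv Phi p v = 0 -> dv Phi p w = 0 ->
  \sum_k (dd (a k) p v * w 0 k - dd (a k) p w * v 0 k) = 0.
Proof.
(* [u] is the bracket of [V v] and [V w] at [p]. Second derivatives of [Phi] cancel by symmetry,
   hence [u] is tangent to the level set and is annihilated by [a]; this removes the derivatives of
   the two fields from the difference of the identities in [tangential_derivative]. *)
move=> v0 w0; pose u := dv (V w) p v - dv (V v) p w.
have symm (l : 'I_m) : \sum_k w 0 k * dd (fun z => dd (fun x => Phi x 0 l) z (delta_mx 0 k)) p v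
    = \sum_k v 0 k * dd (fun z => dd (fun x => Phi x 0 l) z (delta_mx 0 k)) p w.
  transitivity (\sum_k \sum_j w 0 k * (v 0 j *
      dd (fun z => dd (fun x => Phi x 0 l) z (delta_mx 0 k)) p (delta_mx 0 j))).
    by apply: eq_bigr => k _; rewrite dd_rowE mulr_sumr.
  rewrite exchange_big; apply: eq_bigr => j _ /=.
  rewrite [in RHS]dd_rowE mulr_sumr; apply: eq_bigr => k _ /=.
  by rewrite (schwarz _ _ oO (sPhi l) Op) mulrCA.
have u0 : dv Phi p u = 0.
  apply/rowP => l; rewrite dvE mxE /u ddBr.
  have := dPhi_V l v0 w0; have := dPhi_V l w0 v0; rewrite symm.
  lra.
have := a0 Op Phip u0; have := tangential_derivative v0 w0.
have := tangential_derivative w0 v0.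
rewrite sumrB.
have -> : \sum_k a k p * u 0 k = \sum_k a k p * dv (V w) p v 0 k - \sum_k a k p * dv (V v) p w 0 k.
  by rewrite -sumrB; apply: eq_bigr => k _; rewrite /u !mxE mulrBr.
have C (x : 'rV[R]_N) y : \sum_k x 0 k * dd (a k) p y = \sum_k dd (a k) p y * x 0 k.
  by apply: eq_bigr => k _; rewrite mulrC.
rewrite !C; lra.
Qed.

End ConstrainedForm.

(** * Manifolds, curves and derivations *)

Section Charts.
Context {R : realType}.

Lemma open_comp_on {m n} (O : set 'rV[R]_m) (O' : set 'rV[R]_n) (F : 'rV[R]_m -> 'rV[R]_n) :
  open O -> open O' -> smv O F -> open [set q | O q /\ O' (F q)].
Proof.
move=> oO oO' sF; rewrite openE => q [Oq O'q].
have cF := dfv_continuous (smv_dfv sF Oq).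
have A : \forall x \near q, O x by exact: open_nbhs_nbhs.
have B : \forall x \near q, O' (F x) by apply: cF; exact: open_nbhs_nbhs.
exact: filterS2 A B.
Qed.

Lemma open_neq0 {m} (O : set 'rV[R]_m) (f : 'rV[R]_m -> R) : open O -> sm O f ->
  open [set q | O q /\ f q != 0].
Proof.
move=> oO sf; rewrite openE => q [Oq fq].
have A : \forall x \near q, O x by exact: open_nbhs_nbhs.
have cF : {for q, continuous f} by apply: dfb_continuous; exact: sm_diff sf Oq.
have B : \forall x \near q, f x != 0.
  have C : nbhs (f q) [set z : R | z != 0] by apply: open_nbhs_nbhs; split=> //; exact: open_neq.
  exact: (cF _ C).
exact: filterS2 A B.
Qed.

Definition mcompat (M : mfd R) := forall (i j : cidx M) x, cdom i x -> cdom j x ->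
  exists F, is_rep (pts M) id i j x F.

(* The part of [is_manifold] that is used: it passes to products, TM and total spaces without
   topological arguments. *)
Record premfd (M : mfd R) : Prop := {
  ml_cover : forall x, pts M x <-> exists i : cidx M, cdom i x;
  ml_inj : forall (i : cidx M) x y,
    cdom i x -> cdom i y -> cmap i x = cmap i y -> x = y;
  ml_open : forall i : cidx M, open (cmap i @` cdom i);
  ml_compat : mcompat M }.

Lemma manifold_premfd (M : mfd R) : is_manifold M -> premfd M.
Proof. by case. Qed.

Lemma is_repP {M N : mfd R} (S : set M) (f : M -> N) i j x F :
  is_rep S f i j x F <-> cdom i x /\
  exists O : set 'rV[R]_(dim M), [/\ open O, O (cmap i x), smv O F &
    forall y, S y -> cdom i y -> O (cmap i y) -> cdom j (f y) /\ cmap j (f y) = F (cmap i y)].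
Proof.
by split=> -[ix [U [oU Ux sF H]]]; split=> //; exists U; split=> //; apply/CinftyP.
Qed.

Lemma rep_diff {M N : mfd R} (S : set M) (f : M -> N) i j x F v :
  is_rep S f i j x F -> 'd F (cmap i x) v = dv F (cmap i x) v /\ dfv F (cmap i x).
Proof.
move=> /is_repP[ix [U [oU Ux sF _]]]; have D := smv_dfv sF Ux.
by split=> //; rewrite dv_diff //; apply/dfvE.
Qed.

(** Neighbourhoods are expressed in one chart, and [mnear_chart] passes to any other chart. This
    works for total spaces known only through their charts, without a topology on the carrier. *)
Definition mnear {M : mfd R} (x : M) (P : M -> Prop) :=
  exists i, cdom i x /\ exists U : set 'rV[R]_(dim M),
    [/\ open U, U (cmap i x) & forall y, cdom i y -> U (cmap i y) -> P y].

Definition smf {M : mfd R} (x : M) (h : M -> R) :=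
  exists i, cdom i x /\ exists U F,
    [/\ open U, U (cmap i x), sm U F & forall y, cdom i y -> U (cmap i y) -> h y = F (cmap i y)].

Lemma premfd_cov (M : mfd R) (i : cidx M) x : premfd M -> cdom i x -> pts M x.
Proof. by move=> lM ix; apply/(ml_cover lM); exists i. Qed.

(** The part of [premfd] that germs depend on; covering, injectivity of charts and openness of their
    images are left out. It is the property established for the total spaces of TM and of direct
    sums. *)
Definition smooth_atlas (M : mfd R) :=
  (forall (i : cidx M) x, cdom i x -> pts M x) /\ mcompat M.

Lemma premfd_atlas {M : mfd R} : premfd M -> smooth_atlas M.
Proof. by move=> lM; split; [move=> i x; exact: premfd_cov|exact: ml_compat]. Qed.

Section Fixed.
Context {M : mfd R}.
Implicit Types (i j : cidx M) (x y : M).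
Hypothesis gM : smooth_atlas M.
Let cov : forall (i : cidx M) x, cdom i x -> pts M x := gM.1.
Let cpt : mcompat M := gM.2.

Lemma chart_change i j (x : M) : cdom i x -> cdom j x -> exists U F,
  [/\ open U, U (cmap i x), smv U F & forall y, cdom i y -> U (cmap i y) ->
     cdom j y /\ cmap j y = F (cmap i y)].
Proof.
move=> ix jx; have [F /is_repP[_ [U [oU Ux sF H]]]] := cpt ix jx.
by exists U, F; split=> // y iy; apply: H => //; exact: cov iy.
Qed.

Lemma mnear_chart i x P : cdom i x -> mnear x P -> exists U : set 'rV[R]_(dim M),
    [/\ open U, U (cmap i x) & forall y, cdom i y -> U (cmap i y) -> P y].
Proof.
move=> ix [j [jx [U [oU Ux H]]]]; have [W [F [oW Wx sF HF]]] := chart_change ix jx.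
exists [set q | W q /\ U (F q)]; split; first exact: open_comp_on.
  by split=> //; have [_ <-] := HF x ix Wx.
by move=> y iy [Wy Uy]; have [jy E] := HF y iy Wy; apply: H => //; rewrite E.
Qed.

Lemma smf_chart i x h : cdom i x -> smf x h -> exists U F,
    [/\ open U, U (cmap i x), sm U F & forall y, cdom i y -> U (cmap i y) -> h y = F (cmap i y)].
Proof.
move=> ix [j [jx [U [f [oU Ux sf H]]]]]; have [W [F [oW Wx sF HF]]] := chart_change ix jx.
exists [set q | W q /\ U (F q)], (fun q => f (F q)); split; first exact: open_comp_on.
- by split=> //; have [_ <-] := HF x ix Wx.
- apply: (sm_comp _ _ _ sf); first exact: open_comp_on.
    by move=> q [].
  by move=> k; apply: sm_sub (sF k) => q [].
by move=> y iy [Wy Uy]; have [jy E] := HF y iy Wy; rewrite -E; apply: H => //; rewrite E.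
Qed.

Lemma mnear_self x P : mnear x P -> P x.
Proof. by move=> [i [ix [U [oU Ux]]]]; exact. Qed.

Lemma mnearS x (P Q : M -> Prop) : (forall y, P y -> Q y) -> mnear x P -> mnear x Q.
Proof.
by move=> PQ [i [ix [U [oU Ux H]]]]; exists i; split=> //; exists U; split=> // y iy /(H y iy)/PQ.
Qed.

Lemma mnearI x (P Q : M -> Prop) : mnear x P -> mnear x Q -> mnear x (fun y => P y /\ Q y).
Proof.
move=> [i [ix [U [oU Ux H]]]] /(mnear_chart ix)[W [oW Wx H']].
exists i; split=> //; exists (U `&` W); split=> //; first exact: openI.
by move=> y iy [Uy Wy]; split; [exact: H|exact: H'].
Qed.

Lemma mnear_cdom i x : cdom i x -> mnear x (fun y => cdom i y).
Proof. by move=> ix; exists i; split=> //; exists setT; split=> //; exact: openT. Qed.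

Lemma mnear_true i x (P : M -> Prop) : cdom i x -> (forall y, P y) -> mnear x P.
Proof. by move=> ix H; apply: mnearS (mnear_cdom ix). Qed.

Lemma smf_nest x h : smf x h -> mnear x (fun y => smf y h).
Proof.
move=> [i [ix [U [F [oU Ux sF H]]]]]; exists i; split=> //; exists U; split=> // y iy Uy.
by exists i; split=> //; exists U, F.
Qed.

Lemma smf_ext x h h' : mnear x (fun y => h y = h' y) -> smf x h -> smf x h'.
Proof.
move=> hh [i [ix [U [F [oU Ux sF H]]]]]; have [W [oW Wx H']] := mnear_chart ix hh.
exists i; split=> //; exists (U `&` W), F; split=> //; first exact: openI.
  by apply: sm_sub sF => q [].
by move=> y iy [Uy Wy]; rewrite -H' // H.
Qed.

Lemma smf_cst i x (c : R) : cdom i x -> smf x (fun=> c).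
Proof.
by move=> ix; exists i; split=> //; exists setT, (fun=> c); split=> //; [exact: openT|exact: sm_cst].
Qed.

Lemma smf_coord i x k : cdom i x -> smf x (fun y => cmap i y 0 k).
Proof.
move=> ix; exists i; split=> //; exists setT, (fun q => q 0 k); split=> //; first exact: openT.
exact: sm_coord.
Qed.

Lemma smfD x f g : smf x f -> smf x g -> smf x (fun y => f y + g y).
Proof.
move=> [i [ix [U [F [oU Ux sF H]]]]] /(smf_chart ix)[W [G [oW Wx sG H']]].
have oUW : open (U `&` W) by exact: openI.
exists i; split=> //; exists (U `&` W), (fun q => F q + G q); split=> //.
  by apply: smD => //; [apply: sm_sub sF => q []|apply: sm_sub sG => q []].
by move=> y iy [Uy Wy]; rewrite H // H'.
Qed.

Lemma smfM x f g : smf x f -> smf x g -> smf x (fun y => f y * g y).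
Proof.
move=> [i [ix [U [F [oU Ux sF H]]]]] /(smf_chart ix)[W [G [oW Wx sG H']]].
have oUW : open (U `&` W) by exact: openI.
exists i; split=> //; exists (U `&` W), (fun q => F q * G q); split=> //.
  by apply: smM => //; [apply: sm_sub sF => q []|apply: sm_sub sG => q []].
by move=> y iy [Uy Wy]; rewrite H // H'.
Qed.

Lemma smfN x f : smf x f -> smf x (fun y => - f y).
Proof.
move=> [i [ix [U [F [oU Ux sF H]]]]].
exists i; split=> //; exists U, (fun q => - F q); split=> //; first exact: smN.
by move=> y iy Uy; rewrite H.
Qed.

Lemma smfB x f g : smf x f -> smf x g -> smf x (fun y => f y - g y).
Proof. by move=> sf sg; apply: smfD => //; exact: smfN. Qed.

Lemma smf_sum n i x (f : 'I_n -> M -> R) : cdom i x -> (forall k, smf x (f k)) ->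
  smf x (fun y => \sum_k f k y).
Proof.
move=> ix; elim: n f => [|n IH] f sf.
  by apply: smf_ext (smf_cst 0 ix); apply: (mnear_true ix) => y; rewrite big_ord0.
have := smfD (sf ord0) (IH (fun k => f (lift ord0 k)) (fun k => sf _)).
by apply: smf_ext; apply: (mnear_true ix) => y; rewrite big_ord_recl.
Qed.

Lemma smfV x f : f x != 0 -> smf x f -> smf x (fun y => (f y)^-1).
Proof.
move=> f0 [i [ix [U [F [oU Ux sF H]]]]].
pose W := [set q | U q /\ F q != 0].
have oW : open W by exact: open_neq0.
exists i; split=> //; exists W, (fun q => (F q)^-1); split=> //.
- by split=> //; rewrite -H.
- by apply: sm_inv => //; [move=> q []|apply: sm_sub sF => q []].
by move=> y iy [Uy _]; rewrite H.
Qed.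

End Fixed.

Lemma mopen_mnear {M : mfd R} (W : set M) x : premfd M -> mopen W -> W x -> mnear x W.
Proof.
move=> lM [Wp oW] Wx; have /(ml_cover lM)[i ix] := Wp x Wx.
exists i; split=> //; exists (cmap i @` (W `&` cdom i)); split=> //; first by exists x.
by move=> y iy [z [Wz iz] E]; rewrite -(ml_inj lM iz iy E).
Qed.

Lemma mnear_mopen {M : mfd R} (W : set M) : premfd M ->
  (forall x, W x -> mnear x W) -> mopen W.
Proof.
move=> lM H; split=> [x /H[i [ix _]]|i]; first exact: premfd_cov ix.
rewrite openE => q [x [Wx ix] <-].
have [U [oU Ux HU]] := mnear_chart (premfd_atlas lM) ix (H x Wx).
have A : \forall q \near cmap i x, U q by exact: open_nbhs_nbhs.
have B : \forall q \near cmap i x, (cmap i @` cdom i) q.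
  by apply: open_nbhs_nbhs; split; [exact: ml_open|exists x].
apply: filterS2 A B => z Uz [y iy E]; exists y => //; split=> //.
by apply: HU => //; rewrite E.
Qed.

Lemma mnear_pts (M : mfd R) (x : M) : premfd M -> pts M x -> mnear x (pts M).
Proof.
move=> lM /(ml_cover lM)[i ix]; exists i; split=> //; exists setT; split=> //.
  exact: openT.
by move=> y iy _; exact: premfd_cov iy.
Qed.

Lemma mopen_cdom {M : mfd R} (i : cidx M) : premfd M -> mopen (cdom i).
Proof. by move=> lM; apply: mnear_mopen => // x ix; exact: mnear_cdom. Qed.

End Charts.

(** * Maps that are smooth near a point *)

Section Maps.
Context {R : realType}.

(* Smoothness of [f] near [x] only; [smooth_on] takes all points of a set, possibly not open. *)
Definition smap {M N : mfd R} (x : M) (f : M -> N) :=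
  exists j, [/\ cdom j (f x), mnear x (fun y => cdom j (f y)) &
    forall k, smf x (fun y => cmap j (f y) 0 k)].

Lemma smap_rep {M N : mfd R} (S : set M) (f : M -> N) i j x F :
  smooth_atlas M -> mnear x S -> is_rep S f i j x F ->
  mnear x (fun y => cdom j (f y)) /\ forall k, smf x (fun y => cmap j (f y) 0 k).
Proof.
move=> gM nS /is_repP[ix [U [oU Ux sF H]]].
have [W [oW Wx HW]] := mnear_chart gM ix nS.
split=> [|k].
  exists i; split=> //; exists (U `&` W); split=> //; first exact: openI.
  by move=> y iy [Uy Wy]; have [] := H y (HW y iy Wy) iy Uy.
exists i; split=> //; exists (U `&` W), (fun q => F q 0 k); split=> //; first exact: openI.
  by apply: sm_sub (sF k) => q [].
by move=> y iy [Uy Wy]; have [_ ->] := H y (HW y iy Wy) iy Uy.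
Qed.

Lemma smap_smooth_on {M N : mfd R} (S : set M) (f : M -> N) x :
  smooth_atlas M -> mnear x S -> smooth_on S f -> smap x f.
Proof.
move=> gM nS sf; have [i [j [F rF]]] := sf x (mnear_self nS).
have [A B] := smap_rep gM nS rF; exists j; split=> //.
exact: mnear_self A.
Qed.

Lemma smap_local {M N : mfd R} (f : M -> N) x i j : smooth_atlas M ->
  cdom i x -> mnear x (fun y => cdom j (f y)) ->
  (forall k, smf x (fun y => cmap j (f y) 0 k)) ->
  exists V G, [/\ open V, V (cmap i x), smv V G & forall y, cdom i y -> V (cmap i y) ->
    cdom j (f y) /\ cmap j (f y) = G (cmap i y)].
Proof.
move=> gM ix nj sf.
have /choice[g Hg] : forall k, exists g : set 'rV[R]_(dim M) * ('rV[R]_(dim M) -> R),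
    [/\ open g.1, g.1 (cmap i x), sm g.1 g.2 &
      forall y, cdom i y -> g.1 (cmap i y) -> cmap j (f y) 0 k = g.2 (cmap i y)].
  by move=> k; have [V [G [? ? ? ?]]] := smf_chart gM ix (sf k); exists (V, G).
have [W [oW Wx HW]] := mnear_chart gM ix nj.
pose V := [set q | W q /\ forall k, (g k).1 q].
have oV : open V.
  rewrite openE => q [Wq gq].
  have A : \forall z \near q, W z by exact: open_nbhs_nbhs.
  have B : \forall z \near q, forall k, (g k).1 z.
    by apply: (@near_forall_ord R 'rV[R]_(dim M)) => k; apply: open_nbhs_nbhs; split=> //; have [] := Hg k.
  exact: filterS2 A B.
exists V, (fun q => \row_k (g k).2 q); split=> //.
- by split=> // k; have [] := Hg k.
- move=> k; have [_ _ sg _] := Hg k.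
  by apply: (@sm_ext _ _ _ (g k).2) => // [q _|]; [rewrite mxE|apply: sm_sub sg => q []].
move=> y iy [Wy gy]; split; first exact: HW.
by apply/rowP => k; rewrite mxE; have [_ _ _ E] := Hg k; exact: E.
Qed.

Lemma smf_smap {M N : mfd R} (f : M -> N) x h : smooth_atlas M -> smooth_atlas N ->
  smap x f -> smf (f x) h -> smf x (fun y => h (f y)).
Proof.
move=> gM gN [j [jx nj sf]] hh; have [i [ix _]] := nj.
have [U [F [oU Ux sF H]]] := smf_chart gN jx hh.
have [V [G [oV Vx sG GE]]] := smap_local gM ix nj sf.
exists i; split=> //; exists [set q | V q /\ U (G q)], (fun q => F (G q)); split.
- exact: open_comp_on.
- by split=> //; have [_ <-] := GE x ix Vx.
- apply: (sm_comp _ _ _ sF); first exact: open_comp_on.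
    by move=> q [].
  by move=> k; apply: sm_sub (sG k) => q [].
by move=> y iy [Vy Uy]; have [jy E] := GE y iy Vy; rewrite -E H // E.
Qed.

Lemma mnear_smap {M N : mfd R} (f : M -> N) x P : smooth_atlas M -> smooth_atlas N ->
  smap x f -> mnear (f x) P -> mnear x (fun y => P (f y)).
Proof.
move=> gM gN [j [jx nj sf]] hP; have [i [ix _]] := nj.
have [U [oU Ux H]] := mnear_chart gN jx hP.
have [V [G [oV Vx sG GE]]] := smap_local gM ix nj sf.
exists i; split=> //; exists [set q | V q /\ U (G q)]; split.
- exact: open_comp_on.
- by split=> //; have [_ <-] := GE x ix Vx.
by move=> y iy [Vy Uy]; have [jy E] := GE y iy Vy; apply: H => //; rewrite E.
Qed.

Lemma smap_chart {M N : mfd R} (f : M -> N) x j : smooth_atlas M -> smooth_atlas N ->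
  smap x f -> cdom j (f x) ->
  mnear x (fun y => cdom j (f y)) /\ forall k, smf x (fun y => cmap j (f y) 0 k).
Proof.
move=> gM gN sf jx; split; first exact: mnear_smap (mnear_cdom jx).
by move=> k; exact: (smf_smap gM gN sf (smf_coord k jx)).
Qed.

Lemma smap_comp {M N P : mfd R} (f : M -> N) (g : N -> P) x : smooth_atlas M -> smooth_atlas N ->
  smap x f -> smap (f x) g -> smap x (fun y => g (f y)).
Proof.
move=> gM gN sf [j [jx nj sg]]; exists j; split=> //.
  exact: (mnear_smap gM gN sf nj).
by move=> k; exact: (smf_smap gM gN sf (sg k)).
Qed.

Lemma smap_ext {M N : mfd R} (f g : M -> N) x : smooth_atlas M ->
  mnear x (fun y => f y = g y) -> smap x f -> smap x g.
Proof.
move=> gM fg [j [jx nj sf]]; have fx := mnear_self fg.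
exists j; split=> [||k]; first by rewrite -fx.
  by apply: mnearS (mnearI gM nj fg) => y [] + <-.
by apply: (smf_ext gM _ (sf k)); apply: mnearS fg => y ->.
Qed.

Lemma smap_id {M : mfd R} (x : M) i : cdom i x -> smap x (fun y => y).
Proof.
by move=> ix; exists i; split=> //; [exact: mnear_cdom|move=> k; exact: smf_coord].
Qed.

Lemma smap_is_rep {M N : mfd R} (f : M -> N) x (S : set M) i j : smooth_atlas M ->
  cdom i x -> mnear x (fun y => cdom j (f y)) ->
  (forall k, smf x (fun y => cmap j (f y) 0 k)) -> exists F, is_rep S f i j x F.
Proof.
move=> gM ix nj sf; have [V [G [oV Vx sG GE]]] := smap_local gM ix nj sf.
by exists G; apply/is_repP; split=> //; exists V; split=> // y _; exact: GE.
Qed.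

Lemma smooth_onP {M N : mfd R} (f : M -> N) (S : set M) : smooth_atlas M ->
  (forall x, S x -> smap x f) -> smooth_on S f.
Proof.
move=> gM H x Sx; have [j [jx nj sf]] := H x Sx; have [i [ix _]] := nj.
by have [F rF] := smap_is_rep S gM ix nj sf; exists i, j, F.
Qed.

Lemma to_euc_smf {M : mfd R} (x : M) h : smooth_atlas M -> smap x (to_euc h) <-> smf x h.
Proof.
move=> gM; split=> [[j [_ nj sf]]|sf].
  have [i [ix _]] := nj; apply: (smf_ext gM _ (sf 0)).
  by apply: (mnear_true ix) => y; rewrite /= mxE eqxx.
have [i [ix _]] := sf; exists tt; split=> //; first exact: (mnear_true ix).
move=> k; apply: (smf_ext gM _ sf).
by apply: (mnear_true ix) => y; rewrite /= mxE !ord1 eqxx.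
Qed.

Lemma euc_atlas n : smooth_atlas (euc n : mfd R).
Proof.
split=> // i j x _ _; exists id; apply/is_repP; split=> //; exists setT; split=> //.
  exact: openT.
by move=> k; exact: sm_coord.
Qed.

End Maps.

(** * Curves and their velocities *)

Section Curves.
Context {R : realType}.

(** Differentiability is asked at time 0 only, which is exactly what [curve_lift] provides. *)
Definition is_curve {M : mfd R} (c : R -> M) := exists i,
  [/\ cdom i (c 0), \forall t \near 0, cdom i (c t) & dfv (fun t => cmap i (c t)) 0].

Definition vel {M : mfd R} (c : R -> M) : tangent M :=
  TVec (c 0) (fun i => if pselect (cdom i (c 0)) then dv (fun t => cmap i (c t)) 0 1 else 0).

Lemma velE {M : mfd R} (c : R -> M) i : cdom i (c 0) ->
  tcoef (vel c) i = dv (fun t => cmap i (c t)) 0 1.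
Proof. by move=> ic; rewrite /=; case: pselect. Qed.

Lemma curve_near {M : mfd R} (c : R -> M) P : smooth_atlas M -> is_curve c -> mnear (c 0) P ->
  \forall t \near 0, P (c t).
Proof.
move=> gM [i [ic nc dc]] nP; have [U [oU Ux H]] := mnear_chart gM ic nP.
have A : \forall t \near 0, U (cmap i (c t)).
  by have := dfv_continuous dc; apply; exact: open_nbhs_nbhs.
by apply: filterS2 A nc => t Ut it; exact: H.
Qed.

Lemma curve_rep {M N : mfd R} (S : set M) (f : M -> N) (c : R -> M) i j F : smooth_atlas M ->
  cdom i (c 0) -> (\forall t \near 0, cdom i (c t)) -> dfv (fun t => cmap i (c t)) 0 ->
  (\forall t \near 0, S (c t)) ->
  is_rep S f i j (c 0) F ->
  [/\ cdom j (f (c 0)), \forall t \near 0, cdom j (f (c t)), dfv (fun t => cmap j (f (c t))) 0 &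
    dv (fun t => cmap j (f (c t))) 0 1 = dv F (cmap i (c 0)) (dv (fun t => cmap i (c t)) 0 1)].
Proof.
move=> gM ic nc dc nS /is_repP[_ [U [oU Ux sF H]]].
have nU : \forall t \near 0, U (cmap i (c t)).
  by have := dfv_continuous dc; apply; exact: open_nbhs_nbhs.
have nH : \forall t \near 0, cdom j (f (c t)) /\ cmap j (f (c t)) = F (cmap i (c t)).
  by apply: filterS3 nS nU nc => t St Ut it; exact: H.
have nj : \forall t \near 0, cdom j (f (c t)) by apply: filterS nH => t [].
have nE : \forall t \near (0 : R), F (cmap i (c t)) = cmap j (f (c t)) by apply: filterS nH => t [].
have dF := smv_dfv sF Ux; have dFc := dfv_comp dc dF.
split=> //; first exact: (nbhs_singleton nj).
  exact: near_dfv nE dFc.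
by rewrite (near_dv _ nE dFc) (dv_comp _ dc dF).
Qed.

Lemma curve_chart {M : mfd R} (c : R -> M) i : smooth_atlas M -> is_curve c -> cdom i (c 0) ->
  (\forall t \near 0, cdom i (c t)) /\ dfv (fun t => cmap i (c t)) 0.
Proof.
move=> gM [j [jc nc dc]] ic; have [F rF] := gM.2 j i (c 0) jc ic.
have nS : \forall t \near 0, pts M (c t) by apply: filterS nc => t; exact: gM.1.
by have [] := curve_rep gM jc nc dc nS rF.
Qed.

Lemma vel_tvec {M : mfd R} (c : R -> M) : smooth_atlas M -> is_curve c -> is_tvec (vel c).
Proof.
move=> gM cc; have [j [jc nc dc]] := cc; split.
- exact: gM.1 jc.
- by move=> i ic /=; case: pselect.
move=> i k F rF; have [ic _] := rF; have [nic dic] := curve_chart gM cc ic.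
have nS : \forall t \near 0, pts M (c t) by apply: filterS nc => t; exact: gM.1.
have [kc _ _ E] := curve_rep gM ic nic dic nS rF.
by rewrite !velE // E; have [-> _] := rep_diff (dv (fun t => cmap i (c t)) 0 1) rF.
Qed.

Lemma tvec_eq {M : mfd R} (v w : tangent M) i : smooth_atlas M -> is_tvec v -> is_tvec w ->
  tbase v = tbase w -> cdom i (tbase v) -> tcoef v i = tcoef w i -> v = w.
Proof.
move=> [_ pM]; case: v w => [x a] [y b] [/= _ a0 ha] [/= _ b0 hb] /= exy ix ab.
rewrite -exy in b0 hb *; congr TVec; apply/funext => j.
case: (pselect (cdom j x)) => jx; last by rewrite a0 // b0.
by have [F rF] := pM i j x ix jx; rewrite (ha i j F rF) (hb i j F rF) ab.
Qed.

Lemma chart_curve {M : mfd R} (x : M) i (u : 'rV[R]_(dim M)) : premfd M -> cdom i x ->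
  exists c : R -> M, [/\ is_curve c, c 0 = x, tcoef (vel c) i = u & forall t, cdom i (c t)].
Proof.
move=> lM ix; have gM := premfd_atlas lM; pose q0 := cmap i x.
(* Where the straight line leaves the image of the chart, the default value keeps the curve at [x],
   so it lies in [cdom i] at all times. *)
pose c (t : R) := the x [set y | cdom i y /\ cmap i y = q0 + t *: u].
have cE t : (cmap i @` cdom i) (q0 + t *: u) -> cmap i (c t) = q0 + t *: u.
  move=> [y iy E]; rewrite /c /the; case: pselect => [h|[]]; last by exists y.
  by case: (cid h) => z [].
have ci t : cdom i (c t).
  by rewrite /c /the; case: pselect => // h; case: (cid h) => z [].
have D : is_diff (0 : R) (fun t : R => q0 + t *: u) (fun t : R => t *: u).
  have := is_diffD (is_diff_cst q0 (0 : R)) (is_diff_scalel (0 : R) u).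
  by rewrite add0r.
have dl : dfv (fun t : R => q0 + t *: u) 0 by apply/dfvE; exact: ex_diff.
have El : dv (fun t : R => q0 + t *: u) 0 1 = u.
  by rewrite dv_diff ?diff_val ?scale1r //; exact/dfvE.
have nE : \forall t \near (0 : R), q0 + t *: u = cmap i (c t).
  have : \forall t \near (0 : R), (cmap i @` cdom i) (q0 + t *: u).
    have := dfv_continuous dl; apply; apply: open_nbhs_nbhs; split; first exact: ml_open.
    by rewrite scale0r addr0; exists x.
  by apply: filterS => t /cE.
have c0 : c 0 = x.
  by apply: (ml_inj lM (ci 0) ix); rewrite -(nbhs_singleton nE) scale0r addr0.
have cc : is_curve c.
  by exists i; split=> //; [apply: near_all => t; exact: ci|exact: near_dfv nE dl].
by exists c; split=> //; rewrite velE ?c0 // (near_dv _ nE dl).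
Qed.

Lemma tvec_curve {M : mfd R} (v : tangent M) i : premfd M -> is_tvec v -> cdom i (tbase v) ->
  exists c : R -> M, [/\ is_curve c, vel c = v & forall t, cdom i (c t)].
Proof.
move=> lM tv ix; have [c [cc c0 cu ci]] := chart_curve (tcoef v i) lM ix.
exists c; split=> //; apply: (tvec_eq (premfd_atlas lM) (vel_tvec (premfd_atlas lM) cc) tv) cu => //.
by rewrite -[tbase _]/(c 0) c0.
Qed.

Lemma the_unique {T : Type} (x0 y : T) (P : set T) : P y -> (forall z, P z -> z = y) ->
  the x0 P = y.
Proof.
move=> Py U; rewrite /the; case: pselect => [h|[]]; last by exists y.
by case: (cid h) => z Pz /=; exact: U.
Qed.

(** The bridge from differentials, defined by a condition in all pairs of charts, to compositions of
    curves. The set [S] need not be open: the curve only has to stay in it, as for composable pairs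
    of arrows. *)
Lemma dmap_on_vel {M N : mfd R} (S : set M) (f : M -> N) (c : R -> M) :
  smooth_atlas M -> smooth_atlas N -> is_curve c -> (\forall t \near 0, S (c t)) ->
  (exists i j F, is_rep S f i j (c 0) F) ->
  is_curve (fun t => f (c t)) /\ dmap_on S f (vel c) = vel (fun t => f (c t)).
Proof.
move=> gM gN cc nS [i [j [F rF]]].
have [ic _] := rF; have [nic dic] := curve_chart gM cc ic.
have [jc njc djc E] := curve_rep gM ic nic dic nS rF.
have fc : is_curve (fun t => f (c t)) by exists j.
split=> //; apply: the_unique.
  split; first by split=> //; exact: vel_tvec.
  move=> i' j' F' rF'; have [ic' _] := rF'; have [nic' dic'] := curve_chart gM cc ic'.
  have [jc' _ _ E'] := curve_rep gM ic' nic' dic' nS rF'.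
  by rewrite !velE // E'; have [-> _] := rep_diff (dv (fun t => cmap i' (c t)) 0 1) rF'.
move=> w [[tw bw] H]; have bw' : tbase w = f (c 0) := bw.
apply: (tvec_eq (i := j) gN tw (vel_tvec gN fc)) => //; first by rewrite bw'.
rewrite (H i j F rF) !velE // E.
by have [-> _] := rep_diff (dv (fun t => cmap i (c t)) 0 1) rF.
Qed.

End Curves.

(** * Tangent vectors as derivations *)

Section Derivations.
Context {R : realType}.

Lemma dmap_vel {M N : mfd R} (f : M -> N) (c : R -> M) :
  smooth_atlas M -> smooth_atlas N -> is_curve c -> smap (c 0) f ->
  is_curve (fun t => f (c t)) /\ dmap f (vel c) = vel (fun t => f (c t)).
Proof.
move=> gM gN cc [j [jx nj sf]]; have [i [ic nc dc]] := cc.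
apply: dmap_on_vel => //; first by apply: filterS nc => t; exact: gM.1.
by exists i, j; exact: smap_is_rep.
Qed.

Lemma curve_dfb {M : mfd R} (c : R -> M) h : smooth_atlas M -> is_curve c -> smf (c 0) h ->
  dfb (fun t => h (c t)) 0.
Proof.
move=> gM cc /(to_euc_smf _ _ gM) sh.
have [[[] [_ _ d]] _] := dmap_vel gM (euc_atlas 1) cc sh.
apply: (near_dfb _ (d 0)); apply: near_all => t.
by rewrite /= mxE eqxx.
Qed.

Lemma deriv_vel {M : mfd R} (c : R -> M) h : smooth_atlas M -> is_curve c -> smf (c 0) h ->
  deriv (vel c) h = dd (fun t => h (c t)) 0 1.
Proof.
move=> gM cc sh; have /(to_euc_smf _ _ gM) sh' := sh.
have [[[] [_ _ d]] E] := dmap_vel gM (euc_atlas 1) cc sh'.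
rewrite /deriv E velE // dvE; apply: near_dd (curve_dfb gM cc sh).
by apply: near_all => t; rewrite /= mxE eqxx.
Qed.

Section Derivation.
Context {M : mfd R}.
Hypothesis lM : premfd M.
Implicit Types (v w : tangent M) (h f : M -> R) (i j : cidx M) (x y : M).

Let gM : smooth_atlas M := premfd_atlas lM.

Lemma tvec_ex_curve v : is_tvec v ->
  exists c : R -> M, [/\ is_curve c, c 0 = tbase v & vel c = v].
Proof.
move=> tv; have [/(ml_cover lM)[i ix] _ _] := tv.
by have [c [cc E _]] := tvec_curve lM tv ix; exists c; rewrite -E.
Qed.

Lemma deriv_chart i v h U F : is_tvec v -> cdom i (tbase v) -> open U -> U (cmap i (tbase v)) ->
  sm U F -> (forall y, cdom i y -> U (cmap i y) -> h y = F (cmap i y)) ->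
  deriv v h = dd F (cmap i (tbase v)) (tcoef v i).
Proof.
move=> tv ix oU Ux sF H; have [c [cc E nci]] := tvec_curve lM tv ix.
have sh : smf (c 0) h by exists i; split; [exact: nci|exists U, F; rewrite -E in ix Ux *].
rewrite -{1}E deriv_vel // -E velE; last exact: nci.
have [nc dc] := curve_chart gM cc (nci 0).
have Ux0 : U (cmap i (c 0)) by rewrite -E in Ux.
rewrite -dd_comp //; last exact: sm_diff sF Ux0.
apply: (near_dd _ _ (dfb_comp dc (sm_diff sF Ux0))).
have nU : \forall t \near 0, U (cmap i (c t)).
  by have := dfv_continuous dc; apply; exact: open_nbhs_nbhs.
by apply: filterS nU => t Ut; rewrite H.
Qed.

Lemma deriv_coord i v k : is_tvec v -> cdom i (tbase v) ->
  deriv v (fun y => cmap i y 0 k) = tcoef v i 0 k.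
Proof.
move=> tv ix; rewrite (@deriv_chart i _ _ setT (fun q => q 0 k)) ?dd_coord //.
  exact: openT.
exact: sm_coord.
Qed.

Lemma deriv_ext v h f : is_tvec v -> smf (tbase v) h -> mnear (tbase v) (fun y => h y = f y) ->
  deriv v f = deriv v h.
Proof.
move=> tv sh hf; have sf := smf_ext gM hf sh.
have [c [cc c0 <-]] := tvec_ex_curve tv; rewrite -c0 in sh sf hf.
rewrite !deriv_vel //; apply: near_dd (curve_dfb gM cc sh).
exact: curve_near hf.
Qed.

Lemma derivD v h f : is_tvec v -> smf (tbase v) h -> smf (tbase v) f ->
  deriv v (fun y => h y + f y) = deriv v h + deriv v f.
Proof.
move=> tv; have [c [cc <- <-]] := tvec_ex_curve tv => sh sf.
by rewrite !deriv_vel //; [apply: ddD; exact: curve_dfb|apply: (smfD gM)].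
Qed.

Lemma derivM v h f : is_tvec v -> smf (tbase v) h -> smf (tbase v) f ->
  deriv v (fun y => h y * f y) = h (tbase v) * deriv v f + f (tbase v) * deriv v h.
Proof.
move=> tv; have [c [cc <- <-]] := tvec_ex_curve tv => sh sf.
by rewrite !deriv_vel //; [apply: ddM; exact: curve_dfb|apply: (smfM gM)].
Qed.

Lemma deriv_cst v (r : R) : is_tvec v -> deriv v (fun=> r) = 0.
Proof.
move=> tv; have [c [cc _ <-]] := tvec_ex_curve tv; have [i [ic _ _]] := cc.
by rewrite deriv_vel ?dd_cst //; exact: smf_cst ic.
Qed.

Lemma deriv_sum n v (f : 'I_n -> M -> R) : is_tvec v -> (forall k, smf (tbase v) (f k)) ->
  deriv v (fun y => \sum_k f k y) = \sum_k deriv v (f k).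
Proof.
move=> tv; have [c [cc <- <-]] := tvec_ex_curve tv => sf; have [i [ic _ _]] := cc.
rewrite deriv_vel //; last exact: (smf_sum gM ic).
rewrite dd_sum => [|k]; last exact: curve_dfb.
by apply: eq_bigr => k _; rewrite deriv_vel.
Qed.

Lemma tvecD v w : is_tvec v -> is_tvec w -> tbase v = tbase w ->
  is_tvec (TVec (tbase v) (fun i => tcoef v i + tcoef w i)).
Proof.
move=> [pv v0 hv] [_ w0 hw] E; rewrite -E in w0 hw; split=> //= [i ni|i j F rF].
  by rewrite v0 // w0 // addr0.
by rewrite linearD (hv _ _ _ rF) (hw _ _ _ rF).
Qed.

Lemma tvecZ r v : is_tvec v -> is_tvec (TVec (tbase v) (fun i => r *: tcoef v i)).
Proof.
move=> [pv v0 hv]; split=> //= [i ni|i j F rF]; first by rewrite v0 // scaler0.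
by rewrite linearZ (hv _ _ _ rF).
Qed.

Lemma tvec0 x : pts M x -> is_tvec (TVec x (fun _ => 0) : tangent M).
Proof. by move=> px; split=> //= i j F rF; rewrite linear0. Qed.

Lemma smf_ex v h : is_tvec v -> smf (tbase v) h -> exists i U F,
  [/\ cdom i (tbase v), open U, U (cmap i (tbase v)), sm U F &
  forall y, cdom i y -> U (cmap i y) -> h y = F (cmap i y)].
Proof. by move=> _ [i [ix [U [F [oU Ux sF H]]]]]; exists i, U, F. Qed.

Lemma deriv_vadd v w h : is_tvec v -> is_tvec w -> tbase v = tbase w -> smf (tbase v) h ->
  deriv (vadd v w) h = deriv v h + deriv w h.
Proof.
move=> tv tw E sh; have [i [U [F [ix oU Ux sF H]]]] := smf_ex tv sh.
rewrite (deriv_chart (tvecD tv tw E) ix oU Ux sF H) (deriv_chart tv ix oU Ux sF H).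
rewrite E in ix Ux; rewrite (deriv_chart tw ix oU Ux sF H) -E /=.
by rewrite ddDr.
Qed.

Lemma deriv_vscal r v h : is_tvec v -> smf (tbase v) h ->
  deriv (vscal r v) h = r * deriv v h.
Proof.
move=> tv sh; have [i [U [F [ix oU Ux sF H]]]] := smf_ex tv sh.
by rewrite (deriv_chart (tvecZ r tv) ix oU Ux sF H) (deriv_chart tv ix oU Ux sF H) /= ddZr.
Qed.

Lemma tvec_deriv_eq v w : is_tvec v -> is_tvec w -> tbase v = tbase w ->
  (forall h, smf (tbase v) h -> deriv v h = deriv w h) -> v = w.
Proof.
move=> tv tw E H; have [/(ml_cover lM)[i ix] _ _] := tv.
apply: (tvec_eq (premfd_atlas lM) tv tw E ix); apply/rowP => k.
rewrite -(deriv_coord k tv ix) -(deriv_coord k tw) -?E // H //; exact: smf_coord.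
Qed.

Lemma frameP i x k : cdom i x -> fib (tangent M) x (frame (E := tangent M) i x k) /\
  tcoef (frame (E := tangent M) i x k) i = delta_mx 0 k.
Proof.
move=> ix; rewrite /frame /the; case: pselect => [h|[]]; first by case: (cid h) => z [].
have [c [cc c0 cu ci]] := chart_curve (delta_mx 0 k) lM ix.
by exists (vel c); split=> //; split=> //; exact: vel_tvec.
Qed.

Lemma deriv_frame i v h : is_tvec v -> cdom i (tbase v) -> smf (tbase v) h ->
  deriv v h = \sum_k tcoef v i 0 k * deriv (frame (E := tangent M) i (tbase v) k) h.
Proof.
move=> tv ix sh; have [U [F [oU Ux sF H]]] := smf_chart gM ix sh.
rewrite (deriv_chart tv ix oU Ux sF H) dd_rowE; apply: eq_bigr => k _.
have [[tf bf] cf] := frameP k ix; have bf' : tbase (frame (E := tangent M) i (tbase v) k) = tbase v := bf.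
by rewrite (@deriv_chart i _ _ U F) // ?bf' // cf.
Qed.

Lemma smf_deriv_frame i x h k : cdom i x -> smf x h ->
  smf x (fun y => deriv (frame (E := tangent M) i y k) h).
Proof.
move=> ix sh; have [U [F [oU Ux sF H]]] := smf_chart gM ix sh.
exists i; split=> //; exists U, (fun q => dd F q (delta_mx 0 k)); split=> //; first exact: sm_d.
move=> y iy Uy; have [[tf bf] cf] := frameP k iy.
have bf' : tbase (frame (E := tangent M) i y k) = y := bf.
by rewrite (@deriv_chart i _ _ U F) // ?bf' // cf.
Qed.

Lemma smf_deriv_field i x h (X : M -> tangent M) : cdom i x ->
  mnear x (fun y => fib (tangent M) y (X y)) ->
  (forall k, smf x (fun y => tcoef (X y) i 0 k)) -> smf x h ->
  smf x (fun y => deriv (X y) h).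
Proof.
move=> ix nX sX sh; apply: (smf_ext gM _ (_ : smf x (fun y => \sum_k tcoef (X y) i 0 k *
   deriv (frame (E := tangent M) i y k) h))); last first.
  by apply: (smf_sum gM ix) => k; apply: (smfM gM) => //; exact: smf_deriv_frame.
have N := mnearI gM (mnearI gM (mnear_cdom ix) nX) (smf_nest sh).
apply: mnearS N => y [[iy [tX bX]] hy]; have bX' : tbase (X y) = y := bX.
by rewrite (deriv_frame (i := i) tX) bX'.
Qed.

End Derivation.

Section DmapProps.
Context {M N : mfd R}.
Hypotheses (lM : premfd M) (lN : premfd N).
Implicit Types (v w : tangent M).
Let gM : smooth_atlas M := premfd_atlas lM.
Let gN : smooth_atlas N := premfd_atlas lN.

Lemma dmap_fib (f : M -> N) v : is_tvec v -> smap (tbase v) f ->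
  fib (tangent N) (f (tbase v)) (dmap f v).
Proof.
move=> tv; have [c [cc c0 E]] := tvec_ex_curve lM tv; rewrite -c0 -E => sf.
have [cf ->] := dmap_vel gM gN cc sf.
by split=> //; exact: vel_tvec.
Qed.

Lemma deriv_dmap (f : M -> N) v h : is_tvec v -> smap (tbase v) f -> smf (f (tbase v)) h ->
  deriv (dmap f v) h = deriv v (fun y => h (f y)).
Proof.
move=> tv; have [c [cc c0 E]] := tvec_ex_curve lM tv; rewrite -c0 -E => sf sh.
have [cf ->] := dmap_vel gM gN cc sf.
rewrite !deriv_vel //; exact: smf_smap sh.
Qed.

Lemma dmapD (f : M -> N) v w : is_tvec v -> is_tvec w -> tbase v = tbase w ->
  smap (tbase v) f -> dmap f (vadd v w) = vadd (dmap f v) (dmap f w).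
Proof.
move=> tv tw E sf; have tvw := tvecD tv tw E.
have [t1 b1] := dmap_fib tvw sf; have [t2 b2] := dmap_fib tv sf.
have sfw : smap (tbase w) f by rewrite -E.
have [t3 b3] := dmap_fib tw sfw.
have b1' : tbase (dmap f (vadd v w)) = f (tbase v) := b1.
have b2' : tbase (dmap f v) = f (tbase v) := b2.
have b3' : tbase (dmap f w) = f (tbase v) by rewrite E; exact: b3.
apply: (tvec_deriv_eq lN t1); first by apply: tvecD => //; rewrite b2'.
  by rewrite b1' /= b2'.
move=> h; rewrite b1' => sh.
rewrite (deriv_dmap tvw) // (deriv_vadd lN) ?b2' // (deriv_dmap tv) // (deriv_dmap tw) -?E //.
by rewrite (deriv_vadd lM) //; exact: smf_smap sh.
Qed.

Lemma dmapZ (f : M -> N) r v : is_tvec v -> smap (tbase v) f ->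
  dmap f (vscal r v) = vscal r (dmap f v).
Proof.
move=> tv sf; have tv' := tvecZ r tv.
have [t1 b1] := dmap_fib tv' sf; have [t2 b2] := dmap_fib tv sf.
have b1' : tbase (dmap f (vscal r v)) = f (tbase v) := b1.
have b2' : tbase (dmap f v) = f (tbase v) := b2.
apply: (tvec_deriv_eq lN t1); first exact: tvecZ.
  by rewrite b1' /= b2'.
move=> h; rewrite b1' => sh.
rewrite (deriv_dmap tv') // (deriv_vscal lN) ?b2' // (deriv_dmap tv) //.
by rewrite (deriv_vscal lM) //; exact: smf_smap sh.
Qed.

End DmapProps.

Lemma dmap_comp {M N P : mfd R} (f : M -> N) (g : N -> P) (v : tangent M) :
  premfd M -> premfd N -> premfd P -> is_tvec v -> smap (tbase v) f -> smap (f (tbase v)) g ->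
  dmap g (dmap f v) = dmap (fun x => g (f x)) v.
Proof.
move=> lM lN lP tv; have [c [cc c0 E]] := tvec_ex_curve lM tv; rewrite -c0 -E => sf sg.
have [gM gN gP] : [/\ smooth_atlas M, smooth_atlas N & smooth_atlas P] by split; exact: premfd_atlas.
have [cf ->] := dmap_vel gM gN cc sf.
have [_ ->] := dmap_vel gN gP cf sg.
by have [_ ->] := dmap_vel gM gP cc (smap_comp gM gN sf sg).
Qed.

End Derivations.

(** * Charts of TM, vector fields and brackets *)

Section TangentBundle.
Context {R : realType} {M : mfd R}.
Hypothesis lM : premfd M.
Let gM : smooth_atlas M := premfd_atlas lM.

Lemma lsub_coord {n1 n2} (q : 'rV[R]_(n1 + n2)) k : lsubmx q 0 k = q 0 (lshift n2 k).
Proof. by rewrite mxE. Qed.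

Lemma rsub_coord {n1 n2} (q : 'rV[R]_(n1 + n2)) k : rsubmx q 0 k = q 0 (rshift n1 k).
Proof. by rewrite mxE. Qed.

Lemma smv_lsub {n1 n2} (O : set 'rV[R]_(n1 + n2)) : smv O (fun q => lsubmx q).
Proof.
move=> k; have -> : (fun q : 'rV[R]_(n1 + n2) => lsubmx q 0 k) = fun q => q 0 (lshift n2 k).
  by apply/funext => q; rewrite lsub_coord.
exact: sm_coord.
Qed.

Lemma smv_rsub {n1 n2} (O : set 'rV[R]_(n1 + n2)) : smv O (fun q => rsubmx q).
Proof.
move=> k; have -> : (fun q : 'rV[R]_(n1 + n2) => rsubmx q 0 k) = fun q => q 0 (rshift n1 k).
  by apply/funext => q; rewrite rsub_coord.
exact: sm_coord.
Qed.

Lemma smv_row_mx {m n1 n2} (O : set 'rV[R]_m) (F : 'rV[R]_m -> 'rV[R]_n1) (G : 'rV[R]_m -> 'rV[R]_n2) :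
  open O -> smv O F -> smv O G -> smv O (fun q => row_mx (F q) (G q)).
Proof.
move=> oO sF sG k; case: (split_ordP k) => [l ->|l ->].
  by apply: (sm_ext oO _ (sF l)) => q _; rewrite row_mxEl.
by apply: (sm_ext oO _ (sG l)) => q _; rewrite row_mxEr.
Qed.

Lemma open_lsub {n1 n2} (U : set 'rV[R]_n1) : open U ->
  open [set q : 'rV[R]_(n1 + n2) | U (lsubmx q)].
Proof.
move=> oU; have := open_comp_on (@openT _) oU (@smv_lsub n1 n2 setT).
by congr open; apply/seteqP; split=> q //= -[].
Qed.

Lemma open_rsub {n1 n2} (U : set 'rV[R]_n2) : open U ->
  open [set q : 'rV[R]_(n1 + n2) | U (rsubmx q)].
Proof.
move=> oU; have := open_comp_on (@openT _) oU (@smv_rsub n1 n2 setT).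
by congr open; apply/seteqP; split=> q //= -[].
Qed.

(** A chart of TM consists of a chart [i] for the base point and a chart [a] for the components,
    possibly different. The transition therefore uses three chart changes: [F] from [i] to [j] for
    the base point, and for the components the Jacobian of [G] from [a] to [b], taken at the point
    carried from [i] to [a] by [F']. *)
Lemma tangent_atlas : smooth_atlas (total (tangent M)).
Proof.
split=> [[i a] v [tv _ _]|] //.
move=> [i a] [j b] v [/= tv iv av] [/= _ jv bv].
have [U [F [oU Ux sF HF]]] := chart_change gM iv jv.
have [U' [F' [oU' Ux' sF' HF']]] := chart_change gM iv av.
have [W [G [oW Wx sG HG]]] := chart_change gM av bv.
pose V := [set q : 'rV[R]_(dim M + dim M) | (U (lsubmx q) /\ U' (lsubmx q)) /\ W (F' (lsubmx q))].
have sF'l (O : set 'rV[R]_(dim M + dim M)) : open O -> (forall q, O q -> U' (lsubmx q)) -> smv O (fun q => F' (lsubmx q)).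
  by move=> oO OU' k; apply: (sm_comp oO OU' _ (sF' k)) => l; exact: smv_lsub.
have oUU : open [set q : 'rV[R]_(dim M + dim M) | U (lsubmx q) /\ U' (lsubmx q)].
  by apply: openI; exact: open_lsub.
have oV : open V by apply: (open_comp_on oUU oW); apply: sF'l => // q [].
exists (fun q => row_mx (F (lsubmx q)) (\row_k \sum_l rsubmx q 0 l *
   dd (fun z => G z 0 k) (F' (lsubmx q)) (delta_mx 0 l))).
apply/is_repP; split=> //; exists V; split=> //.
- rewrite /V /= row_mxKl; split=> //; have [_ <-] := HF' _ iv Ux'; exact: Wx.
- apply: smv_row_mx => //.
    by move=> k; apply: (sm_comp oV _ _ (sF k)) => [q [[]]//|l]; exact: smv_lsub.
  move=> k; apply: (sm_ext oV (fun q _ => esym (mxE _ _ _ _))).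
  apply: sm_sum => // l; apply: smM => //; first exact: smv_rsub.
  apply: (@sm_comp _ _ _ V W (fun q => F' (lsubmx q)) (fun z => dd (fun z => G z 0 k) z (delta_mx 0 l))) => //.
  - by move=> q [].
  - by apply: sF'l => // q [[]].
  - exact: sm_d.
move=> w tw [_ /= iw aw]; rewrite /V /= row_mxKl row_mxKr => -[[Uw U'w] Ww].
have [jw Ej] := HF _ iw Uw; have [_ Ea] := HF' _ iw U'w.
rewrite -Ea in Ww *; have [bw Eb] := HG _ aw Ww.
split; first by split.
rewrite Ej; congr row_mx; have [_ _ hw] := tw.
have rG : is_rep (pts M) id a b (tbase w) G.
  by apply/is_repP; split=> //; exists W; split=> // y _; exact: HG.
rewrite (hw _ _ _ rG); have [-> _] := rep_diff (tcoef w a) rG.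
by apply/rowP => k; rewrite !mxE dd_rowE.
Qed.

Lemma tangent_smap {P : mfd R} (X : P -> total (tangent M)) x i : smooth_atlas P ->
  cdom i (tbase (X x)) -> mnear x (fun y => vin (X y)) ->
  smap x X <-> smap x (fun y => tbase (X y)) /\ forall k, smf x (fun y => tcoef (X y) i 0 k).
Proof.
move=> gP iX nX; have [p [px _]] := nX; split=> [sX|[sb sc]].
  have cX : @cdom _ (total (tangent M)) (i, i) (X x) by split=> //; exact: mnear_self nX.
  have [nc sc] := smap_chart gP tangent_atlas sX cX.
  split=> [|k]; last first.
    apply: (smf_ext gP _ (sc (rshift _ k))).
    by apply: (mnear_true px) => y /=; rewrite row_mxEr.
  exists i; split=> //; first by apply: mnearS nc => y [].
  move=> k; apply: (smf_ext gP _ (sc (lshift _ k))).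
  by apply: (mnear_true px) => y /=; rewrite row_mxEl.
have [ni si] := smap_chart gP gM sb iX.
exists (i, i); split=> //; first by split=> //; exact: mnear_self nX.
  by apply: mnearS (mnearI gP nX ni) => y [].
move=> k; case: (split_ordP k) => [l ->|l ->].
  apply: (smf_ext gP _ (si l)).
  by apply: (mnear_true px) => y /=; rewrite row_mxEl.
apply: (smf_ext gP _ (sc l)).
by apply: (mnear_true px) => y /=; rewrite row_mxEr.
Qed.

Lemma field_smf (W : set M) X x i k : mopen W -> section_on W (X : M -> tangent M) -> W x -> cdom i x ->
  smf x (fun y => tcoef (X y) i 0 k).
Proof.
move=> oW [fX sX] Wx ix; have nW := mopen_mnear lM oW Wx.
have [_ bX] := fX x Wx; have bX' : tbase (X x) = x := bX.
have iX : cdom i (tbase (X x)) by rewrite bX'.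
have nX : mnear x (fun y => vin (X y)) by apply: mnearS nW => y /fX[].
have /(tangent_smap gM iX nX)[_] := smap_smooth_on gM nW sX; exact.
Qed.

Lemma field_section (W : set M) (X : M -> tangent M) : mopen W ->
  (forall x, W x -> fib (tangent M) x (X x)) ->
  (forall x, W x -> exists2 i, cdom i x & forall k, smf x (fun y => tcoef (X y) i 0 k)) ->
  section_on W X.
Proof.
move=> oW fX sX; split=> //; apply: smooth_onP => // x Wx.
have nW := mopen_mnear lM oW Wx; have [i ix sXi] := sX x Wx.
have [_ bX] := fX x Wx; have bX' : tbase (X x) = x := bX.
have nX : mnear x (fun y => vin (X y)) by apply: mnearS nW => y /fX[].
apply/(@tangent_smap _ _ _ i) => //; first by rewrite bX'.
split=> //; apply: (smap_ext gM _ (smap_id ix)).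
by apply: mnearS nW => y /fX[_ /= ->].
Qed.

Lemma frame_section i (u : 'rV[R]_(dim M)) : exists X : M -> tangent M,
  section_on (cdom i) X /\ forall x, cdom i x -> tcoef (X x) i = u.
Proof.
have /choice[X HX] : forall x, exists v : tangent M, cdom i x ->
    fib (tangent M) x v /\ tcoef v i = u.
  move=> x; case: (pselect (cdom i x)) => [ix|nix]; last by exists (TVec x (fun=> 0)).
  have [c [cc c0 cu _]] := chart_curve u lM ix; exists (vel c) => _; split=> //.
  by split=> //; exact: vel_tvec.
exists X; split=> [|x ix]; last by have [] := HX x ix.
apply: field_section => [|x /HX[]//|x ix]; first exact: mopen_cdom.
exists i => // k; apply: (smf_ext gM _ (smf_cst (u 0 k) ix)).
by apply: mnearS (mnear_cdom ix) => y iy; have [_ ->] := HX y iy.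
Qed.

Lemma tvec_of_coef i x (u : 'rV[R]_(dim M)) : cdom i x ->
  exists v : tangent M, [/\ is_tvec v, tbase v = x & tcoef v i = u].
Proof.
move=> ix; have [c [cc c0 cu _]] := chart_curve u lM ix; exists (vel c); split=> //.
exact: vel_tvec.
Qed.

(** The commutator of two fields is a first order operator: in [expand] the second derivatives of
    [h] enter through a bilinear form in the components of [X] and [Y], which is symmetric by
    [schwarz] and cancels. The remaining first order part has the stated components. *)
Lemma bracketP (X Y : M -> tangent M) x i : cdom i x ->
  mnear x (fun y => fib (tangent M) y (X y)) -> mnear x (fun y => fib (tangent M) y (Y y)) ->
  (forall k, smf x (fun y => tcoef (X y) i 0 k)) ->
  (forall k, smf x (fun y => tcoef (Y y) i 0 k)) ->
  fib (tangent M) x (bracket X Y x) /\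
  forall k, tcoef (bracket X Y x) i 0 k =
    deriv (X x) (fun y => tcoef (Y y) i 0 k) - deriv (Y x) (fun y => tcoef (X y) i 0 k).
Proof.
move=> ix nX nY sX sY.
have [tX bX] := mnear_self nX; have [tY bY] := mnear_self nY.
have bX' : tbase (X x) = x := bX; have bY' : tbase (Y x) = x := bY.
pose u : 'rV[R]_(dim M) := \row_k (deriv (X x) (fun y => tcoef (Y y) i 0 k) -
   deriv (Y x) (fun y => tcoef (X y) i 0 k)).
have [v [tv bv cv]] := tvec_of_coef u ix.
suff -> : bracket X Y x = v by split=> [|k]; [split|rewrite cv mxE].
have expand (Z : M -> tangent M) (Z' : tangent M) h U F : is_tvec Z' -> tbase Z' = x ->
    mnear x (fun y => fib (tangent M) y (Z y)) ->
    (forall k, smf x (fun y => tcoef (Z y) i 0 k)) ->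
    open U -> U (cmap i x) -> sm U F -> (forall y, cdom i y -> U (cmap i y) -> h y = F (cmap i y)) ->
    deriv Z' (fun y => deriv (Z y) h) =
    \sum_k (tcoef (Z x) i 0 k * dd (fun q => dd F q (delta_mx 0 k)) (cmap i x) (tcoef Z' i)
       + dd F (cmap i x) (delta_mx 0 k) * deriv Z' (fun y => tcoef (Z y) i 0 k)).
  move=> tZ' bZ' nZ sZ oU Ux sF H; rewrite -bZ' in nZ sZ Ux.
  have ix' : cdom i (tbase Z') by rewrite bZ'.
  have sG k : smf (tbase Z') (fun y => dd F (cmap i y) (delta_mx 0 k)).
    by exists i; split=> //; exists U, (fun q => dd F q (delta_mx 0 k)); split=> //; exact: sm_d.
  have sM k := smfM gM (sZ k) (sG k).
  have nE : mnear (tbase Z') (fun y => \sum_k tcoef (Z y) i 0 k * dd F (cmap i y) (delta_mx 0 k) = deriv (Z y) h).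
    have nU : mnear (tbase Z') (fun y => U (cmap i y) /\ cdom i y).
      by exists i; split=> //; exists U.
    apply: mnearS (mnearI gM nZ nU) => y [[tZ bZ] [Uy iy]].
    have bZ2 : tbase (Z y) = y := bZ.
    by rewrite (@deriv_chart _ _ lM i _ _ U F) // ?bZ2 // dd_rowE.
  rewrite (deriv_ext lM tZ' (smf_sum gM ix' sM) nE) deriv_sum //.
  apply: eq_bigr => k _; rewrite derivM // bZ'; congr (_ * _ + _).
  rewrite -bZ'; exact: (@deriv_chart _ _ lM i Z' (fun y => dd F (cmap i y) (delta_mx 0 k)) U
    (fun q => dd F q (delta_mx 0 k)) tZ' ix' oU Ux (sm_d _ sF) (fun _ _ _ => erefl)).
apply: the_unique.
  split=> // W h oW Wx sh.
  have sh' : smf x h.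
    apply/to_euc_smf => //; apply: (smap_smooth_on (S := W)) => //; exact: mopen_mnear.
  have [U [F [oU Ux sF H]]] := smf_chart gM ix sh'.
  rewrite (expand Y (X x) h U F) // (expand X (Y x) h U F) //.
  rewrite (@deriv_chart _ _ lM i _ _ U F) // ?bv // cv dd_rowE.
  rewrite !big_split /=.
  have -> : \sum_k tcoef (Y x) i 0 k * dd (fun q => dd F q (delta_mx 0 k)) (cmap i x) (tcoef (X x) i) =
    \sum_k tcoef (X x) i 0 k * dd (fun q => dd F q (delta_mx 0 k)) (cmap i x) (tcoef (Y x) i).
    transitivity (\sum_k \sum_l tcoef (Y x) i 0 k * (tcoef (X x) i 0 l *
        dd (fun q => dd F q (delta_mx 0 k)) (cmap i x) (delta_mx 0 l))).
      by apply: eq_bigr => k _; rewrite dd_rowE mulr_sumr.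
    rewrite exchange_big; apply: eq_bigr => l _ /=.
    rewrite [in RHS]dd_rowE mulr_sumr; apply: eq_bigr => k _ /=.
    by rewrite (schwarz _ _ oU sF Ux) mulrCA.
  rewrite opprD addrACA subrr add0r -sumrB; apply: eq_bigr => k _.
  by rewrite mxE -mulrBr mulrC.
(* Uniqueness: testing on the coordinate functions of the chart already determines the vector. *)
move=> w [[tw bw] Hw]; have bw' : tbase w = x := bw.
have iw : cdom i (tbase w) by rewrite bw'.
apply: (tvec_eq (premfd_atlas lM) tw tv _ iw); first by rewrite bv.
apply/rowP => k; rewrite -(deriv_coord lM k tw iw) cv mxE.
rewrite (Hw (cdom i)) //; last 2 first.
- exact: mopen_cdom.
- apply: smooth_onP => // y iy; apply/to_euc_smf => //; exact: smf_coord.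
have D (Z : M -> tangent M) (Z' : tangent M) : is_tvec Z' -> tbase Z' = x ->
    mnear x (fun y => fib (tangent M) y (Z y)) -> (forall k, smf x (fun y => tcoef (Z y) i 0 k)) ->
    deriv Z' (fun y => deriv (Z y) (fun y => cmap i y 0 k)) = deriv Z' (fun y => tcoef (Z y) i 0 k).
  move=> tZ' bZ' nZ sZ; apply: deriv_ext => //; first by rewrite bZ'.
  rewrite bZ'; apply: mnearS (mnearI gM nZ (mnear_cdom ix)) => y [[tZ bZ] iy].
  have bZ2 : tbase (Z y) = y := bZ.
  by rewrite deriv_coord // bZ2.
by rewrite !D.
Qed.

End TangentBundle.

(** * Products of manifolds and their tangent vectors *)

Section Products.
Context {R : realType} {M N : mfd R}.
Hypotheses (lM : premfd M) (lN : premfd N).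
Let gM : smooth_atlas M := premfd_atlas lM.
Let gN : smooth_atlas N := premfd_atlas lN.

Lemma mprod_premfd : premfd (mprod M N).
Proof.
split.
- move=> [x y] /=; split=> [[/(ml_cover lM)[i ix] /(ml_cover lN)[j jy]]|[[i j] [ix jy]]].
    by exists (i, j).
  by split; [exact: premfd_cov ix|exact: premfd_cov jy].
- move=> [i j] [x y] [x' y'] /= [ix jy] [ix' jy'] /eq_row_mx[E1 E2].
  by rewrite (ml_inj lM ix ix' E1) (ml_inj lN jy jy' E2).
- move=> [i j]; have -> : [set @cmap _ (mprod M N) (i, j) p | p in @cdom _ (mprod M N) (i, j)] =
      [set q : 'rV[R]_(dim M + dim N) | (cmap i @` cdom i) (lsubmx q)] `&`
      [set q : 'rV[R]_(dim M + dim N) | (cmap j @` cdom j) (rsubmx q)].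
    apply/seteqP; split=> [q [[x y] [/= ix jy] <-]|q [[x ix E1] [y jy E2]]] /=.
      by rewrite row_mxKl row_mxKr; split; [exists x|exists y].
    by exists (x, y) => //=; rewrite E1 E2 hsubmxK.
  by apply: openI; [apply: open_lsub; exact: ml_open|apply: open_rsub; exact: ml_open].
- move=> [i j] [i' j'] [x y] [/= ix jy] [/= ix' jy'].
  have [U [F [oU Ux sF HF]]] := chart_change gM ix ix'.
  have [W [H [oW Wy sH HH]]] := chart_change gN jy jy'.
  pose V := [set q : 'rV[R]_(dim M + dim N) | U (lsubmx q)] `&` [set q | W (rsubmx q)].
  have oV : open V by apply: openI; [exact: open_lsub|exact: open_rsub].
  exists (fun q => row_mx (F (lsubmx q)) (H (rsubmx q))); apply/is_repP; split=> //.
  exists V; split=> //.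
  + by split; rewrite /= ?row_mxKl ?row_mxKr.
  + apply: smv_row_mx => //.
      by move=> k; apply: (sm_comp oV _ _ (sF k)) => [q []//|l]; exact: smv_lsub.
    by move=> k; apply: (sm_comp oV _ _ (sH k)) => [q []//|l]; exact: smv_rsub.
  move=> [a b] _ [/= ia jb]; rewrite /V /= row_mxKl row_mxKr => -[Ua Wb].
  by have [? ->] := HF _ ia Ua; have [? ->] := HH _ jb Wb.
Qed.

Lemma smap_fst (p : mprod M N) : pts (mprod M N) p -> smap p (fst : mprod M N -> M).
Proof.
move=> [/(ml_cover lM)[i ix] /(ml_cover lN)[j jy]].
have cp : @cdom _ (mprod M N) (i, j) p by [].
exists i; split=> //; first by apply: mnearS (mnear_cdom cp) => q [].
move=> k; have g := premfd_atlas mprod_premfd.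
apply: (smf_ext g _ (smf_coord (lshift (dim N) k : 'I_(dim (mprod M N))) cp)).
by apply: (mnear_true cp) => q /=; rewrite row_mxEl.
Qed.

Lemma smap_snd (p : mprod M N) : pts (mprod M N) p -> smap p (snd : mprod M N -> N).
Proof.
move=> [/(ml_cover lM)[i ix] /(ml_cover lN)[j jy]].
have cp : @cdom _ (mprod M N) (i, j) p by [].
exists j; split=> //; first by apply: mnearS (mnear_cdom cp) => q [].
move=> k; have g := premfd_atlas mprod_premfd.
apply: (smf_ext g _ (smf_coord (rshift (dim M) k : 'I_(dim (mprod M N))) cp)).
by apply: (mnear_true cp) => q /=; rewrite row_mxEr.
Qed.

Lemma curve_pair (c : R -> M) (d : R -> N) : is_curve c -> is_curve d ->
  is_curve (fun t => (c t, d t) : mprod M N).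
Proof.
move=> [i [ic nc dc]] [j [jd nd dfd]]; exists (i, j); split=> //.
  by apply: filterS2 nc nd => t.
move=> k; case: (split_ordP k) => [l ->|l ->] /=.
  by apply: near_dfb (dc l); apply: near_all => t; rewrite row_mxEl.
by apply: near_dfb (dfd l); apply: near_all => t; rewrite row_mxEr.
Qed.

Lemma tvec_fst (u : tangent (mprod M N)) i j : is_tvec u -> @cdom _ (mprod M N) (i, j) (tbase u) ->
  tcoef u (i, j) = row_mx (tcoef (dmap (fst : mprod M N -> M) u) i) (tcoef (dmap (snd : mprod M N -> N) u) j).
Proof.
move=> tu iju; have g := premfd_atlas mprod_premfd.
have [e [ce E _]] := tvec_curve mprod_premfd tu iju; rewrite -E in iju *.
have pe : pts (mprod M N) (e 0) by exact: premfd_cov mprod_premfd iju.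
have [c1 ->] := dmap_vel g gM ce (smap_fst pe).
have [c2 ->] := dmap_vel g gN ce (smap_snd pe).
have [ie je] := iju; have [nc dc] := curve_chart g ce iju.
rewrite (velE (i := ((i, j) : cidx (mprod M N)))) // (velE (i := i)) // (velE (i := j)) //.
apply/rowP => k; case: (split_ordP k) => [l ->|l ->]; rewrite dvE ?row_mxEl ?row_mxEr dvE.
  by apply: near_dd; [apply: near_all => t; rewrite /= row_mxEl|have [_ dl] := curve_chart gM c1 ie; exact: dl].
by apply: near_dd; [apply: near_all => t; rewrite /= row_mxEr|have [_ dl] := curve_chart gN c2 je; exact: dl].
Qed.

Lemma tpair_vel (c : R -> M) (d : R -> N) : is_curve c -> is_curve d ->
  tpair (vel c) (vel d) = vel (fun t => (c t, d t) : mprod M N).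
Proof.
move=> cc cd; have g := premfd_atlas mprod_premfd; have cp := curve_pair cc cd.
have [i [ic _ _]] := cc; have [j [jd _ _]] := cd.
have pe : pts (mprod M N) (c 0, d 0).
  by split; [exact: premfd_cov ic|exact: premfd_cov jd].
apply: the_unique.
  split; first exact: vel_tvec.
    by have [_ ->] := dmap_vel g gM cp (smap_fst pe).
  by have [_ ->] := dmap_vel g gN cp (smap_snd pe).
move=> u [tu Eu1 Eu2]; have [[p1 p2] _ _] := tu.
have bu : tbase u = (c 0, d 0).
  have [_ b1] := dmap_fib mprod_premfd lM tu (smap_fst (conj p1 p2)).
  have [_ b2] := dmap_fib mprod_premfd lN tu (smap_snd (conj p1 p2)).
  rewrite Eu1 in b1; rewrite Eu2 in b2; rewrite [LHS]surjective_pairing.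
  by rewrite -[(tbase u).1]b1 -[(tbase u).2]b2.
have iju : @cdom _ (mprod M N) (i, j) (tbase u) by rewrite bu.
apply: (tvec_eq (i := ((i, j) : cidx (mprod M N))) g tu (vel_tvec g cp)) => //.
rewrite tvec_fst // Eu1 Eu2.
have iju' : @cdom _ (mprod M N) (i, j) (tbase (vel (fun t => (c t, d t) : mprod M N))) by [].
rewrite (tvec_fst (vel_tvec g cp) iju').
have [_ ->] := dmap_vel g gM cp (smap_fst pe).
by have [_ ->] := dmap_vel g gN cp (smap_snd pe).
Qed.

End Products.

(** * Lifting curves through a submersion of manifolds *)

Section SubmersionLift.
Context {R : realType} {M P : mfd R}.
Hypotheses (lM : premfd M) (lP : premfd P).
Let gM : smooth_atlas M := premfd_atlas lM.
Let gP : smooth_atlas P := premfd_atlas lP.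

Lemma dmap_chart (f : M -> P) (v : tangent M) i j G : is_tvec v -> smap (tbase v) f ->
  is_rep (pts M) f i j (tbase v) G -> tcoef (dmap f v) j = dv G (cmap i (tbase v)) (tcoef v i).
Proof.
move=> tv sf rG; have [iv _] := rG; have [c [cc E _]] := tvec_curve lM tv iv.
rewrite -E in sf rG iv *; have [cf ->] := dmap_vel gM gP cc sf.
have [nc dc] := curve_chart gM cc iv.
have nS : \forall t \near 0, pts M (c t) by apply: filterS nc => t; exact: gM.1.
by have [jc _ _ Ev] := curve_rep gM iv nc dc nS rG; rewrite !velE.
Qed.

(** This is [curve_lift] in charts. Surjectivity of the differential is asked at the base point of
    [v] only; the right inverse comes from lifts of the coordinate vectors. *)
Lemma submersion_lift (f : M -> P) (v : tangent M) (d : R -> P) :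
  is_tvec v -> smap (tbase v) f ->
  (forall w, fib (tangent P) (f (tbase v)) w ->
     exists2 v', fib (tangent M) (tbase v) v' & dmap f v' = w) ->
  is_curve d -> vel d = dmap f v ->
  exists c : R -> M, [/\ is_curve c, vel c = v & \forall t \near 0, f (c t) = d t].
Proof.
move=> tv sf surj cd Ed; have [tdf bdf] := dmap_fib lM lP tv sf.
have [/(ml_cover lM)[i iv] _ _] := tv.
have d0 : d 0 = f (tbase v) by have := bdf; rewrite -Ed.
have [j [jd nd dd]] := cd; have jf : cdom j (f (tbase v)) by rewrite -d0.
have [nj sj] := smap_chart gM gP sf jf.
have [V [G [oV Vx sG HG]]] := smap_local gM iv nj sj.
have rG : is_rep (pts M) f i j (tbase v) G.
  by apply/is_repP; split=> //; exists V; split=> // y _; exact: HG.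
pose p := cmap i (tbase v).
have Gp : G p = cmap j (d 0) by have [_ <-] := HG _ iv Vx; rewrite d0.
have [B HB] : exists B : 'M[R]_(dim P, dim M), forall u, dv G p (u *m B) = u.
  apply: surj_right_inverse => u; have [w [tw bw cw]] := tvec_of_coef lP u jf.
  have [|v' [tv' bv'] Ev'] := surj w; first by split.
  have bv2 : tbase v' = tbase v := bv'.
  exists (tcoef v' i); rewrite -cw -Ev' (dmap_chart (G := G) (i := i)) // ?bv2 //.
have Ev : dv (fun t => cmap j (d t)) 0 1 = dv G p (tcoef v i).
  by rewrite -velE // Ed (dmap_chart _ _ rG).
have [cu [cu0 dcu vcu ncu]] := curve_lift oV sG Vx HB dd (esym Gp) Ev.
pose c (t : R) := the (tbase v) [set y | cdom i y /\ cmap i y = cu t].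
have cE : \forall t \near 0, cdom i (c t) /\ cmap i (c t) = cu t.
  have : \forall t \near (0 : R), (cmap i @` cdom i) (cu t).
    have := dfv_continuous dcu; apply; apply: open_nbhs_nbhs; split; first exact: ml_open.
    by rewrite cu0; exists (tbase v).
  apply: filterS => t [y iy Ey]; rewrite /c /the; case: pselect => [h|[]]; last by exists y.
  by case: (cid h) => z [].
have nci : \forall t \near 0, cdom i (c t) by apply: filterS cE => t [].
have nce : \forall t \near 0, cu t = cmap i (c t) by apply: filterS cE => t [].
have c0 : c 0 = tbase v.
  apply: (ml_inj lM (nbhs_singleton nci) iv); rewrite -(nbhs_singleton nce); exact: cu0.
have cc : is_curve c.
  exists i; split=> //; [by rewrite c0|exact: near_dfv nce dcu].
exists c; split=> //.
  apply: (tvec_eq (i := i) (premfd_atlas lM) (vel_tvec gM cc) tv) => //.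
    exact: nbhs_singleton nci.
  by rewrite velE ?(near_dv _ nce dcu) //; exact: nbhs_singleton nci.
have nV : \forall t \near 0, V (cu t).
  by have := dfv_continuous dcu; apply; apply: open_nbhs_nbhs; split=> //; rewrite cu0.
have A : \forall t \near 0, V (cu t) /\ G (cu t) = cmap j (d t).
  by apply: filterS2 nV ncu => t.
apply: filterS3 A cE nd => t [Vt Gt] [it Et] jt.
have [jt' E'] : cdom j (f (c t)) /\ cmap j (f (c t)) = G (cmap i (c t)) by apply: HG; rewrite ?Et.
by apply: (ml_inj lP jt' jt); rewrite E' Et.
Qed.

End SubmersionLift.

(** * Line bundles and connections *)

Section BundleBasics.
Context {R : realType} {M : mfd R} {E : vb M}.
Hypothesis vE : is_vb E.

Lemma vb_premfd : premfd M.
Proof. exact: (manifold_premfd (vb_base vE)). Qed.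

Lemma vb_atlas : smooth_atlas M.
Proof. exact: (premfd_atlas vb_premfd). Qed.

Lemma total_premfd : premfd (total E).
Proof. exact: (manifold_premfd (vb_total vE)). Qed.

Lemma total_atlas : smooth_atlas (total E).
Proof. exact: (premfd_atlas total_premfd). Qed.

Lemma tdom_near a x : tdom (E := E) a x -> mnear x (tdom (E := E) a).
Proof. by move=> ax; apply: mopen_mnear ax; [exact: vb_premfd|exact: vb_tdom]. Qed.

Lemma tdom_pts a x : tdom (E := E) a x -> pts M x.
Proof. by move=> ax; have [+ _] := vb_tdom vE a; apply. Qed.

Lemma fib_pts x (e : E) : fib E x e -> pts M x.
Proof. by move=> [ve <-]; exact: vb_proj. Qed.

Lemma bundle_smap {P : mfd R} (X : P -> total E) x a : smooth_atlas P ->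
  tdom a (vproj (X x)) -> mnear x (fun y => vin (X y)) ->
  smap x X <-> smap x (fun y => vproj (X y)) /\ forall k, smf x (fun y => tmap a (X y) 0 k).
Proof.
move=> gP aX nX; have [p [px _]] := nX.
have [/= i iX] : exists i, cdom i (vproj (X x)).
  by apply/(ml_cover vb_premfd); exact: tdom_pts aX.
split=> [sX|[sb sc]].
  have cX : @cdom _ (total E) (i, a) (X x) by split=> //; exact: mnear_self nX.
  have [nc sc] := smap_chart gP total_atlas sX cX.
  split=> [|k]; last first.
    apply: (smf_ext gP _ (sc (rshift _ k))).
    by apply: (mnear_true px) => y /=; rewrite row_mxEr.
  exists i; split=> //; first by apply: mnearS nc => y [].
  move=> k; apply: (smf_ext gP _ (sc (lshift _ k))).
  by apply: (mnear_true px) => y /=; rewrite row_mxEl.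
have [ni si] := smap_chart gP vb_atlas sb iX.
have na := mnear_smap gP vb_atlas sb (tdom_near aX).
exists (i, a); split=> //; first by split=> //; exact: mnear_self nX.
  by apply: mnearS (mnearI gP nX (mnearI gP ni na)) => y [? []].
move=> k; case: (split_ordP k) => [l ->|l ->].
  apply: (smf_ext gP _ (si l)).
  by apply: (mnear_true px) => y /=; rewrite row_mxEl.
apply: (smf_ext gP _ (sc l)).
by apply: (mnear_true px) => y /=; rewrite row_mxEr.
Qed.

Lemma vsub0 x : pts M x -> vadd (vzero E x) (vzero E x) = vzero E x.
Proof.
move=> px; have [a ax] := vb_cover vE px; have fz := vb_zero vE px.
have [e [_ U]] := vb_bij vE 0 ax.
have <- : e = vzero E x by apply: U; split=> //; exact: vb_tmap0 ax.
apply/esym; rewrite {1}(U (vadd (vzero E x) (vzero E x))); first by congr vadd; apply/esym/U; split=> //; exact: vb_tmap0 ax.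
split; first exact: vb_add.
by rewrite (vb_tmapD vE ax fz fz) (vb_tmap0 vE ax) addr0.
Qed.

(** The vector space laws of the fibres are consequences of linearity of the trivializations; this
    injectivity is how they, and all linear identities below, are checked. *)
Lemma vb_eq a x (e e' : E) : tdom a x -> fib E x e -> fib E x e' -> tmap a e = tmap a e' -> e = e'.
Proof.
by move=> ax fe fe' H; have [z [_ U]] := vb_bij vE (tmap a e) ax; rewrite -(U e) // -(U e').
Qed.

Lemma vscal0z x r : pts M x -> vscal r (vzero E x) = vzero E x.
Proof.
move=> px; have [a ax] := vb_cover vE px; have fz := vb_zero vE px.
apply: (vb_eq ax) => //; first exact: vb_scal.
by rewrite (vb_tmapZ vE r ax fz) (vb_tmap0 vE ax) scaler0.
Qed.

End BundleBasics.

(** * Coordinates and frames of line bundles, connection forms *)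

Section LineBundle.
Context {R : realType} {M : mfd R} {E : vb M}.
Hypothesis vE : is_vb E.
Hypothesis rE : vrk E = 1%N.

(* Coordinate and frame of a line bundle; the sum over the single index avoids a cast of
   ['rV_(vrk E)] to scalars. *)
Definition lc (a : tidx E) (e : E) : R := \sum_k tmap a e 0 k.

Definition lf (a : tidx E) (x : M) : E := the (vzero E x) [set e | fib E x e /\ lc a e = 1].

Lemma rank1_ord (k l : 'I_(vrk E)) : k = l.
Proof. by apply: val_inj; case: k l => [k kl] [l ll] /=; move: kl ll; rewrite rE !ltnS !leqn0 => /eqP-> /eqP->. Qed.

Lemma lcE a e k : tmap a e 0 k = lc a e.
Proof.
rewrite /lc (bigD1 k) //= big1 ?addr0 // => l; by rewrite (rank1_ord l k) eqxx.
Qed.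

Variables (a : tidx E) (x : M).
Hypothesis ax : tdom a x.

Lemma lcD (e e' : E) : fib E x e -> fib E x e' -> lc a (vadd e e') = lc a e + lc a e'.
Proof. by move=> fe fe'; rewrite /lc (vb_tmapD vE ax fe fe') -big_split; apply: eq_bigr => k _; rewrite mxE. Qed.

Lemma lcZ r (e : E) : fib E x e -> lc a (vscal r e) = r * lc a e.
Proof. by move=> fe; rewrite /lc (vb_tmapZ vE r ax fe) mulr_sumr; apply: eq_bigr => k _; rewrite mxE. Qed.

Lemma lcN (e : E) : fib E x e -> lc a (vopp e) = - lc a e.
Proof. by move=> fe; rewrite lcZ // mulN1r. Qed.

Lemma lc0 : lc a (vzero E x) = 0.
Proof. by rewrite /lc (vb_tmap0 vE ax) big1 // => k _; rewrite mxE. Qed.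

Lemma lc_inj (e e' : E) : fib E x e -> fib E x e' -> lc a e = lc a e' -> e = e'.
Proof.
by move=> fe fe' H; apply: (vb_eq vE ax fe fe'); apply/rowP => k; rewrite !lcE.
Qed.

Lemma lc_surj r : exists e, fib E x e /\ lc a e = r.
Proof.
have [e [[fe te] _]] := vb_bij vE (const_mx r) ax; exists e; split=> //.
have k : 'I_(vrk E) by rewrite rE; exact: ord0.
by rewrite -(lcE a e k) te mxE.
Qed.

Lemma lfP : fib E x (lf a x) /\ lc a (lf a x) = 1.
Proof.
rewrite /lf /the; case: pselect => [h|[]]; first by case: (cid h).
exact: lc_surj.
Qed.

Lemma lf_scal (e : E) : fib E x e -> e = vscal (lc a e) (lf a x).
Proof.
move=> fe; have [ff f1] := lfP; apply: lc_inj => //; first exact: vb_scal.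
by rewrite lcZ // f1 mulr1.
Qed.

End LineBundle.

Section LineSections.
Context {R : realType} {M : mfd R} {E : vb M}.
Hypothesis vE : is_vb E.
Hypothesis rE : vrk E = 1%N.
Let gM : smooth_atlas M := vb_atlas vE.
Let lM : premfd M := vb_premfd vE.

Lemma line_smap {P : mfd R} (X : P -> total E) x (a : tidx E) : smooth_atlas P ->
  tdom a (vproj (X x)) -> mnear x (fun y => vin (X y)) ->
  smap x X <-> smap x (fun y => vproj (X y)) /\ smf x (fun y => lc a (X y)).
Proof.
move=> gP aX nX; have [p [px _]] := nX.
rewrite (bundle_smap vE gP aX nX); split=> -[sb sc]; split=> //.
  exact: (smf_sum gP px).
move=> k; apply: (smf_ext gP _ sc).
by apply: (mnear_true px) => y; rewrite lcE.
Qed.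

Lemma section_smf (W : set M) (s : M -> E) x (a : tidx E) : mopen W -> section_on W s -> W x ->
  tdom a x -> smf x (fun y => lc a (s y)).
Proof.
move=> oW [fs ss] Wx ax; have nW := mopen_mnear lM oW Wx.
have [_ bs] := fs x Wx.
have as' : tdom a (vproj (s x)) by rewrite bs.
have nX : mnear x (fun y => vin (s y)) by apply: mnearS nW => y /fs[].
by have /(line_smap gM as' nX)[] := smap_smooth_on gM nW ss.
Qed.

Lemma smf_section (W : set M) (s : M -> E) : mopen W -> (forall x, W x -> fib E x (s x)) ->
  (forall x, W x -> exists2 a : tidx E, tdom a x & smf x (fun y => lc a (s y))) -> section_on W s.
Proof.
move=> oW fs ss; split=> //; apply: smooth_onP => // x Wx.
have nW := mopen_mnear lM oW Wx; have [a ax sa] := ss x Wx.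
have [_ bs] := fs x Wx; have /(ml_cover lM)[i ix] := tdom_pts vE ax.
have as' : tdom a (vproj (s x)) by rewrite bs.
have nX : mnear x (fun y => vin (s y)) by apply: mnearS nW => y /fs[].
apply/(line_smap gM as' nX); split=> //; apply: (smap_ext gM _ (smap_id ix)).
by apply: mnearS nW => y /fs[_ ->].
Qed.

Lemma lf_section (a : tidx E) : section_on (tdom a) (lf a).
Proof.
apply: smf_section => [|x ax|x ax]; first exact: vb_tdom.
  by have [] := lfP vE rE ax.
have /(ml_cover lM)[i ix] := tdom_pts vE ax.
exists a => //; apply: (smf_ext gM _ (smf_cst 1 ix)).
by apply: mnearS (tdom_near vE ax) => y ay; have [_ ->] := lfP vE rE ay.
Qed.

Lemma mopenI (W W' : set M) : mopen W -> mopen W' -> mopen (W `&` W').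
Proof.
move=> oW oW'; apply: mnear_mopen => // x [Wx W'x].
by apply: (mnearI gM); exact: mopen_mnear.
Qed.

Lemma section_sub (W W' : set M) (s : M -> E) : mopen W -> mopen W' -> W' `<=` W ->
  section_on W s -> section_on W' s.
Proof.
move=> oW oW' WW ss; apply: smf_section => // [x W'x|x W'x]; first by case: ss => fs _; exact/fs/WW.
have px : pts M x by have [+ _] := oW; apply; exact: WW.
by have [a ax] := vb_cover vE px; exists a => //; apply: (section_smf oW ss) => //; exact: WW.
Qed.

Lemma smooth_on_to_euc (W : set M) h : (forall x, W x -> smf x h) -> smooth_on W (to_euc h).
Proof. by move=> H; apply: smooth_onP => // x Wx; apply/to_euc_smf => //; exact: H. Qed.

Variable D : conn E.
Hypothesis cD : is_conn D.

(** The connection 1-form of [D] in the frame [lf a]. *)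
Definition cform (a : tidx E) (v : tangent M) : R := lc a (D v (lf a)).

(** The familiar [D = d + A] in a frame. Near the base point the section is a function times the
    frame; locality on [W] intersected with [tdom a] allows the replacement, and the Leibniz rule
    does the rest. *)
Lemma conn_lc (W : set M) (s : M -> E) (v : tangent M) (a : tidx E) : mopen W -> section_on W s ->
  W (tbase v) -> vin v -> tdom a (tbase v) ->
  lc a (D v s) = deriv v (fun y => lc a (s y)) + lc a (s (tbase v)) * cform a v.
Proof.
move=> oW ss Wx tv ax; pose W' := W `&` tdom a.
have oW' : mopen W' by apply: mopenI => //; exact: vb_tdom.
have W'x : W' (tbase v) by [].
have sa : section_on W' (lf a).
  by apply: (section_sub _ oW' _ (lf_section a)); [exact: vb_tdom|move=> y []].
have ss' : section_on W' s by apply: (section_sub oW oW' _ ss) => y [].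
have sh : smooth_on W' (to_euc (fun y => lc a (s y))).
  by apply: smooth_on_to_euc => y [Wy ay]; exact: section_smf Wy ay.
have E1 y : W' y -> s y = vscal (lc a (s y)) (lf a y).
  by move=> [Wy ay]; apply: (lf_scal vE rE ay); have [fs _] := ss; exact: fs.
have s2 : section_on W' (fun y => vscal (lc a (s y)) (lf a y)).
  apply: smf_section => // [y W'y|y W'y]; first by rewrite -E1 //; have [fs _] := ss'; exact: fs.
  have [Wy ay] := W'y; exists a => //; apply: (smf_ext gM _ (section_smf oW ss Wy ay)).
  by apply: mnearS (mopen_mnear lM oW' W'y) => z W'z; rewrite -E1.
rewrite (conn_local cD oW' W'x tv ss' s2 E1) (conn_leibniz cD oW' W'x tv sh sa).
have [ff f1] := lfP vE rE ax; have fD := conn_fib cD oW' W'x tv sa.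
rewrite (lcD vE ax (vb_scal vE _ ff) (vb_scal vE _ fD)).
by rewrite (lcZ vE ax _ ff) (lcZ vE ax _ fD) f1 mulr1.
Qed.

Lemma cformD (a : tidx E) (v w : tangent M) : vin v -> vin w -> tbase v = tbase w ->
  tdom a (tbase v) -> cform a (vadd v w) = cform a v + cform a w.
Proof.
move=> tv tw vw ax; have oa := vb_tdom vE a; have sa := lf_section a.
rewrite /cform (conn_addv cD oa ax tv tw vw sa) (lcD vE ax) //.
  exact: (conn_fib cD oa).
by rewrite vw; apply: (conn_fib cD oa) => //; rewrite -vw.
Qed.

Lemma cformZ (a : tidx E) r (v : tangent M) : vin v ->
  tdom a (tbase v) -> cform a (vscal r v) = r * cform a v.
Proof.
move=> tv ax; have oa := vb_tdom vE a; have sa := lf_section a.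
rewrite /cform (conn_scalv cD r oa ax tv sa) (lcZ vE ax) //.
exact: (conn_fib cD oa).
Qed.

Lemma cform_field (a : tidx E) (W : set M) (X : M -> tangent M) x : mopen W -> section_on W X ->
  W x -> tdom a x -> smf x (fun y => cform a (X y)).
Proof.
move=> oW sX Wx ax; pose W' := W `&` tdom a.
have oW' : mopen W' by apply: mopenI => //; exact: vb_tdom.
have sa : section_on W' (lf a).
  by apply: (section_sub _ oW' _ (lf_section a)); [exact: vb_tdom|move=> y []].
have sX' : section_on W' X.
  have [fX _] := sX; apply: (field_section lM oW') => [y [Wy _]|y [Wy _]]; first exact: fX.
  have /(ml_cover lM)[i iy] : pts M y by have [+ _] := oW; apply.
  by exists i => // k; exact: (field_smf lM k oW sX).
exact: (section_smf oW' (conn_smooth cD oW' sX' sa)).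
Qed.

End LineSections.

(** Equality of tangent vectors is available through their coefficients, so linearity of [A] is
    first transported to row vectors by the section [phi], where the expansion in the standard basis
    applies. *)
Lemma form_frame {R : realType} {M : mfd R} (A : tangent M -> R) i x (v : tangent M) :
  premfd M -> cdom i x -> fib (tangent M) x v ->
  (forall v w, fib (tangent M) x v -> fib (tangent M) x w -> A (vadd v w) = A v + A w) ->
  (forall r v, fib (tangent M) x v -> A (vscal r v) = r * A v) ->
  A v = \sum_k tcoef v i 0 k * A (frame (E := tangent M) i x k).
Proof.
move=> lM ix [tv bv] AD AZ.
have /choice[phi Hphi] : forall u : 'rV[R]_(dim M), exists v : tangent M,
    fib (tangent M) x v /\ tcoef v i = u.
  by move=> u; have [w [tw bw cw]] := tvec_of_coef lM u ix; exists w.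
have uniq (u : tangent M) : fib (tangent M) x u -> u = phi (tcoef u i).
  move=> [tu bu]; have [[tp bp] cp] := Hphi (tcoef u i).
  have bu' : tbase u = x := bu; have bp' : tbase (phi (tcoef u i)) = x := bp.
  by apply: (tvec_eq (i := i) (premfd_atlas lM) tu tp); rewrite ?bu' ?bp'.
have phiD u u' : A (phi (u + u')) = A (phi u) + A (phi u').
  have [[t1 b1] c1] := Hphi u; have [[t2 b2] c2] := Hphi u'.
  rewrite -AD //; congr A; apply/esym; rewrite -c1 -c2 c1 c2.
  have b1' : tbase (phi u) = x := b1; have b2' : tbase (phi u') = x := b2.
  have f : fib (tangent M) x (vadd (phi u) (phi u')).
    by split=> //; apply: tvecD => //; rewrite b1'.
  have Ev : tcoef (vadd (phi u) (phi u') : tangent M) i = u + u' by rewrite /= c1 c2.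
  by rewrite [LHS]uniq // Ev.
have phiZ r u : A (phi (r *: u)) = r * A (phi u).
  have [[t1 b1] c1] := Hphi u; rewrite -AZ //; congr A; apply/esym.
  have f : fib (tangent M) x (vscal r (phi u)) by split=> //; exact: tvecZ.
  have Ev : tcoef (vscal r (phi u) : tangent M) i = r *: u by rewrite /= c1.
  by rewrite [LHS]uniq // Ev.
have phi0 : A (phi 0) = 0 by rewrite -(scale0r 0) phiZ mul0r.
rewrite [in LHS](uniq v) // [in LHS](row_sumE (tcoef v i)).
rewrite (big_morph (fun u => A (phi u)) phiD phi0); apply: eq_bigr => k _.
rewrite phiZ; congr (_ * A _); have [ff cf] := frameP lM k ix.
by rewrite -cf -uniq.
Qed.

(** * Pull-back of connections along fibrewise isomorphisms *)

Section PullBack.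
Context {R : realType} {M N : mfd R} {E : vb M} {E' : vb N}.
Hypotheses (vE : is_vb E) (rE : vrk E = 1%N) (vE' : is_vb E') (rE' : vrk E' = 1%N).
Variables (F : E -> E') (f : M -> N).
Hypothesis Ff : is_vbmor F f.
Hypothesis Finj : forall x e e', fib E x e -> fib E x e' -> F e = F e' -> e = e'.
Let gM : smooth_atlas M := vb_atlas vE.
Let gN : smooth_atlas N := vb_atlas vE'.
Let lM : premfd M := vb_premfd vE.
Let lN : premfd N := vb_premfd vE'.

Lemma pull_smap x : pts M x -> smap x f.
Proof.
move=> px; apply: (smap_smooth_on gM (mnear_pts lM px)).
exact: vbmor_smooth_base Ff.
Qed.

Lemma pull_fib x e : fib E x e -> fib E' (f x) (F e).
Proof. by move=> fe; apply: (vbmor_fib Ff) => //; exact: fib_pts fe. Qed.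

(* [lc a \o F] is the coordinate on [E] with respect to the pulled back frame. *)
Section Coordinate.
Variables (a : tidx E') (x : M).
Hypotheses (px : pts M x) (ax : tdom a (f x)).

Lemma pcD e e' : fib E x e -> fib E x e' -> lc a (F (vadd e e')) = lc a (F e) + lc a (F e').
Proof.
move=> fe fe'; rewrite (vbmor_add Ff px fe fe').
by rewrite (lcD vE' ax) //; exact: pull_fib.
Qed.

Lemma pcZ r e : fib E x e -> lc a (F (vscal r e)) = r * lc a (F e).
Proof.
move=> fe; rewrite (vbmor_scal Ff r px fe).
by rewrite (lcZ vE' ax) //; exact: pull_fib.
Qed.

Lemma pcN e : fib E x e -> lc a (F (vopp e)) = - lc a (F e).
Proof. by move=> fe; rewrite pcZ // mulN1r. Qed.

Lemma pc_inj e e' : fib E x e -> fib E x e' -> lc a (F e) = lc a (F e') -> e = e'.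
Proof.
move=> fe fe' H; apply: (Finj fe fe').
by apply: (lc_inj vE' rE' ax) => //; exact: pull_fib.
Qed.

Lemma pc0 : lc a (F (vzero E x)) = 0.
Proof.
have fz := vb_zero vE px; rewrite -(vscal0z vE 0 px) pcZ // mul0r //.
Qed.

Lemma pc_lf_neq0 (b : tidx E) : tdom b x -> lc a (F (lf b x)) != 0.
Proof.
move=> bx; have [ff f1] := lfP vE rE bx; apply/eqP => H.
have fz := vb_zero vE px; have := pc_inj ff fz; rewrite H pc0 => /(_ erefl) E0.
by move: f1; rewrite E0 (lc0 vE bx) => /esym/eqP; rewrite oner_eq0.
Qed.

Lemma pc_lc (b : tidx E) e : tdom b x -> fib E x e ->
  lc a (F e) = lc b e * lc a (F (lf b x)).
Proof.
move=> bx fe; have [ff f1] := lfP vE rE bx.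
by rewrite {1}(lf_scal vE rE bx fe) pcZ.
Qed.

Lemma pc_surj r : exists e, fib E x e /\ lc a (F e) = r.
Proof.
have [b bx] := vb_cover vE px; have [ff f1] := lfP vE rE bx.
exists (vscal (r / lc a (F (lf b x))) (lf b x)); split; first exact: vb_scal.
by rewrite pcZ // divfK // pc_lf_neq0.
Qed.

End Coordinate.

Lemma fibinvP x l : pts M x -> fib E' (f x) l ->
  fib E x (fibinv F x l) /\ F (fibinv F x l) = l.
Proof.
move=> px fl; rewrite /fibinv /the; case: pselect => [h|[]]; first by case: (cid h).
have [a ax] := vb_cover vE' (fib_pts vE' fl).
have [e [fe Ee]] := pc_surj px ax (lc a l); exists e; split=> //.
by apply: (lc_inj vE' rE' ax) => //; exact: pull_fib.
Qed.

Lemma fibinvK x e : fib E x e -> fibinv F x (F e) = e.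
Proof.
move=> fe; have [f1 E1] := fibinvP (fib_pts vE fe) (pull_fib fe).
exact: Finj f1 fe E1.
Qed.

Lemma smap_bundle (e : total E) : vin e -> smap e (F : total E -> total E').
Proof.
move=> ve; have lE := total_premfd vE.
apply: (smap_smooth_on (premfd_atlas lE) (mnear_pts lE ve)).
exact: vbmor_smooth Ff.
Qed.

Lemma pc_section (W : set M) (s : M -> E) x (a : tidx E') : mopen W -> section_on W s -> W x ->
  tdom a (f x) -> smf x (fun y => lc a (F (s y))).
Proof.
move=> oW [fs ss] Wx ax; have nW := mopen_mnear lM oW Wx.
have sx : smap x (s : M -> total E) := smap_smooth_on gM nW ss.
have sF := smap_comp gM (total_atlas vE) sx (smap_bundle (fs x Wx).1).
have [_ bF] := pull_fib (fs x Wx).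
have aF : tdom a (vproj (F (s x))) by rewrite bF.
have nX : mnear x (fun y => vin (F (s y))) by apply: mnearS nW => y /fs/pull_fib[].
by have /(line_smap vE' rE' gM aF nX)[] := sF.
Qed.

Lemma smf_pc_lc (s : M -> E) x (a : tidx E') (b : tidx E) : mnear x (fun y => fib E y (s y)) ->
  tdom a (f x) -> tdom b x -> smf x (fun y => lc a (F (s y))) -> smf x (fun y => lc b (s y)).
Proof.
move=> ns ax bx sc; have px := tdom_pts vE bx.
have nb := tdom_near vE bx.
have na : mnear x (fun y => tdom a (f y)).
  by apply: (mnear_smap gM gN (pull_smap px)); exact: tdom_near vE' _ _ ax.
have sl : smf x (fun y => lc a (F (lf b y))).
  by apply: (pc_section (vb_tdom vE b) (lf_section vE rE b)).
have sV := smfV (pc_lf_neq0 px ax bx) sl.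
apply: (smf_ext gM _ (smfM gM sc sV)).
apply: mnearS (mnearI gM ns (mnearI gM nb na)) => y [fy [by_ ay]].
have py := tdom_pts vE by_.
by rewrite (pc_lc py ay by_ fy) mulfK // pc_lf_neq0.
Qed.

Lemma pc_smf_section (W : set M) (s : M -> E) : mopen W -> (forall x, W x -> fib E x (s x)) ->
  (forall x, W x -> exists2 a : tidx E', tdom a (f x) & smf x (fun y => lc a (F (s y)))) ->
  section_on W s.
Proof.
move=> oW fs ss; apply: (smf_section vE rE oW fs) => x Wx; have [a ax sa] := ss x Wx.
have [b bx] := vb_cover vE (fib_pts vE (fs x Wx)); exists b => //.
apply: (smf_pc_lc _ ax bx sa); apply: mnearS (mopen_mnear lM oW Wx) => y; exact: fs.
Qed.

Variable nab : conn E'.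
Hypothesis cnab : is_conn nab.

Lemma cform_smf (a : tidx E') j y k : tdom a y -> cdom j y ->
  smf y (fun z => cform nab a (frame (E := tangent N) j z k)).
Proof.
move=> ay jy; have oj := mopen_cdom j lN.
apply: (cform_field vE' rE' cnab oj _ jy ay); apply: (field_section lN oj).
  by move=> z jz; have [] := frameP lN k jz.
move=> z jz; exists j => // l; apply: (smf_ext gN _ (smf_cst ((delta_mx 0 k : 'rV[R]_(dim N)) 0 l) jz)).
by apply: mnearS (mnear_cdom jz) => w jw; have [_ ->] := frameP lN k jw.
Qed.

Lemma cform_frame (a : tidx E') j y (w : tangent N) : tdom a y -> cdom j y -> fib (tangent N) y w ->
  cform nab a w = \sum_k tcoef w j 0 k * cform nab a (frame (E := tangent N) j y k).
Proof.
move=> ay jy fw; apply: form_frame => //.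
  move=> u v [tu bu] [tv bv]; have bu' : tbase u = y := bu; have bv' : tbase v = y := bv.
  by apply: (cformD vE' rE' cnab) => //; rewrite bu'.
move=> r v [tv bv]; have bv' : tbase v = y := bv.
by apply: (cformZ vE' rE' cnab) => //; rewrite bv'.
Qed.

Lemma pull_dmap v : is_tvec v -> fib (tangent N) (f (tbase v)) (dmap f v).
Proof. by move=> tv; apply: (dmap_fib lM lN tv); apply: pull_smap; case: tv. Qed.

Definition pull_formula (v : tangent M) (s : M -> E) (a : tidx E') : R :=
  deriv v (fun y => lc a (F (s y))) + lc a (F (s (tbase v))) * cform nab a (dmap f v).

(** The formula changes with the frame like the coordinate of a vector: the derivative of the
    transition function [g] cancels against the inhomogeneous term in the change of the connection
    form, which is [rel2]. This makes [pull0] independent of the frame. *)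
Lemma pull_formula_change (W : set M) v s a a' : mopen W -> section_on W s -> W (tbase v) ->
  is_tvec v -> tdom a (f (tbase v)) -> tdom a' (f (tbase v)) ->
  pull_formula v s a' = lc a' (lf a (f (tbase v))) * pull_formula v s a.
Proof.
move=> oW ss Wx tv ax ax'; have px : pts M (tbase v) by case: tv.
have [tw bw] := pull_dmap tv; have bw' : tbase (dmap f v) = f (tbase v) := bw.
have sfx := pull_smap px.
pose g y := lc a' (lf a y).
have sg : smf (f (tbase v)) g.
  exact: (section_smf vE' rE' (vb_tdom vE' a) (lf_section vE' rE' a)).
have sgf : smf (tbase v) (fun y => g (f y)) := smf_smap gM gN sfx sg.
have su := pc_section oW ss Wx ax.
have rel : lc a' (nab (dmap f v) (lf a)) = g (f (tbase v)) * cform nab a (dmap f v).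
  have fD : fib E' (f (tbase v)) (nab (dmap f v) (lf a)).
    rewrite -bw'; apply: (conn_fib cnab (vb_tdom vE' a)) => //; first by rewrite bw'.
    exact: lf_section.
  rewrite {1}(lf_scal vE' rE' ax fD) (lcZ vE' ax') 1?mulrC //.
  by have [] := lfP vE' rE' ax.
have := conn_lc vE' rE' cnab (v := dmap f v) (a := a') (vb_tdom vE' a) (lf_section vE' rE' a).
rewrite bw' => /(_ ax tw ax'); rewrite rel (deriv_dmap lM lN tv sfx sg) -/(g (f (tbase v))) => rel2.
have nE : mnear (tbase v) (fun y => lc a (F (s y)) * g (f y) = lc a' (F (s y))).
  have na : mnear (tbase v) (fun y => tdom a (f y) /\ tdom a' (f y)).
    apply: (mnear_smap gM gN sfx (P := fun y => tdom a y /\ tdom a' y)).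
    by apply: (mnearI gN); exact: tdom_near.
  have nW := mopen_mnear lM oW Wx.
  apply: mnearS (mnearI gM na nW) => y [[ay ay'] Wy].
  have fF := pull_fib (ss.1 y Wy); rewrite [in RHS](lf_scal vE' rE' ay fF) (lcZ vE' ay') //.
  by have [] := lfP vE' rE' ay.
rewrite /pull_formula (deriv_ext lM tv (smfM gM su sgf) nE) (derivM lM tv su sgf).
by rewrite -(mnear_self nE) -/(g (f (tbase v))) mulrDr [in RHS]mulrCA rel2; ring.
Qed.

(* [pull_conn] in coordinates: a local section is a function times a pulled back frame. *)
Definition pull0 : conn E := fun v s => the (vzero E (tbase v))
  [set e | fib E (tbase v) e /\
     forall a, tdom a (f (tbase v)) -> lc a (F e) = pull_formula v s a].

Lemma pull0_eq v s e : pts M (tbase v) -> fib E (tbase v) e ->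
  (forall a, tdom a (f (tbase v)) -> lc a (F e) = pull_formula v s a) -> pull0 v s = e.
Proof.
move=> px fe He; apply: the_unique => // e' [fe' He'].
have [a ax] := vb_cover vE' (fib_pts vE' (pull_fib fe)).
by apply: (pc_inj ax fe' fe); rewrite He // He'.
Qed.

Lemma pull0P (W : set M) v s : mopen W -> section_on W s -> W (tbase v) -> is_tvec v ->
  fib E (tbase v) (pull0 v s) /\
  forall a, tdom a (f (tbase v)) -> lc a (F (pull0 v s)) = pull_formula v s a.
Proof.
move=> oW ss Wx tv; have px : pts M (tbase v) by case: tv.
have [a ax] := vb_cover vE' (fib_pts vE' (pull_fib (ss.1 _ Wx))).
have [e [fe Ee]] := pc_surj px ax (pull_formula v s a).
have He a' : tdom a' (f (tbase v)) -> lc a' (F e) = pull_formula v s a'.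
  move=> ax'; rewrite (pull_formula_change oW ss Wx tv ax ax') -Ee.
  rewrite {1}(lf_scal vE' rE' ax (pull_fib fe)) (lcZ vE' ax') 1?mulrC //.
  by have [] := lfP vE' rE' ax.
by rewrite (pull0_eq px fe He).
Qed.

Lemma pull0_conn : is_conn pull0.
Proof.
have cov x : pts M x -> exists a, tdom (E := E') a (f x).
  move=> px; have fz := pull_fib (vb_zero vE px).
  by have [a ax] := vb_cover vE' (fib_pts vE' fz); exists a.
split.
- by move=> W v s oW Wx tv ss; have [] := pull0P oW ss Wx tv.
- move=> W v s s' oW Wx tv ss ss' H; have [f1 E1] := pull0P oW ss Wx tv.
  apply/esym; apply: pull0_eq => // [|a ax]; first by case: tv.
  rewrite E1 // /pull_formula H //; congr (_ + _).
  apply: (deriv_ext lM tv (pc_section oW ss' Wx ax)).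
  by apply: mnearS (mopen_mnear lM oW Wx) => y Wy; rewrite H.
- move=> W v w s oW Wx tv tw vw ss; have Wxw : W (tbase w) by rewrite -vw.
  have px : pts M (tbase v) by case: tv.
  have [f1 E1] := pull0P oW ss Wx tv; have [f2 E2] := pull0P oW ss Wxw tw.
  rewrite -vw in f2 E2; apply: pull0_eq => // [|a ax]; first exact: vb_add.
  rewrite (pcD px ax f1 f2) E1 // E2 // /pull_formula.
  rewrite (deriv_vadd lM tv tw vw); last exact: pc_section ss Wx ax.
  rewrite (dmapD lM lN tv tw vw (pull_smap px)).
  have [t1 b1] := pull_dmap tv; have [t2 b2] := pull_dmap tw.
  have b1' : tbase (dmap f v) = f (tbase v) := b1; have b2' : tbase (dmap f w) = f (tbase v) by rewrite vw.
  rewrite (cformD vE' rE' cnab t1 t2) ?b1' ?b2' // -vw /=; ring.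
- move=> W r v s oW Wx tv ss; have px : pts M (tbase v) by case: tv.
  have [f1 E1] := pull0P oW ss Wx tv.
  apply: pull0_eq => // [|a ax]; first exact: vb_scal.
  rewrite (pcZ px ax r f1) E1 // /pull_formula.
  rewrite (deriv_vscal lM r tv); last exact: pc_section ss Wx ax.
  rewrite (dmapZ lM lN r tv (pull_smap px)).
  have [t1 b1] := pull_dmap tv; have b1' : tbase (dmap f v) = f (tbase v) := b1.
  rewrite (cformZ vE' rE' cnab r t1) ?b1' //=; ring.
- move=> W v s s' oW Wx tv ss ss'; have px : pts M (tbase v) by case: tv.
  have [f1 E1] := pull0P oW ss Wx tv; have [f2 E2] := pull0P oW ss' Wx tv.
  apply: pull0_eq => // [|a ax]; first exact: vb_add.
  have sa := pc_section oW ss Wx ax; have sa' := pc_section oW ss' Wx ax.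
  have nE : mnear (tbase v) (fun y => lc a (F (s y)) + lc a (F (s' y)) = lc a (F (vadd (s y) (s' y)))).
    have na := mnear_smap gM gN (pull_smap px) (tdom_near vE' ax).
    apply: mnearS (mnearI gM na (mopen_mnear lM oW Wx)) => y [ay Wy].
    by rewrite (pcD (fib_pts vE (ss.1 y Wy)) ay (ss.1 y Wy) (ss'.1 y Wy)).
  rewrite (pcD px ax f1 f2) E1 // E2 // /pull_formula.
  rewrite (deriv_ext lM tv (smfD gM sa sa') nE) (derivD lM tv sa sa').
  rewrite -(mnear_self nE); ring.
- move=> W v h s oW Wx tv sh ss; have px : pts M (tbase v) by case: tv.
  have [f1 E1] := pull0P oW ss Wx tv; have fs := ss.1 _ Wx.
  apply: pull0_eq => // [|a ax]; first by apply: vb_add => //; exact: vb_scal.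
  have sa := pc_section oW ss Wx ax.
  have sh' : smf (tbase v) h.
    by apply/to_euc_smf => //; apply: (smap_smooth_on gM _ sh); exact: mopen_mnear.
  have nE : mnear (tbase v) (fun y => h y * lc a (F (s y)) = lc a (F (vscal (h y) (s y)))).
    have na := mnear_smap gM gN (pull_smap px) (tdom_near vE' ax).
    apply: mnearS (mnearI gM na (mopen_mnear lM oW Wx)) => y [ay Wy].
    by rewrite (pcZ (fib_pts vE (ss.1 y Wy)) ay _ (ss.1 y Wy)).
  rewrite (pcD px ax (vb_scal vE _ fs) (vb_scal vE _ f1)) (pcZ px ax _ fs) (pcZ px ax _ f1) E1 //.
  rewrite /pull_formula (deriv_ext lM tv (smfM gM sh' sa) nE) (derivM lM tv sh' sa).
  rewrite -(mnear_self nE); ring.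
move=> W X s oW sX ss; have [fX _] := sX.
apply: pc_smf_section => // x Wx.
  have [tX bX] := fX x Wx; have bX' : tbase (X x) = x := bX.
  by have [] := @pull0P W (X x) s oW ss; rewrite ?bX'.
have px : pts M x by have [+ _] := oW; apply.
have [a ax] := cov x px; exists a => //.
have /(ml_cover lM)[i ix] := px; have sfx := pull_smap px.
have [j jx] : exists j, cdom j (f x) by apply/(ml_cover lN); exact: fib_pts vE' _ _ (pull_fib (ss.1 x Wx)).
have nW := mopen_mnear lM oW Wx; have na := mnear_smap gM gN sfx (tdom_near vE' ax).
have [nj sj] := smap_chart gM gN sfx jx.
have sXk k := field_smf lM k oW sX Wx ix.
have nX : mnear x (fun y => fib (tangent M) y (X y)) by apply: mnearS nW => y /fX.
have s1 : smf x (fun y => deriv (X y) (fun z => lc a (F (s z)))).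
  by apply: (smf_deriv_field lM ix nX sXk); exact: pc_section ss Wx ax.
(* The connection form on [dmap f (X y)] in the chart [j]: the components of [dmap f (X y)] are the
   derivatives along [X y] of the coordinates of [f]. *)
have s2 : smf x (fun y => \sum_k deriv (X y) (fun z => cmap j (f z) 0 k) *
    cform nab a (frame (E := tangent N) j (f y) k)).
  apply: (smf_sum gM ix) => k; apply: (smfM gM).
    exact: (smf_deriv_field lM ix nX sXk (sj k)).
  exact: (smf_smap gM gN sfx (cform_smf k ax jx)).
apply: (smf_ext gM _ (smfD gM s1 (smfM gM (pc_section oW ss Wx ax) s2))).
apply: mnearS (mnearI gM nW (mnearI gM na nj)) => y [Wy [ay jy]].
have [tX bX] := fX y Wy; have bX' : tbase (X y) = y := bX.
have [|_ ->] := @pull0P W (X y) s oW ss _ tX; rewrite ?bX' //.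
rewrite /pull_formula bX'; congr (_ + _ * _).
have [tw bw] := pull_dmap tX; rewrite bX' in bw; have bw' : tbase (dmap f (X y)) = f y := bw.
rewrite (cform_frame ay jy) //; apply: eq_bigr => k _; congr (_ * _).
rewrite -(deriv_coord lN k tw) ?bw' // (deriv_dmap lM lN tX) // ?bX' //.
  by apply: pull_smap; exact: fib_pts vE _ _ (ss.1 y Wy).
exact: smf_coord.
Qed.

Lemma pull0_compat (W : set N) (s : N -> E') (v : tangent M) : mopen W -> section_on W s -> vin v ->
  W (f (tbase v)) ->
  pull0 v (fun x => fibinv F x (s (f x))) = fibinv F (tbase v) (nab (dmap f v) s).
Proof.
move=> oW ss tv Wx; have px : pts M (tbase v) by case: tv.
have [tw bw] := pull_dmap tv; have bw' : tbase (dmap f v) = f (tbase v) := bw.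
have sfx := pull_smap px.
have fD : fib E' (f (tbase v)) (nab (dmap f v) s).
  by rewrite -bw'; apply: (conn_fib cnab oW) => //; rewrite bw'.
have [f1 E1] := fibinvP px fD.
apply: pull0_eq => // a ax; rewrite E1 /pull_formula.
have [f2 E2] := fibinvP px (ss.1 _ Wx); rewrite E2.
have sa := section_smf vE' rE' oW ss Wx ax.
have := conn_lc vE' rE' cnab (v := dmap f v) (a := a) oW ss.
rewrite bw' => /(_ Wx tw ax) ->; congr (_ + _).
rewrite (deriv_dmap lM lN tv sfx sa).
apply/esym/(deriv_ext lM tv (smf_smap gM gN sfx sa)).
have nW := mnear_smap gM gN sfx (mopen_mnear lN oW Wx).
apply: mnearS (mnearI gM nW (mnear_pts lM px)) => y [Wy py].
by have [_ ->] := fibinvP py (ss.1 _ Wy).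
Qed.

(** [pull0] shows that a pulled back connection exists. Whichever one is chosen by [pull_conn], its
    values on local sections are forced: a section is locally [h e] with [e] the pulled back frame,
    on which compatibility gives the value, and the Leibniz rule gives the rest. *)
Lemma pull_connP : is_conn (pull_conn F f nab) /\
  forall (W : set M) v s a, mopen W -> section_on W s -> W (tbase v) -> is_tvec v ->
    tdom a (f (tbase v)) -> lc a (F (pull_conn F f nab v s)) = pull_formula v s a.
Proof.
have [cD comp] : is_conn (pull_conn F f nab) /\
    forall (W : set N) (s : N -> E') (v : tangent M), mopen W -> section_on W s -> vin v ->
      W (f (tbase v)) -> pull_conn F f nab v (fun x => fibinv F x (s (f x))) =
           fibinv F (tbase v) (nab (dmap f v) s).
  rewrite /pull_conn /the; case: pselect => [h|[]]; first by case: (cid h).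
  by exists pull0; split; [exact: pull0_conn|exact: pull0_compat].
split=> // W v s a oW ss Wx tv ax; set D := pull_conn F f nab in cD comp *.
have px : pts M (tbase v) by case: tv.
have [tw bw] := pull_dmap tv; have bw' : tbase (dmap f v) = f (tbase v) := bw.
pose U := [set x | W x /\ tdom a (f x)].
have oU : mopen U.
  apply: (mnear_mopen lM) => x [Wy ay]; apply: (mnearI gM); first exact: mopen_mnear.
  apply: (mnear_smap gM gN _ (tdom_near vE' ay)); apply: pull_smap.
  by have [+ _] := oW; apply.
have Ux : U (tbase v) by [].
pose e x := fibinv F x (lf a (f x)).
have eP x : U x -> fib E x (e x) /\ F (e x) = lf a (f x).
  by move=> [Wy ay]; apply: fibinvP; [have [+ _] := oW; apply|have [] := lfP vE' rE' ay].
have pcE x : U x -> lc a (F (e x)) = 1.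
  by move=> Ux'; have [_ ->] := eP x Ux'; case: Ux' => _ ay; have [] := lfP vE' rE' ay.
have se : section_on U e.
  apply: pc_smf_section => // x Ux'; first by have [] := eP x Ux'.
  have [Wy ay] := Ux'; exists a => //.
  have [i [ix _]] := mopen_mnear lM oU Ux'.
  apply: (smf_ext gM _ (smf_cst 1 ix)).
  by apply: mnearS (mopen_mnear lM oU Ux') => y Uy; rewrite pcE.
pose h x := lc a (F (s x)).
have fsU x : U x -> fib E x (s x) by move=> [Wy _]; exact: ss.1.
have sE x : U x -> s x = vscal (h x) (e x).
  move=> Ux'; have [Wy ay] := Ux'; have py := fib_pts vE (fsU x Ux'); have [fe _] := eP x Ux'.
  apply: (pc_inj ay) => //; first exact: fsU.
    exact: vb_scal.
  by rewrite (pcZ py ay _ fe) pcE // mulr1.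
have sh x : U x -> smf x h by move=> [Wy ay]; exact: pc_section oW ss Wy ay.
have ssU : section_on U s by apply: (section_sub vE rE oW oU _ ss) => y [].
have ssU' : section_on U (fun x => vscal (h x) (e x)).
  apply: pc_smf_section => // x Ux'; first by rewrite -sE //; exact: fsU.
  have [Wy ay] := Ux'; exists a => //.
  apply: (smf_ext gM _ (sh x Ux')).
  by apply: mnearS (mopen_mnear lM oU Ux') => y Uy; rewrite -sE.
have shU : smooth_on U (to_euc h) by apply: (smooth_on_to_euc vE) => x; exact: sh.
rewrite (conn_local cD oU Ux tv ssU ssU' sE) (conn_leibniz cD oU Ux tv shU se).
have [fe Fe] := eP _ Ux.
have fD : fib E (tbase v) (D v e) by exact: (conn_fib cD oU).
rewrite (pcD px ax (vb_scal vE _ fe) (vb_scal vE _ fD)) (pcZ px ax _ fe) (pcZ px ax _ fD) pcE // mulr1.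
rewrite /pull_formula; congr (_ + _ * _).
rewrite (comp (tdom a) (lf a)) //; [|exact: vb_tdom|exact: lf_section].
have fn : fib E' (f (tbase v)) (nab (dmap f v) (lf a)).
  rewrite -bw'; apply: (conn_fib cnab (vb_tdom vE' a)) => //; first by rewrite bw'.
  exact: lf_section.
by have [_ ->] := fibinvP px fn.
Qed.

End PullBack.

(** * Difference of two connections *)

Section ConnMinus.
Context {R : realType} {M : mfd R} {E : vb M}.
Hypotheses (vE : is_vb E) (rE : vrk E = 1%N).
Let gM : smooth_atlas M := vb_atlas vE.
Let lM : premfd M := vb_premfd vE.
Variables (D D' : conn E).
Hypotheses (cD : is_conn D) (cD' : is_conn D').

(** In a common frame the derivative terms of the two connections coincide, so only the difference
    of the connection forms is left; it does not see the section. *)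
Lemma conn_minusE (a : tidx E) v : is_tvec v -> tdom a (tbase v) ->
  conn_minus D D' v = cform D a v - cform D' a v.
Proof.
move=> tv ax; apply: the_unique => [W s oW Wx ss|r /(_ (tdom a) (lf a))].
  have fs := ss.1 _ Wx; have fD := conn_fib cD oW Wx tv ss; have fD' := conn_fib cD' oW Wx tv ss.
  apply: (lc_inj vE rE ax fD); first by apply: vb_add => //; exact: vb_scal.
  rewrite (lcD vE ax fD' (vb_scal vE _ fs)) (lcZ vE ax _ fs).
  rewrite (conn_lc vE rE cD oW ss Wx tv ax) (conn_lc vE rE cD' oW ss Wx tv ax); ring.
have oa := vb_tdom vE a; have sa := lf_section vE rE a; have [ff f1] := lfP vE rE ax.
move=> /(_ oa ax sa) H; rewrite /cform H.
rewrite (lcD vE ax (conn_fib cD' oa ax tv sa) (vb_scal vE _ ff)) (lcZ vE ax _ ff) f1; ring.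
Qed.

Lemma conn_minusP (W : set M) s v : mopen W -> section_on W s -> W (tbase v) -> is_tvec v ->
  D v s = vadd (D' v s) (vscal (conn_minus D D' v) (s (tbase v))).
Proof.
move=> oW ss Wx tv; have px : pts M (tbase v) by case: tv.
have [a ax] := vb_cover vE px; have fs := ss.1 _ Wx.
have fD := conn_fib cD oW Wx tv ss; have fD' := conn_fib cD' oW Wx tv ss.
apply: (lc_inj vE rE ax fD); first by apply: vb_add => //; exact: vb_scal.
rewrite (lcD vE ax fD' (vb_scal vE _ fs)) (lcZ vE ax _ fs) (conn_minusE tv ax).
rewrite (conn_lc vE rE cD oW ss Wx tv ax) (conn_lc vE rE cD' oW ss Wx tv ax); ring.
Qed.

Lemma conn_minusD (v w : tangent M) : is_tvec v -> is_tvec w -> tbase v = tbase w ->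
  conn_minus D D' (vadd v w) = conn_minus D D' v + conn_minus D D' w.
Proof.
move=> tv tw vw; have px : pts M (tbase v) by case: tv.
have [a ax] := vb_cover vE px; have axw : tdom a (tbase w) by rewrite -vw.
rewrite (conn_minusE (tvecD tv tw vw) (a := a)) // !(conn_minusE _ (a := a)) //.
rewrite (cformD vE rE cD tv tw vw ax) (cformD vE rE cD' tv tw vw ax); ring.
Qed.

Lemma conn_minusZ r (v : tangent M) : is_tvec v -> conn_minus D D' (vscal r v) = r * conn_minus D D' v.
Proof.
move=> tv; have px : pts M (tbase v) by case: tv.
have [a ax] := vb_cover vE px.
rewrite (conn_minusE (tvecZ r tv) (a := a)) // (conn_minusE tv (a := a)) //.
rewrite (cformZ vE rE cD r tv ax) (cformZ vE rE cD' r tv ax); ring.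
Qed.

Lemma conn_minus_smf i x k : cdom i x ->
  smf x (fun y => conn_minus D D' (frame (E := tangent M) i y k)).
Proof.
move=> ix; have px := premfd_cov lM ix; have [a ax] := vb_cover vE px.
apply: (smf_ext gM _ (smfB gM (cform_smf vE rE cD k ax ix) (cform_smf vE rE cD' k ax ix))).
apply: mnearS (mnearI gM (mnear_cdom ix) (tdom_near vE ax)) => y [iy ay].
have [[tf bf] _] := frameP lM k iy; have bf' : tbase (frame (E := tangent M) i y k) = y := bf.
by rewrite (conn_minusE tf (a := a)) // bf'.
Qed.

End ConnMinus.

(** * The connection differential of a 1-form *)

Section ConnDiff.
Context {R : realType} {M N : mfd R} {E : vb M} {E' : vb N}.
Hypotheses (vE : is_vb E) (rE : vrk E = 1%N) (vE' : is_vb E') (rE' : vrk E' = 1%N).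
Variables (F : E -> E') (f : M -> N).
Hypothesis Ff : is_vbmor F f.
Hypothesis Finj : forall x e e', fib E x e -> fib E x e' -> F e = F e' -> e = e'.
Variable nab : conn E'.
Hypothesis cnab : is_conn nab.
Let gM : smooth_atlas M := vb_atlas vE.
Let gN : smooth_atlas N := vb_atlas vE'.
Let lM : premfd M := vb_premfd vE.
Let D := pull_conn F f nab.
Variable theta : tangent M -> E.
Hypothesis ftheta : is_form1 theta.

Let cD : is_conn D := (pull_connP vE rE vE' rE' Ff Finj cnab).1.

Lemma form_fib x v : fib (tangent M) x v -> fib E x (theta v).
Proof. by move=> [tv <-]; apply: (vbmor_fib ftheta) => //; case: tv. Qed.

Definition fcomp (a : tidx E') (i : cidx M) (k : 'I_(dim M)) (y : M) : R :=
  lc a (F (theta (frame (E := tangent M) i y k))).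

Lemma form_section (W : set M) (X : M -> tangent M) : mopen W -> section_on W X ->
  section_on W (fun y => theta (X y)).
Proof.
move=> oW [fX sX]; split=> [x Wx|]; first by apply: form_fib; exact: fX.
apply: smooth_onP => // x Wx; have nW := mopen_mnear lM oW Wx.
have gT := tangent_atlas lM.
have sXx : smap x (X : M -> total (tangent M)) := smap_smooth_on gM nW sX.
have px : pts M x by have [+ _] := oW; apply.
have [tX bX] := fX x Wx.
have nT : mnear (X x : total (tangent M)) (pts (total (tangent M))).
  have /(ml_cover lM)[i ix] := px; have bX' : tbase (X x) = x := bX.
  have ci : @cdom _ (total (tangent M)) (i, i) (X x) by split=> //=; rewrite bX'.
  by apply: mnearS (mnear_cdom ci) => v; exact: gT.1.
have st : smap (X x : total (tangent M)) (theta : total (tangent M) -> total E).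
  apply: (smap_smooth_on gT nT); exact: vbmor_smooth ftheta.
exact: (smap_comp gM gT sXx st).
Qed.

Lemma fcomp_smf a i k x : tdom a (f x) -> cdom i x -> smf x (fcomp a i k).
Proof.
move=> ax ix; have oi := mopen_cdom i lM.
have [X [sX cX]] := frame_section lM i (delta_mx 0 k).
have := pc_section vE vE' rE' Ff oi (form_section oi sX) ix ax.
apply: (smf_ext gM); apply: mnearS (mnear_cdom ix) => y iy.
rewrite /fcomp; congr (lc a (F (theta _))).
have [[tf bf] cf] := frameP lM k iy; have bf' : tbase (frame (E := tangent M) i y k) = y := bf.
have [tX bX] := sX.1 y iy; have bX' : tbase (X y) = y := bX.
by apply: (tvec_eq (i := i) gM tX tf); rewrite ?bX' ?bf' ?cX ?cf.
Qed.

Lemma fcompE a i x v : tdom a (f x) -> cdom i x -> fib (tangent M) x v ->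
  lc a (F (theta v)) = \sum_k tcoef v i 0 k * fcomp a i k x.
Proof.
move=> ax ix fv; have px := premfd_cov lM ix.
rewrite (form_frame (A := fun v => lc a (F (theta v))) lM ix fv) //.
  move=> u w fu fw; rewrite (vbmor_add ftheta px fu fw).
  by rewrite (pcD vE vE' Ff px ax) //; exact: form_fib.
move=> r u fu; rewrite (vbmor_scal ftheta r px fu).
by rewrite (pcZ vE vE' Ff px ax) //; exact: form_fib.
Qed.

(* The coordinate of (d^D theta)(v, w); the bracket terms of [conn_diff] cancel against the
   derivatives of the components of the vector fields. *)
Definition curv_formula (a : tidx E') (i : cidx M) (v w : tangent M) : R :=
  \sum_k (deriv v (fcomp a i k) * tcoef w i 0 k - deriv w (fcomp a i k) * tcoef v i 0 k)
  + lc a (F (theta w)) * cform nab a (dmap f v) - lc a (F (theta v)) * cform nab a (dmap f w).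

(** The right-hand side depends on the fields through their values at [x] only; hence the choice of
    extensions in [conn_diff] does not matter. *)
Lemma curv_fields (W : set M) (X Y : M -> tangent M) x a i : mopen W -> W x ->
  section_on W X -> section_on W Y -> tdom a (f x) -> cdom i x ->
  let l := vadd (vadd (D (X x) (theta \o Y)) (vopp (D (Y x) (theta \o X))))
                (vopp (theta (bracket X Y x))) in
  fib E x l /\ lc a (F l) = curv_formula a i (X x) (Y x).
Proof.
move=> oW Wx sX sY ax ix; have nW := mopen_mnear lM oW Wx; have px := premfd_cov lM ix.
have [tX bX] := sX.1 x Wx; have [tY bY] := sY.1 x Wx.
have bX' : tbase (X x) = x := bX; have bY' : tbase (Y x) = x := bY.
have sXk k := field_smf lM k oW sX Wx ix; have sYk k := field_smf lM k oW sY Wx ix.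
have nX : mnear x (fun y => fib (tangent M) y (X y)) by apply: mnearS nW; exact: sX.1.
have nY : mnear x (fun y => fib (tangent M) y (Y y)) by apply: mnearS nW; exact: sY.1.
have [fB cB] := bracketP lM ix nX nY sXk sYk.
have sTX := form_section oW sX; have sTY := form_section oW sY.
have f1 : fib E x (D (X x) (theta \o Y)).
  by rewrite -[X in fib E X]bX'; apply: (conn_fib cD oW) => //; rewrite bX'.
have f2 : fib E x (D (Y x) (theta \o X)).
  by rewrite -[X in fib E X]bY'; apply: (conn_fib cD oW) => //; rewrite bY'.
have f3 := form_fib fB.
have f2' : fib E x (vopp (D (Y x) (theta \o X))) by exact: vb_scal.
have f3' : fib E x (vopp (theta (bracket X Y x))) by exact: vb_scal.
have f12 := vb_add vE f1 f2'.
split; first exact: vb_add.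
rewrite (pcD vE vE' Ff px ax f12 f3') (pcD vE vE' Ff px ax f1 f2').
rewrite (pcN vE vE' Ff px ax f2) (pcN vE vE' Ff px ax f3).
have PF (Z : M -> tangent M) v : section_on W Z -> is_tvec v -> tbase v = x ->
    lc a (F (D v (theta \o Z))) = \sum_k (tcoef (Z x) i 0 k * deriv v (fcomp a i k)
      + fcomp a i k x * deriv v (fun y => tcoef (Z y) i 0 k))
      + lc a (F (theta (Z x))) * cform nab a (dmap f v).
  move=> sZ tv bv; have sT := form_section oW sZ.
  have nZ : mnear x (fun y => fib (tangent M) y (Z y)) by apply: mnearS nW; exact: sZ.1.
  have Wv : W (tbase v) by rewrite bv.
  have av : tdom a (f (tbase v)) by rewrite bv.
  rewrite ((pull_connP vE rE vE' rE' Ff Finj cnab).2 W v _ a oW sT Wv tv av) /pull_formula bv.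
  congr (_ + _).
  have sM k : smf (tbase v) (fun y => tcoef (Z y) i 0 k * fcomp a i k y).
    rewrite bv; apply: (smfM gM); first exact: (field_smf lM k oW sZ).
    exact: fcomp_smf.
  have iv : cdom i (tbase v) by rewrite bv.
  rewrite (deriv_ext lM tv (smf_sum gM iv sM)).
    rewrite (deriv_sum lM tv sM); apply: eq_bigr => k _.
    by rewrite (derivM lM tv) ?bv //; [exact: (field_smf lM k oW sZ)|exact: fcomp_smf].
  rewrite bv; have na := mnear_smap gM gN (pull_smap vE Ff px) (tdom_near vE' ax).
  apply: mnearS (mnearI gM nZ (mnearI gM (mnear_cdom ix) na)) => y [fZ [iy ay]].
  by rewrite -fcompE.
rewrite (PF Y (X x)) // (PF X (Y x)) // (fcompE ax ix fB) /curv_formula.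
have -> : \sum_k tcoef (bracket X Y x) i 0 k * fcomp a i k x =
   \sum_k fcomp a i k x * deriv (X x) (fun y => tcoef (Y y) i 0 k)
   - \sum_k fcomp a i k x * deriv (Y x) (fun y => tcoef (X y) i 0 k).
  by rewrite -sumrB; apply: eq_bigr => k _; rewrite cB; ring.
rewrite !big_split /= !sumrN.
have C (Z Z' : tangent M) : \sum_k tcoef Z i 0 k * deriv Z' (fcomp a i k) =
    \sum_k deriv Z' (fcomp a i k) * tcoef Z i 0 k.
  by apply: eq_bigr => k _; rewrite mulrC.
rewrite !C; ring.
Qed.

Lemma conn_diffP x v w : fib (tangent M) x v -> fib (tangent M) x w ->
  fib E x (conn_diff D theta v w) /\
  forall a i, tdom a (f x) -> cdom i x ->
    lc a (F (conn_diff D theta v w)) = curv_formula a i v w.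
Proof.
move=> [tv bv] [tw bw]; have bv' : tbase v = x := bv; have bw' : tbase w = x := bw.
have px : pts M x by rewrite -bv'; case: tv.
have /(ml_cover lM)[i ix] := px.
have [a ax] : exists a, tdom (E := E') a (f x).
  by apply/(vb_cover vE')/(fib_pts vE')/(pull_fib vE Ff)/(vb_zero vE px).
(* The vectors are extended with constant coefficients in the chart [i]. *)
have [X [sX cX]] := frame_section lM i (tcoef v i).
have [Y [sY cY]] := frame_section lM i (tcoef w i).
have oi := mopen_cdom i lM.
have Xv : X x = v.
  have [tX bX] := sX.1 x ix; have bX' : tbase (X x) = x := bX.
  by apply: (tvec_eq (i := i) gM tX tv); rewrite ?bX' ?bv' ?cX.
have Yw : Y x = w.
  have [tY bY] := sY.1 x ix; have bY' : tbase (Y x) = x := bY.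
  by apply: (tvec_eq (i := i) gM tY tw); rewrite ?bY' ?bw' ?cY.
pose l := vadd (vadd (D (X x) (theta \o Y)) (vopp (D (Y x) (theta \o X))))
                (vopp (theta (bracket X Y x))).
have [fl _] := curv_fields oi ix sX sY ax ix.
have El : conn_diff D theta v w = l.
  apply: the_unique => [W X' Y' oW Wx sX' sY' X'v Y'w|l' H].
    rewrite bv' in Wx X'v Y'w *; rewrite -X'v -Y'w.
    have [fl' El'] := curv_fields oW Wx sX' sY' ax ix.
    apply: (pc_inj vE vE' rE' Ff Finj ax fl fl').
    by have [_ ->] := curv_fields oi ix sX sY ax ix; rewrite El' Xv Yw X'v Y'w.
  rewrite bv' in H; have := H (cdom i) X Y oi ix sX sY Xv Yw.
  by rewrite /l Xv Yw.
rewrite El; split=> // a' i' ax' ix'.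
by have [_ ->] := curv_fields oi ix sX sY ax' ix'; rewrite Xv Yw.
Qed.

End ConnDiff.

(** * Multiplicative forms and the tangent groupoid *)

Section FormOnFibreProduct.
Context {R : realType} {n1 n2 n m : nat}.
Variables (O : set 'rV[R]_(n1 + n2)) (U1 : set 'rV[R]_n1) (U2 : set 'rV[R]_n2) (U3 : set 'rV[R]_n).
Variables (F : 'rV[R]_(n1 + n2) -> 'rV[R]_n) (Phi : 'rV[R]_(n1 + n2) -> 'rV[R]_m).
Variables (beta : 'I_n -> 'rV[R]_n -> R) (gam : 'I_n1 -> 'rV[R]_n1 -> R)
  (del : 'I_n2 -> 'rV[R]_n2 -> R) (phi : 'rV[R]_n1 -> R) (p : 'rV[R]_(n1 + n2)).
Hypothesis oO : open O.
Hypotheses (OU1 : forall z, O z -> U1 (lsubmx z)) (OU2 : forall z, O z -> U2 (rsubmx z))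
  (OU3 : forall z, O z -> U3 (F z)).
Hypotheses (sF : smv O F) (sPhi : smv O Phi).
Hypotheses (sb : forall k, sm U3 (beta k)) (sg : forall k, sm U1 (gam k))
  (sd : forall k, sm U2 (del k)) (sphi : sm U1 phi).
Hypotheses (Op : O p) (Phip : Phi p = 0) (surj : forall u, exists v, dv Phi p v = u).
Hypothesis mult : forall z, O z -> Phi z = 0 -> forall u, dv Phi z u = 0 ->
  \sum_k beta k (F z) * dv F z u 0 k =
  \sum_k gam k (lsubmx z) * lsubmx u 0 k
    + phi (lsubmx z) * \sum_k del k (rsubmx z) * rsubmx u 0 k.

(* The exterior derivative of the form sum_k b_k dx_k. *)
Definition eder {N} (b : 'I_N -> 'rV[R]_N -> R) q (u u' : 'rV[R]_N) : R :=
  \sum_k (dd (b k) q u * u' 0 k - dd (b k) q u' * u 0 k).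

(** The coefficients of the form [F^* beta - pr_1^* gam - (phi o pr_1) pr_2^* del]; the hypothesis
    [mult] says that it vanishes on vectors tangent to the fibre product [Phi = 0]. *)
Let a (l : 'I_(n1 + n2)) (z : 'rV[R]_(n1 + n2)) : R :=
  (\sum_k beta k (F z) * dd (fun x => F x 0 k) z (delta_mx 0 l)) -
  match fintype.split l with
  | inl l1 => gam l1 (lsubmx z)
  | inr l2 => phi (lsubmx z) * del l2 (rsubmx z)
  end.

Local Lemma sum_split (f : 'I_(n1 + n2) -> R) :
  \sum_l f l = \sum_l f (lshift n2 l) + \sum_l f (rshift n1 l).
Proof. by rewrite big_split_ord. Qed.

Local Lemma sm_lsub (h : 'rV[R]_n1 -> R) : sm U1 h -> sm O (fun z => h (lsubmx z)).
Proof. by move=> sh; apply: (sm_comp oO OU1 _ sh) => k; exact: smv_lsub. Qed.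

Local Lemma sm_rsub (h : 'rV[R]_n2 -> R) : sm U2 h -> sm O (fun z => h (rsubmx z)).
Proof. by move=> sh; apply: (sm_comp oO OU2 _ sh) => k; exact: smv_rsub. Qed.

Lemma dv_lsub q (u : 'rV[R]_(n1 + n2)) :
  dfv (fun z : 'rV[R]_(n1 + n2) => lsubmx z) q /\ dv (fun z => lsubmx z) q u = lsubmx u.
Proof.
split; first exact: (smv_dfv (@smv_lsub _ n1 n2 setT)).
apply/rowP => k; rewrite dvE (near_dd (f := fun z : 'rV[R]_(n1 + n2) => z 0 (lshift n2 k))) ?dd_coord ?mxE //.
  by apply: (@near_all R 'rV[R]_(n1 + n2)) => z; rewrite mxE.
exact: dfb_coord.
Qed.

Lemma dv_rsub q (u : 'rV[R]_(n1 + n2)) :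
  dfv (fun z : 'rV[R]_(n1 + n2) => rsubmx z) q /\ dv (fun z => rsubmx z) q u = rsubmx u.
Proof.
split; first exact: (smv_dfv (@smv_rsub _ n1 n2 setT)).
apply/rowP => k; rewrite dvE (near_dd (f := fun z : 'rV[R]_(n1 + n2) => z 0 (rshift n1 k))) ?dd_coord ?mxE //.
  by apply: (@near_all R 'rV[R]_(n1 + n2)) => z; rewrite mxE.
exact: dfb_coord.
Qed.

Local Lemma sm_bF k l : sm O (fun z => beta k (F z) * dd (fun x => F x 0 k) z (delta_mx 0 l)).
Proof. by apply: smM => //; [exact: (sm_comp oO OU3 sF (sb k))|exact: sm_d]. Qed.

Local Lemma sm_a l : sm O (a l).
Proof.
apply: smD => //; first by apply: sm_sum => // k; exact: sm_bF.
apply: smN => //; case: (fintype.split l) => k; first exact: sm_lsub.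
by apply: smM => //; [exact: sm_lsub|exact: sm_rsub].
Qed.

Local Lemma fm_a z (u : 'rV[R]_(n1 + n2)) : \sum_l a l z * u 0 l =
  \sum_k beta k (F z) * dv F z u 0 k - (\sum_k gam k (lsubmx z) * lsubmx u 0 k
    + phi (lsubmx z) * \sum_k del k (rsubmx z) * rsubmx u 0 k).
Proof.
transitivity (\sum_l ((\sum_k beta k (F z) * dd (fun x => F x 0 k) z (delta_mx 0 l)) * u 0 l) -
  \sum_l match fintype.split l with inl l1 => gam l1 (lsubmx z)
                      | inr l2 => phi (lsubmx z) * del l2 (rsubmx z) end * u 0 l).
  by rewrite -sumrB; apply: eq_bigr => l _; rewrite mulrBl.
congr (_ - _).
  under eq_bigr do rewrite mulr_suml; rewrite exchange_big; apply: eq_bigr => k _.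
  by rewrite dvE dd_rowE mulr_sumr; apply: eq_bigr => l _; ring.
rewrite sum_split; congr (_ + _).
  by apply: eq_bigr => l _; rewrite (unsplitK (inl l)) mxE.
by rewrite mulr_sumr; apply: eq_bigr => l _; rewrite (unsplitK (inr l)) mxE mulrA.
Qed.

Local Lemma dd_a u l : dd (a l) p u =
  \sum_k (beta k (F p) * dd (fun z => dd (fun x => F x 0 k) z (delta_mx 0 l)) p u
    + dd (fun x => F x 0 k) p (delta_mx 0 l) * dd (beta k) (F p) (dv F p u)) -
  match fintype.split l with
  | inl l1 => dd (gam l1) (lsubmx p) (lsubmx u)
  | inr l2 => phi (lsubmx p) * dd (del l2) (rsubmx p) (rsubmx u)
      + del l2 (rsubmx p) * dd phi (lsubmx p) (lsubmx u)
  end.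
Proof.
have d1 k : dfb (fun z => beta k (F z) * dd (fun x => F x 0 k) z (delta_mx 0 l)) p.
  exact: sm_diff (sm_bF k l) Op.
have dF : dfv F p := smv_dfv sF Op.
have dl : dfv (fun z : 'rV[R]_(n1 + n2) => lsubmx z) p by have [] := dv_lsub p 0.
have dr : dfv (fun z : 'rV[R]_(n1 + n2) => rsubmx z) p by have [] := dv_rsub p 0.
have dg k := sm_diff (sg k) (OU1 Op); have ddl k := sm_diff (sd k) (OU2 Op).
have dp := sm_diff sphi (OU1 Op).
have El (h : 'rV[R]_n1 -> R) : dfb h (lsubmx p) -> dd (fun z => h (lsubmx z)) p u = dd h (lsubmx p) (lsubmx u).
  by move=> dh; rewrite dd_comp //; have [_ ->] := dv_lsub p u.
have Er (h : 'rV[R]_n2 -> R) : dfb h (rsubmx p) -> dd (fun z => h (rsubmx z)) p u = dd h (rsubmx p) (rsubmx u).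
  by move=> dh; rewrite dd_comp //; have [_ ->] := dv_rsub p u.
rewrite /a ddB; last 2 first.
- exact: dfb_sum.
- case: (fintype.split l) => k; first exact: (dfb_comp dl (dg k)).
  by apply: dfbM; [exact: (dfb_comp dl dp)|exact: (dfb_comp dr (ddl k))].
congr (_ - _).
  rewrite dd_sum //; apply: eq_bigr => k _; rewrite ddM.
  - by rewrite dd_comp //; exact: sm_diff (sb k) (OU3 Op).
  - by apply: dfb_comp => //; exact: sm_diff (sb k) (OU3 Op).
  - exact: sm_diff (sm_d _ (sF k)) Op.
case: (fintype.split l) => k; first exact: El.
by rewrite ddM ?El ?Er //; [exact: (dfb_comp dl dp)|exact: (dfb_comp dr (ddl k))].
Qed.

Local Lemma sum_dd_a (u u' : 'rV[R]_(n1 + n2)) : \sum_l dd (a l) p u * u' 0 l =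
  \sum_k beta k (F p) * \sum_l dd (fun z => dd (fun x => F x 0 k) z (delta_mx 0 l)) p u * u' 0 l
  + \sum_k dd (beta k) (F p) (dv F p u) * dv F p u' 0 k
  - (\sum_k dd (gam k) (lsubmx p) (lsubmx u) * lsubmx u' 0 k
    + phi (lsubmx p) * \sum_k dd (del k) (rsubmx p) (rsubmx u) * rsubmx u' 0 k
    + dd phi (lsubmx p) (lsubmx u) * \sum_k del k (rsubmx p) * rsubmx u' 0 k).
Proof.
under eq_bigr do rewrite dd_a mulrBl; rewrite sumrB; congr (_ - _).
  under eq_bigr do rewrite mulr_suml; rewrite exchange_big -big_split; apply: eq_bigr => k _ /=.
  rewrite mulr_sumr [dv F p u' 0 k]dvE (dd_rowE _ p u') mulr_sumr -big_split.
  by apply: eq_bigr => l _ /=; ring.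
rewrite sum_split -addrA; congr (_ + _).
  by apply: eq_bigr => l _; rewrite (unsplitK (inl l)) mxE.
rewrite !mulr_sumr -big_split; apply: eq_bigr => l _ /=.
rewrite (unsplitK (inr l)) !mxE; ring.
Qed.

(** [constrained_form_closed] is applied to the form [a]. The last two terms are the value of
    [d phi] wedge [del], from the derivative of the variable factor [phi]. *)
Lemma multiplicative_eder u u' : dv Phi p u = 0 -> dv Phi p u' = 0 ->
  eder beta (F p) (dv F p u) (dv F p u') =
  eder gam (lsubmx p) (lsubmx u) (lsubmx u')
  + phi (lsubmx p) * eder del (rsubmx p) (rsubmx u) (rsubmx u')
  + dd phi (lsubmx p) (lsubmx u) * \sum_k del k (rsubmx p) * rsubmx u' 0 k
  - dd phi (lsubmx p) (lsubmx u') * \sum_k del k (rsubmx p) * rsubmx u 0 k.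
Proof.
move=> u0 u'0; have [B HB] := surj_right_inverse surj.
have a0 z : O z -> Phi z = 0 -> forall v, dv Phi z v = 0 -> \sum_k a k z * v 0 k = 0.
  by move=> Oz z0 v v0; rewrite fm_a mult // subrr.
have := constrained_form_closed oO sPhi Op HB Phip sm_a a0 u0 u'0.
rewrite sumrB !sum_dd_a /eder !sumrB.
(* The second derivatives of [F] are symmetric in [u] and [u']; this is the commutation of the
   exterior derivative with the pull-back by [F]. *)
have -> : \sum_k beta k (F p) * \sum_l dd (fun z => dd (fun x => F x 0 k) z (delta_mx 0 l)) p u * u' 0 l =
  \sum_k beta k (F p) * \sum_l dd (fun z => dd (fun x => F x 0 k) z (delta_mx 0 l)) p u' * u 0 l.
  apply: eq_bigr => k _; congr (_ * _).
  transitivity (\sum_l \sum_j u 0 j * u' 0 l * dd (fun z => dd (fun x => F x 0 k) z (delta_mx 0 l)) p (delta_mx 0 j)).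
    by apply: eq_bigr => l _; rewrite dd_rowE mulr_suml; apply: eq_bigr => j _; ring.
  rewrite exchange_big; apply: eq_bigr => j _ /=.
  rewrite [in RHS]dd_rowE mulr_suml; apply: eq_bigr => l _ /=.
  by rewrite (schwarz _ _ oO (sF k) Op); ring.
move: (\sum_k beta k (F p) * _) => X.
move: (\sum_k dd (beta k) (F p) (dv F p u) * _) (\sum_k dd (beta k) (F p) (dv F p u') * _) => b1 b2.
move: (\sum_k dd (gam k) _ (lsubmx u) * _) (\sum_k dd (gam k) _ (lsubmx u') * _) => g1 g2.
move: (\sum_k dd (del k) _ (rsubmx u) * _) (\sum_k dd (del k) _ (rsubmx u') * _) => d1 d2.
move: (\sum_k del k _ * rsubmx u' 0 k) (\sum_k del k _ * rsubmx u 0 k) => e1 e2.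
move: (phi _) (dd phi _ _) (dd phi _ _) => f f1 f2 H.
by apply/eqP; rewrite -subr_eq0 -[X in _ == X]H; apply/eqP; ring.
Qed.

End FormOnFibreProduct.

(** * The groupoid laws of TG *)

Section TangentGroupoid.
Context {R : realType} {G : gpd R}.
Hypothesis lG : is_lie G.

Definition lie_arr_premfd : premfd (arr G) := manifold_premfd (lie_arr lG).
Definition lie_obj_premfd : premfd (obj G) := manifold_premfd (lie_obj lG).
Let gA : smooth_atlas (arr G) := premfd_atlas lie_arr_premfd.
Let gO : smooth_atlas (obj G) := premfd_atlas lie_obj_premfd.

Implicit Types (g h k : arr G) (v w : tangent (arr G)) (c d : R -> arr G).

Lemma smap_src g : pts (arr G) g -> smap g (@src R G).
Proof. by move=> pg; apply: (smap_smooth_on gA (mnear_pts lie_arr_premfd pg)); exact: lie_src. Qed.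

Lemma smap_tgt g : pts (arr G) g -> smap g (@tgt R G).
Proof. by move=> pg; apply: (smap_smooth_on gA (mnear_pts lie_arr_premfd pg)); exact: lie_tgt. Qed.

Lemma smap_unt x : pts (obj G) x -> smap x (@unt R G).
Proof. by move=> px; apply: (smap_smooth_on gO (mnear_pts lie_obj_premfd px)); exact: lie_unt. Qed.

Lemma smap_ginv g : pts (arr G) g -> smap g (@ginv R G).
Proof. by move=> pg; apply: (smap_smooth_on gA (mnear_pts lie_arr_premfd pg)); exact: lie_inv. Qed.

Lemma smap_pts {M N : mfd R} (x : M) (f : M -> N) : smooth_atlas N -> smap x f -> pts N (f x).
Proof. by move=> gN [j [jx _ _]]; exact: gN.1 jx. Qed.

Lemma pts_src g : pts (arr G) g -> pts (obj G) (src g).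
Proof. by move=> /smap_src; exact: smap_pts. Qed.

Lemma pts_tgt g : pts (arr G) g -> pts (obj G) (tgt g).
Proof. by move=> /smap_tgt; exact: smap_pts. Qed.

Lemma pts_unt x : pts (obj G) x -> pts (arr G) (unt x).
Proof. by move=> /smap_unt; exact: smap_pts. Qed.

Lemma pts_ginv g : pts (arr G) g -> pts (arr G) (ginv g).
Proof. by move=> /smap_ginv; exact: smap_pts. Qed.

(** Smoothness of the multiplication places the product in the domain of a chart, hence in G. *)
Lemma pts_mul g h : composable G (g, h) -> pts (arr G) (mul g h).
Proof.
move=> cgh; have [i [j [F /is_repP[ix [U [oU Ux sF H]]]]]] := lie_mul lG (g, h) cgh.
by have [jx _] := H _ cgh ix Ux; exact: gA.1 jx.
Qed.

Lemma curve_pts {M : mfd R} (c : R -> M) : smooth_atlas M -> is_curve c -> \forall t \near 0, pts M (c t).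
Proof. by move=> gM [i [_ nc _]]; apply: filterS nc => t; exact: gM.1. Qed.

Lemma tmul_vel c d : is_curve c -> is_curve d -> (\forall t \near 0, composable G (c t, d t)) ->
  is_curve (fun t => mul (c t) (d t)) /\ tmul (vel c) (vel d) = vel (fun t => mul (c t) (d t)).
Proof.
move=> cc cd ncd; rewrite /tmul (tpair_vel lie_arr_premfd lie_arr_premfd cc cd).
have gP := premfd_atlas (mprod_premfd lie_arr_premfd lie_arr_premfd).
apply: (dmap_on_vel (f := fun p : mprod (arr G) (arr G) => mul p.1 p.2) gP gA (curve_pair cc cd) ncd).
exact: (lie_mul lG (c 0, d 0) (nbhs_singleton ncd)).
Qed.

Definition tcomp g h v w := [/\ composable G (g, h), fib (tangent (arr G)) g v,
  fib (tangent (arr G)) h w & dmap (@src R G) v = dmap (@tgt R G) w].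

Lemma vel_near {M : mfd R} (c d : R -> M) : smooth_atlas M -> is_curve c ->
  (\forall t \near 0, c t = d t) -> vel c = vel d.
Proof.
move=> gM cc E; have E0 : c 0 = d 0 := nbhs_singleton E; have [i [ic nc dc]] := cc.
have Ei : \forall t \near 0, cmap i (c t) = cmap i (d t) by apply: filterS E => t ->.
have cd : is_curve d.
  exists i; split; [by rewrite -E0| |exact: near_dfv Ei dc].
  by apply: filterS2 E nc => t ->.
apply: (tvec_eq (i := i) gM (vel_tvec gM cc) (vel_tvec gM cd)) => //.
rewrite !velE //; first by rewrite (near_dv _ Ei).
by rewrite -E0.
Qed.

Lemma tcomp_curves g h v w : tcomp g h v w -> exists c d,
  [/\ is_curve c, vel c = v, is_curve d & vel d = w] /\
  [/\ c 0 = g, d 0 = h & \forall t \near 0, composable G (c t, d t)].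
Proof.
move=> [cgh [tv bv] [tw bw] E]; have bv' : tbase v = g := bv; have bw' : tbase w = h := bw.
have [pg ph _] := cgh; have [d [cd d0 Ed]] := tvec_ex_curve lie_arr_premfd tw.
have sm : smap (d 0) (@tgt R G) by rewrite d0 bw'; exact: smap_tgt.
have [ctd Etd] := dmap_vel gA gO cd sm.
have sv : smap (tbase v) (@src R G) by rewrite bv'; exact: smap_src.
(* The curve [d] realizing [w] is arbitrary; [tgt o d] is then lifted through the source map to a
   curve with the prescribed velocity [v]. *)
have [||c [cc Ec nc]] := submersion_lift lie_arr_premfd lie_obj_premfd tv sv _ ctd.
- by move=> u fu; rewrite bv' in fu *; exact: (lie_src_subm lG pg fu).
- by rewrite -Etd Ed E.
exists c, d; split=> //; split; [by rewrite -bv' -Ec|by rewrite d0|].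
by apply: filterS3 nc (curve_pts gA cc) (curve_pts gA cd) => t ? ? ?.
Qed.

Lemma tmul_fib g h v w : tcomp g h v w -> fib (tangent (arr G)) (mul g h) (tmul v w).
Proof.
move=> /tcomp_curves[c [d [[cc <- cd <-] [c0 d0 ncd]]]].
have [cm ->] := tmul_vel cc cd ncd; split; first exact: vel_tvec.
by rewrite -c0 -d0.
Qed.

Lemma dmap_src_tmul g h v w : tcomp g h v w -> dmap (@src R G) (tmul v w) = dmap (@src R G) w.
Proof.
move=> /tcomp_curves[c [d [[cc <- cd <-] [c0 d0 ncd]]]].
have [cm ->] := tmul_vel cc cd ncd; have c00 := nbhs_singleton ncd.
have [_ pd _] := c00.
have [cs1 ->] := dmap_vel gA gO cm (smap_src (pts_mul c00)).
have [cs2 ->] := dmap_vel gA gO cd (smap_src pd).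
by apply: vel_near => //; apply: filterS ncd => t ct; rewrite (lie_src_mul lG ct).
Qed.

Lemma dmap_tgt_tmul g h v w : tcomp g h v w -> dmap (@tgt R G) (tmul v w) = dmap (@tgt R G) v.
Proof.
move=> /tcomp_curves[c [d [[cc <- cd <-] [c0 d0 ncd]]]].
have [cm ->] := tmul_vel cc cd ncd; have c00 := nbhs_singleton ncd.
have [pc _ _] := c00.
have [cs1 ->] := dmap_vel gA gO cm (smap_tgt (pts_mul c00)).
have [cs2 ->] := dmap_vel gA gO cc (smap_tgt pc).
by apply: vel_near => //; apply: filterS ncd => t ct; rewrite (lie_tgt_mul lG ct).
Qed.

Lemma tmul_deriv g h v w f : tcomp g h v w -> exists c d,
  [/\ is_curve c, vel c = v, is_curve d & vel d = w] /\
  [/\ c 0 = g, d 0 = h, \forall t \near 0, composable G (c t, d t) &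
    smf (mul g h) f -> deriv (tmul v w) f = dd (fun t => f (mul (c t) (d t))) 0 1].
Proof.
move=> /tcomp_curves[c [d [[cc Ec cd Ed] [c0 d0 ncd]]]].
exists c, d; split=> //; split=> //; have [cm Em] := tmul_vel cc cd ncd.
by move=> sf; rewrite -Ec -Ed Em deriv_vel // c0 d0.
Qed.

(** [F] continues the multiplication off G^(2) in an arbitrary way. Its differential is nevertheless
    determined on composable pairs, since these are velocities of curves inside G^(2). *)
Lemma tmul_coef g h v w i1 i2 j F : tcomp g h v w ->
  is_rep (composable G) (fun p : mprod (arr G) (arr G) => mul p.1 p.2)
    ((i1, i2) : cidx (mprod (arr G) (arr G))) j (g, h) F ->
  tcoef (tmul v w) j = dv F (row_mx (cmap i1 g) (cmap i2 h)) (row_mx (tcoef v i1) (tcoef w i2)).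
Proof.
move=> tvw rF; have [c [d [[cc Ec cd Ed] [c0 d0 ncd]]]] := tcomp_curves tvw.
have [cm Em] := tmul_vel cc cd ncd; have lP := mprod_premfd lie_arr_premfd lie_arr_premfd.
have gP := premfd_atlas lP; have cp := curve_pair cc cd.
have [[ig ih] _] := rF.
have i0 : @cdom _ (mprod (arr G) (arr G)) (i1, i2) (c 0, d 0) by rewrite c0 d0.
have [n1 n2] := curve_chart gP cp i0.
rewrite -c0 -d0 in rF; have [jm _ _ E] := curve_rep gP i0 n1 n2 ncd rF.
rewrite -Ec -Ed Em velE // E c0 d0; congr (dv F _ _).
rewrite -(@velE _ (mprod (arr G) (arr G)) (fun t => (c t, d t)) (i1, i2)) //.
rewrite (tvec_fst lie_arr_premfd lie_arr_premfd (vel_tvec gP cp) i0).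
have pcd := premfd_cov lP i0.
have [_ ->] := dmap_vel gP gA cp (smap_fst lie_arr_premfd lie_arr_premfd pcd).
by have [_ ->] := dmap_vel gP gA cp (smap_snd lie_arr_premfd lie_arr_premfd pcd).
Qed.

Lemma composable_unt_r g : pts (arr G) g -> composable G (g, unt (src g)).
Proof. by move=> pg; split=> //=; [exact/pts_unt/pts_src|rewrite lie_tgt_unt //; exact: pts_src]. Qed.

Lemma composable_unt_l g : pts (arr G) g -> composable G (unt (tgt g), g).
Proof. by move=> pg; split=> //=; [exact/pts_unt/pts_tgt|rewrite lie_src_unt //; exact: pts_tgt]. Qed.

Lemma composable_inv_r g : pts (arr G) g -> composable G (g, ginv g).
Proof. by move=> pg; have [? ? ? _ _] := lie_inverse lG pg. Qed.

Lemma composable_inv_l g : pts (arr G) g -> composable G (ginv g, g).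
Proof. by move=> pg; have [? ? ? _ _] := lie_inverse lG pg. Qed.

Lemma inverse_unt x : pts (obj G) x -> ginv (unt x) = unt x.
Proof.
move=> px; have pu := pts_unt px; have [pi si ti m1 m2] := lie_inverse lG pu.
by rewrite -[LHS](lie_mul_unt lG pi) si lie_tgt_unt // m2 lie_src_unt.
Qed.

Let TA g v := fib (tangent (arr G)) g v.

Lemma dsrc_fib g v : TA g v -> fib (tangent (obj G)) (src g) (dmap (@src R G) v).
Proof.
move=> [tv bv]; have b : tbase v = g := bv; rewrite -b; apply: (dmap_fib lie_arr_premfd lie_obj_premfd tv).
by rewrite b; apply: smap_src; rewrite -b; have [] := tv.
Qed.

Lemma dtgt_fib g v : TA g v -> fib (tangent (obj G)) (tgt g) (dmap (@tgt R G) v).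
Proof.
move=> [tv bv]; have b : tbase v = g := bv; rewrite -b; apply: (dmap_fib lie_arr_premfd lie_obj_premfd tv).
by rewrite b; apply: smap_tgt; rewrite -b; have [] := tv.
Qed.

Lemma dunt_fib x u : fib (tangent (obj G)) x u -> TA (unt x) (dmap (@unt R G) u).
Proof.
move=> [tv bv]; have b : tbase u = x := bv; rewrite -b; apply: (dmap_fib lie_obj_premfd lie_arr_premfd tv).
by rewrite b; apply: smap_unt; rewrite -b; have [] := tv.
Qed.

Lemma TA_pts g v : TA g v -> pts (arr G) g.
Proof. by move=> [[p _ _] b]; rewrite -(b : tbase v = g). Qed.

Lemma dmap_near {M N : mfd R} (f f' : M -> N) (v : tangent M) : premfd M -> premfd N ->
  is_tvec v -> smap (tbase v) f -> mnear (tbase v) (fun x => f x = f' x) -> dmap f v = dmap f' v.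
Proof.
move=> lM lN tv sf E; have gM := premfd_atlas lM; have gN := premfd_atlas lN.
have [c [cc c0 Ec]] := tvec_ex_curve lM tv.
have sf0 : smap (c 0) f by rewrite c0.
have sf' : smap (c 0) f' by apply: smap_ext sf0 => //; rewrite c0.
rewrite -Ec (dmap_vel gM gN cc sf0).2 (dmap_vel gM gN cc sf').2.
apply: vel_near => //; first exact: (dmap_vel gM gN cc sf0).1.
by apply: (curve_near (P := fun x => f x = f' x) gM cc); rewrite c0.
Qed.

Lemma dmap_idE {M : mfd R} (v : tangent M) : premfd M -> is_tvec v -> dmap (fun x : M => x) v = v.
Proof.
move=> lM tv; have gM := premfd_atlas lM; have [c [cc c0 Ec]] := tvec_ex_curve lM tv.
have [i [ic _ _]] := cc.
by rewrite -Ec (dmap_vel gM gM cc (smap_id ic)).2.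
Qed.

Lemma dsrc_unt x u : fib (tangent (obj G)) x u -> dmap (@src R G) (dmap (@unt R G) u) = u.
Proof.
move=> [tu bu]; have b : tbase u = x := bu; have px : pts (obj G) (tbase u) by case: tu.
rewrite (dmap_comp lie_obj_premfd lie_arr_premfd lie_obj_premfd tu (smap_unt px) (smap_src (pts_unt px))).
rewrite -[RHS](dmap_idE lie_obj_premfd tu); apply: dmap_near lie_obj_premfd lie_obj_premfd tu _ _.
  exact: smap_comp gO gA (smap_unt px) (smap_src (pts_unt px)).
by apply: mnearS (mnear_pts lie_obj_premfd px) => y py; rewrite lie_src_unt.
Qed.

Lemma curves_tcomp c d : is_curve c -> is_curve d -> (\forall t \near 0, composable G (c t, d t)) ->
  tcomp (c 0) (d 0) (vel c) (vel d).
Proof.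
move=> cc cd ncd; have c0 := nbhs_singleton ncd; have [pc pd _] := c0.
split=> //; first by split=> //; exact: vel_tvec.
  by split=> //; exact: vel_tvec.
have [cs ->] := dmap_vel gA gO cc (smap_src pc); have [_ ->] := dmap_vel gA gO cd (smap_tgt pd).
by apply: vel_near => //; apply: filterS ncd => t [].
Qed.

(** Differentiates an identity [f k f' k = f2 k] between arrows along a curve. The unit and inverse
    laws of TG are the instances where the maps are built from the identity, units and inversion. *)
Lemma tmul_maps (f f' f2 : arr G -> arr G) g v : TA g v -> smap g f -> smap g f' -> smap g f2 ->
  (forall k, pts (arr G) k -> composable G (f k, f' k) /\ mul (f k) (f' k) = f2 k) ->
  tcomp (f g) (f' g) (dmap f v) (dmap f' v) /\ tmul (dmap f v) (dmap f' v) = dmap f2 v.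
Proof.
move=> [tv bv] sf sf' sf2 H; have b : tbase v = g := bv.
have [c [cc c0 <-]] := tvec_ex_curve lie_arr_premfd tv; rewrite b in c0; rewrite -c0 in sf sf' sf2 *.
have [cf Ef] := dmap_vel gA gA cc sf; have [cf' Ef'] := dmap_vel gA gA cc sf'.
have npc := curve_pts gA cc.
have ncd : \forall t \near 0, composable G (f (c t), f' (c t)).
  by apply: filterS npc => t /H[].
rewrite Ef Ef'; split; first exact: (curves_tcomp cf cf').
have [cm ->] := tmul_vel cf cf' ncd.
have E : \forall t \near 0, mul (f (c t)) (f' (c t)) = f2 (c t) by apply: filterS npc => t /H[].
by rewrite (vel_near gA cm E) -(dmap_vel gA gA cc sf2).2.
Qed.

Lemma smap_idA g : pts (arr G) g -> smap g (fun k : arr G => k).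
Proof. by move=> /(mfd_cover (lie_arr lG) _).1[i]; exact: smap_id. Qed.

Lemma smap_unt_src g : pts (arr G) g -> smap g (fun k => unt (src k)).
Proof. by move=> pg; exact: smap_comp gA gO (smap_src pg) (smap_unt (pts_src pg)). Qed.

Lemma smap_unt_tgt g : pts (arr G) g -> smap g (fun k => unt (tgt k)).
Proof. by move=> pg; exact: smap_comp gA gO (smap_tgt pg) (smap_unt (pts_tgt pg)). Qed.

Lemma dunt_src g v : TA g v -> dmap (fun k => unt (src k)) v = dmap (@unt R G) (dmap (@src R G) v).
Proof.
move=> fv; have pg := TA_pts fv; case: fv => tv bv; have b : tbase v = g := bv.
rewrite -b in pg; rewrite (dmap_comp lie_arr_premfd lie_obj_premfd lie_arr_premfd tv (smap_src pg) (smap_unt (pts_src pg))) //.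
Qed.

Lemma dunt_tgt g v : TA g v -> dmap (fun k => unt (tgt k)) v = dmap (@unt R G) (dmap (@tgt R G) v).
Proof.
move=> fv; have pg := TA_pts fv; case: fv => tv bv; have b : tbase v = g := bv.
rewrite -b in pg; rewrite (dmap_comp lie_arr_premfd lie_obj_premfd lie_arr_premfd tv (smap_tgt pg) (smap_unt (pts_tgt pg))) //.
Qed.

Lemma tmul_unt g v : TA g v -> tcomp g (unt (src g)) v (dmap (@unt R G) (dmap (@src R G) v)) /\
  tmul v (dmap (@unt R G) (dmap (@src R G) v)) = v.
Proof.
move=> fv; have pg := TA_pts fv; have si := smap_idA pg.
have [k pk|] := tmul_maps fv si (smap_unt_src pg) si.
  by split; [exact: composable_unt_r|exact: lie_mul_unt].
by rewrite (dunt_src fv) dmap_idE //; [exact: lie_arr_premfd|case: fv].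
Qed.

Lemma unt_tmul g v : TA g v -> tcomp (unt (tgt g)) g (dmap (@unt R G) (dmap (@tgt R G) v)) v /\
  tmul (dmap (@unt R G) (dmap (@tgt R G) v)) v = v.
Proof.
move=> fv; have pg := TA_pts fv; have si := smap_idA pg.
have [k pk|] := tmul_maps fv (smap_unt_tgt pg) si si.
  by split; [exact: composable_unt_l|exact: lie_unt_mul].
by rewrite (dunt_tgt fv) dmap_idE //; [exact: lie_arr_premfd|case: fv].
Qed.

Lemma tmul_ginv g v : TA g v -> tcomp g (ginv g) v (dmap (@ginv R G) v) /\
  tmul v (dmap (@ginv R G) v) = dmap (@unt R G) (dmap (@tgt R G) v).
Proof.
move=> fv; have pg := TA_pts fv; have si := smap_idA pg.
have [k pk|] := tmul_maps fv si (smap_ginv pg) (smap_unt_tgt pg).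
  by split; [exact: composable_inv_r|have [] := lie_inverse lG pk].
by rewrite (dunt_tgt fv) // dmap_idE //; [exact: lie_arr_premfd|case: fv].
Qed.

Lemma ginv_tmul g v : TA g v -> tcomp (ginv g) g (dmap (@ginv R G) v) v /\
  tmul (dmap (@ginv R G) v) v = dmap (@unt R G) (dmap (@src R G) v).
Proof.
move=> fv; have pg := TA_pts fv; have si := smap_idA pg.
have [k pk|] := tmul_maps fv (smap_ginv pg) si (smap_unt_src pg).
  by split; [exact: composable_inv_l|have [] := lie_inverse lG pk].
by rewrite (dunt_src fv) // dmap_idE //; [exact: lie_arr_premfd|case: fv].
Qed.

Lemma dsrc_dginv g v : TA g v -> dmap (@src R G) (dmap (@ginv R G) v) = dmap (@tgt R G) v.
Proof. by move=> fv; have [[_ _ _ ->]] := ginv_tmul fv. Qed.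

Lemma dtgt_dginv g v : TA g v -> dmap (@tgt R G) (dmap (@ginv R G) v) = dmap (@src R G) v.
Proof. by move=> fv; have [[_ _ _ ->]] := tmul_ginv fv. Qed.

(* k = (k h^-1) h for a lift h of src k. *)
Lemma tmul_surj g h u : composable G (g, h) -> TA (mul g h) u ->
  exists v w, tcomp g h v w /\ tmul v w = u.
Proof.
move=> cgh [tu bu]; have b : tbase u = mul g h := bu; have [pg ph sg] := cgh.
have pm := pts_mul cgh; have [k [ck k0 Ek]] := tvec_ex_curve lie_arr_premfd tu; rewrite b in k0.
have sk : smap (k 0) (@src R G) by rewrite k0; exact: smap_src.
have [csk Esk] := dmap_vel gA gO ck sk.
have fs : fib (tangent (obj G)) (src h) (dmap (@src R G) u).
  by rewrite -(lie_src_mul lG cgh); exact: dsrc_fib.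
have [w [tw bw] Ew] := lie_src_subm lG ph fs; have b' : tbase w = h := bw.
have sw : smap (tbase w) (@src R G) by rewrite b'; exact: smap_src.
have [||e [ce Ee ne]] := submersion_lift lie_arr_premfd lie_obj_premfd tw sw _ csk.
- by move=> x fx; rewrite b' in fx *; exact: (lie_src_subm lG ph fx).
- by rewrite -Esk Ek Ew.
have e0 : e 0 = h by rewrite -b' -Ee.
have si : smap (e 0) (@ginv R G) by rewrite e0; exact: smap_ginv.
have [cie Eie] := dmap_vel gA gA ce si.
have nki : \forall t \near 0, composable G (k t, ginv (e t)).
  apply: filterS3 ne (curve_pts gA ck) (curve_pts gA ce) => t Et pk pe.
  by have [? ? ti _ _] := lie_inverse lG pe; split=> //=; rewrite ti.
have [cc _] := tmul_vel ck cie nki.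
have nce : \forall t \near 0, composable G (mul (k t) (ginv (e t)), e t).
  apply: filterS2 nki (curve_pts gA ce) => t ct pe.
  split=> //=; first exact: pts_mul.
  by rewrite (lie_src_mul lG ct); have [] := lie_inverse lG pe.
have E : \forall t \near 0, mul (mul (k t) (ginv (e t))) (e t) = k t.
  apply: filterS3 nki (curve_pts gA ce) ne => t ct pe Et; have [pk _ _] := ct.
  by rewrite -(lie_assoc lG ct (composable_inv_l pe)); have [_ _ _ _ ->] := lie_inverse lG pe;
    rewrite Et lie_mul_unt.
have [cm Em] := tmul_vel cc ce nce.
exists (vel (fun t => mul (k t) (ginv (e t)))), (vel e); split; last first.
  by rewrite Em (vel_near gA cm E).
have := curves_tcomp cc ce nce; rewrite e0 k0.
suff -> : mul (mul g h) (ginv h) = g by [].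
rewrite -(lie_assoc lG cgh (composable_inv_r ph)); have [_ _ _ -> _] := lie_inverse lG ph.
by rewrite -sg lie_mul_unt.
Qed.

End TangentGroupoid.

Lemma theP {T : Type} (x0 : T) (P : set T) : (exists x, P x) -> P (the x0 P).
Proof. by move=> h; rewrite /the; case: pselect => // h'; exact: svalP (cid h'). Qed.

(** * Line bundle groupoids *)

Section VbFibre.
Context {R : realType} {M : mfd R} {E : vb M}.
Hypothesis vE : is_vb E.

Lemma vscal0 x (e : E) : fib E x e -> vscal 0 e = vzero E x.
Proof.
move=> fe; have px := fib_pts vE fe; have [a ax] := vb_cover vE px.
apply: (vb_eq vE ax (vb_scal vE 0 fe) (vb_zero vE px)).
by rewrite (vb_tmapZ vE 0 ax fe) scale0r vb_tmap0.
Qed.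

Lemma vopp_fib x (e : E) : fib E x e -> fib E x (vopp e).
Proof. exact: vb_scal. Qed.

Lemma vsub_self x (e : E) : fib E x e -> vadd e (vopp e) = vzero E x.
Proof.
move=> fe; have px := fib_pts vE fe; have [a ax] := vb_cover vE px.
apply: (vb_eq vE ax (vb_add vE fe (vb_scal vE _ fe)) (vb_zero vE px)).
by rewrite (vb_tmapD vE ax fe (vb_scal vE _ fe)) vb_tmap0 // (vb_tmapZ vE _ ax fe) scaleN1r subrr.
Qed.

Lemma vsub_eq0 x (e e' : E) : fib E x e -> fib E x e' -> vadd e (vopp e') = vzero E x -> e = e'.
Proof.
move=> fe fe' H; have px := fib_pts vE fe; have [a ax] := vb_cover vE px.
apply: (vb_eq vE ax fe fe'); apply/eqP; rewrite -subr_eq0; apply/eqP.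
have /(congr1 (tmap a)) := H; rewrite (vb_tmapD vE ax fe (vb_scal vE _ fe')) vb_tmap0 //.
by rewrite (vb_tmapZ vE _ ax fe') scaleN1r.
Qed.

Lemma vadd0 x (e : E) : fib E x e -> vadd e (vzero E x) = e.
Proof.
move=> fe; have px := fib_pts vE fe; have [a ax] := vb_cover vE px; have f0 := vb_zero vE px.
apply: (vb_eq vE ax (vb_add vE fe f0) fe).
by rewrite (vb_tmapD vE ax fe f0) vb_tmap0 // addr0.
Qed.

End VbFibre.

Section VbMorphism.
Context {R : realType} {M N : mfd R} {E : vb M} {E' : vb N}.
Hypotheses (vE : is_vb E) (vE' : is_vb E').
Variables (F : E -> E') (f : M -> N).
Hypothesis Ff : is_vbmor F f.

Lemma vbmor_zero x : pts M x -> F (vzero E x) = vzero E' (f x).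
Proof.
move=> px; have fz := vb_zero vE px; rewrite -(vscal0 vE fz) (vbmor_scal Ff 0 px fz).
exact: (vscal0 vE' (vbmor_fib Ff px fz)).
Qed.

Lemma vbmor_opp x e : pts M x -> fib E x e -> F (vopp e) = vopp (F e).
Proof. by move=> px fe; rewrite /vopp (vbmor_scal Ff (-1) px fe). Qed.

Lemma vbmor_inj : (forall x e, fib E x e -> F e = vzero E' (f x) -> e = vzero E x) ->
  forall x e e', fib E x e -> fib E x e' -> F e = F e' -> e = e'.
Proof.
move=> ker x e e' fe fe' H; have px := fib_pts vE fe; apply: (vsub_eq0 vE fe fe').
apply: ker; first exact: (vb_add vE fe (vopp_fib vE fe')).
rewrite (vbmor_add Ff px fe (vopp_fib vE fe')) (vbmor_opp px fe') H.
exact: (vsub_self vE' (vbmor_fib Ff px fe')).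
Qed.

End VbMorphism.

Lemma mopen_preim {R : realType} {M N : mfd R} (f : M -> N) (W : set N) : premfd M -> premfd N ->
  (forall x, pts M x -> smap x f) -> mopen W -> mopen (pts M `&` f @^-1` W).
Proof.
move=> lM lN sf oW; apply: mnear_mopen => // x [px Wx].
apply: (mnearI (premfd_atlas lM) (mnear_pts lM px)).
by apply: mnear_smap (sf x px) (mopen_mnear lN oW Wx); exact: premfd_atlas.
Qed.

Lemma smooth_id {R : realType} {M : mfd R} : premfd M -> smooth (id : M -> M).
Proof.
move=> lM; apply: (smooth_onP (premfd_atlas lM)) => x /(ml_cover lM)[i ix].
exact: smap_id ix.
Qed.

Lemma hom_eq {R : realType} {M : mfd R} {E F : vb M} (psi phi : hom E F) :
  hbase psi = hbase phi -> (forall e, psi e = phi e) -> psi = phi.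
Proof. by case: psi phi => [x f] [y k] /= -> H; congr Hom; exact/funext. Qed.

Lemma mkhomE {R : realType} {M : mfd R} {E F : vb M} x (f : E -> F) e : fib E x e ->
  mkhom x f e = f e.
Proof. by move=> fe; rewrite /mkhom /=; case: pselect. Qed.

Lemma mkhom_off {R : realType} {M : mfd R} {E F : vb M} x (f : E -> F) e : ~ fib E x e ->
  mkhom x f e = vzero F x.
Proof. by move=> fe; rewrite /mkhom /=; case: pselect. Qed.

Lemma is_homI {R : realType} {M : mfd R} {E F : vb M} (psi : hom E F) x : hbase psi = x ->
  pts M x -> (forall e, fib E x e -> fib F x (psi e)) ->
  (forall e e', fib E x e -> fib E x e' -> psi (vadd e e') = vadd (psi e) (psi e')) ->
  (forall r e, fib E x e -> psi (vscal r e) = vscal r (psi e)) ->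
  (forall e, ~ fib E x e -> psi e = vzero F x) -> is_hom psi.
Proof. by move=> <-. Qed.

Lemma homb_addE {R : realType} {M : mfd R} {E F : vb M} (psi phi : homb E F) (e : E) :
  (vadd psi phi : hom E F) e = vadd ((psi : hom E F) e) ((phi : hom E F) e).
Proof. by []. Qed.

Lemma homb_scalE {R : realType} {M : mfd R} {E F : vb M} r (psi : homb E F) (e : E) :
  (vscal r psi : hom E F) e = vscal r ((psi : hom E F) e).
Proof. by []. Qed.

(** * Smoothness criteria for rows, direct sums and Hom bundles *)

Section SmoothRows.
Context {R : realType} {M : mfd R}.
Implicit Types x : M.

Lemma smf_row_mx m n x (f : M -> 'rV[R]_m) (g : M -> 'rV[R]_n) :
  (forall k, smf x (fun y => f y 0 k)) -> (forall k, smf x (fun y => g y 0 k)) ->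
  forall k, smf x (fun y => row_mx (f y) (g y) 0 k).
Proof.
move=> sf sg k; case: (split_ordP k) => j ->.
  have -> : (fun y => row_mx (f y) (g y) 0 (lshift n j)) = (fun y => f y 0 j) by apply/funext => y; rewrite row_mxEl.
  exact: sf.
have -> : (fun y => row_mx (f y) (g y) 0 (rshift m j)) = (fun y => g y 0 j) by apply/funext => y; rewrite row_mxEr.
exact: sg.
Qed.

Lemma smf_mxvec m n x (A : M -> 'M[R]_(m, n)) : (forall i j, smf x (fun y => A y i j)) ->
  forall k, smf x (fun y => mxvec (A y) 0 k).
Proof.
move=> sA k; case: (mxvec_indexP k) => i j.
have -> : (fun y => mxvec (A y) 0 (mxvec_index i j)) = (fun y => A y i j).
  by apply/funext => y; rewrite mxvecE.
exact: sA.
Qed.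

End SmoothRows.

Section DirectSum.
Context {R : realType} {M : mfd R} {E F : vb M}.
Hypotheses (gE : smooth_atlas (total E)) (gF : smooth_atlas (total F)).

(* A change of trivialization of E + F is assembled from those of E and of F, which share the
   change of charts of the base. *)
Lemma dsum_atlas : smooth_atlas (total (dsum E F)).
Proof.
split; first by move=> ia e [].
move=> [i [a b]] [j [a' b']] e /= [ve ie [ae be]] [_ je [ae' be']]; have [v1 v2 e12] := ve.
have c1 : @cdom _ (total E) (i, a) e.1 by split.
have c1' : @cdom _ (total E) (j, a') e.1 by split.
have c2 : @cdom _ (total F) (i, b) e.2 by rewrite /= -e12; split.
have c2' : @cdom _ (total F) (j, b') e.2 by rewrite /= -e12; split.
have [U1 [F1 [oU1 U1e sF1 H1]]] := chart_change gE c1 c1'.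
have [U2 [F2 [oU2 U2e sF2 H2]]] := chart_change gF c2 c2'.
pose N := (dim M + (vrk E + vrk F))%N.
pose p1 (z : 'rV[R]_N) : 'rV[R]_(dim M + vrk E) := row_mx (lsubmx z) (lsubmx (rsubmx z)).
pose p2 (z : 'rV[R]_N) : 'rV[R]_(dim M + vrk F) := row_mx (lsubmx z) (rsubmx (rsubmx z)).
have sr (Q : set 'rV[R]_N) : smv Q (fun z => rsubmx z) by exact: smv_rsub.
have sp1 : smv setT p1.
  apply: smv_row_mx; [exact: openT|exact: smv_lsub|] => k.
  exact: (sm_comp openT (fun _ _ => I) (@sr setT) (@smv_lsub _ _ _ setT k)).
have sp2 : smv setT p2.
  apply: smv_row_mx; [exact: openT|exact: smv_lsub|] => k.
  exact: (sm_comp openT (fun _ _ => I) (@sr setT) (@smv_rsub _ _ _ setT k)).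
pose Q := [set z | U1 (p1 z) /\ U2 (p2 z)].
have oQ : open Q.
  have o1 := open_comp_on openT oU1 sp1; have o2 := open_comp_on openT oU2 sp2.
  rewrite (_ : Q = [set q | setT q /\ U1 (p1 q)] `&` [set q | setT q /\ U2 (p2 q)]); first exact: openI.
  by apply/seteqP; split=> z /=; [case=> *; split|case=> -[_ ?] [_ ?]; split].
have s1 : smv Q (fun z => F1 (p1 z)).
  move=> k; apply: (sm_comp oQ _ _ (sF1 k)) => [z []//|l]; exact: sm_sub (sp1 l).
have s2 : smv Q (fun z => F2 (p2 z)).
  move=> k; apply: (sm_comp oQ _ _ (sF2 k)) => [z []//|l]; exact: sm_sub (sp2 l).
have pE (y : E * F) : vproj y.1 = vproj y.2 ->
    p1 (row_mx (cmap i (vproj y.1)) (row_mx (tmap a y.1) (tmap b y.2))) = row_mx (cmap i (vproj y.1)) (tmap a y.1) /\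
    p2 (row_mx (cmap i (vproj y.1)) (row_mx (tmap a y.1) (tmap b y.2))) = row_mx (cmap i (vproj y.2)) (tmap b y.2).
  by move=> Ey; rewrite /p1 /p2 !(row_mxKl, row_mxKr) Ey.
exists (fun z => row_mx (lsubmx (F1 (p1 z))) (row_mx (rsubmx (F1 (p1 z))) (rsubmx (F2 (p2 z))))).
apply/is_repP; split=> //; exists Q; split=> //.
- by have [E1 E2] := pE e e12; rewrite /Q /mkset /= E1 E2.
- apply: smv_row_mx => // [k|].
    exact: (sm_comp oQ (fun _ _ => I) s1 (@smv_lsub _ _ _ setT k)).
  apply: smv_row_mx => // k.
    exact: (sm_comp oQ (fun _ _ => I) s1 (@smv_rsub _ _ _ setT k)).
  exact: (sm_comp oQ (fun _ _ => I) s2 (@smv_rsub _ _ _ setT k)).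
move=> y _ [[w1 w2 w12] iy [ay b_y]]; have [E1 E2] := pE y w12.
rewrite /Q /mkset /= E1 E2 => -[Q1 Q2].
have [|[_ jy ay'] G1] := H1 y.1 _ Q1; first by split.
have [|[_ jy' by'] G2] := H2 y.2 _ Q2; first by rewrite /= -w12; split.
split; first by split=> //; split=> //=; rewrite /= w12.
by rewrite -G1 -G2 /= !(row_mxKl, row_mxKr).
Qed.

Section Chart.
Variables (i : cidx M) (a : tidx E) (b : tidx F) (e : total (dsum E F)).
Hypothesis ie : @cdom _ (total (dsum E F)) (i, (a, b)) e.

Lemma dsum_base_smf k : smf e (fun y : total (dsum E F) => cmap i (vproj y.1) 0 k).
Proof.
have := @smf_coord _ (total (dsum E F)) _ _ (lshift (vrk E + vrk F) k) ie.
by congr smf; apply/funext => y; rewrite /= row_mxEl.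
Qed.

Lemma dsum_fst_smf k : smf e (fun y : total (dsum E F) => tmap a y.1 0 k).
Proof.
have := @smf_coord _ (total (dsum E F)) _ _ (rshift (dim M) (lshift (vrk F) k)) ie.
by congr smf; apply/funext => y; rewrite /= row_mxEr row_mxEl.
Qed.

Lemma dsum_snd_smf k : smf e (fun y : total (dsum E F) => tmap b y.2 0 k).
Proof.
have := @smf_coord _ (total (dsum E F)) _ _ (rshift (dim M) (rshift (vrk E) k)) ie.
by congr smf; apply/funext => y; rewrite /= row_mxEr row_mxEr.
Qed.

Lemma dsum_near : mnear e (fun y : total (dsum E F) =>
  [/\ vin y, cdom i (vproj y.1), tdom a (vproj y.1) & tdom b (vproj y.1)]).
Proof. by apply: mnearS (mnear_cdom ie) => y [vy iy [ay b_y]]; split. Qed.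

Lemma dsum_base_smap : smap e (fun y : total (dsum E F) => vproj y.1).
Proof.
exists i; split; [by have [_ ? _] := ie| |exact: dsum_base_smf].
by apply: mnearS dsum_near => y [].
Qed.

End Chart.

End DirectSum.

(** [smap] asks for one chart around the image, so smoothness into a Hom bundle comes down to the
    matrix entries in one pair of trivializations. *)
Lemma homb_smap {R : realType} {P M : mfd R} {E F : vb M} (psi : P -> total (homb E F)) x i a b :
  smooth_atlas P ->
  mnear x (fun y => [/\ is_hom (psi y : hom E F), cdom i (hbase (psi y)), tdom a (hbase (psi y)) & tdom b (hbase (psi y))]) ->
  (forall k, smf x (fun y => cmap i (hbase (psi y)) 0 k)) ->
  (forall k l, smf x (fun y => tmap b ((psi y : hom E F) (frame a (hbase (psi y)) k)) 0 l)) ->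
  smap x psi.
Proof.
move=> gP nx sb se; exists (i, (a, b)); split.
- by have [] := mnear_self nx.
- by apply: mnearS nx => y [].
move=> k; apply: (smf_row_mx sb); apply: smf_mxvec => {}k l.
have -> : (fun y => (\matrix_(k < vrk E, l < vrk F) tmap b ((psi y : hom E F) (frame a (hbase (psi y)) k)) 0 l) k l) =
  (fun y => tmap b ((psi y : hom E F) (frame a (hbase (psi y)) k)) 0 l).
  by apply/funext => y; rewrite mxE.
exact: se.
Qed.

Section SmoothInverse.
Context {R : realType}.

Lemma sm_invmx {m n} (O : set 'rV[R]_m) (D : 'rV[R]_m -> 'M[R]_n) i j : open O ->
  (forall i j, sm O (fun q => D q i j)) -> (forall q, O q -> \det (D q) != 0) ->
  sm O (fun q => invmx (D q) i j).
Proof.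
move=> oO sD d0.
apply: (sm_ext oO (f := fun q => (\det (D q))^-1 * (\adj (D q)) i j)).
  by move=> q Oq; rewrite /invmx unitmxE unitfE (d0 q Oq) [RHS]mxE.
apply: smM => //; last exact: sm_adj.
by apply: sm_inv => //; exact: sm_det.
Qed.

(* If U S = 1, complete S by T so that U and a basis K of ker S make (S T) invertible near S. *)
Lemma kernel_complement n m r (S : 'M[R]_(n, m)) (U : 'M[R]_(m, n)) : U *m S = 1%:M ->
  r = (n - m)%N -> exists (N : 'M[R]_(m + r, n)) (T : 'M[R]_(n, r)), N *m row_mx S T \in unitmx.
Proof.
move=> US rE; have rS : \rank S = m.
  by apply/eqP; rewrite -/(row_full S); apply/row_fullP; exists U.
have [K [KS fK]] : exists K : 'M[R]_(r, n), K *m S = 0 /\ row_free K.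
  have -> : r = \rank (kermx S) by rewrite mxrank_ker rS.
  exists (row_base (kermx S)); split; last exact: row_base_free.
  by apply/sub_kermxP; rewrite eq_row_base.
exists (col_mx U K), (pinvmx K).
rewrite mul_col_row US KS mulmxVp // unitmxE det_ublock !det1 mulr1; exact: unitr1.
Qed.

End SmoothInverse.

(** * The action of G on L_M *)

Section LineBundleGroupoid.
Context {R : realType} {G : gpd R} {L : vbg G}.
Hypothesis lL : is_lbg L.
Implicit Types (g h : arr G).

Let lG : is_lie G. Proof. by case: lL => - []. Qed.
Let lT : is_lie (vgpd L). Proof. by case: lL => - []. Qed.
Lemma lbg_top : is_vb (vtop L). Proof. by case: lL => - []. Qed.
Lemma lbg_bot : is_vb (vbot L). Proof. by case: lL => - []. Qed.
Lemma lbg_rk : vrk (vtop L) = 1%N. Proof. by case: lL. Qed.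
Lemma lbg_rkM : vrk (vbot L) = 1%N. Proof. by case: lL. Qed.
Lemma lbg_src : is_vbmor (@vsrc R G L) (@src R G). Proof. by case: lL => - []. Qed.
Lemma lbg_tgt : is_vbmor (@vtgt R G L) (@tgt R G). Proof. by case: lL => - []. Qed.
Lemma lbg_unt : is_vbmor (@vunt R G L) (@unt R G). Proof. by case: lL => - []. Qed.
Lemma lbg_lie : is_lie G. Proof. exact: lG. Qed.
Let vL : is_vbg L. Proof. by case: lL. Qed.

Local Notation TL g l := (fib (vtop L) g l).
Local Notation BL x m := (fib (vbot L) x m).

Lemma vsrc_fib g l : TL g l -> BL (src g) (vsrc l).
Proof. exact: (pull_fib lbg_top lbg_src). Qed.

Lemma vtgt_fib g l : TL g l -> BL (tgt g) (vtgt l).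
Proof. exact: (pull_fib lbg_top lbg_tgt). Qed.

Lemma vunt_fib x m : BL x m -> TL (unt x) (vunt m).
Proof. exact: (pull_fib lbg_bot lbg_unt). Qed.

Lemma vsrc_unt x m : BL x m -> vsrc (vunt m) = m.
Proof. by move=> [vm _]; exact: (lie_src_unt lT vm). Qed.

Lemma vtgt_unt x m : BL x m -> vtgt (vunt m) = m.
Proof. by move=> [vm _]; exact: (lie_tgt_unt lT vm). Qed.

(** Both fibres are lines, and the unit map is injective because the source map inverts it on the
    left; so the image of a frame is nonzero and spans. *)
Lemma vunt_surj x l : pts (obj G) x -> TL (unt x) l -> exists2 m, BL x m & l = vunt m.
Proof.
move=> px fl; have [b bx] := vb_cover lbg_bot px; have pu := pts_unt lG px.
have [a ax] := vb_cover lbg_top pu; have [fm m1] := lfP lbg_bot lbg_rkM bx.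
have fu := vunt_fib fm.
have nz : lc a (vunt (lf b x)) != 0.
  apply: contra_eq_neq m1 => z0; rewrite -(vsrc_unt fm).
  have -> : vunt (lf b x) = vzero (vtop L) (unt x).
    by apply: (lc_inj lbg_top lbg_rk ax fu (vb_zero lbg_top pu)); rewrite z0 lc0 //; exact: lbg_top.
  rewrite (vbmor_zero lbg_top lbg_bot lbg_src pu) lie_src_unt // lc0 //; last exact: lbg_bot.
  by rewrite eq_sym oner_neq0.
exists (vscal (lc a l / lc a (vunt (lf b x))) (lf b x)); first exact: (vb_scal lbg_bot _ fm).
rewrite (vbmor_scal lbg_unt _ px fm); apply: (lc_inj lbg_top lbg_rk ax fl (vb_scal lbg_top _ fu)).
by rewrite (lcZ lbg_top ax _ fu) divfK.
Qed.

Lemma vunt_src x l : pts (obj G) x -> TL (unt x) l -> vunt (vsrc l) = l.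
Proof. by move=> px fl; have [m fm ->] := vunt_surj px fl; rewrite (vsrc_unt fm). Qed.

Lemma vunt_tgt x l : pts (obj G) x -> TL (unt x) l -> vunt (vtgt l) = l.
Proof. by move=> px fl; have [m fm ->] := vunt_surj px fl; rewrite (vtgt_unt fm). Qed.

Lemma fib_comp g h l l' : TL g l -> TL h l' -> vsrc l = vtgt l' -> composable G (g, h).
Proof.
move=> fl fl' E; split=> /=; [exact: (fib_pts lbg_top fl)|exact: (fib_pts lbg_top fl')|].
by have [_ <-] := vsrc_fib fl; have [_ <-] := vtgt_fib fl'; rewrite E.
Qed.

Lemma vcomp_comp g h l l' : vcomposable g h l l' ->
  composable (vgpd L) ((l, l') : mprod (total (vtop L)) (total (vtop L))) /\ composable G (g, h).
Proof. by move=> [fl fl' E]; split; [case: fl; case: fl' => *; split|exact: (fib_comp fl fl' E)]. Qed.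

Lemma vmul_fib g h l l' : vcomposable g h l l' -> TL (mul g h) (vmul l l').
Proof. by move=> c; have [_ cgh] := vcomp_comp c; exact: (vbg_mul vL cgh c). Qed.

Lemma vsrc_mul g h (l l' : vtop L) : vcomposable g h l l' -> vsrc (vmul l l') = vsrc l'.
Proof. by move=> c; have [cl _] := vcomp_comp c; exact: (lie_src_mul lT cl). Qed.

Lemma vtgt_mul g h (l l' : vtop L) : vcomposable g h l l' -> vtgt (vmul l l') = vtgt l.
Proof. by move=> c; have [cl _] := vcomp_comp c; exact: (lie_tgt_mul lT cl). Qed.

Let tz g : pts (arr G) g -> TL g (vzero (vtop L) g). Proof. exact: vb_zero lbg_top g. Qed.

Lemma vsrc_zero g : pts (arr G) g -> vsrc (vzero (vtop L) g) = vzero (vbot L) (src g).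
Proof. by move=> pg; exact: (vbmor_zero lbg_top lbg_bot lbg_src pg). Qed.

Lemma vtgt_zero g : pts (arr G) g -> vtgt (vzero (vtop L) g) = vzero (vbot L) (tgt g).
Proof. by move=> pg; exact: (vbmor_zero lbg_top lbg_bot lbg_tgt pg). Qed.

Lemma vzero_comp g h : composable G (g, h) -> vcomposable g h (vzero (vtop L) g) (vzero (vtop L) h).
Proof. by move=> [pg ph E]; split; [exact: tz|exact: tz|rewrite vsrc_zero // vtgt_zero // E]. Qed.

Lemma vzero_mul g h : composable G (g, h) ->
  vmul (vzero (vtop L) g) (vzero (vtop L) h) = vzero (vtop L) (mul g h).
Proof.
move=> cgh; have [pg ph _] := cgh; have c := vzero_comp cgh.
rewrite -{1}(vscal0z lbg_top 0 pg) -{1}(vscal0z lbg_top 0 ph) (vbg_mul_scal vL 0 cgh c).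
exact: (vscal0 lbg_top (vmul_fib c)).
Qed.

Lemma vassoc g h k (l l' l'' : vtop L) : vcomposable g h l l' -> vcomposable h k l' l'' ->
  vmul l (vmul l' l'') = vmul (vmul l l') l''.
Proof. by move=> /vcomp_comp[c _] /vcomp_comp[c' _]; exact: (lie_assoc lT c c'). Qed.

Lemma vmul_unt g l : TL g l -> vmul l (vunt (vsrc l)) = l.
Proof. by move=> [vl _]; exact: (lie_mul_unt lT vl). Qed.

Lemma vunt_mul g l : TL g l -> vmul (vunt (vtgt l)) l = l.
Proof. by move=> [vl _]; exact: (lie_unt_mul lT vl). Qed.

Lemma vunt_zero x : pts (obj G) x -> vunt (vzero (vbot L) x) = vzero (vtop L) (unt x).
Proof. by move=> px; exact: (vbmor_zero lbg_bot lbg_top lbg_unt px). Qed.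

(* If s l = 0 then l 0_{g^-1} has source zero over a unit, so it vanishes; multiply by 0_g. *)
Lemma vsrc_ker g l : TL g l -> vsrc l = vzero (vbot L) (src g) -> l = vzero (vtop L) g.
Proof.
move=> fl l0; have pg := fib_pts lbg_top fl; have [pi si ti m1 m2] := lie_inverse lG pg.
have ci := composable_inv_r lG pg; have ci' := composable_inv_l lG pg.
have c1 : vcomposable g (ginv g) l (vzero (vtop L) (ginv g)).
  by split=> //; [exact: tz|rewrite vtgt_zero // ti].
have c2 := vzero_comp ci'; have pt := pts_tgt lG pg.
have z1 : vmul l (vzero (vtop L) (ginv g)) = vzero (vtop L) (unt (tgt g)).
  have := vmul_fib c1; rewrite m1 => f1; rewrite -(vunt_src pt f1) (vsrc_mul c1) vsrc_zero // si.
  by rewrite vunt_zero.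
have := vassoc c1 c2; rewrite vzero_mul // z1 m2 -vunt_zero; last exact: pts_src.
rewrite -l0 (vmul_unt fl) => ->; rewrite vzero_mul; last exact: composable_unt_l.
by rewrite lie_unt_mul.
Qed.

Lemma vtgt_ker g l : TL g l -> vtgt l = vzero (vbot L) (tgt g) -> l = vzero (vtop L) g.
Proof.
move=> fl l0; have pg := fib_pts lbg_top fl; have [pi si ti m1 m2] := lie_inverse lG pg.
have ci := composable_inv_r lG pg; have ci' := composable_inv_l lG pg.
have c1 : vcomposable (ginv g) g (vzero (vtop L) (ginv g)) l.
  by split=> //; [exact: tz|rewrite vsrc_zero // si].
have c2 := vzero_comp ci; have ps := pts_src lG pg.
have z1 : vmul (vzero (vtop L) (ginv g)) l = vzero (vtop L) (unt (src g)).
  have := vmul_fib c1; rewrite m2 => f1; rewrite -(vunt_tgt ps f1) (vtgt_mul c1) vtgt_zero // ti.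
  by rewrite vunt_zero.
have := vassoc c2 c1; rewrite vzero_mul // z1 m1 -[X in _ = vmul X _ -> _]vunt_zero; last exact: pts_tgt.
rewrite -l0 (vunt_mul fl) => <-; rewrite vzero_mul; last exact: composable_unt_r.
by rewrite lie_mul_unt.
Qed.

Lemma vsrc_inj g l l' : TL g l -> TL g l' -> vsrc l = vsrc l' -> l = l'.
Proof. exact: (vbmor_inj lbg_top lbg_bot lbg_src vsrc_ker). Qed.

Lemma vtgt_inj g l l' : TL g l -> TL g l' -> vtgt l = vtgt l' -> l = l'.
Proof. exact: (vbmor_inj lbg_top lbg_bot lbg_tgt vtgt_ker). Qed.

Lemma lsinvP g m : pts (arr G) g -> BL (src g) m -> TL g (lsinv g m) /\ vsrc (lsinv (L := L) g m) = m.
Proof. by move=> pg fm; exact: (fibinvP lbg_top lbg_rk lbg_bot lbg_rkM lbg_src vsrc_inj pg fm). Qed.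

Lemma lsinvK g l : TL g l -> lsinv g (vsrc l) = l.
Proof. by move=> fl; exact: (fibinvK lbg_top lbg_rk lbg_bot lbg_rkM lbg_src vsrc_inj fl). Qed.

Lemma lact_src g l : TL g l -> lact g (vsrc l) = vtgt l.
Proof. by move=> fl; rewrite /lact lsinvK. Qed.

Lemma lact_fib g m : pts (arr G) g -> BL (src g) m -> BL (tgt g) (lact g m).
Proof. by move=> pg fm; have [f _] := lsinvP pg fm; exact: vtgt_fib. Qed.

Lemma lsinvD g m m' : pts (arr G) g -> BL (src g) m -> BL (src g) m' ->
  lsinv (L := L) g (vadd m m') = vadd (lsinv g m) (lsinv g m').
Proof.
move=> pg fm fm'; have [f E] := lsinvP pg fm; have [f' E'] := lsinvP pg fm'.
have [f2 E2] := lsinvP pg (vb_add lbg_bot fm fm').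
by apply: (vsrc_inj f2 (vb_add lbg_top f f')); rewrite E2 (vbmor_add lbg_src pg f f') E E'.
Qed.

Lemma lsinvZ g r m : pts (arr G) g -> BL (src g) m ->
  lsinv (L := L) g (vscal r m) = vscal r (lsinv g m).
Proof.
move=> pg fm; have [f E] := lsinvP pg fm; have [f2 E2] := lsinvP pg (vb_scal lbg_bot r fm).
by apply: (vsrc_inj f2 (vb_scal lbg_top r f)); rewrite E2 (vbmor_scal lbg_src r pg f) E.
Qed.

Lemma lactD g m m' : pts (arr G) g -> BL (src g) m -> BL (src g) m' ->
  lact g (vadd m m') = vadd (lact g m) (lact g m').
Proof.
move=> pg fm fm'; have [f _] := lsinvP pg fm; have [f' _] := lsinvP pg fm'.
by rewrite /lact lsinvD // (vbmor_add lbg_tgt pg f f').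
Qed.

Lemma lactZ g r m : pts (arr G) g -> BL (src g) m -> lact g (vscal r m) = vscal r (lact g m).
Proof.
move=> pg fm; have [f _] := lsinvP pg fm.
by rewrite /lact lsinvZ // (vbmor_scal lbg_tgt r pg f).
Qed.

(** Read off from the product in L of a lift over [g] and a lift over [h]: its source is that of the
    right factor and its target that of the left one. *)
Lemma lact_mul g h m : composable G (g, h) -> BL (src h) m -> lact (mul g h) m = lact g (lact h m).
Proof.
move=> cgh fm; have [pg ph E] := cgh; have [f2 E2] := lsinvP ph fm.
have := vtgt_fib f2; rewrite -[tgt h]E => ft; have [f1 E1] := lsinvP pg ft.
have c : vcomposable g h (lsinv g (vtgt (lsinv h m))) (lsinv h m) by [].
by have := lact_src (vmul_fib c); rewrite (vsrc_mul c) E2 (vtgt_mul c).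
Qed.

Lemma lact_unt x m : pts (obj G) x -> BL x m -> lact (unt x) m = m.
Proof. by move=> px fm; have := lact_src (vunt_fib fm); rewrite (vsrc_unt fm) (vtgt_unt fm). Qed.

Lemma lactKV g m : pts (arr G) g -> BL (tgt g) m -> lact g (lact (ginv g) m) = m.
Proof.
move=> pg fm; have c := composable_inv_r lG pg; have [_ s _ E _] := lie_inverse lG pg.
by rewrite -lact_mul // ?s // E lact_unt //; exact: pts_tgt.
Qed.

Lemma vmul_surj g h l : composable G (g, h) -> TL (mul g h) l ->
  exists p : vtop L * vtop L, vcomposable g h p.1 p.2 /\ vmul p.1 p.2 = l.
Proof.
move=> cgh fl; have [pg ph E] := cgh; have := vsrc_fib fl; rewrite (lie_src_mul lG cgh) => fs.
have [f2 E2] := lsinvP ph fs; have := vtgt_fib f2; rewrite -[tgt h]E => ft.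
have [f1 E1] := lsinvP pg ft.
have c : vcomposable g h (lsinv g (vtgt (lsinv h (vsrc l)))) (lsinv h (vsrc l)) by [].
exists (lsinv g (vtgt (lsinv h (vsrc l))), lsinv h (vsrc l)); split=> //=.
by apply: vsrc_inj (vmul_fib c) fl _; rewrite (vsrc_mul c).
Qed.

(* The action of [k] on [L_M] is multiplication by [act_lc a b k] in the frames at source and
   target of [k]. *)
Definition act_lc (a b : tidx (vbot L)) k : R := lc b (lact k (lf a (src k))).

Lemma act_lcE a b k m : pts (arr G) k -> tdom a (src k) -> tdom b (tgt k) -> BL (src k) m ->
  lc b (lact k m) = act_lc a b k * lc a m.
Proof.
move=> pk ak bk fm; have [ff _] := lfP lbg_bot lbg_rkM ak.
rewrite {1}(lf_scal lbg_bot lbg_rkM ak fm) lactZ // (lcZ lbg_bot bk); last exact: lact_fib.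
by rewrite mulrC.
Qed.

Lemma act_lc_tgt a b k l : tdom a (src k) -> tdom b (tgt k) -> TL k l ->
  lc b (vtgt l) = act_lc a b k * lc a (vsrc l).
Proof.
move=> ak bk fl; have pk := fib_pts lbg_top fl.
by rewrite -(act_lcE pk ak bk (vsrc_fib fl)) lact_src.
Qed.

Lemma act_lc_mul a b c g h : composable G (g, h) -> tdom a (src h) -> tdom b (src g) -> tdom c (tgt g) ->
  act_lc a c (mul g h) = act_lc b c g * act_lc a b h.
Proof.
move=> cgh ah bg cg; have [pg ph E] := cgh.
have [ff _] := lfP lbg_bot lbg_rkM ah.
rewrite /act_lc (lie_src_mul lG cgh) lact_mul // (act_lcE pg bg cg) //.
by rewrite [src g]E; exact: lact_fib.
Qed.

Lemma act_lc_neq0 a b k : pts (arr G) k -> tdom a (src k) -> tdom b (tgt k) -> act_lc a b k != 0.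
Proof.
move=> pk ak bk; have [ff f1] := lfP lbg_bot lbg_rkM ak; apply/eqP => f0.
have z : lact k (lf a (src k)) = vzero (vbot L) (tgt k).
  apply: (lc_inj lbg_bot lbg_rkM bk (lact_fib pk ff) (vb_zero lbg_bot (pts_tgt lG pk))).
  by rewrite (lc0 lbg_bot bk).
have [fl sl] := lsinvP pk ff; have := vtgt_ker fl z.
move/(congr1 (@vsrc R G L)); rewrite sl vsrc_zero // => /(congr1 (lc a)).
by rewrite f1 (lc0 lbg_bot ak) => /eqP; rewrite oner_eq0.
Qed.

Definition src_frame (a : tidx (vbot L)) k : vtop L := lsinv k (lf a (src k)).

Lemma src_frame_section a : let W := pts (arr G) `&` (@src R G) @^-1` (tdom a) in
  mopen W /\ section_on W (src_frame a).
Proof.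
have oW : mopen (pts (arr G) `&` (@src R G) @^-1` (tdom a)).
  by apply: mopen_preim (smap_src lG) (vb_tdom lbg_bot a); [exact: lie_arr_premfd|exact: lie_obj_premfd].
have H k : (pts (arr G) `&` (@src R G) @^-1` (tdom a)) k ->
    TL k (src_frame a k) /\ lc a (vsrc (src_frame a k)) = 1.
  move=> [pk ak]; have [ff f1] := lfP lbg_bot lbg_rkM ak.
  by have [f ->] := lsinvP pk ff.
split=> //; apply: (pc_smf_section lbg_top lbg_rk lbg_bot lbg_rkM lbg_src vsrc_inj oW) => k Wk.
  by have [] := H k Wk.
exists a; first by case: Wk.
have gA := premfd_atlas (lie_arr_premfd lG).
have [i ik] : exists i : cidx (arr G), cdom i k.
  by case: Wk => pk _; exact/(mfd_cover (lie_arr lG) k).1.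
apply: (smf_ext gA _ (smf_cst (1 : R) ik)).
by apply: mnearS (mopen_mnear (lie_arr_premfd lG) oW Wk) => y /H[_ ->].
Qed.

Lemma act_lc_smf a b k : pts (arr G) k -> tdom a (src k) -> tdom b (tgt k) -> smf k (act_lc a b).
Proof.
move=> pk ak bk; have [oW sW] := src_frame_section a.
exact: (pc_section lbg_top lbg_bot lbg_rkM lbg_tgt oW sW (conj pk ak) bk).
Qed.

(** * The form eta *)

Variable nab : conn (vbot L).
Hypothesis cnab : is_conn nab.
Implicit Types (v w : tangent (arr G)) (a b : tidx (vbot L)).

Let vT := lbg_top.
Let vB := lbg_bot.
Let rT := lbg_rk.
Let rB := lbg_rkM.
Let Sm := lbg_src.
Let Tm := lbg_tgt.
Let lA : premfd (arr G) := lie_arr_premfd lG.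
Let lO : premfd (obj G) := lie_obj_premfd lG.
Let gA : smooth_atlas (arr G) := premfd_atlas lA.
Let gO : smooth_atlas (obj G) := premfd_atlas lO.

Local Notation TA g v := (fib (tangent (arr G)) g v).
Local Notation TO x u := (fib (tangent (obj G)) x u).
Local Notation dsrc := (dmap (@src R G)).
Local Notation dtgt := (dmap (@tgt R G)).
Local Notation dunt := (dmap (@unt R G)).
Local Notation A a := (cform nab a).
Local Notation et := (eta (L := L) nab).

Lemma s_pull_conn : is_conn (s_pull (L := L) nab).
Proof. exact: (pull_connP vT rT vB rB Sm (vsrc_inj) cnab).1. Qed.

Lemma t_pull_conn : is_conn (t_pull (L := L) nab).
Proof. exact: (pull_connP vT rT vB rB Tm (vtgt_inj) cnab).1. Qed.

(** Both pulled back connections are evaluated on [src_frame a]: its source coordinate is constantly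
    1, so [s^* nab] contributes a connection form only, and its target coordinate is [act_lc a b],
    whose derivative enters through [t^* nab]. The factor [act_lc a b g] on both sides avoids a
    logarithmic derivative. *)
Lemma eta_formula a b g v : TA g v -> tdom a (src g) -> tdom b (tgt g) ->
  et v * act_lc a b g =
  act_lc a b g * A a (dsrc v) - deriv v (act_lc a b) - act_lc a b g * A b (dtgt v).
Proof.
move=> [tv bv] ag bg; have e : tbase v = g := bv; have pg : pts (arr G) g by rewrite -e; case: tv.
have [oW sW] := src_frame_section a.
have Wg : (pts (arr G) `&` (@src R G) @^-1` (tdom a)) (tbase v) by rewrite e.
have [ff f1] := lfP vB rB ag; have [fe se] := lsinvP pg ff.
have ag' : tdom a (src (tbase v)) by rewrite e.
have bg' : tdom b (tgt (tbase v)) by rewrite e.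
have Es := (pull_connP vT rT vB rB Sm (vsrc_inj) cnab).2 _ v _ a oW sW Wg tv ag'.
have Et := (pull_connP vT rT vB rB Tm (vtgt_inj) cnab).2 _ v _ b oW sW Wg tv bg'.
have := conn_minusP vT rT s_pull_conn t_pull_conn oW sW Wg tv.
have := conn_fib s_pull_conn oW Wg tv sW; have := conn_fib t_pull_conn oW Wg tv sW.
rewrite -/(et v) e => fD' fD E.
have := congr1 (fun l => lc b (vtgt l)) E; rewrite /= (act_lc_tgt ag bg fD).
rewrite (pcD vT vB Tm pg bg fD' (vb_scal vT _ fe)) (pcZ vT vB Tm pg bg _ fe).
rewrite /s_pull Es /t_pull Et /pull_formula e [lc b (vtgt (src_frame a g))]/(act_lc a b g) se f1.
have -> : deriv v (fun y => lc a (vsrc (src_frame a y))) = 0.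
  have [i ig] := (mfd_cover (lie_arr lG) g).1 pg; rewrite -e in ig.
  rewrite -[RHS](deriv_cst lA (1 : R) tv); apply: (deriv_ext lA tv (smf_cst (1 : R) ig)).
  apply: mnearS (mopen_mnear lA oW Wg) => y [py ay]; have [fy y1] := lfP vB rB ay.
  by have [_ ->] := lsinvP py fy; rewrite y1.
rewrite add0r mul1r -[X in deriv v X]/(act_lc a b) -[lc b (lact _ _)]/(act_lc a b g) => H; rewrite [et _ * _](_ : _ = act_lc a b g * A a (dsrc v)
  - (deriv v (act_lc a b) + act_lc a b g * A b (dtgt v))); first by rewrite opprD addrA.
by rewrite H; ring.
Qed.

Lemma tdom_src_near a (k : arr G) : pts (arr G) k -> tdom a (src k) -> mnear k (fun y => tdom a (src y)).
Proof. by move=> pk ak; apply: (mnear_smap gA gO (smap_src lG pk)); exact: (tdom_near vB). Qed.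

Lemma tdom_tgt_near a (k : arr G) : pts (arr G) k -> tdom a (tgt k) -> mnear k (fun y => tdom a (tgt y)).
Proof. by move=> pk ak; apply: (mnear_smap gA gO (smap_tgt lG pk)); exact: (tdom_near vB). Qed.

(* eta is s^*A - t^*A - d log (act_lc), and [act_lc] is multiplicative. *)
Lemma eta_tmul g h v w : tcomp g h v w ->
  et (tmul v w) = et v + et w.
Proof.
move=> tc; have fm := tmul_fib lG tc; have [cgh fv fw E] := tc; have [pg ph Es] := cgh.
have pm := pts_mul lG cgh.
have [a ah] := vb_cover vB (pts_src lG ph); have [b bh] := vb_cover vB (pts_tgt lG ph).
have bg : tdom b (src g) by rewrite [src g]Es.
have [c cg] := vb_cover vB (pts_tgt lG pg).
have am : tdom a (src (mul g h)) by rewrite lie_src_mul.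
have cm : tdom c (tgt (mul g h)) by rewrite lie_tgt_mul.
have [k [d [[ck Ek cd Ed] [k0 d0 nkd H]]]] := tmul_deriv lG (act_lc a c) tc.
have Dm := H (act_lc_smf pm am cm).
have sk : smf (k 0) (act_lc b c) by rewrite k0; exact: act_lc_smf.
have sd : smf (d 0) (act_lc a b) by rewrite d0; exact: act_lc_smf.
have D1 := deriv_vel gA ck sk; have D2 := deriv_vel gA cd sd.
have n1 : \forall t \near 0, tdom b (src (k t)) /\ tdom c (tgt (k t)).
  apply: (curve_near (P := fun y => tdom b (src y) /\ tdom c (tgt y)) gA ck); rewrite k0.
  by apply: (mnearI gA); [exact: tdom_src_near|exact: tdom_tgt_near].
have n2 : \forall t \near 0, tdom a (src (d t)).
  by apply: (curve_near (P := fun y => tdom a (src y)) gA cd); rewrite d0; exact: tdom_src_near.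
have nE : \forall t \near 0, act_lc b c (k t) * act_lc a b (d t) = act_lc a c (mul (k t) (d t)).
  by apply: filterS3 nkd n1 n2 => t ct [bt st] at_; rewrite (act_lc_mul ct at_ bt st).
have dk := curve_dfb gA ck sk; have dd' := curve_dfb gA cd sd.
rewrite (near_dd _ nE (dfbM dk dd')) (ddM _ dk dd') -D1 -D2 Ek Ed k0 d0 in Dm.
have F1 := eta_formula fm am cm; have F2 := eta_formula fv bg cg; have F3 := eta_formula fw ah bh.
have f0 := act_lc_neq0 pm am cm.
apply: (mulIf f0); rewrite F1 Dm (dmap_src_tmul lG tc) (dmap_tgt_tmul lG tc).
rewrite (act_lc_mul cgh ah bg cg) mulrDl.
rewrite [et v * _]mulrA F2 [et w * _](_ : _ = act_lc b c g * (et w * act_lc a b h)).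
  by rewrite F3 E; ring.
by ring.
Qed.

Lemma etaD g v w : TA g v -> TA g w ->
  et (vadd v w) = et v + et w.
Proof.
move=> [tv bv] [tw bw]; apply: (conn_minusD vT rT s_pull_conn t_pull_conn tv tw).
by rewrite [tbase v]bv [tbase w]bw.
Qed.

Lemma etaZ g r v : TA g v -> et (vscal r v) = r * et v.
Proof. by move=> [tv _]; exact: (conn_minusZ vT rT s_pull_conn t_pull_conn r tv). Qed.

Lemma eta_smf i x k : cdom i x ->
  smf x (fun y => et (frame (E := tangent (arr G)) i y k)).
Proof. exact: (conn_minus_smf vT rT s_pull_conn t_pull_conn k). Qed.

(** * Multiplicativity of theta and of its curvature *)

Variable theta : tangent (arr G) -> vtop L.
Hypotheses (ft : is_form1 theta) (mt : multiplicative theta).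

(** The defining identity lives in L^(2); the target map is applied to its first component. The lift
    of [theta w] along [pr_2] has a first component with source [t theta(w)], hence target
    [g.(t theta(w))], and the lift along the multiplication has the target of [theta (tmul v w)]. *)
Lemma theta_mul g h v w : tcomp g h v w ->
  vtgt (theta (tmul v w)) = vadd (vtgt (theta v)) (lact g (vtgt (theta w))).
Proof.
move=> c; have [cgh fv fw E] := c; have [pg ph Es] := cgh.
have fm := tmul_fib lG c.
have tv := form_fib ft fv; have tw := form_fib ft fw; have tm := form_fib ft fm.
have [H _] := mt cgh (And3 fv fw E).
have [[fp fp' Ep] Ep2] : vcomposable g h (lift2 snd g h (theta w)).1 (lift2 snd g h (theta w)).2 /\
    (lift2 snd g h (theta w)).2 = theta w.
  apply: (@theP _ _ [set p | vcomposable g h p.1 p.2 /\ p.2 = theta w]).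
  have := vtgt_fib tw; rewrite -[tgt h]Es => f; have [f1 E1] := lsinvP pg f.
  by exists (lsinv g (vtgt (theta w)), theta w).
have [[fq fq' Eq] Eq1] : vcomposable g h (lift2 fst g h (theta v)).1 (lift2 fst g h (theta v)).2 /\
    (lift2 fst g h (theta v)).1 = theta v.
  apply: (@theP _ _ [set p | vcomposable g h p.1 p.2 /\ p.1 = theta v]).
  have := vsrc_fib tv; rewrite [src g]Es => f.
  have [f1 E1] := fibinvP lbg_top lbg_rk lbg_bot lbg_rkM lbg_tgt vtgt_inj ph f.
  by exists (theta v, fibinv (@vtgt R G L) h (vsrc (theta v))).
have [cr Er] : let r := lift2 (fun p => vmul p.1 p.2) g h (theta (tmul v w)) in
    vcomposable g h r.1 r.2 /\ vmul r.1 r.2 = theta (tmul v w).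
  apply: (@theP _ _ [set p | vcomposable g h p.1 p.2 /\ vmul p.1 p.2 = theta (tmul v w)]).
  exact: vmul_surj.
have [fr fr' _] := cr.
move: H Ep Ep2 Eq1 fp fp' fq fq'; rewrite /=; move: (lift2 snd _ _ _) (lift2 fst _ _ _) => p q.
move=> H Ep Ep2 Eq1 fp fp' fq fq'.
have f3 := vb_scal lbg_top (-1) fr; have f4 := vb_add lbg_top fp f3.
have := congr1 (@vtgt R G L) H.
rewrite (vbmor_add lbg_tgt pg f4 fq) (vbmor_add lbg_tgt pg fp f3) (vbmor_scal lbg_tgt _ pg fr).
rewrite vtgt_zero // -(vtgt_mul cr) Er Eq1 -(lact_src fp) Ep Ep2.
have pt := pts_tgt lG pg; have [b bx] := vb_cover lbg_bot pt.
have g1 := vtgt_fib tv; have g2 : BL (tgt g) (lact g (vtgt (theta w))).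
  by apply: lact_fib => //; rewrite [src g]Es; exact: vtgt_fib.
have := vtgt_fib tm; rewrite (lie_tgt_mul lG cgh) => g3.
have g4 := vb_scal lbg_bot (-1) g3; have g5 := vb_add lbg_bot g2 g4.
move/(congr1 (lc b)); rewrite (lcD lbg_bot bx g5 g1) (lcD lbg_bot bx g2 g4) (lcZ lbg_bot bx _ g3).
rewrite (lc0 lbg_bot bx) => H2.
apply: (lc_inj lbg_bot lbg_rkM bx g3 (vb_add lbg_bot g1 g2)).
rewrite (lcD lbg_bot bx g1 g2); apply/eqP; rewrite -subr_eq0; apply/eqP.
by rewrite -[RHS]oppr0 -[in RHS]H2; ring.
Qed.

Definition curv v w : vtop L := conn_diff (t_pull (L := L) nab) theta v w.

Lemma curvP g v w : TA g v -> TA g w -> fib (vtop L) g (curv v w) /\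
  forall a i, tdom a (tgt g) -> cdom i g ->
    lc a (vtgt (curv v w)) = curv_formula (@vtgt R G L) (@tgt R G) nab theta a i v w.
Proof. exact: (conn_diffP vT rT vB rB Tm (vtgt_inj) cnab ft). Qed.

Local Notation K := curv.
Local Notation th a i k := (fcomp (@vtgt R G L) theta a i k).

Lemma fcomp_chart b i x : tdom b (tgt x) -> cdom i x -> exists (V : set 'rV[R]_(dim (arr G))) beta,
  [/\ open V, V (cmap i x), forall k, sm V (beta k) &
    forall y, cdom i y -> V (cmap i y) -> forall k : 'I_(dim (arr G)), th b i k y = beta k (cmap i y)].
Proof.
move=> bx ix; have sk k : smf x (th b i k) := fcomp_smf vT vB rB Tm ft k bx ix.
(* The components are read as a single map to [euc], so that all of them are represented on one
   neighbourhood. *)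
have [] := @smap_local R (arr G) (euc (dim (arr G))) (fun y => \row_k th b i k y) x i tt gA ix.
- exact: (mnear_true ix).
- move=> k; apply: (smf_ext gA _ (sk k)); apply: (mnear_true ix) => y.
  by rewrite /= mxE.
move=> V [beta [oV Vx sV H]]; exists V, (fun k q => beta q 0 k); split=> // y iy Vy k.
by have [_ /=/rowP/(_ k)] := H y iy Vy; rewrite mxE.
Qed.

Lemma smap_chart_rep {N : mfd R} (f : arr G -> N) x i o : smooth_atlas N -> smap x f -> cdom i x ->
  cdom o (f x) -> exists V S, [/\ open V, V (cmap i x), smv V S & forall y, cdom i y -> V (cmap i y) ->
    cdom o (f y) /\ cmap o (f y) = S (cmap i y)].
Proof. by move=> gN sf ix ox; have [n s] := smap_chart gA gN sf ox; exact: smap_local n s. Qed.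

Lemma curv_formula_eder b i g v w (V : set 'rV[R]_(dim (arr G))) beta : TA g v -> TA g w ->
  cdom i g -> open V -> V (cmap i g) -> (forall l, sm V (beta l)) ->
  (forall y, cdom i y -> V (cmap i y) -> forall l, th b i l y = beta l (cmap i y)) ->
  curv_formula (@vtgt R G L) (@tgt R G) nab theta b i v w =
  eder beta (cmap i g) (tcoef v i) (tcoef w i)
  + lc b (vtgt (theta w)) * A b (dtgt v) - lc b (vtgt (theta v)) * A b (dtgt w).
Proof.
move=> [tv bv] [tw bw] ig oV Vg sb H; have ev : tbase v = g := bv; have ew : tbase w = g := bw.
have D (u : tangent (arr G)) l : is_tvec u -> tbase u = g ->
    deriv u (th b i l) = dd (beta l) (cmap i g) (tcoef u i).
  move=> tu eu; rewrite -eu.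
  by apply: (deriv_chart lA tu _ oV _ (sb l)) => [||y iy Vy]; rewrite ?eu //; exact: H.
rewrite /curv_formula; congr (_ + _ - _).
by apply: eq_bigr => l _; rewrite !D.
Qed.

Lemma theta_coef b i g v (V : set 'rV[R]_(dim (arr G))) beta : TA g v ->
  cdom i g -> tdom b (tgt g) -> V (cmap i g) ->
  (forall y, cdom i y -> V (cmap i y) -> forall l, th b i l y = beta l (cmap i y)) ->
  lc b (vtgt (theta v)) = \sum_l beta l (cmap i g) * tcoef v i 0 l.
Proof.
move=> fv ig bg Vg H; rewrite (fcompE vT vB Tm ft bg ig fv).
by apply: eq_bigr => l _; rewrite (H g ig Vg) mulrC.
Qed.

Lemma theta_tmul_lc a b g h v w : tcomp g h v w -> tdom a (src g) -> tdom b (tgt g) ->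
  lc b (vtgt (theta (tmul v w))) =
  lc b (vtgt (theta v)) + act_lc a b g * lc a (vtgt (theta w)).
Proof.
move=> tc ag bg; have [cgh fv fw E] := tc; have [pg ph Es] := cgh.
have f1 : fib (vbot L) (src g) (vtgt (theta w)).
  by rewrite [src g]Es; exact: (vtgt_fib (form_fib ft fw)).
rewrite (theta_mul tc) (lcD vB bg (vtgt_fib (form_fib ft fv)) (lact_fib pg f1)).
by rewrite (act_lcE pg ag bg f1).
Qed.

Lemma act_lc_chart a b g i : tdom a (src g) -> tdom b (tgt g) -> cdom i g ->
  exists (V : set 'rV[R]_(dim (arr G))) phi, [/\ open V, V (cmap i g), sm V phi &
    forall y, cdom i y -> V (cmap i y) ->
      [/\ tdom a (src y), tdom b (tgt y) & act_lc a b y = phi (cmap i y)]].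
Proof.
move=> ag bg ig; have pg := premfd_cov lA ig.
have [V [phi [oV Vg sphi H]]] := smf_chart gA ig (act_lc_smf pg ag bg).
have [V1 [oV1 V1g H1]] := mnear_chart gA ig (tdom_src_near pg ag).
have [V2 [oV2 V2g H2]] := mnear_chart gA ig (tdom_tgt_near pg bg).
exists (V `&` (V1 `&` V2)), phi; split=> //.
- by apply: openI => //; exact: openI.
- by apply: sm_sub sphi => q [].
- by move=> y iy [Vy [V1y V2y]]; split; [exact: H1|exact: H2|exact: H].
Qed.

(* Multiplicativity of theta is an equality of forms on G^(2), up to the function [act_lc] whose
   differential is expressed through eta; the exterior derivative of it is taken in charts, where
   G^(2) is the zero set of the submersion (x, y) |-> s(x) - t(y). *)
Lemma curv_tmul a b g h v w v' w' : tcomp g h v w -> tcomp g h v' w' ->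
  tdom a (src g) -> tdom b (tgt g) ->
  lc b (vtgt (curv (tmul v w) (tmul v' w'))) =
  lc b (vtgt (curv v v')) + act_lc a b g * lc a (vtgt (curv w w'))
  - et v * (act_lc a b g * lc a (vtgt (theta w')))
  + et v' * (act_lc a b g * lc a (vtgt (theta w))).
Proof.
move=> tc tc' ag bg; have [cgh fv fw E] := tc; have [_ fv' fw' E'] := tc'.
have [pg ph Es] := cgh; have pm := pts_mul lG cgh.
have fm := tmul_fib lG tc; have fm' := tmul_fib lG tc'.
have ah : tdom a (tgt h) by rewrite -[tgt h]Es.
have bm : tdom b (tgt (mul g h)) by rewrite lie_tgt_mul.
have [[i1 i2] [j [F rF]]] := lie_mul lG (g, h) cgh.
have [/= [ig ih] [U [oO Op sF HF]]] := (is_repP _ _ _ _ _ _).1 rF.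
have [jm EF] := HF (g, h) cgh (conj ig ih) Op; rewrite /= in jm EF.
have [s0 og] := (mfd_cover (lie_obj lG) (src g)).1 (pts_src lG pg).
have oh : cdom s0 (tgt h) by rewrite -[tgt h]Es.
have [V1 [S [oV1 V1g sS HS]]] := smap_chart_rep gO (smap_src lG pg) ig og.
have [V2 [T [oV2 V2h sT HT]]] := smap_chart_rep gO (smap_tgt lG ph) ih oh.
have [V3 [beta [oV3 V3m sb Hb]]] := fcomp_chart bm jm.
have [V4 [gam [oV4 V4g sg Hg]]] := fcomp_chart bg ig.
have [V5 [del [oV5 V5h sd Hd]]] := fcomp_chart ah ih.
have [V6 [phi [oV6 V6g sphi Hphi]]] := act_lc_chart ag bg ig.
(* The images of the charts belong to the domain, so that every point of [O'] comes from a pair of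
   arrows. *)
pose C1 := cmap i1 @` @cdom R (arr G) i1; pose C2 := cmap i2 @` @cdom R (arr G) i2.
have oC1 : open C1 := mfd_open (lie_arr lG) i1; have oC2 : open C2 := mfd_open (lie_arr lG) i2.
pose W1 := [set q | V1 q /\ (V4 q /\ (V6 q /\ C1 q))].
pose W2 := [set q | V2 q /\ (V5 q /\ C2 q)].
have oW1 : open W1 by do 3! apply: openI => //.
have oW2 : open W2 by do 2! apply: openI => //.
pose O' := [set z | [/\ U z, W1 (lsubmx z), W2 (rsubmx z) & V3 (F z)]].
pose Phi (z : 'rV[R]_(dim (arr G) + dim (arr G))) := S (lsubmx z) - T (rsubmx z).
have oO' : open O'.
  have -> : O' = [set z | U z /\ V3 (F z)] `&` ([set z | W1 (lsubmx z)] `&` [set z | W2 (rsubmx z)]).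
    by apply/seteqP; split=> z /=; [case=> *; split|case=> -[? ?] [? ?]; split].
  apply: openI; first exact: open_comp_on.
  by apply: openI; [exact: open_lsub|exact: open_rsub].
pose p : 'rV[R]_(dim (arr G) + dim (arr G)) := row_mx (cmap i1 g) (cmap i2 h).
have Wp1 : W1 (cmap i1 g) by split=> //; split=> //; split=> //; exists g.
have Wp2 : W2 (cmap i2 h) by split=> //; split=> //; exists h.
have O'p : O' p by split; rewrite ?row_mxKl ?row_mxKr //; rewrite -EF.
have sPhi : smv O' Phi.
  have s1 : smv O' (fun z => S (lsubmx z)).
    move=> k; apply: (sm_comp oO' _ _ (sS k)) => [z [_ [? _] _ _] //|]; exact: smv_lsub.
  have s2 : smv O' (fun z => T (rsubmx z)).
    move=> k; apply: (sm_comp oO' _ _ (sT k)) => [z [_ _ [? _] _] //|]; exact: smv_rsub.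
  move=> k; apply: (sm_ext oO' _ (smD oO' (s1 k) (smN oO' (s2 k)))) => z _.
  by rewrite /Phi !mxE.
have dPhi z (u : 'rV[R]_(dim (arr G) + dim (arr G))) : O' z ->
    dv Phi z u = dv S (lsubmx z) (lsubmx u) - dv T (rsubmx z) (rsubmx u).
  move=> [_ [V1z _] [V2z _] _].
  have [l1 l2] := dv_lsub z u; have [r1 r2] := dv_rsub z u.
  have S1 := smv_dfv sS V1z; have T1 := smv_dfv sT V2z.
  rewrite -l2 -r2 -(dv_comp u l1 S1) -(dv_comp u r1 T1); apply/rowP => k.
  rewrite !mxE -ddB; [|exact: (dfv_comp l1 S1)|exact: (dfv_comp r1 T1)].
  by congr dd; apply/funext => x; rewrite /Phi !mxE.
have pts1 z : O' z -> exists x y, [/\ cdom i1 x, cdom i2 y & z = row_mx (cmap i1 x) (cmap i2 y)].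
  move=> [_ [_ [_ [_ [x ix Ex]]]] [_ [_ [y iy Ey]]] _].
  by exists x, y; split=> //; rewrite Ex Ey hsubmxK.
have tcz x y : cdom i1 x -> cdom i2 y -> O' (row_mx (cmap i1 x) (cmap i2 y)) ->
    Phi (row_mx (cmap i1 x) (cmap i2 y)) = 0 -> composable G (x, y).
  move=> ix iy [_]; rewrite row_mxKl row_mxKr => -[V1x _] [V2y _] _.
  rewrite /Phi row_mxKl row_mxKr => /eqP; rewrite subr_eq0 => /eqP Exy.
  have [ox Sx] := HS x ix V1x; have [oy Ty] := HT y iy V2y.
  split; [exact: premfd_cov ix|exact: premfd_cov iy|rewrite /=].
  by apply: (mfd_inj (lie_obj lG) ox oy); rewrite Sx Ty.
have Phip : Phi p = 0.
  have [_ Sg] := HS g ig V1g; have [_ Th] := HT h ih V2h.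
  by rewrite /Phi row_mxKl row_mxKr -Sg -Th [src g]Es subrr.
have coefS x (u : tangent (arr G)) : cdom i1 x -> V1 (cmap i1 x) -> TA x u ->
    tcoef (dsrc u) s0 = dv S (cmap i1 x) (tcoef u i1).
  move=> ix V1x [tu bu]; have e : tbase u = x := bu; rewrite -e in ix V1x *.
  apply: (dmap_chart lA lO tu (smap_src lG _)); first by case: tu.
  apply/is_repP; split=> //; exists V1; split=> // y _; exact: HS.
have coefT x (u : tangent (arr G)) : cdom i2 x -> V2 (cmap i2 x) -> TA x u ->
    tcoef (dtgt u) s0 = dv T (cmap i2 x) (tcoef u i2).
  move=> ix V1x [tu bu]; have e : tbase u = x := bu; rewrite -e in ix V1x *.
  apply: (dmap_chart lA lO tu (smap_tgt lG _)); first by case: tu.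
  apply/is_repP; split=> //; exists V2; split=> // y _; exact: HT.
(* A variation of the first arrow alone suffices, because the source map is a submersion. *)
have surj u : exists x, dv Phi p x = u.
  have [y [ty ey yo]] := tvec_of_coef lO u og.
  have [x fx Ex] := lie_src_subm lG pg (conj ty ey).
  exists (row_mx (tcoef x i1) 0); rewrite dPhi // /p !row_mxKl !row_mxKr -(coefS g) //.
  by rewrite Ex yo -[X in dv T _ X](scale0r 0) dvZr scale0r subr0.
have mult z : O' z -> Phi z = 0 -> forall u, dv Phi z u = 0 ->
    \sum_l beta l (F z) * dv F z u 0 l =
    \sum_l gam l (lsubmx z) * lsubmx u 0 l
      + phi (lsubmx z) * \sum_l del l (rsubmx z) * rsubmx u 0 l.
  move=> Oz Pz u; have [x [y [ix iy ez]]] := pts1 z Oz; rewrite (dPhi _ _ Oz).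
  move: Oz Pz; rewrite ez => Oz Pz; have cxy := tcz x y ix iy Oz Pz.
  move: (Oz) => [Oxy]; rewrite !row_mxKl !row_mxKr => -[V1x [V4x [V6x _]]] [V2y [V5y _]] V3xy.
  (* A vector in the kernel of the differential of [Phi] is a composable pair of tangent vectors, to
     which multiplicativity of [theta] applies. *)
  have [xi [ti ei ci]] := tvec_of_coef lA (lsubmx u) ix.
  have [ze [tze eze cze]] := tvec_of_coef lA (rsubmx u) iy.
  rewrite -ci -cze -(coefS x) // -(coefT y) //.
  move=> /eqP; rewrite subr_eq0 => /eqP Euv.
  have [px py sxy] := cxy; have [ox Sx] := HS x ix V1x.
  have d1 := dsrc_fib lG (conj ti ei); have d2 := dtgt_fib lG (conj tze eze).
  have tcu : tcomp x y xi ze.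
    split=> //; have [t1 b1] := d1; have [t2 b2] := d2.
    apply: (tvec_eq (i := s0) gO t1 t2 _ _ Euv); first by rewrite [LHS]b1 [RHS]b2.
    by rewrite [tbase _]b1.
  have [jxy Fxy] := HF (x, y) cxy (conj ix iy) Oxy; rewrite /= in jxy Fxy.
  have rxy : is_rep (composable G) (fun p : mprod (arr G) (arr G) => mul p.1 p.2)
    ((i1, i2) : cidx (mprod (arr G) (arr G))) j (x, y) F.
    by apply/is_repP; split=> //; exists U.
  have Cm := tmul_coef lG tcu rxy; rewrite ci cze hsubmxK in Cm.
  have [ax bx phix] := Hphi x ix V6x.
  have ay : tdom a (tgt y) by rewrite -[tgt y]sxy.
  have fu := tmul_fib lG tcu.
  have bxy : tdom b (tgt (mul x y)) by rewrite lie_tgt_mul.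
  have := theta_tmul_lc tcu ax bx.
  rewrite (theta_coef fu jxy bxy _ Hb); last by rewrite Fxy.
  rewrite (theta_coef (conj ti ei) ix bx V4x Hg) (theta_coef (conj tze eze) iy ay V5y Hd).
  by rewrite Fxy Cm phix.
have H0 u : tcomp g h u.1 u.2 -> let u' := row_mx (tcoef u.1 i1) (tcoef u.2 i2) in
    dv Phi p u' = 0 /\ tcoef (tmul u.1 u.2) j = dv F p u'.
  move: u => [u1 u2] /= tcu; split; last exact: (tmul_coef lG tcu rF).
  rewrite dPhi // /p !row_mxKl !row_mxKr; have [_ f1 f2 E12] := tcu.
  by rewrite -(coefS g) // -(coefT h) // E12 subrr.
have [K1 C1'] := H0 (v, w) tc; have [K2 C2'] := H0 (v', w') tc'; rewrite /= in K1 C1' K2 C2'.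
have sF' : smv O' F by move=> k; apply: sm_sub (sF k) => z [].
have sg' k : sm W1 (gam k) by apply: sm_sub (sg k) => q [_ []].
have sd' k : sm W2 (del k) by apply: sm_sub (sd k) => q [_ []].
have sp' : sm W1 phi by apply: sm_sub sphi => q [_ [_ []]].
have := multiplicative_eder oO' (fun z Oz => let: And4 _ w _ _ := Oz in w)
  (fun z Oz => let: And4 _ _ w _ := Oz in w) (fun z Oz => let: And4 _ _ _ w := Oz in w)
  sF' sPhi sb sg' sd' sp' O'p Phip surj mult K1 K2.
rewrite /p -C1' -C2' !row_mxKl !row_mxKr -EF => Heder.
have [_ X1] := curvP fm fm'; have [_ X2] := curvP fv fv'; have [_ X3] := curvP fw fw'.
rewrite (X1 b j bm jm) (X2 b i1 bg ig) (X3 a i2 ah ih).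
rewrite (curv_formula_eder fm fm' jm oV3 V3m sb Hb) (curv_formula_eder fv fv' ig oV4 V4g sg Hg).
rewrite (curv_formula_eder fw fw' ih oV5 V5h sd Hd) Heder.
rewrite (dmap_tgt_tmul lG tc) (dmap_tgt_tmul lG tc') (theta_tmul_lc tc ag bg) (theta_tmul_lc tc' ag bg).
have [ag' bg' phig] := Hphi g ig V6g.
have Dphi (u : tangent (arr G)) : TA g u -> deriv u (act_lc a b) = dd phi (cmap i1 g) (tcoef u i1).
  move=> [tu bu]; have eu : tbase u = g := bu; rewrite -eu.
  apply: (deriv_chart lA tu _ oV6 _ sphi) => [||y iy Vy]; rewrite ?eu //.
  by have [] := Hphi y iy Vy.
(* The differential of the action factor, which the exterior derivative has produced, is expressed
   by [eta] and connection forms; the latter cancel against the connection terms of the three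
   curvatures. *)
have F1 := eta_formula fv ag bg; have F2 := eta_formula fv' ag bg.
rewrite (Dphi v fv) in F1; rewrite (Dphi v' fv') in F2.
rewrite -(theta_coef fw' ih ah V5h Hd) -(theta_coef fw ih ah V5h Hd) -phig.
rewrite ![et _ * (_ * _)]mulrA F1 F2 E E'.
by ring.
Qed.

(** * Bilinearity of K, values on units, smoothness *)

Lemma tangent_add g v w : TA g v -> TA g w -> TA g (vadd v w).
Proof. by move=> [tv bv] [tw bw]; split=> //; apply: (tvecD tv tw); rewrite [LHS]bv [RHS]bw. Qed.

Lemma tangent_scal g r v : TA g v -> TA g (vscal r v).
Proof. by move=> [tv bv]; split=> //; exact: (tvecZ r tv). Qed.

Lemma tangent_zero g : pts (arr G) g -> TA g (vzero (tangent (arr G)) g).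
Proof. by move=> pg; split=> //; exact: (tvec0 pg). Qed.

Lemma tangent_scal0 g v : TA g v -> vscal 0 v = vzero (tangent (arr G)) g.
Proof.
by move=> [_ bv]; rewrite /= [tbase v]bv; congr TVec; apply/funext => i; rewrite scale0r.
Qed.

Lemma chart_ex g : pts (arr G) g -> exists i : cidx (arr G), cdom i g.
Proof. exact: (mfd_cover (lie_arr lG) g).1. Qed.

Lemma curv_fib g v w : TA g v -> TA g w -> fib (vtop L) g (K v w).
Proof. by move=> fv fw; have [] := curvP fv fw. Qed.

Lemma theta_fib g v : TA g v -> fib (vtop L) g (theta v).
Proof. exact: form_fib. Qed.

(** One [beta] serves all [v] and [w]; antisymmetry and linearity of [K] are then inherited from
    [eder], [theta] and the connection form. *)
Lemma curv_eder b i g : tdom b (tgt g) -> cdom i g -> exists beta, forall v w, TA g v -> TA g w ->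
  lc b (vtgt (K v w)) = eder beta (cmap i g) (tcoef v i) (tcoef w i)
  + lc b (vtgt (theta w)) * cform nab b (dtgt v) - lc b (vtgt (theta v)) * cform nab b (dtgt w).
Proof.
move=> bg ig; have [V [beta [oV Vg sb H]]] := fcomp_chart bg ig.
exists beta => v w fv fw; rewrite ((curvP fv fw).2 b i bg ig).
by rewrite (curv_formula_eder fv fw ig oV Vg sb H).
Qed.

Lemma vtgt_lc_inj b g (l l' : vtop L) : tdom b (tgt g) -> fib (vtop L) g l -> fib (vtop L) g l' ->
  lc b (vtgt l) = lc b (vtgt l') -> l = l'.
Proof. by move=> bg fl fl'; exact: (pc_inj vT vB rB Tm (vtgt_inj) bg fl fl'). Qed.

Lemma curv_anti g v w : TA g v -> TA g w -> K w v = vopp (K v w).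
Proof.
move=> fv fw; have pg := TA_pts fv; have [b bg] := vb_cover vB (pts_tgt lG pg).
have [i ig] := chart_ex pg; have [beta H] := curv_eder bg ig; have fk := curv_fib fv fw.
apply: (vtgt_lc_inj bg (curv_fib fw fv) (vopp_fib vT fk)).
rewrite (pcN vT vB Tm pg bg fk) !H //.
have -> : eder beta (cmap i g) (tcoef w i) (tcoef v i) = - eder beta (cmap i g) (tcoef v i) (tcoef w i).
  by rewrite /eder -sumrN; apply: eq_bigr => k _; rewrite opprB.
by ring.
Qed.

Lemma curvDl g v v' w : TA g v -> TA g v' -> TA g w -> K (vadd v v') w = vadd (K v w) (K v' w).
Proof.
move=> fv fv' fw; have pg := TA_pts fv; have [b bg] := vb_cover vB (pts_tgt lG pg).
have [i ig] := chart_ex pg; have [beta H] := curv_eder bg ig.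
have f1 := curv_fib fv fw; have f2 := curv_fib fv' fw; have fD := tangent_add fv fv'.
apply: (vtgt_lc_inj bg (curv_fib fD fw) (vb_add vT f1 f2)).
rewrite (pcD vT vB Tm pg bg f1 f2) !H // (vbmor_add ft pg fv fv').
rewrite (pcD vT vB Tm pg bg (theta_fib fv) (theta_fib fv')).
have e : tbase v = g by case: fv. have e' : tbase v' = g by case: fv'.
rewrite (dmapD lA lO) ?e ?e' //; [|by case: fv|by case: fv'|exact: smap_tgt].
have [d1 b1] := dtgt_fib lG fv; have [d2 b2] := dtgt_fib lG fv'.
rewrite (cformD vB rB cnab (a := b) d1 d2) //; last 2 first.
- by rewrite [LHS]b1 [RHS]b2.
- by rewrite [tbase _]b1.
have -> : eder beta (cmap i g) (tcoef (vadd v v') i) (tcoef w i) =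
    eder beta (cmap i g) (tcoef v i) (tcoef w i) + eder beta (cmap i g) (tcoef v' i) (tcoef w i).
  rewrite /eder -big_split; apply: eq_bigr => k _ /=; rewrite ddDr mxE; ring.
by ring.
Qed.

Lemma curvZl g r v w : TA g v -> TA g w -> K (vscal r v) w = vscal r (K v w).
Proof.
move=> fv fw; have pg := TA_pts fv; have [b bg] := vb_cover vB (pts_tgt lG pg).
have [i ig] := chart_ex pg; have [beta H] := curv_eder bg ig.
have f1 := curv_fib fv fw; have fZ := tangent_scal r fv.
apply: (vtgt_lc_inj bg (curv_fib fZ fw) (vb_scal vT r f1)).
rewrite (pcZ vT vB Tm pg bg r f1) !H // (vbmor_scal ft r pg fv).
rewrite (pcZ vT vB Tm pg bg r (theta_fib fv)).
have e : tbase v = g by case: fv.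
rewrite (dmapZ lA lO) ?e //; [|by case: fv|exact: smap_tgt].
have [d1 b1] := dtgt_fib lG fv.
rewrite (cformZ vB rB cnab (a := b) r d1) //; last by rewrite [tbase _]b1.
have -> : eder beta (cmap i g) (tcoef (vscal r v) i) (tcoef w i) =
    r * eder beta (cmap i g) (tcoef v i) (tcoef w i).
  rewrite /eder mulr_sumr; apply: eq_bigr => k _ /=; rewrite ddZr mxE; ring.
by ring.
Qed.

Lemma curvDr g v w w' : TA g v -> TA g w -> TA g w' -> K v (vadd w w') = vadd (K v w) (K v w').
Proof.
move=> fv fw fw'; have pg := TA_pts fv; have fD := tangent_add fw fw'.
rewrite (curv_anti fD fv) (curvDl fw fw' fv) (curv_anti fv fw) (curv_anti fv fw').
have f1 := curv_fib fv fw; have f2 := curv_fib fv fw'.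
have [b bg] := vb_cover vB (pts_tgt lG pg).
have n1 := vopp_fib vT f1; have n2 := vopp_fib vT f2.
apply: (vtgt_lc_inj bg (vopp_fib vT (vb_add vT n1 n2)) (vb_add vT f1 f2)).
rewrite (pcN vT vB Tm pg bg (vb_add vT n1 n2)) (pcD vT vB Tm pg bg n1 n2) (pcD vT vB Tm pg bg f1 f2).
by rewrite (pcN vT vB Tm pg bg f1) (pcN vT vB Tm pg bg f2) opprD !opprK.
Qed.

Lemma curvZr g r v w : TA g v -> TA g w -> K v (vscal r w) = vscal r (K v w).
Proof.
move=> fv fw; have pg := TA_pts fv; have fZ := tangent_scal r fw.
rewrite (curv_anti fZ fv) (curvZl r fw fv) (curv_anti fv fw).
have f1 := curv_fib fv fw; have [b bg] := vb_cover vB (pts_tgt lG pg).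
have n1 := vopp_fib vT f1; have n2 := vb_scal vT r n1.
apply: (vtgt_lc_inj bg (vopp_fib vT n2) (vb_scal vT r f1)).
rewrite (pcN vT vB Tm pg bg n2) (pcZ vT vB Tm pg bg r n1) (pcN vT vB Tm pg bg f1).
by rewrite (pcZ vT vB Tm pg bg r f1) mulrN opprK.
Qed.

Lemma curv0r g v : TA g v -> K v (vzero (tangent (arr G)) g) = vzero (vtop L) g.
Proof.
move=> fv; have f0 := tangent_zero (TA_pts fv).
rewrite -(tangent_scal0 f0) (curvZr 0 fv f0); exact: (vscal0 vT (curv_fib fv f0)).
Qed.

Lemma theta0 g : pts (arr G) g -> theta (vzero (tangent (arr G)) g) = vzero (vtop L) g.
Proof.
move=> pg; have f0 := tangent_zero pg; rewrite -{1}(tangent_scal0 f0) (vbmor_scal ft 0 pg f0).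
exact: (vscal0 vT (theta_fib f0)).
Qed.

Lemma eta0 g : pts (arr G) g -> et (vzero (tangent (arr G)) g) = 0.
Proof.
by move=> pg; have f0 := tangent_zero pg; rewrite -(tangent_scal0 f0) (etaZ 0 f0) mul0r.
Qed.

Lemma dunt_comp x u : TO x u -> tcomp (unt x) (unt x) (dunt u) (dunt u) /\ tmul (dunt u) (dunt u) = dunt u.
Proof.
move=> fu; have px : pts (obj G) x by case: fu => -[px _ _] <-.
by have := tmul_unt lG (dunt_fib lG fu); rewrite (dsrc_unt lG fu) lie_src_unt.
Qed.

Lemma mul_units x : pts (obj G) x -> mul (unt x) (unt x) = unt x.
Proof. by move=> px; have := lie_mul_unt lG (pts_unt lG px); rewrite lie_src_unt. Qed.

(** A unit vector is its own square, so [theta] equals itself plus an invertible multiple of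
    itself. *)
Lemma theta_unit x u : TO x u -> theta (dunt u) = vzero (vtop L) (unt x).
Proof.
move=> fu; have [tc E] := dunt_comp fu; have px : pts (obj G) x by case: fu => -[px _ _] <-.
have pu := pts_unt lG px; have [b bx] := vb_cover vB (pts_tgt lG pu).
have ax : tdom b (src (unt x)) by rewrite lie_src_unt // -{1}(lie_tgt_unt lG px).
have := theta_tmul_lc tc ax bx; rewrite E => H.
have ff := theta_fib (dunt_fib lG fu).
apply: (vtgt_lc_inj bx ff (vb_zero vT pu)); rewrite (pc0 vT vB Tm pu bx).
have f0 := act_lc_neq0 pu ax bx; apply: (mulfI f0); rewrite mulr0.
by apply/eqP; rewrite -[X in _ == X](subrr (lc b (vtgt (theta (dunt u))))) {2}H addrAC subrr add0r.
Qed.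

Lemma eta_unit x u : TO x u -> et (dunt u) = 0.
Proof.
move=> fu; have [tc E] := dunt_comp fu; have := eta_tmul tc; rewrite E => /eqP.
by rewrite -subr_eq0 opprD addrA subrr sub0r oppr_eq0 => /eqP.
Qed.

(** The argument of [theta_unit] once more; the correction terms in [curv_tmul] carry factors [eta]
    of unit vectors and vanish. *)
Lemma curv_unit x u u' : TO x u -> TO x u' -> K (dunt u) (dunt u') = vzero (vtop L) (unt x).
Proof.
move=> fu fu'; have [tc E] := dunt_comp fu; have [tc' E'] := dunt_comp fu'.
have px : pts (obj G) x by case: fu => -[px _ _] <-.
have pu := pts_unt lG px; have [b bx] := vb_cover vB (pts_tgt lG pu).
have ax : tdom b (src (unt x)) by rewrite lie_src_unt // -{1}(lie_tgt_unt lG px).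
have := curv_tmul tc tc' ax bx; rewrite E E' (eta_unit fu) (eta_unit fu') !mul0r subr0 addr0 => H.
have ff := curv_fib (dunt_fib lG fu) (dunt_fib lG fu').
apply: (vtgt_lc_inj bx ff (vb_zero vT pu)); rewrite (pc0 vT vB Tm pu bx).
have f0 := act_lc_neq0 pu ax bx; apply: (mulfI f0); rewrite mulr0.
apply/eqP; rewrite -[X in _ == X](subrr (lc b (vtgt (K (dunt u) (dunt u'))))) {2}H.
by rewrite addrAC subrr add0r.
Qed.

Lemma cform_tgt_smf b i x k : tdom b (tgt x) -> cdom i x ->
  smf x (fun z => cform nab b (dtgt (frame (E := tangent (arr G)) i z k))).
Proof.
move=> bx ix; have px := premfd_cov lA ix; have st := smap_tgt lG px.
have [j jx] := (mfd_cover (lie_obj lG) (tgt x)).1 (pts_tgt lG px).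
have [nj sj] := smap_chart gA gO st jx.
have s2 : smf x (fun y => \sum_l deriv (frame (E := tangent (arr G)) i y k) (fun z => cmap j (tgt z) 0 l) *
    cform nab b (frame (E := tangent (obj G)) j (tgt y) l)).
  apply: (smf_sum gA ix) => l; apply: (smfM gA).
    exact: (smf_deriv_frame lA k ix (sj l)).
  exact: (smf_smap gA gO st (cform_smf vB rB cnab l bx jx)).
apply: (smf_ext gA _ s2).
have nb := tdom_tgt_near px bx.
apply: mnearS (mnearI gA nb (mnearI gA nj (mnear_cdom ix))) => y [b_y [jy iy]].
have [fy cy] := frameP lA k iy; have [ty ey] := fy; have e' : tbase (frame (E := tangent (arr G)) i y k) = y := ey.
have [tw bw] := dtgt_fib lG fy; have bw' : tbase (dtgt (frame (E := tangent (arr G)) i y k)) = tgt y := bw.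
rewrite (cform_frame vB rB cnab b_y jy (conj tw bw)); apply: eq_bigr => l _; congr (_ * _).
rewrite -(deriv_coord lO l tw) ?bw' // (deriv_dmap lA lO ty) // ?e' //.
  by apply: (smap_tgt lG); exact: premfd_cov iy.
exact: smf_coord.
Qed.

Lemma curv_frame_smf b i x (j k : 'I_(dim (arr G))) : tdom b (tgt x) -> cdom i x ->
  smf x (fun z => lc b (vtgt (K (frame (E := tangent (arr G)) i z j) (frame (E := tangent (arr G)) i z k)))).
Proof.
move=> bx ix; have px := premfd_cov lA ix; pose th l := fcomp (@vtgt R G L) theta b i l.
have sth l : smf x (th l) := fcomp_smf vT vB rB Tm ft l bx ix.
pose e l y := frame (E := tangent (arr G)) i y l.
pose d l (l' : 'I_(dim (arr G))) : R := (delta_mx 0 l : 'rV[R]_(dim (arr G))) 0 l'.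
have s0 : smf x (fun y => \sum_l (deriv (e j y) (th l) * d k l - deriv (e k y) (th l) * d j l)).
  apply: (smf_sum gA ix) => l; apply: (smfB gA);
    apply: (smfM gA _ (smf_cst _ ix)); exact: (smf_deriv_frame lA _ ix (sth l)).
have s1 := smfM gA (sth k) (cform_tgt_smf j bx ix).
have s2 := smfM gA (sth j) (cform_tgt_smf k bx ix).
apply: (smf_ext gA _ (smfB gA (smfD gA s0 s1) s2)).
apply: mnearS (mnearI gA (tdom_tgt_near px bx) (mnear_cdom ix)) => y [b_y iy].
have [fj cj] := frameP lA j iy; have [fk ck] := frameP lA k iy.
rewrite ((curvP fj fk).2 b i b_y iy) /curv_formula; congr (_ + _ - _).
by apply: eq_bigr => l _; rewrite cj ck.
Qed.

Lemma curv_frames b i g v w : tdom b (tgt g) -> cdom i g -> TA g v -> TA g w ->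
  lc b (vtgt (K v w)) = \sum_j tcoef v i 0 j * \sum_k tcoef w i 0 k *
    lc b (vtgt (K (frame (E := tangent (arr G)) i g j) (frame (E := tangent (arr G)) i g k))).
Proof.
move=> bg ig fv fw; have pg := TA_pts fv.
rewrite (form_frame (A := fun v => lc b (vtgt (K v w))) lA ig fv) => [|u u' fu fu'|r u fu]; last 2 first.
- by rewrite (curvDl fu fu' fw) (pcD vT vB Tm pg bg (curv_fib fu fw) (curv_fib fu' fw)).
- by rewrite (curvZl r fu fw) (pcZ vT vB Tm pg bg r (curv_fib fu fw)).
apply: eq_bigr => j _; congr (_ * _); have [fj _] := frameP lA j ig.
rewrite (form_frame (A := fun w => lc b (vtgt (K _ w))) lA ig fw) => [//|u u' fu fu'|r u fu].
- by rewrite (curvDr fj fu fu') (pcD vT vB Tm pg bg (curv_fib fj fu) (curv_fib fj fu')).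
- by rewrite (curvZr r fj fu) (pcZ vT vB Tm pg bg r (curv_fib fj fu)).
Qed.

(** * Values of eta and K on vector fields along a map *)

Section SmoothComponents.
Variables (P : mfd R) (x0 : P) (X Y : P -> tangent (arr G)) (f : P -> arr G) (i : cidx (arr G)).
Hypotheses (gP : smooth_atlas P) (sf : smap x0 f) (ix : cdom i (f x0)).
Hypothesis fX : mnear x0 (fun y => TA (f y) (X y)).
Hypothesis sX : forall k, smf x0 (fun y => tcoef (X y) i 0 k).

Let nix : mnear x0 (fun y => cdom i (f y)).
Proof. exact: (mnear_smap gP gA sf (mnear_cdom ix)). Qed.

Lemma eta_field_smf : smf x0 (fun y => et (X y)).
Proof.
have [p [px0 _]] := nix.
apply: (smf_ext gP (h := fun y => \sum_k tcoef (X y) i 0 k * et (frame (E := tangent (arr G)) i (f y) k))).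
  apply: mnearS (mnearI gP nix fX) => y [iy fy].
  rewrite (form_frame (A := et) lA iy fy) => [//|u u' fu fu'|r u fu].
    exact: (etaD fu fu').
  exact: (etaZ r fu).
apply: (smf_sum gP px0) => k; apply: (smfM gP (sX k)).
exact: (smf_smap gP gA sf (eta_smf k ix)).
Qed.

Hypothesis fY : mnear x0 (fun y => TA (f y) (Y y)).
Hypothesis sY : forall k, smf x0 (fun y => tcoef (Y y) i 0 k).

Lemma curv_field_smf b : tdom b (tgt (f x0)) -> smf x0 (fun y => lc b (vtgt (K (X y) (Y y)))).
Proof.
move=> bx; have [p [px0 _]] := nix; have px := premfd_cov lA ix.
have nb := mnear_smap gP gA sf (tdom_tgt_near px bx).
apply: (smf_ext gP (h := fun y => \sum_j tcoef (X y) i 0 j * \sum_k tcoef (Y y) i 0 k *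
    lc b (vtgt (K (frame (E := tangent (arr G)) i (f y) j) (frame (E := tangent (arr G)) i (f y) k))))).
  apply: mnearS (mnearI gP (mnearI gP nix nb) (mnearI gP fX fY)) => y [[iy b_y] [fy fy']].
  by rewrite (curv_frames b_y iy fy fy').
apply: (smf_sum gP px0) => j; apply: (smfM gP (sX j)).
apply: (smf_sum gP px0) => k; apply: (smfM gP (sY k)).
exact: (smf_smap gP gA sf (curv_frame_smf j k bx ix)).
Qed.

End SmoothComponents.

(** * The Morita curvature *)

Local Notation MK := (morita_kernel theta).
Local Notation MC := (morita_curv theta nab).
Local Notation MU := (morita_curv_units theta nab).

Lemma mk_fibP g (p : vtop MK) : fib (vtop MK) g p <-> TA g p.1 /\ TL g p.2.
Proof.
split=> [[[v1 v2 e] b]|[[v1 b1] [v2 b2]]]; last by split=> //; split=> //; rewrite b1 b2.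
by split; split=> //; rewrite -e.
Qed.

Lemma mkb_fibP x (p : vbot MK) : fib (vbot MK) x p <-> TO x p.1 /\ BL x p.2.
Proof.
split=> [[[v1 v2 e] b]|[[v1 b1] [v2 b2]]]; last by split=> //; split=> //; rewrite b1 b2.
by split; split=> //; rewrite -e.
Qed.

Lemma mk_vin (p : vtop MK) : vin p -> fib (vtop MK) (tbase p.1) p.
Proof. by move=> vp; split. Qed.

Lemma mkb_vin (p : vbot MK) : vin p -> fib (vbot MK) (tbase p.1) p.
Proof. by move=> vp; split. Qed.

Definition curv_pairing (p q : vtop MK) : vtop L :=
  vadd (vadd (K p.1 q.1) (vscal (et q.1) p.2)) (vscal (- et p.1) q.2).

Lemma morita_curvE g p q : fib (vtop MK) g p -> fib (vtop MK) g q -> MC p q = curv_pairing p q.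
Proof.
move=> fp fq; have [f1 f2] := (mk_fibP g p).1 fp; have [f3 f4] := (mk_fibP g q).1 fq.
have e : tbase p.1 = g by case: f1.
rewrite /morita_curv /dual_pair mkhomE; last by rewrite /= e.
by rewrite mkhomE //= e.
Qed.

(** Elements of Hom are functions on the whole carrier, so an equality between them also concerns
    vectors off the fibre, where both sides have to be the same zero vector. *)
Lemma morita_curv_off p q : ~ fib (vtop MK) (tbase p.1) q -> MC p q = vzero (vtop L) (tbase p.1).
Proof. by move=> nq; rewrite /morita_curv /dual_pair mkhom_off. Qed.

Lemma curv_pairing_fib g p q : fib (vtop MK) g p -> fib (vtop MK) g q -> TL g (curv_pairing p q).
Proof.
move=> /mk_fibP[f1 f2] /mk_fibP[f3 f4]; apply: (vb_add vT); last exact: (vb_scal vT).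
by apply: (vb_add vT (curv_fib f1 f3)); exact: (vb_scal vT).
Qed.

Lemma curv_pairing_lc b g p q : fib (vtop MK) g p -> fib (vtop MK) g q -> tdom b (tgt g) ->
  lc b (vtgt (curv_pairing p q)) =
  lc b (vtgt (K p.1 q.1)) + et q.1 * lc b (vtgt p.2) - et p.1 * lc b (vtgt q.2).
Proof.
move=> /mk_fibP[f1 f2] /mk_fibP[f3 f4] bg; have pg := TA_pts f1.
have g1 := curv_fib f1 f3; have g2 := vb_scal vT (et q.1) f2.
have g3 := vb_scal vT (- et p.1) f4.
rewrite (pcD vT vB Tm pg bg (vb_add vT g1 g2) g3) (pcD vT vB Tm pg bg g1 g2).
by rewrite !(pcZ vT vB Tm pg bg) // mulNr.
Qed.

Lemma mk_add g (p q : vtop MK) : fib (vtop MK) g p -> fib (vtop MK) g q -> fib (vtop MK) g (vadd p q).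
Proof.
move=> /mk_fibP[f1 f2] /mk_fibP[f3 f4]; apply/mk_fibP; split; [exact: tangent_add|exact: (vb_add vT)].
Qed.

Lemma mk_scal g r (p : vtop MK) : fib (vtop MK) g p -> fib (vtop MK) g (vscal r p).
Proof. by move=> /mk_fibP[f1 f2]; apply/mk_fibP; split; [exact: tangent_scal|exact: (vb_scal vT)]. Qed.

Lemma curv_pairingDr g p q q' : fib (vtop MK) g p -> fib (vtop MK) g q -> fib (vtop MK) g q' ->
  curv_pairing p (vadd q q') = vadd (curv_pairing p q) (curv_pairing p q').
Proof.
move=> fp fq fq'; have [f1 f2] := (mk_fibP g p).1 fp; have [f3 f4] := (mk_fibP g q).1 fq.
have [f5 f6] := (mk_fibP g q').1 fq'; have pg := TA_pts f1; have [b bg] := vb_cover vB (pts_tgt lG pg).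
have fm := curv_pairing_fib fp fq; have fm' := curv_pairing_fib fp fq'; have fD := mk_add fq fq'.
apply: (vtgt_lc_inj bg (curv_pairing_fib fp fD) (vb_add vT fm fm')).
rewrite (pcD vT vB Tm pg bg fm fm') !(curv_pairing_lc _ _ bg) //= (curvDr f1 f3 f5).
rewrite (pcD vT vB Tm pg bg (curv_fib f1 f3) (curv_fib f1 f5)).
rewrite (pcD vT vB Tm pg bg f4 f6) (etaD f3 f5); ring.
Qed.

Lemma curv_pairingDl g p p' q : fib (vtop MK) g p -> fib (vtop MK) g p' -> fib (vtop MK) g q ->
  curv_pairing (vadd p p') q = vadd (curv_pairing p q) (curv_pairing p' q).
Proof.
move=> fp fp' fq; have [f1 f2] := (mk_fibP g p).1 fp; have [f3 f4] := (mk_fibP g q).1 fq.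
have [f5 f6] := (mk_fibP g p').1 fp'; have pg := TA_pts f1; have [b bg] := vb_cover vB (pts_tgt lG pg).
have fm := curv_pairing_fib fp fq; have fm' := curv_pairing_fib fp' fq; have fD := mk_add fp fp'.
apply: (vtgt_lc_inj bg (curv_pairing_fib fD fq) (vb_add vT fm fm')).
rewrite (pcD vT vB Tm pg bg fm fm') !(curv_pairing_lc _ _ bg) //= (curvDl f1 f5 f3).
rewrite (pcD vT vB Tm pg bg (curv_fib f1 f3) (curv_fib f5 f3)).
rewrite (pcD vT vB Tm pg bg f2 f6) (etaD f1 f5); ring.
Qed.

Lemma curv_pairingZr g r p q : fib (vtop MK) g p -> fib (vtop MK) g q ->
  curv_pairing p (vscal r q) = vscal r (curv_pairing p q).
Proof.
move=> fp fq; have [f1 f2] := (mk_fibP g p).1 fp; have [f3 f4] := (mk_fibP g q).1 fq.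
have pg := TA_pts f1; have [b bg] := vb_cover vB (pts_tgt lG pg).
have fm := curv_pairing_fib fp fq; have fD := mk_scal r fq.
apply: (vtgt_lc_inj bg (curv_pairing_fib fp fD) (vb_scal vT r fm)).
rewrite (pcZ vT vB Tm pg bg r fm) !(curv_pairing_lc _ _ bg) //= (curvZr r f1 f3).
rewrite (pcZ vT vB Tm pg bg r (curv_fib f1 f3)) (pcZ vT vB Tm pg bg r f4).
rewrite (etaZ r f3); ring.
Qed.

Lemma curv_pairingZl g r p q : fib (vtop MK) g p -> fib (vtop MK) g q ->
  curv_pairing (vscal r p) q = vscal r (curv_pairing p q).
Proof.
move=> fp fq; have [f1 f2] := (mk_fibP g p).1 fp; have [f3 f4] := (mk_fibP g q).1 fq.
have pg := TA_pts f1; have [b bg] := vb_cover vB (pts_tgt lG pg).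
have fm := curv_pairing_fib fp fq; have fD := mk_scal r fp.
apply: (vtgt_lc_inj bg (curv_pairing_fib fD fq) (vb_scal vT r fm)).
rewrite (pcZ vT vB Tm pg bg r fm) !(curv_pairing_lc _ _ bg) //= (curvZl r f1 f3).
rewrite (pcZ vT vB Tm pg bg r (curv_fib f1 f3)) (pcZ vT vB Tm pg bg r f2).
rewrite (etaZ r f1); ring.
Qed.

Lemma morita_curv_is_hom g p : fib (vtop MK) g p -> fib (vtop (twisted_dual MK L)) g (MC p).
Proof.
move=> fp; have [f1 f2] := (mk_fibP g p).1 fp; have e : tbase p.1 = g by case: f1.
have pg := TA_pts f1; split; last exact: e.
apply: (is_homI (x := g)) => //.
- by move=> q fq; rewrite (morita_curvE fp fq); exact: curv_pairing_fib.
- by move=> q q' fq fq'; rewrite !(morita_curvE fp) //; [exact: curv_pairingDr fq fq'|exact: mk_add].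
- by move=> r q fq; rewrite !(morita_curvE fp) //; [exact: curv_pairingZr fq|exact: mk_scal].
- by move=> q nq; rewrite morita_curv_off e.
Qed.

Lemma morita_curv_add g (p q : vtop MK) : fib (vtop MK) g p -> fib (vtop MK) g q ->
  MC (vadd p q) = vadd (MC p) (MC q).
Proof.
move=> fp fq; have [f1 f2] := (mk_fibP g p).1 fp; have e : tbase p.1 = g by case: f1.
have [f3 _] := (mk_fibP g q).1 fq; have e' : tbase q.1 = g by case: f3.
apply: hom_eq => // z; have [fz|nz] := pselect (fib (vtop MK) g z).
  by have fD := mk_add fp fq; rewrite homb_addE !(@morita_curvE g) //; exact: (curv_pairingDl fp fq fz).
have pg := TA_pts f1.
by rewrite homb_addE !morita_curv_off /= ?e ?e' // (vsub0 vT pg).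
Qed.

Lemma morita_curv_scal g r (p : vtop MK) : fib (vtop MK) g p -> MC (vscal r p) = vscal r (MC p).
Proof.
move=> fp; have [f1 f2] := (mk_fibP g p).1 fp; have e : tbase p.1 = g by case: f1.
apply: hom_eq => // z; have [fz|nz] := pselect (fib (vtop MK) g z).
  by have fD := mk_scal r fp; rewrite homb_scalE !(@morita_curvE g) //; exact: (curv_pairingZl r fp fz).
have pg := TA_pts f1.
by rewrite homb_scalE !morita_curv_off /= ?e // (vscal0z vT r pg).
Qed.

(** The component in L of a core element has source zero, hence vanishes by [vsrc_ker]; what remains
    is an element of the Lie algebroid. *)
Lemma coreP x (c : vtop MK) : pts (obj G) x -> fib (core MK) x c <->
  [/\ TA (unt x) c.1, dsrc c.1 = vzero (tangent (obj G)) x & c.2 = vzero (vtop L) (unt x)].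
Proof.
move=> px; split=> [[[y [py fc [E1 E2]]] bc]|[f1 E1 E2]].
  have [g1 g2] := (mk_fibP _ c).1 fc; have exy : y = x.
    have [_ b1] := g1; rewrite -bc -(lie_src_unt lG py); congr src.
    by rewrite -(b1 : tbase c.1 = _).
  rewrite -exy; split=> //; apply: (vsrc_ker g2); by rewrite E2 lie_src_unt.
have pu := pts_unt lG px; split; last first.
  have [_ b1] := f1; rewrite -[RHS](lie_src_unt lG px); congr src.
  exact: b1.
exists x; split=> //; first by apply/mk_fibP; split=> //; rewrite E2; exact: (vb_zero vT).
by rewrite /= E1 E2 (vsrc_zero pu) lie_src_unt.
Qed.

Lemma core_algebroid x (c : vtop MK) : pts (obj G) x -> fib (core MK) x c -> fib (algebroid G) x c.1.
Proof.
move=> px /(coreP c px)[f1 E1 E2]; split; first by exists x.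
by have [_ b1] := f1; rewrite -[RHS](lie_src_unt lG px); congr src; exact: b1.
Qed.

Definition unit_pairing (p : vbot MK) (c : vtop MK) : vbot L :=
  vadd (vsrc (K (dunt p.1) c.1)) (vscal (et c.1) p.2).

Lemma morita_unitsE x p c : fib (vbot MK) x p -> fib (core MK) x c -> MU p c = unit_pairing p c.
Proof.
move=> fp fc; have [f1 f2] := (mkb_fibP x p).1 fp; have e : tbase p.1 = x by case: f1.
have px := fib_pts vB f2; rewrite /morita_curv_units /dual_core.
rewrite mkhomE; last by rewrite /= e.
by cbv beta; rewrite mkhomE // e; exact: core_algebroid.
Qed.

Lemma morita_units_off p c : ~ fib (core MK) (tbase p.1) c -> MU p c = vzero (vbot L) (tbase p.1).
Proof. by move=> nq; rewrite /morita_curv_units /dual_core mkhom_off. Qed.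

Lemma unit_pairing_fib x p c : fib (vbot MK) x p -> fib (core MK) x c -> BL x (unit_pairing p c).
Proof.
move=> /mkb_fibP[f1 f2] fc; have px := fib_pts vB f2; have [g1 g2 g3] := (coreP c px).1 fc.
apply: (vb_add vB); last exact: (vb_scal vB).
have := vsrc_fib (curv_fib (dunt_fib lG f1) g1).
by rewrite lie_src_unt.
Qed.

(** An element of L over a unit is itself a unit. Thus the source map, which identifies such
    elements with L_M in [morita_curv_units], may be replaced by the target map used in all
    coordinates here. *)
Lemma vsrc_vtgt_unt x l : pts (obj G) x -> TL (unt x) l -> vsrc l = vtgt l.
Proof.
move=> px fl; have [m fm ->] := vunt_surj px fl.
by rewrite (vsrc_unt fm) (vtgt_unt fm).
Qed.

Lemma unit_pairing_lc b x p c : fib (vbot MK) x p -> fib (core MK) x c -> tdom b x ->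
  lc b (unit_pairing p c) = lc b (vtgt (K (dunt p.1) c.1)) + et c.1 * lc b p.2.
Proof.
move=> /mkb_fibP[f1 f2] fc bx; have px := fib_pts vB f2; have [g1 g2 g3] := (coreP c px).1 fc.
have fk := curv_fib (dunt_fib lG f1) g1.
have fs := vsrc_fib fk; rewrite lie_src_unt // in fs.
rewrite (lcD vB bx fs (vb_scal vB _ f2)) (lcZ vB bx _ f2).
by rewrite (vsrc_vtgt_unt px fk).
Qed.

Lemma tangent_zeroD x : pts (obj G) x -> vadd (vzero (tangent (obj G)) x) (vzero (tangent (obj G)) x) = vzero (tangent (obj G)) x.
Proof. by move=> px; congr TVec; apply/funext => i /=; rewrite addr0. Qed.

Lemma core_addP x (c c' : vtop MK) : fib (core MK) x c -> fib (core MK) x c' -> pts (obj G) x ->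
  fib (core MK) x (vadd c c').
Proof.
move=> + + px; move=> /(coreP c px)[f1 f2 f3] /(coreP c' px)[f4 f5 f6]; have pu := pts_unt lG px.
apply/(coreP _ px); split; first exact: tangent_add.
  rewrite /= (dmapD lA lO) ?f2 ?f5 ?tangent_zeroD //; [by case: f1|by case: f4| |].
    by have [_ b1] := f1; have [_ b4] := f4; rewrite [LHS]b1 [RHS]b4.
  by have [_ b1] := f1; rewrite [tbase _]b1; exact: smap_src.
by rewrite /= f3 f6 (vsub0 vT pu).
Qed.

Lemma core_scalP x r (c : vtop MK) : fib (core MK) x c -> pts (obj G) x ->
  fib (core MK) x (vscal r c).
Proof.
move=> + px; move=> /(coreP c px)[f1 f2 f3]; have pu := pts_unt lG px.
apply/(coreP _ px); split; first exact: tangent_scal.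
  rewrite /= (dmapZ lA lO) ?f2 //; [|by case: f1|].
    by rewrite /=; congr TVec; apply/funext => i; rewrite scaler0.
  by have [_ b1] := f1; rewrite [tbase _]b1; exact: smap_src.
by rewrite /= f3 (vscal0z vT r pu).
Qed.

Lemma morita_units_is_hom x p : fib (vbot MK) x p -> fib (vbot (twisted_dual MK L)) x (MU p).
Proof.
move=> fp; have [f1 f2] := (mkb_fibP x p).1 fp; have e : tbase p.1 = x by case: f1.
have px := fib_pts vB f2; have pu := pts_unt lG px; split; last exact: e.
have [b bx] := vb_cover vB px; have du := dunt_fib lG f1.
have bu : tdom b (tgt (unt x)) by rewrite lie_tgt_unt.
apply: (is_homI (x := x)) => //.
- by move=> q fq; rewrite (morita_unitsE fp fq); exact: unit_pairing_fib.
- move=> q q' fq fq'; have fD := core_addP fq fq' px; rewrite !(morita_unitsE fp) //.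
  have m1 := unit_pairing_fib fp fq; have m2 := unit_pairing_fib fp fq'.
  apply: (lc_inj vB rB bx (unit_pairing_fib fp fD) (vb_add vB m1 m2)).
  have [g1 _ _] := (coreP q px).1 fq; have [g2 _ _] := (coreP q' px).1 fq'.
  rewrite (lcD vB bx m1 m2) !(unit_pairing_lc fp _ bx) // (curvDr du g1 g2) (etaD g1 g2).
  rewrite (pcD vT vB Tm pu bu (curv_fib du g1) (curv_fib du g2)); ring.
- move=> r q fq; have fD := core_scalP r fq px; rewrite !(morita_unitsE fp) //.
  have m1 := unit_pairing_fib fp fq; apply: (lc_inj vB rB bx (unit_pairing_fib fp fD) (vb_scal vB r m1)).
  have [g1 _ _] := (coreP q px).1 fq.
  rewrite (lcZ vB bx r m1) !(unit_pairing_lc fp _ bx) // (curvZr r du g1) (etaZ r g1).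
  rewrite (pcZ vT vB Tm pu bu r (curv_fib du g1)); ring.
- by move=> q nq; rewrite morita_units_off e.
Qed.

Lemma mkb_add x (p q : vbot MK) : fib (vbot MK) x p -> fib (vbot MK) x q -> fib (vbot MK) x (vadd p q).
Proof.
move=> /mkb_fibP[f1 f2] /mkb_fibP[f3 f4]; apply/mkb_fibP; split; last exact: (vb_add vB).
have [t1 b1] := f1; have [t3 b3] := f3; split=> //; apply: (tvecD t1 t3).
by rewrite [LHS]b1 [RHS]b3.
Qed.

Lemma mkb_scal x r (p : vbot MK) : fib (vbot MK) x p -> fib (vbot MK) x (vscal r p).
Proof.
move=> /mkb_fibP[f1 f2]; apply/mkb_fibP; split; last exact: (vb_scal vB).
by have [t1 b1] := f1; split=> //; exact: (tvecZ r t1).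
Qed.

Lemma morita_units_add x (p q : vbot MK) : fib (vbot MK) x p -> fib (vbot MK) x q ->
  MU (vadd p q) = vadd (MU p) (MU q).
Proof.
move=> fp fq; have [f1 f2] := (mkb_fibP x p).1 fp; have e : tbase p.1 = x by case: f1.
have [f3 f4] := (mkb_fibP x q).1 fq; have e' : tbase q.1 = x by case: f3.
have px := fib_pts vB f2; have pu := pts_unt lG px; have [b bx] := vb_cover vB px.
have bu : tdom b (tgt (unt x)) by rewrite lie_tgt_unt.
apply: hom_eq => // c; have [fc|nc] := pselect (fib (core MK) x c); last first.
  by rewrite homb_addE !morita_units_off /= ?e ?e' // (vsub0 vB px).
have fD := mkb_add fp fq; rewrite homb_addE !(@morita_unitsE x) //.
have m1 := unit_pairing_fib fp fc; have m2 := unit_pairing_fib fq fc.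
apply: (lc_inj vB rB bx (unit_pairing_fib fD fc) (vb_add vB m1 m2)).
have [g1 _ _] := (coreP c px).1 fc; have d1 := dunt_fib lG f1; have d3 := dunt_fib lG f3.
rewrite (lcD vB bx m1 m2) !(unit_pairing_lc _ fc bx) //= (lcD vB bx f2 f4).
rewrite (dmapD lO lA) ?e ?e' //; [|by case: f1|by case: f3|exact: smap_unt].
rewrite (curvDl d1 d3 g1).
rewrite (pcD vT vB Tm pu bu (curv_fib d1 g1) (curv_fib d3 g1)); ring.
Qed.

Lemma morita_units_scal x r (p : vbot MK) : fib (vbot MK) x p -> MU (vscal r p) = vscal r (MU p).
Proof.
move=> fp; have [f1 f2] := (mkb_fibP x p).1 fp; have e : tbase p.1 = x by case: f1.
have px := fib_pts vB f2; have pu := pts_unt lG px; have [b bx] := vb_cover vB px.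
have bu : tdom b (tgt (unt x)) by rewrite lie_tgt_unt.
apply: hom_eq => // c; have [fc|nc] := pselect (fib (core MK) x c); last first.
  by rewrite homb_scalE !morita_units_off /= ?e // (vscal0z vB r px).
have fD := mkb_scal r fp; rewrite homb_scalE !(@morita_unitsE x) //.
have m1 := unit_pairing_fib fp fc.
apply: (lc_inj vB rB bx (unit_pairing_fib fD fc) (vb_scal vB r m1)).
have [g1 _ _] := (coreP c px).1 fc; have d1 := dunt_fib lG f1.
rewrite (lcZ vB bx r m1) !(unit_pairing_lc _ fc bx) //= (lcZ vB bx r f2).
rewrite (dmapZ lO lA) ?e //; [|by case: f1|exact: smap_unt].
rewrite (curvZl r d1 g1).
rewrite (pcZ vT vB Tm pu bu r (curv_fib d1 g1)); ring.
Qed.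

Lemma dsrc_zero g : pts (arr G) g -> dsrc (vzero (tangent (arr G)) g) = vzero (tangent (obj G)) (src g).
Proof.
move=> pg; have f0 := tangent_zero pg; have [t0 _] := f0.
have [_ b1] := dsrc_fib lG f0.
rewrite -{1}(tangent_scal0 f0) (dmapZ lA lO 0 t0); last exact: smap_src.
by move: b1; case: (dsrc _) => x c /= ->; congr TVec; apply/funext => i; rewrite scale0r.
Qed.

Lemma dtgt_zero g : pts (arr G) g -> dtgt (vzero (tangent (arr G)) g) = vzero (tangent (obj G)) (tgt g).
Proof.
move=> pg; have f0 := tangent_zero pg; have [t0 _] := f0.
have [_ b1] := dtgt_fib lG f0.
rewrite -{1}(tangent_scal0 f0) (dmapZ lA lO 0 t0); last exact: smap_tgt.
by move: b1; case: (dtgt _) => x c /= ->; congr TVec; apply/funext => i; rewrite scale0r.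
Qed.

Lemma act_lc_unit b x : pts (obj G) x -> tdom b x -> act_lc b b (unt x) = 1.
Proof.
move=> px bx; rewrite /act_lc lie_src_unt //; have [ff f1] := lfP vB rB bx.
by rewrite (lact_unt px ff).
Qed.

Lemma vtgt_lsinv_lc a b g m : pts (arr G) g -> BL (src g) m -> tdom a (src g) -> tdom b (tgt g) ->
  lc b (vtgt (lsinv (L := L) g m)) = act_lc a b g * lc a m.
Proof. by move=> pg fm ag bg; rewrite -(act_lcE pg ag bg fm). Qed.

Lemma mk_comp g h (p q : vtop MK) : vcomposable g h p q ->
  [/\ tcomp g h p.1 q.1, TL g p.2, TL h q.2 & vsrc p.2 = vtgt (vadd q.2 (theta q.1))].
Proof.
move=> [/mk_fibP[f1 f2] /mk_fibP[f3 f4] [E1 E2]]; split=> //; split=> //.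
by apply: (fib_comp f2 (vb_add vT f4 (form_fib ft f3))).
Qed.

(** Composability in the Morita kernel, [s p.2 = t (q.2 + theta q.1)], moved to the target of [g];
    this is where the twist by [theta] enters the computation. *)
Lemma vsrc_lc a b g h (p q : vtop MK) : vcomposable g h p q -> tdom a (src g) -> tdom b (tgt g) ->
  lc b (vtgt p.2) = act_lc a b g * (lc a (vtgt q.2) + lc a (vtgt (theta q.1))).
Proof.
move=> /mk_comp[tc f2 f4 E] ag bg; have [[pg ph Es] f1 f3 _] := tc.
have ah : tdom a (tgt h) by rewrite -[tgt h]Es.
by rewrite (act_lc_tgt ag bg f2) E (pcD vT vB Tm ph ah f4 (form_fib ft f3)).
Qed.

Lemma mk_mul_fib g h (p q : vtop MK) : vcomposable g h p q -> fib (vtop MK) (mul g h) (vmul p q).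
Proof.
move=> c; have [tc f2 f4 E] := mk_comp c; have [cgh f1 f3 _] := tc.
have [_ b1] := f1; have [_ b3] := f3.
apply/mk_fibP; split; first exact: (tmul_fib lG tc).
rewrite /= (b1 : tbase p.1 = g) (b3 : tbase q.1 = h).
apply: (lsinvP (pts_mul lG cgh) _).1.
by rewrite (lie_src_mul lG cgh); exact: (vsrc_fib f4).
Qed.

(** Both sides are pushed to L_M by the target map. There [lsinv (mul g h)] becomes the action of
    [mul g h], the factor [lact (ginv h)] is cancelled by [h], and the right-hand side is the target
    of the first pairing plus [g] acting on the target of the second. *)
Lemma curv_pairing_mul g h (p q v w : vtop MK) : vcomposable g h p q -> vcomposable g h v w ->
  curv_pairing (vmul p q) (vmul v w) =
  lsinv (mul g h) (vadd (lact (ginv h) (vsrc (curv_pairing p v))) (vsrc (curv_pairing q w))).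
Proof.
move=> c1 c2; have [tc f2 f4 E] := mk_comp c1; have [tc' f2' f4' E'] := mk_comp c2.
have [cgh f1 f3 _] := tc; have [_ f1' f3' _] := tc'; have [pg ph Es] := cgh; have pm := pts_mul lG cgh.
have [fp fq _] := c1; have [fv fw _] := c2.
have [a ag] := vb_cover vB (pts_src lG pg); have [b bg] := vb_cover vB (pts_tgt lG pg).
have ah : tdom a (tgt h) by rewrite -[tgt h]Es.
have m1 := curv_pairing_fib fp fv; have m2 := curv_pairing_fib fq fw.
have sm1 := vsrc_fib m1; have sm2 := vsrc_fib m2; rewrite [src g]Es in sm1.
have pi := pts_ginv lG ph; have [_ si ti _ _] := lie_inverse lG ph.
have lm1 := lact_fib (g := ginv h) pi; rewrite si ti in lm1; have {}lm1 := lm1 _ sm1.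
have fS := vb_add vB lm1 sm2; rewrite -(lie_src_mul lG cgh) in fS.
have [fl Esl] := lsinvP pm fS.
have bm : tdom b (tgt (mul g h)) by rewrite lie_tgt_mul.
apply: (vtgt_lc_inj bm (curv_pairing_fib (mk_mul_fib c1) (mk_mul_fib c2)) fl).
rewrite -[vtgt (lsinv _ _)]/(lact _ _); rewrite (lie_src_mul lG cgh) in fS.
rewrite (lact_mul cgh fS) (lactD ph lm1 sm2) (lactKV ph sm1) (lact_src m2).
have tm2 := vtgt_fib m2; rewrite -[tgt h]Es in tm2; rewrite -[tgt h]Es in sm1.
rewrite (lactD pg sm1 tm2) (lact_src m1).
rewrite (lcD vB bg (vtgt_fib m1) (lact_fib pg tm2)) (act_lcE pg ag bg tm2).
rewrite (curv_pairing_lc fp fv bg) (curv_pairing_lc fq fw ah).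
rewrite (curv_pairing_lc (mk_mul_fib c1) (mk_mul_fib c2) bm).
rewrite (curv_tmul tc tc' ag bg) /= (eta_tmul tc) (eta_tmul tc').
have [_ e1] := f1; have [_ e3] := f3; have [_ e1'] := f1'; have [_ e3'] := f3'.
rewrite (e1 : tbase p.1 = g) (e3 : tbase q.1 = h) (e1' : tbase v.1 = g) (e3' : tbase w.1 = h).
have lsv l : TL h l -> lc b (vtgt (lsinv (L := L) (mul g h) (vsrc l))) = act_lc a b g * lc a (vtgt l).
  move=> fl'; have := vsrc_fib fl'; rewrite -(lie_src_mul lG cgh) => fs.
  rewrite -[vtgt _]/(lact _ _); rewrite (lie_src_mul lG cgh) in fs.
  rewrite (lact_mul cgh fs) (lact_src fl').
  by apply: (act_lcE pg ag bg); rewrite [src g]Es; exact: (vtgt_fib fl').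
(* The terms in [theta] from [curv_tmul] meet those from composability of the two pairs and
   cancel. *)
rewrite !lsv // (vsrc_lc c1 ag bg) (vsrc_lc c2 ag bg); ring.
Qed.

(** The product in the twisted dual is specified by a condition on all factorizations of its
    argument; its value is determined because there is at least one. *)
Lemma mk_vmul_surj g h (w : vtop MK) : composable G (g, h) -> fib (vtop MK) (mul g h) w ->
  exists v v' : vtop MK, vcomposable g h v v' /\ vmul v v' = w.
Proof.
move=> cgh /mk_fibP[f1 f2]; have [pg ph Es] := cgh.
have [x [y [tc E]]] := tmul_surj lG cgh f1; have [_ fx fy Exy] := tc.
have := vsrc_fib f2; rewrite (lie_src_mul lG cgh) => fs.
have [fl sl] := lsinvP ph fs; have fD := vb_add vT fl (form_fib ft fy).
have := vtgt_fib fD; rewrite -[tgt h]Es => fD'; have [fl' sl'] := lsinvP pg fD'.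
exists ((x, lsinv g (vtgt (vadd (lsinv h (vsrc w.2)) (theta y)))) : vtop MK).
exists ((y, lsinv h (vsrc w.2)) : vtop MK); split.
  split; [exact/mk_fibP|exact/mk_fibP|by rewrite /= Exy sl'].
have [_ bx] := fx; have [_ b_y] := fy.
rewrite /= E (bx : tbase x = g) (b_y : tbase y = h) sl (lsinvK f2).
by case: (w).
Qed.

Lemma morita_curv_mul g h (p q : vtop MK) : vcomposable g h p q ->
  MC (vmul p q) = vmul (MC p : vtop (twisted_dual MK L)) (MC q).
Proof.
move=> c; have [tc f2 f4 E] := mk_comp c; have [cgh f1 f3 _] := tc.
have [_ b1] := f1; have [_ b3] := f3; have e1 : tbase p.1 = g := b1; have e3 : tbase q.1 = h := b3.
have fm := mk_mul_fib c; have [_ bm] := tmul_fib lG tc; have em : tbase (tmul p.1 q.1) = mul g h := bm.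
have [fp fq _] := c.
apply: hom_eq; first by rewrite /= em e1 e3.
move=> w; have [fw|nw] := pselect (fib (vtop MK) (mul g h) w); last first.
  rewrite morita_curv_off; last by rewrite /= em.
  by rewrite [RHS]mkhom_off /= ?em // e1 e3.
rewrite [RHS]mkhomE; last by rewrite /= e1 e3.
rewrite (morita_curvE fm fw); symmetry; apply: the_unique; last first.
  move=> z; rewrite /mkset [hbase (MC p)]e1 [hbase (MC q)]e3 => Hz; have [v [v' [cv Ev]]] := mk_vmul_surj cgh fw.
  have [fv fv' _] := cv; rewrite -Ev (curv_pairing_mul c cv).
  by rewrite (Hz v v' cv Ev) (morita_curvE fp fv) (morita_curvE fq fv').
rewrite /mkset [hbase (MC p)]e1 [hbase (MC q)]e3 => v v' cv Ev; have [fv fv' _] := cv.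
by rewrite (morita_curvE fp fv) (morita_curvE fq fv') -Ev (curv_pairing_mul c cv).
Qed.

Lemma vtgt_mk_fib g (p : vtop MK) : fib (vtop MK) g p -> fib (vbot MK) (tgt g) (vtgt p).
Proof.
move=> /mk_fibP[f1 f2]; apply/mkb_fibP; split; first exact: (dtgt_fib lG f1).
exact: (vtgt_fib (vb_add vT f2 (form_fib ft f1))).
Qed.

Lemma vsrc_mk_fib g (p : vtop MK) : fib (vtop MK) g p -> fib (vbot MK) (src g) (vsrc p).
Proof. by move=> /mk_fibP[f1 f2]; apply/mkb_fibP; split; [exact: (dsrc_fib lG f1)|exact: (vsrc_fib f2)]. Qed.

Lemma core_vin x (c : vtop MK) : pts (obj G) x -> fib (core MK) x c -> fib (vtop MK) (unt x) c.
Proof.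
move=> px fc; have [f1 _ f2] := (coreP c px).1 fc; apply/mk_fibP; split=> //.
by rewrite f2; exact: (vb_zero vT (pts_unt lG px)).
Qed.

(** With [v = 1_{dt v} . v], the formula [curv_tmul] for [K (v, c . 0_g)] yields [K (1_{dt v}, c)]
    plus [eta c] times [t theta(v)]. The second term accounts for [theta] in the target
    [t (l + theta v)] of the Morita kernel. *)
Lemma morita_curv_tgt g (p : vtop MK) : fib (vtop MK) g p ->
  vtgt (MC p : vtop (twisted_dual MK L)) = MU (vtgt p).
Proof.
move=> fp; have [f1 f2] := (mk_fibP g p).1 fp; have [_ b1] := f1; have e1 : tbase p.1 = g := b1.
have pg := TA_pts f1; have pt := pts_tgt lG pg; have pu := pts_unt lG pt.
have ftp := vtgt_mk_fib fp; have [fd1 fd2] := (mkb_fibP _ _).1 ftp.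
have eb : tbase (vtgt p).1 = tgt g by case: fd1.
apply: hom_eq; first by rewrite /= e1 -[RHS]/(tbase (vtgt p).1) eb.
move=> c; have [fc|nc] := pselect (fib (core MK) (tgt g) c); last first.
  rewrite [LHS]mkhom_off; last by rewrite /= e1.
  by rewrite morita_units_off eb //= e1.
rewrite [LHS]mkhomE; last by rewrite /= e1.
cbv beta; rewrite [hbase (MC p)]e1 (morita_unitsE ftp fc).
have [c1 c2 c3] := (coreP c pt).1 fc; have [_ bc] := c1; have ec : tbase c.1 = unt (tgt g) := bc.
have t0 := tangent_zero pg; have cug := composable_unt_l lG pg.
have cc : vcomposable (unt (tgt g)) g c (vzero (vtop MK) g).
  split; first exact: core_vin.
    by apply/mk_fibP; split=> //; exact: (vb_zero vT pg).
  rewrite /= c2 (dtgt_zero pg) c3; congr pair.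
  by rewrite (theta0 pg) (vsub0 vT pg) (vsrc_zero pu) (vtgt_zero pg) lie_src_unt.
have [b bt] := vb_cover vB pt; have bg' : tdom b (tgt g) := bt.
have bu : tdom b (src (unt (tgt g))) by rewrite lie_src_unt.
have bu' : tdom b (tgt (unt (tgt g))) by rewrite lie_tgt_unt.
have fm := mk_mul_fib cc; rewrite (lie_unt_mul lG pg) in fm.
rewrite (morita_curvE fp fm).
apply: (lc_inj vB rB bt (vtgt_fib (curv_pairing_fib fp fm)) (unit_pairing_fib ftp fc)).
rewrite (curv_pairing_lc fp fm bt) (unit_pairing_lc ftp fc bt).
have [tcu Eu] := unt_tmul lG f1; have [tc0 _ _ _] := mk_comp cc.
have := curv_tmul tcu tc0 bu bu'; rewrite Eu (act_lc_unit pt bt) !mul1r.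
rewrite (eta_unit fd1) mul0r subr0 (curv0r f1) (pc0 vT vB Tm pg bg') addr0.

move=> EK; have -> : (vmul c (vzero (vtop MK) g)).2 = vzero (vtop L) g.
  by rewrite /= ec (lie_unt_mul lG pg) (lsinvK (vb_zero vT pg)).
rewrite (pc0 vT vB Tm pg bg') mulr0 subr0.
rewrite [(vmul c _).1]/(tmul c.1 (vzero (tangent (arr G)) g)) EK.
rewrite (eta_tmul tc0) (eta0 pg) addr0.
rewrite [(vtgt p).2]/(vtgt (vadd p.2 (theta p.1))) (pcD vT vB Tm pg bg' f2 (form_fib ft f1)).
by rewrite [(vtgt p).1]/(dtgt p.1); ring.
Qed.

(** The second component is forced: the source of the inverse is the target of [c], whose component
    in L_M is [t theta(c)], and over a unit an element of L is determined by its source. *)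
Lemma core_inverse x (c : vtop MK) : pts (obj G) x -> fib (core MK) x c ->
  @is_inverse R (vgpd MK) c (dmap (@ginv R G) c.1, vunt (vtgt (theta c.1))).
Proof.
move=> px fc; have [c1 c2 c3] := (coreP c px).1 fc; have pu := pts_unt lG px.
have [tci Ei] := tmul_ginv lG c1; have [tci' Ei'] := ginv_tmul lG c1.
rewrite (inverse_unt lG px) in tci tci'.
have [_ _ f3 _] := tci; have ftc := form_fib ft c1; have tf := vtgt_fib ftc.
rewrite lie_tgt_unt // in tf; have fi := vunt_fib tf; have fti := form_fib ft f3.
have [_ b1] := c1; have e1 : tbase c.1 = unt x := b1.
have [_ b3] := f3; have e3 : tbase (dmap (@ginv R G) c.1) = unt x := b3.
have zx := vb_zero vB px; have m1 := mul_units px.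
have th0 : vadd (vtgt (theta c.1)) (vtgt (theta (dmap (@ginv R G) c.1))) = vzero (vbot L) x.
  have := theta_mul tci; rewrite Ei (theta_unit (dtgt_fib lG c1)).
  rewrite !lie_tgt_unt // (vtgt_zero pu) lie_tgt_unt //.
  by have := vtgt_fib fti; rewrite lie_tgt_unt // => f; rewrite (lact_unt px f).
have adc (m m' : vbot L) : BL x m -> BL x m' -> vadd m m' = vadd m' m.
  move=> fm fm'; have [b bx] := vb_cover vB px.
  apply: (lc_inj vB rB bx (vb_add vB fm fm') (vb_add vB fm' fm)).
  by rewrite (lcD vB bx fm fm') (lcD vB bx fm' fm) addrC.
have ft' := vtgt_fib fti; rewrite lie_tgt_unt // in ft'.
have fc' := core_vin px fc; have [c'1 c'2] := (mk_fibP _ _).1 fc'.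
split.
- by have [] := (mk_fibP (unt x) (dmap (@ginv R G) c.1, vunt (vtgt (theta c.1)))).2 (conj f3 fi).
- rewrite /= (dsrc_dginv lG c1) (vsrc_unt tf) c3; congr pair.
  rewrite (vbmor_add Tm pu (vb_zero vT pu) ftc) (vtgt_zero pu) lie_tgt_unt //.
  by rewrite (adc _ _ zx tf) (vadd0 vB tf).
- rewrite /= (dtgt_dginv lG c1) c3 (vsrc_zero pu) lie_src_unt //; congr pair.
  by rewrite (vbmor_add Tm pu fi fti) (vtgt_unt tf).
- rewrite /= Ei e1 e3 m1 (vsrc_unt tf) c3; congr pair.
  rewrite (vbmor_add Tm pu (vb_zero vT pu) ftc) (vtgt_zero pu) lie_tgt_unt //.
  rewrite (adc _ _ zx tf) (vadd0 vB tf).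
  by have := lsinvK fi; rewrite (vsrc_unt tf).
- rewrite /= Ei' e1 e3 m1 c3 (lsinvK (vb_zero vT pu)) (vsrc_zero pu) lie_src_unt //.
  by rewrite (vunt_zero px).
Qed.

(** [vinv] chooses some inverse. Its base point, its product with [c] and the source of its
    component in L are derived from the defining equations, which hold for any inverse. *)
Lemma core_vinv x (c : vtop MK) : pts (obj G) x -> fib (core MK) x c -> let c' := vinv (V := MK) c in
  [/\ fib (vtop MK) (unt x) c', tcomp (unt x) (unt x) c.1 c'.1, dtgt c'.1 = vzero (tangent (obj G)) x,
      tmul c.1 c'.1 = dunt (dtgt c.1) & vsrc c'.2 = vtgt (theta c.1)].
Proof.
move=> px fc; have [c1 c2 c3] := (coreP c px).1 fc; have pu := pts_unt lG px.
have := theP c (ex_intro _ _ (core_inverse px fc)); rewrite -/(ginv (G := vgpd MK) c) -/(vinv (V := MK) c).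
move: (vinv _) => c' [vc' sc' tc' mcc' _] /=.
have Et : dtgt c'.1 = vzero (tangent (obj G)) x by have := congr1 fst tc'; rewrite /= c2.
have Es : dsrc c'.1 = dtgt c.1 by have := congr1 fst sc'.
have fc'1 := mk_vin vc'; have [t' l'] := (mk_fibP _ _).1 fc'1.
have pc' := TA_pts t'; have [_ b1] := c1; have e1 : tbase c.1 = unt x := b1.
have tce : tcomp (unt x) (tbase c'.1) c.1 c'.1.
  split=> //; last by rewrite c2 Et.
  split=> //=; rewrite lie_src_unt //.
  by have [_ b] := dtgt_fib lG t'; rewrite -b Et.
have Em : tmul c.1 c'.1 = dunt (dtgt c.1) by have := congr1 fst mcc'.
have eb : tbase c'.1 = unt x.
  have [_ b] := tmul_fib lG tce; have [cu _ _ _] := tce; have [_ _ su] := cu.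
  rewrite /= lie_src_unt // in su.
  have := lie_unt_mul lG pc'; rewrite -su => <-.
  rewrite -[LHS]b Em; have [_ ->] := dunt_fib lG (dtgt_fib lG c1).
  by rewrite lie_tgt_unt.
rewrite eb in fc'1 tce; split=> //.
have := congr1 snd sc'; rewrite /= c3 => ->; have ftc := form_fib ft c1.
have tf := vtgt_fib ftc; rewrite lie_tgt_unt // in tf; have zx := vb_zero vB px.
rewrite (vbmor_add Tm pu (vb_zero vT pu) ftc) (vtgt_zero pu) lie_tgt_unt //.
have [b bx] := vb_cover vB px.
apply: (lc_inj vB rB bx (vb_add vB zx tf) tf).
by rewrite (lcD vB bx zx tf) (lc0 vB bx) add0r.
Qed.

(** Two factorizations are used: [v = v . 1_{ds v}] paired with [0_g . c'], and
    [1_{ds v} . 1_{ds v}] paired with [c . c'], where [c'] is the inverse of [c]. As [c . c'] is a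
    unit, the second one shows that K on the unit vector, [theta] and [eta] change sign from [c] to
    [c'], which accounts for the minus sign in the source map. The [theta] term of [curv_tmul]
    cancels against the component of [c'] in L. *)
Lemma morita_curv_src g (p : vtop MK) : fib (vtop MK) g p ->
  vsrc (MC p : vtop (twisted_dual MK L)) = MU (vsrc p).
Proof.
move=> fp; have [f1 f2] := (mk_fibP g p).1 fp; have [_ b1] := f1; have e1 : tbase p.1 = g := b1.
have pg := TA_pts f1; have pt := pts_src lG pg; have pu := pts_unt lG pt.
have ftp := vsrc_mk_fib fp; have [fd1 fd2] := (mkb_fibP _ _).1 ftp.
have eb : tbase (vsrc p).1 = src g by case: fd1.
apply: hom_eq; first by rewrite /= e1 -[RHS]/(tbase (vsrc p).1) eb.
move=> c; have [fc|nc] := pselect (fib (core MK) (src g) c); last first.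
  rewrite [LHS]mkhom_off; last by rewrite /= e1.
  by rewrite morita_units_off eb //= e1.
rewrite [LHS]mkhomE; last by rewrite /= e1.
cbv beta; rewrite [hbase (MC p)]e1 (morita_unitsE ftp fc).
have [c1 c2 c3] := (coreP c pt).1 fc; have [_ bc] := c1; have ec : tbase c.1 = unt (src g) := bc.
have [fc' tcc Et Em Es] := core_vinv pt fc; move: (vinv _) fc' tcc Et Em Es => c' fc' tcc Et Em Es.
have [c'1 c'2] := (mk_fibP _ _).1 fc'; have [_ bc'] := c'1; have ec' : tbase c'.1 = unt (src g) := bc'.
have t0 := tangent_zero pg; have cug := composable_unt_r lG pg.
have tc0 : tcomp g (unt (src g)) (vzero (tangent (arr G)) g) c'.1.
  by split=> //; rewrite Et dsrc_zero.
have fs : BL (src g) (vsrc c'.2) by have := vsrc_fib c'2; rewrite lie_src_unt.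
have fm : fib (vtop MK) g (vmul (vzero (vtop MK) g) c').
  apply/mk_fibP; split; first by have := tmul_fib lG tc0; rewrite (lie_mul_unt lG pg).
  by rewrite /= ec' (lie_mul_unt lG pg); exact: (lsinvP pg fs).1.
rewrite (morita_curvE fp fm).
have [a ag] := vb_cover vB pt; have [b bg] := vb_cover vB (pts_tgt lG pg).
have f0 := act_lc_neq0 pg ag bg; have fv := curv_pairing_fib fp fm; have fvs := vsrc_fib fv.
apply: (lc_inj vB rB ag (vopp_fib vB fvs) (unit_pairing_fib ftp fc)).
apply: (mulfI f0); rewrite (lcN vB ag fvs) mulrN -(act_lc_tgt ag bg fv).
rewrite (curv_pairing_lc fp fm bg) (unit_pairing_lc ftp fc ag).
have au : tdom a (src (unt (src g))) by rewrite lie_src_unt.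
have au' : tdom a (tgt (unt (src g))) by rewrite lie_tgt_unt.
have [tcu Eu] := tmul_unt lG f1.
have := curv_tmul tcu tc0 ag bg; rewrite Eu (curv0r f1) (pc0 vT vB Tm pg bg).
rewrite (eta0 pg) mul0r addr0 add0r => EK.
have [tuu Euu] := dunt_comp fd1.
have := curv_tmul tuu tcc au au'.
have fdt := dtgt_fib lG c1; rewrite lie_tgt_unt // in fdt.
rewrite Euu Em (curv_unit fd1 fdt) (act_lc_unit pt ag) !mul1r (eta_unit fd1) mul0r subr0.
rewrite (theta_unit fd1) (pc0 vT vB Tm pu au') mulr0 addr0 => EK2.
have := theta_tmul_lc tcc au au'.
rewrite Em (theta_unit fdt) (pc0 vT vB Tm pu au') (act_lc_unit pt ag) mul1r => Eth.
have := eta_tmul tcc; rewrite Em (eta_unit fdt) => Eet.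
have -> : (vmul (vzero (vtop MK) g) c').2 = lsinv g (vsrc c'.2).
  by rewrite /= ec' (lie_mul_unt lG pg).
rewrite (vtgt_lsinv_lc pg fs ag bg) Es.
rewrite [(vmul _ c').1]/(tmul (vzero (tangent (arr G)) g) c'.1) EK.
rewrite (eta_tmul tc0) (eta0 pg) add0r (act_lc_tgt ag bg f2).
rewrite [(vsrc p).2]/(vsrc p.2) [(vsrc p).1]/(dsrc p.1).
have K' : lc a (vtgt (K (dunt (dsrc p.1)) c'.1)) = - lc a (vtgt (K (dunt (dsrc p.1)) c.1)).
  by apply/eqP; rewrite -addr_eq0 addrC -EK2.
have T' : lc a (vtgt (theta c'.1)) = - lc a (vtgt (theta c.1)).
  by apply/eqP; rewrite -addr_eq0 addrC -Eth.
have N' : et c'.1 = - et c.1 by apply/eqP; rewrite -addr_eq0 addrC -Eet.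
by rewrite K' T' N'; ring.
Qed.

Lemma core_prP x (q : vtop MK) : pts (obj G) x -> fib (vtop MK) (unt x) q ->
  core_pr q = (vadd q.1 (vopp (dunt (dsrc q.1))), vzero (vtop L) (unt x)) /\ fib (core MK) x (core_pr q).
Proof.
move=> px fq; have [f1 f2] := (mk_fibP _ _).1 fq; have pu := pts_unt lG px.
have E : core_pr q = (vadd q.1 (vopp (dunt (dsrc q.1))), vzero (vtop L) (unt x)).
  by rewrite /core_pr /=; congr pair; rewrite (vunt_src px f2) (vsub_self vT f2).
split=> //; rewrite E; apply/(coreP _ px).
have fs := dsrc_fib lG f1; rewrite lie_src_unt // in fs; have fu := dunt_fib lG fs.
have fn := tangent_scal (-1) fu; split=> //; first exact: (tangent_add f1 fn).
have [t1 b1] := f1; have [t2 b2] := fn; have [t3 b3] := fu; have [ts bs] := fs.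
have e1 : tbase q.1 = unt x := b1; have e3 : tbase (dunt (dsrc q.1)) = unt x := b3.
have s1 : smap (tbase q.1) (@src R G) by rewrite e1; exact: smap_src.
have s3 : smap (tbase (dunt (dsrc q.1))) (@src R G) by rewrite e3; exact: smap_src.
rewrite (dmapD lA lO t1 t2 _ s1); last by rewrite e1 [RHS]b2.
rewrite (dmapZ lA lO _ t3 s3) (dsrc_unt lG fs).
by move: bs; case: (dsrc _) => y k /= ->; congr TVec; apply/funext => i; rewrite scaleN1r subrr.
Qed.

(** [q] is the sum of its core part and a unit vector; the pairing with a unit does not see the
    latter, because K and [eta] vanish on units. *)
Lemma morita_curv_unt x (p : vbot MK) : fib (vbot MK) x p ->
  MC (vunt p) = vunt (MU p : vbot (twisted_dual MK L)).
Proof.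
move=> fp; have [f1 f2] := (mkb_fibP x p).1 fp; have [_ b1] := f1; have e1 : tbase p.1 = x := b1.
have px := fib_pts vB f2; have pu := pts_unt lG px; have d1 := dunt_fib lG f1.
have [_ bd] := d1; have ed : tbase (dunt p.1) = unt x := bd; have l1 := vunt_fib f2.
have fu : fib (vtop MK) (unt x) (vunt p) by apply/mk_fibP.
apply: hom_eq; first by rewrite /= ed e1.
move=> q; have [fq|nq] := pselect (fib (vtop MK) (unt x) q); last first.
  rewrite morita_curv_off; last by rewrite /= ed.
  by rewrite [RHS]mkhom_off /= ?e1 // ed.
rewrite [RHS]mkhomE; last by rewrite /= e1.
have [Ec fc] := core_prP px fq; rewrite (morita_curvE fu fq) (morita_unitsE fp fc).
have fm := unit_pairing_fib fp fc; have fv := curv_pairing_fib fu fq.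
have [b bx] := vb_cover vB px; have bu : tdom b (tgt (unt x)) by rewrite lie_tgt_unt.
apply: (vtgt_lc_inj bu fv (vunt_fib fm)); rewrite (vtgt_unt fm).
rewrite (curv_pairing_lc fu fq bu) (unit_pairing_lc fp fc bx).
rewrite [(vunt p).1]/(dunt p.1) [(vunt p).2]/(vunt p.2) (vtgt_unt f2) (eta_unit f1) mul0r subr0.
have [q1 q2] := (mk_fibP _ _).1 fq; have fs := dsrc_fib lG q1; rewrite lie_src_unt // in fs.
have fdu := dunt_fib lG fs; rewrite Ec [(_, _).1]/(vadd q.1 (vopp (dunt (dsrc q.1)))).
rewrite (curvDr d1 q1 (tangent_scal _ fdu)) (curvZr _ d1 fdu) (curv_unit f1 fs).
rewrite (vscal0z vT _ pu) (vadd0 vT (curv_fib d1 q1)).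
by rewrite (etaD q1 (tangent_scal _ fdu)) (etaZ _ fdu) (eta_unit fs) mulr0 addr0.
Qed.

(** * Smoothness of the Morita curvature *)

Let gMK : smooth_atlas (total (vtop MK)) := dsum_atlas (tangent_atlas lA) (total_atlas vT).
Let gMKb : smooth_atlas (total (vbot MK)) := dsum_atlas (tangent_atlas lO) (total_atlas vB).

(* The isomorphism t : L -> L_M relates the two kinds of local coordinates on L. *)
Lemma vtgt_lc_lc {P : mfd R} (x0 : P) (f : P -> arr G) (l : P -> vtop L) b c : smooth_atlas P ->
  smap x0 f -> tdom b (tgt (f x0)) -> tdom c (f x0) -> mnear x0 (fun y => TL (f y) (l y)) ->
  (smf x0 (fun y => lc b (vtgt (l y))) <-> smf x0 (fun y => lc c (l y))).
Proof.
move=> gP sf bx cx fl; have pf := smap_pts gA sf.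
have oc := vb_tdom vT c; have sc := lf_section vT rT c.
have su := pc_section vT vB rB Tm oc sc cx bx.
have u0 : lc b (vtgt (lf c (f x0))) != 0 := pc_lf_neq0 vT rT vB rB Tm (vtgt_inj) pf bx cx.
have suf := smf_smap gP gA sf su; have suV := smfV (f := fun y => lc b (vtgt (lf c (f y)))) u0 suf.
have n1 := mnear_smap gP gA sf (tdom_tgt_near pf bx).
have n2 := mnear_smap gP gA sf (tdom_near vT cx).
have n := mnearI gP fl (mnearI gP n1 n2).
split=> s.
  apply: (smf_ext gP _ (smfM gP s suV)); apply: mnearS n => y [fy [b_y cy]].
  have py := fib_pts vT fy; rewrite (pc_lc vT rT vB Tm py b_y cy fy) mulfK //.
  exact: (pc_lf_neq0 vT rT vB rB Tm (vtgt_inj) py b_y cy).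
apply: (smf_ext gP _ (smfM gP s suf)); apply: mnearS n => y [fy [b_y cy]].
by rewrite (pc_lc vT rT vB Tm (fib_pts vT fy) b_y cy fy).
Qed.

Lemma mk_frameP i c y k : cdom i y -> tdom c y ->
  let z := frame (E := vtop MK) (i, c) y k in
  fib (vtop MK) y z /\ row_mx (tcoef z.1 i) (tmap c z.2) = delta_mx 0 k.
Proof.
move=> iy cy; suff H : exists e : vtop MK, fib (vtop MK) y e /\
      tmap (E := vtop MK) (i, c) e = delta_mx 0 k.
  exact: (theP _ H).
have [v [tv ev cv]] := tvec_of_coef lA (lsubmx (delta_mx 0 k : 'rV[R]_(dim (arr G) + vrk (vtop L)))) iy.
have [l [[fl cl] _]] := vb_bij vT (rsubmx (delta_mx 0 k : 'rV[R]_(dim (arr G) + vrk (vtop L)))) cy.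
exists ((v, l) : vtop MK); split; first exact/mk_fibP.
by rewrite /= cv cl hsubmxK.
Qed.

(** The matrix entries required by [homb_smap] are coordinates in L, whereas [curv_pairing_lc]
    computes coordinates of targets in L_M; [vtgt_lc_lc] converts between the two in both
    directions. *)
Lemma morita_curv_smap (p : total (vtop MK)) : vin p -> smap p (MC : total (vtop MK) -> total (vtop (twisted_dual MK L))).
Proof.
move=> vp; have fp := mk_vin vp; have [f1 f2] := (mk_fibP _ _).1 fp; have pg := TA_pts f1.
set g := tbase p.1 in fp f1 f2 pg; have [i ig] := chart_ex pg.
have [c cg] := vb_cover vT pg; have [b bg] := vb_cover vB (pts_tgt lG pg).
have ip : @cdom _ (total (vtop MK)) (i, (i, c)) p by split.
have sf := dsum_base_smap ip; have nd := dsum_near ip.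
have nfib : mnear p (fun y : total (vtop MK) => fib (vtop MK) (tbase y.1) y).
  by apply: mnearS nd => y [vy _ _ _]; exact: mk_vin.
apply: (@homb_smap R (total (vtop MK)) (arr G) (vtop MK) (vtop L) MC p i (i, c) c gMK).
- apply: mnearS nd => y [vy iy iy' cy]; split=> //.
  by have [] := morita_curv_is_hom (mk_vin vy).
- by move=> k; exact: (dsum_base_smf ip).
move=> k l.
pose z (y : total (vtop MK)) := frame (E := vtop MK) (i, c) (tbase y.1) k.
have nz : mnear p (fun y : total (vtop MK) => fib (vtop MK) (tbase y.1) (z y) /\
    row_mx (tcoef (z y).1 i) (tmap c (z y).2) = delta_mx 0 k).
  by apply: mnearS nd => y [vy iy iy' cy]; exact: mk_frameP.
have n0 := mnearI gMK nfib nz.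
have fX : mnear p (fun y : total (vtop MK) => TA (tbase y.1) y.1) by apply: mnearS nfib => y /mk_fibP[].
have fY : mnear p (fun y : total (vtop MK) => TA (tbase y.1) (z y).1).
  by apply: mnearS nz => y [/mk_fibP[]].
have sX k' : smf p (fun y : total (vtop MK) => tcoef y.1 i 0 k') := dsum_fst_smf ip k'.
(* The frame vectors have constant coefficients in their own chart. *)
have sY k' : smf p (fun y => tcoef (z y).1 i 0 k').
  apply: (smf_ext gMK _ (smf_cst ((delta_mx 0 k : 'rV[R]_(_ + vrk (vtop L))) 0 (lshift _ k')) ip)).
  by apply: mnearS nz => y [_ <-]; rewrite row_mxEl.
have sK := curv_field_smf gMK sf ig fX sX fY sY bg.
have se1 := eta_field_smf gMK sf ig fX sX.
have se2 := eta_field_smf gMK sf ig fY sY.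
have sl1 : smf p (fun y : total (vtop MK) => lc b (vtgt y.2)).
  apply/(vtgt_lc_lc gMK sf bg cg); first by apply: mnearS nfib => y /mk_fibP[].
  by apply: (smf_sum gMK ip) => k'; exact: (dsum_snd_smf ip).
have sl2 : smf p (fun y => lc b (vtgt (z y).2)).
  apply/(vtgt_lc_lc gMK sf bg cg); first by apply: mnearS nz => y [/mk_fibP[]].
  apply: (smf_sum gMK ip) => k'.
  apply: (smf_ext gMK _ (smf_cst ((delta_mx 0 k : 'rV[R]_(dim (arr G) + vrk (vtop L))) 0 (rshift _ k')) ip)).
  by apply: mnearS nz => y [_ <-]; rewrite row_mxEr.
have sT : smf p (fun y : total (vtop MK) => lc b (vtgt (MC y (z y)))).
  apply: (smf_ext gMK _ (smfB gMK (smfD gMK sK (smfM gMK se2 sl1)) (smfM gMK se1 sl2))).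
  have nb := mnear_smap gMK gA sf (tdom_tgt_near pg bg).
  apply: mnearS (mnearI gMK nb n0) => y [b_y [fy [fz _]]].
  by rewrite (morita_curvE fy fz) (curv_pairing_lc fy fz b_y).
have nT : mnear p (fun y : total (vtop MK) => TL (tbase y.1) (MC y (z y))).
  apply: mnearS n0 => y [fy [fz _]]; rewrite (morita_curvE fy fz); exact: curv_pairing_fib.
have := (vtgt_lc_lc gMK sf bg cg nT).1 sT.
by congr smf; apply/funext => y; rewrite (lcE rT).
Qed.

Lemma morita_curv_smooth : smooth (MC : total (vtop MK) -> total (vtop (twisted_dual MK L))).
Proof. exact: (smooth_onP gMK morita_curv_smap). Qed.

Lemma core_rkE : core_rk MK = (dim (arr G) - dim (obj G))%N.
Proof. by rewrite /core_rk /= rT rB subnDr. Qed.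

Definition vec_at (i : cidx (arr G)) g (u : 'rV[R]_(dim (arr G))) : tangent (arr G) :=
  the (vzero (tangent (arr G)) g) [set v | TA g v /\ tcoef v i = u].

Lemma vec_atP i g u : cdom i g -> TA g (vec_at i g u) /\ tcoef (vec_at i g u) i = u.
Proof.
move=> ig; have [v [tv ev cv]] := tvec_of_coef lA u ig.
by apply: (@theP _ _ [set v | TA g v /\ tcoef v i = u]); exists v.
Qed.

Lemma vec_at_eq i g v : cdom i g -> TA g v -> vec_at i g (tcoef v i) = v.
Proof.
move=> ig fv; have [[t1 b1] c1] := vec_atP (tcoef v i) ig; have [t2 b2] := fv.
apply: (tvec_eq (i := i) gA t1 t2 _ _ c1); first by rewrite [LHS]b1 [RHS]b2.
by rewrite [tbase _]b1.
Qed.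

(** The core is the kernel of the Jacobian [Sq] of the source map along units. A complement [T] to
    [Sq] at [x0] remains one nearby, so the coefficients multiplied by [T] are coordinates on the
    kernel. The atlas of [core] consists of all trivializations, so this is what makes a chart
    available at a given point. *)
Lemma core_triv_ex x0 : pts (obj G) x0 ->
  exists W (tau : vtop MK -> 'rV[R]_(core_rk MK)), is_core_triv W tau /\ W x0.
Proof.
move=> px; have pu := pts_unt lG px; have [s0 ox] := (mfd_cover (lie_obj lG) x0).1 px.
have [i iu] := chart_ex pu.
have osu : cdom s0 (src (unt x0)) by rewrite lie_src_unt.
have [nu su] := smap_chart gO gA (smap_unt lG px) iu.
have [V1 [U [oV1 V1x sU HU]]] := smap_local gO ox nu su.
have [V2 [S [oV2 V2u sS HS]]] := smap_chart_rep gO (smap_src lG pu) iu osu.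
have [_ Ux] := HU x0 ox V1x.
pose m := dim (obj G); pose n := dim (arr G); pose r := core_rk MK.
pose Sq (q : 'rV[R]_m) : 'M[R]_(n, m) := \matrix_(j, k) dd (fun x => S x 0 k) (U q) (delta_mx 0 j).
have dS q u : dv S (U q) u = u *m Sq q.
  by apply/rowP => k; rewrite dvE dd_rowE mxE; apply: eq_bigr => j _; rewrite mxE.
pose Q1 := [set q | V1 q /\ V2 (U q)]; have oQ1 : open Q1 by exact: open_comp_on.
have Q1x : Q1 (cmap s0 x0) by split=> //; rewrite -Ux.
have coefS y (v : tangent (arr G)) : cdom s0 y -> Q1 (cmap s0 y) -> TA (unt y) v ->
    cdom s0 (src (unt y)) /\ tcoef (dsrc v) s0 = tcoef v i *m Sq (cmap s0 y).
  move=> oy [V1y V2y] [tv bv]; have [iy Uy] := HU y oy V1y; rewrite -Uy in V2y.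
  have [osy _] := HS _ iy V2y; split=> //; rewrite -dS -Uy.
  have e : tbase v = unt y := bv; rewrite -e in iy V2y *.
  apply: (dmap_chart lA lO tv (smap_src lG _)); first by case: tv.
  by apply/is_repP; split=> //; exists V2; split=> // z _; exact: HS.
have [B HB] : exists B : 'M[R]_(m, n), B *m Sq (cmap s0 x0) = 1%:M.
  have [|B HB] := @surj_right_inverse R n m S (U (cmap s0 x0)).
    move=> u; have [w [tw ew cw]] := tvec_of_coef lO u osu.
    have [v fv Ev] := lie_src_subm lG pu (conj tw ew).
    by exists (tcoef v i); rewrite dS; have [_ <-] := coefS x0 v ox Q1x fv; rewrite Ev.
  exists B; apply/row_matrixP => k; rewrite rowE mulmxA -dS HB.
  by rewrite rowE mulmx1.
have [N [T NT]] := kernel_complement HB core_rkE.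
pose D q : 'M[R]_(m + r) := N *m row_mx (Sq q) T.
have sD k l : sm Q1 (fun q => D q k l).
  apply: (sm_ext oQ1 (f := fun q => \sum_j N k j * row_mx (Sq q) T j l)).
    by move=> q _; rewrite mxE.
  apply: sm_sum => // j; apply: smM => //; first exact: sm_cst.
  case: (split_ordP l) => l' ->.
    apply: (sm_ext oQ1 (f := fun q => dd (fun x => S x 0 l') (U q) (delta_mx 0 j))).
      by move=> q _; rewrite row_mxEl mxE.
    apply: (sm_comp (O' := V2) oQ1 _ _ (sm_d _ (sS l'))) => [q []//|k'].
    by apply: sm_sub (sU k') => q [].
  apply: (sm_ext oQ1 (f := fun=> T j l')); last exact: sm_cst.
  by move=> q _; rewrite row_mxEr.
pose Q := [set q | Q1 q /\ \det (D q) != 0].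
have oQ : open Q by apply: open_neq0 => //; exact: sm_det.
pose W : set (obj G) := [set y | cdom s0 y /\ Q (cmap s0 y)].
have mW y : W y -> mnear y W.
  by move=> [oy Qy]; exists s0; split=> //; exists Q; split.
have oW : mopen W := mnear_mopen lO mW.
(* The inverse of the coordinates: the vector whose image under [row_mx (Sq q) T] is [(0, z)].
   Smoothness in [q] is that of the inverse matrix of [D q]. *)
pose cf (q : 'rV[R]_m) (z : 'rV[R]_r) : 'rV[R]_n := row_mx 0 z *m invmx (D q) *m N.
pose sg (y : obj G) (z : 'rV[R]_r) : vtop MK := (vec_at i (unt y) (cf (cmap s0 y) z), vzero (vtop L) (unt y)).
pose tau (c : vtop MK) : 'rV[R]_r := tcoef c.1 i *m T.
have unitD q : Q q -> D q \in unitmx by move=> [_ d0]; rewrite unitmxE unitfE.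
have cfM q z : Q q -> cf q z *m Sq q = 0 /\ cf q z *m T = z.
  move=> Qq; apply: eq_row_mx; rewrite -mul_mx_row /cf -(mulmxA _ N) -/(D q).
  by rewrite -mulmxA mulVmx ?mulmx1 //; exact: unitD.
(* [Sq] has rank [m] at [x0], hence [m <= n] and the truncated subtraction in [core_rk] is a genuine
   one. *)
have nmr : n = (m + r)%N.
  have le : (m <= n)%N.
    have <- : \rank (Sq (cmap s0 x0)) = m.
      by apply/eqP; rewrite -/(row_full _); apply/row_fullP; exists B.
    exact: rank_leq_row.
  by rewrite /r core_rkE subnKC.
(* [row_mx (Sq q) T] is a factor of the invertible [D q], hence of rank [m + r = n]; two vectors
   with the same image under it are equal. *)
have cfK q (u : 'rV[R]_n) : Q q -> u *m Sq q = 0 -> cf q (u *m T) = u.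
  move=> Qq u0; have free : row_free (row_mx (Sq q) T).
    rewrite /row_free eqn_leq rank_leq_row /= {1}nmr.
    have rD : \rank (D q) = (m + r)%N by apply: mxrank_unit; exact: unitD.
    by apply: leq_trans (mxrankM_maxr N _); rewrite -/(D q) rD.
  apply: (row_free_inj free); have [E1 E2] := cfM q (u *m T) Qq.
  by rewrite !mul_mx_row E1 E2 u0.
have iy y : W y -> cdom i (unt y) by move=> [oy [[V1y _] _]]; have [] := HU y oy V1y.
have pW y : W y -> pts (obj G) y by move=> [oy _]; exact: premfd_cov oy.
exists W, tau; split; last by split=> //; split=> //; rewrite /D -unitfE -unitmxE.
split=> //; exists sg; split.
- move=> y z Wy; have [oy Qy] := Wy; have py := pW y Wy; have puy := pts_unt lG py.
  have [fv cv] := vec_atP (cf (cmap s0 y) z) (iy y Wy); have [E1 E2] := cfM _ z Qy.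
  split; last by rewrite /tau /= cv.
  apply/(coreP _ py); split=> //=.
  have [osy c0] := coefS y _ oy Qy.1 fv; rewrite cv E1 in c0.
  have [t1 b1] := dsrc_fib lG fv; rewrite lie_src_unt // in b1 osy.
  apply: (tvec_eq (i := s0) gO t1 (tvec0 py)); first exact: b1.
    by rewrite [tbase _]b1.
  by rewrite c0.
- move=> y c Wy fc; have [oy Qy] := Wy; have py := pW y Wy.
  have [c1 c2 c3] := (coreP c py).1 fc; have [_ cS] := coefS y _ oy Qy.1 c1.
  rewrite c2 /= in cS; rewrite /sg /tau cfK //; rewrite (vec_at_eq (iy y Wy) c1) -c3.
  by case: (c).
- by move=> y c c' _ _ _; rewrite /tau /= mulmxDl.
- by move=> y s c _ _; rewrite /tau /= scalemxAl.
move=> z; apply: (smooth_onP gO) => y Wy; have [oy Qy] := Wy; have py := pW y Wy.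
have puy := pts_unt lG py; have [c cu] := vb_cover vT puy.
have [nuy suy] := smap_chart gO gA (smap_unt lG py) (iy y Wy).
have ncu := mnear_smap gO gA (smap_unt lG py) (tdom_near vT cu).
have scf k : smf y (fun y => cf (cmap s0 y) z 0 k).
  exists s0; split=> //; exists Q, (fun q => cf q z 0 k); split=> //.
  apply: (sm_ext oQ (f := fun q => \sum_j (\sum_l row_mx (0 : 'rV[R]_m) z 0 l * invmx (D q) l j) * N j k)).
    by move=> q _; rewrite mxE; apply: eq_bigr => j _; congr (_ * _); rewrite mxE.
  apply: sm_sum => // j; apply: smM => //; last exact: sm_cst.
  apply: sm_sum => // l; apply: smM => //; first exact: sm_cst.
  apply: sm_invmx => //; last by move=> q [].
  by move=> k' l'; apply: sm_sub (sD k' l') => q [].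
have vin_sg y' : W y' -> vin (sg y' z).
  move=> Wy'; have [fv cv] := vec_atP (cf (cmap s0 y') z) (iy y' Wy').
  by have [] := (mk_fibP (unt y') (sg y' z)).2 (conj fv (vb_zero vT (pts_unt lG (pW y' Wy')))).
have base_sg y' : W y' -> tbase (sg y' z).1 = unt y'.
  by move=> Wy'; have [[_ b] _] := vec_atP (cf (cmap s0 y') z) (iy y' Wy').
have n0 := mnearI gO (mW y Wy) (mnearI gO nuy ncu).
exists (i, (i, c)); split.
- by split; [exact: vin_sg|rewrite /= base_sg //; exact: iy|rewrite /= base_sg //; split=> //; exact: iy].
- apply: mnearS n0 => y' [Wy' [iy' cy']].
  by split; [exact: vin_sg|rewrite /= base_sg|rewrite /= base_sg].
move=> k; apply: smf_row_mx => {}k; last apply: smf_row_mx => {}k.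
- apply: (smf_ext gO _ (suy k)); apply: mnearS (mW y Wy) => y' Wy'.
  by rewrite [vproj _]base_sg.
- apply: (smf_ext gO _ (scf k)); apply: mnearS (mW y Wy) => y' Wy'.
  by have [_ /= ->] := vec_atP (cf (cmap s0 y') z) (iy y' Wy').
- apply: (smf_ext gO _ (smf_cst (0 : R) oy)); apply: mnearS ncu => y' cy'.
  by rewrite /= (vb_tmap0 vT cy') mxE.
Qed.

Lemma dunt_coef_smf (p : total (vbot MK)) s0 b i k : @cdom _ (total (vbot MK)) (s0, (s0, b)) p ->
  cdom i (unt (tbase p.1)) -> smf p (fun y : total (vbot MK) => tcoef (dunt y.1) i 0 k).
Proof.
move=> ip iu; have [_ sx _] := ip; have px := premfd_cov lO sx.
have [nu su] := smap_chart gO gA (smap_unt lG px) iu.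
have [V [U [oV Vx sU HU]]] := smap_local gO sx nu su.
have sf := dsum_base_smap ip.
have sd l : smf (tbase p.1) (fun y => dd (fun q => U q 0 k) (cmap s0 y) (delta_mx 0 l)).
  by exists s0; split=> //; exists V, (fun q => dd (fun q => U q 0 k) q (delta_mx 0 l)); split=> //; exact: sm_d.
apply: (smf_ext gMKb (h := fun y : total (vbot MK) => \sum_l tcoef y.1 s0 0 l *
    dd (fun q => U q 0 k) (cmap s0 (tbase y.1)) (delta_mx 0 l))); last first.
  apply: (smf_sum gMKb ip) => l; apply: (smfM gMKb (dsum_fst_smf ip l)).
  exact: (smf_smap gMKb gO sf (sd l)).
have nV : mnear (tbase p.1) (fun y => cdom s0 y /\ V (cmap s0 y)).
  by exists s0; split=> //; exists V.
apply: mnearS (mnearI gMKb (dsum_near ip) (mnear_smap gMKb gO sf nV)) => y [[vy _ _ _] [sy Vy]].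
have [[ty _] _] := (mkb_fibP _ _).1 (mkb_vin vy); have py := premfd_cov lO sy.
rewrite (dmap_chart (i := s0) (j := i) (G := U) lO lA ty (smap_unt lG py)).
  by rewrite dvE dd_rowE.
by apply/is_repP; split=> //; exists V; split=> // z _; exact: HU.
Qed.

Lemma morita_units_smap (p : total (vbot MK)) : vin p ->
  smap p (MU : total (vbot MK) -> total (vbot (twisted_dual MK L))).
Proof.
move=> vp; have fp := mkb_vin vp; have [f1 f2] := (mkb_fibP _ _).1 fp; have px := fib_pts vB f2.
have pu := pts_unt lG px; have [i iu] := chart_ex pu.
have [s0 sx] := (mfd_cover (lie_obj lG) _).1 px; have [b bx] := vb_cover vB px.
have [c cu] := vb_cover vT pu.
have [W [tau [ct Wx]]] := core_triv_ex px.
have [oW [sg [sg1 sg2 sg3 sg4 sg5]]] := ct.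
pose t : tidx (core MK) := exist _ (W, tau) ct.
have ip : @cdom _ (total (vbot MK)) (s0, (s0, b)) p by split.
have sf := dsum_base_smap ip; have nd := dsum_near ip.
have nW := mnear_smap gMKb gO sf (mopen_mnear lO oW Wx).
have sfu := smap_comp gMKb gO sf (smap_unt lG px).
apply: (@homb_smap R (total (vbot MK)) (obj G) (core MK) (vbot L) MU p s0 t b gMKb).
- apply: mnearS (mnearI gMKb nd nW) => y [[vy sy sy' b_y] Wy]; split=> //.
  by have [] := morita_units_is_hom (mkb_vin vy).
- by move=> k; exact: (dsum_base_smf ip).
move=> k l; pose z x := sg x (delta_mx 0 k).
(* [frame] chooses a core vector with coordinates [delta_mx 0 k]; in the trivialization it can only
   be the value of the smooth section [sg]. *)
have Ez y : W y -> frame (E := core MK) t y k = z y.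
  move=> Wy; have H : exists e : core MK, fib (core MK) y e /\ tmap (E := core MK) t e = delta_mx 0 k.
    by exists (z y); exact: sg1.
  have [fe te] : [set e : core MK | fib (core MK) y e /\ tmap (E := core MK) t e = delta_mx 0 k]
      (frame (E := core MK) t y k) := theP _ H.
  by rewrite -(sg2 y _ Wy fe); congr sg; exact: te.
have fz y : W y -> fib (core MK) y (z y) by move=> Wy; have [] := sg1 y (delta_mx 0 k) Wy.
have pW y : W y -> pts (obj G) y by have [H _] := oW; exact: H.
have fzT y : W y -> TA (unt y) (z y).1.
  by move=> Wy; have [] := (coreP (z y) (pW y Wy)).1 (fz y Wy).
have [_ bz] := fzT _ Wx; have [vz _] := core_vin (pW _ Wx) (fz _ Wx).
have iz : @cdom _ (total (vtop MK)) (i, (i, c)) (z (tbase p.1)).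
  by split; [exact: vz|rewrite /= (bz : tbase (z _).1 = _)|rewrite /= (bz : tbase (z _).1 = _); split].
have sz : smap (tbase p.1) (z : obj G -> total (vtop MK)).
  exact: (smap_smooth_on gO (mopen_mnear lO oW Wx) (sg5 _)).
have fX : mnear p (fun y : total (vbot MK) => TA (unt (tbase y.1)) (dunt y.1)).
  by apply: mnearS nd => y [vy _ _ _]; have [fy _] := (mkb_fibP _ _).1 (mkb_vin vy); exact: (dunt_fib lG fy).
have fY : mnear p (fun y : total (vbot MK) => TA (unt (tbase y.1)) (z (tbase y.1)).1).
  by apply: mnearS nW => y; exact: fzT.
have sX k' := dunt_coef_smf k' ip iu.
have sY k' : smf p (fun y : total (vbot MK) => tcoef (z (tbase y.1)).1 i 0 k').
  have := smf_smap gO gMK sz (dsum_fst_smf iz k'); exact: (smf_smap gMKb gO sf).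
have but : tdom b (tgt (unt (tbase p.1))) by rewrite lie_tgt_unt.
have sK := curv_field_smf gMKb sfu iu fX sX fY sY but.
have se := eta_field_smf gMKb sfu iu fY sY.
have sl : smf p (fun y : total (vbot MK) => lc b y.2).
  by apply: (smf_sum gMKb ip) => k'; exact: (dsum_snd_smf ip).
apply: (smf_ext gMKb _ (smfD gMKb sK (smfM gMKb se sl))).
apply: mnearS (mnearI gMKb nd nW) => y [[vy _ _ b_y] Wy].
have fy : fib (vbot MK) (tbase y.1) y := mkb_vin vy; rewrite [hbase (MU y)]/(tbase y.1) Ez // (lcE rB).
by rewrite (morita_unitsE fy (fz _ Wy)) (unit_pairing_lc fy (fz _ Wy) b_y).
Qed.

Lemma morita_units_smooth : smooth (MU : total (vbot MK) -> total (vbot (twisted_dual MK L))).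
Proof. exact: (smooth_onP gMKb morita_units_smap). Qed.

Lemma morita_curv_vbmor : is_vbmor (E := vtop MK) (E' := vtop (twisted_dual MK L)) MC id.
Proof.
split; [exact: morita_curv_smooth|exact: smooth_id| | |].
- by move=> g p _ fp; exact: morita_curv_is_hom.
- by move=> g p q _ fp fq; exact: morita_curv_add fp fq.
- by move=> g r p _ fp; exact: morita_curv_scal fp.
Qed.

Lemma morita_curv_units_vbmor : is_vbmor (E := vbot MK) (E' := vbot (twisted_dual MK L)) MU id.
Proof.
split; [exact: morita_units_smooth|exact: smooth_id| | |].
- by move=> x p _ fp; exact: morita_units_is_hom.
- by move=> x p q _ fp fq; exact: morita_units_add fp fq.
- by move=> x r p _ fp; exact: morita_units_scal fp.
Qed.

Lemma morita_curv_liemor : @is_liemor R (vgpd MK) (vgpd (twisted_dual MK L)) MC MU.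
Proof.
split; [exact: morita_curv_smooth|exact: morita_units_smooth| | | |].
- by move=> p vp; exact: morita_curv_src (mk_vin vp).
- by move=> p vp; exact: morita_curv_tgt (mk_vin vp).
- by move=> p vp; exact: morita_curv_unt (mkb_vin vp).
- move=> p q [vp vq E]; apply: (morita_curv_mul (g := tbase p.1) (h := tbase q.1)).
  by split; [exact: (mk_vin vp)|exact: (mk_vin vq)|exact: E].
Qed.

End LineBundleGroupoid.

Theorem mainTheorem4 (R : realType) (G : gpd R) (L : vbg G)
    (theta : tangent (arr G) -> vtop L) (nab : conn (vbot L)) :
  is_lbg L ->
  is_form1 theta ->
  multiplicative theta ->
  is_conn nab ->
  @is_vbgmor R G G (morita_kernel theta) (twisted_dual (morita_kernel theta) L)
    (morita_curv theta nab) (morita_curv_units theta nab) id id.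
Proof.
move=> lL ft mt cnab; have lG := lbg_lie lL; split.
- exact: morita_curv_vbmor.
- exact: morita_curv_units_vbmor.
- exact: morita_curv_liemor.
- by split=> //; apply: smooth_id; [exact: lie_arr_premfd|exact: lie_obj_premfd].
Qed.
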